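(* Let $\varphi\in\mathcal{G}L^\infty(\mathbb{R})$, let $W_\varphi$ and $H_\varphi$ be the Wiener-Hopf and Hankel operators with Fourier symbol $\varphi$, acting from $L^2_+(\mathbb{R})$ to $L^2(\mathbb{R}_+)$, and let $WH_\varphi=W_\varphi+H_\varphi$. Let $\mathcal{S}$ be the set of sectorial functions in $L^\infty(\mathbb{R})$. In (a) and (d) the equivalence holds for each of the two choices of sign $+$ and $-$ (the same sign being taken at all places). Then: (a) $WH_\varphi$ and $W_\varphi-H_\varphi$ are both invertible if and only if $\varphi\widetilde{\varphi^{-1}}=sh$ for some $s\in\mathcal{S}$ and $h\in\mathcal{G}H^\infty_\pm$. (b) $WH_\varphi$ and $W_\varphi-H_\varphi$ are both left-invertible if and only if $\varphi\widetilde{\varphi^{-1}}=sh$ for some $s\in\mathcal{S}$ and $h\in H^\infty_+$. (c) $WH_\varphi$ and $W_\varphi-H_\varphi$ are both right-invertible if and only if $\varphi\widetilde{\varphi^{-1}}=sh$ for some $s\in\mathcal{S}$ and $h\in H^\infty_-$. (d) $WH_\varphi$ and $W_\varphi-H_\varphi$ are both Fredholm if and only if $\varphi\widetilde{\varphi^{-1}}=sh_1h_2$ for some $s\in\mathcal{S}$, $h_1\in\mathcal{G}[C(\dot{\mathbb{R}})+H^\infty_\pm]$ and $h_2\in\mathcal{G}H^\infty_\pm$. (e) $WH_\varphi$ and $W_\varphi-H_\varphi$ are both left-Fredholm if and only if $\varphi\widetilde{\varphi^{-1}}=sh_1h_2$ for some $s\in\mathcal{S}$, $h_1\in C(\dot{\mathbb{R}})+H^\infty_+$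 and $h_2\in\mathcal{G}H^\infty_+$. (f) $WH_\varphi$ and $W_\varphi-H_\varphi$ are both right-Fredholm if and only if $\varphi\widetilde{\varphi^{-1}}=sh_1h_2$ for some $s\in\mathcal{S}$, $h_1\in C(\dot{\mathbb{R}})+H^\infty_-$ and $h_2\in\mathcal{G}H^\infty_-$.
   Context: All function spaces are complex-valued. $\mathbb{R}_+=(0,+\infty)$; $L^2_+(\mathbb{R})$ is the subspace of $L^2(\mathbb{R})$ of functions supported in the closure of $\mathbb{R}_+$; $r_+:L^2(\mathbb{R})\to L^2(\mathbb{R}_+)$ is the restriction operator; $\mathcal{F}$ is the Fourier transformation, with the convention $\mathcal{F}f(x)=\int_{\mathbb{R}}e^{ixt}f(t)\,dt$ (up to normalization), so that Fourier transforms of functions in $L^2_+(\mathbb{R})$ extend analytically to the upper half-plane. $J$ is the reflection operator, $J\psi(x)=\widetilde{\psi}(x)=\psi(-x)$. For $\varphi\in L^\infty(\mathbb{R})$, $$W_\varphi=r_+\mathcal{F}^{-1}\varphi\cdot\mathcal{F}:L^2_+(\mathbb{R})\to L^2(\mathbb{R}_+),\quad H_\varphi=r_+\mathcal{F}^{-1}\varphi\cdot\mathcal{F}J:L^2_+(\mathbb{R})\to L^2(\mathbb{R}_+),\quad WH_\varphi=W_\varphi+H_\varphi,$$ where $\varphi\cdot$ denotes multiplication by $\varphi$. For invertible $\varphi$, $\varphi^{-1}=1/\varphi$ is the pointwise reciprocal, so $\widetilde{\varphi^{-1}}(x)=1/\varphi(-x)$. $H^\infty_\pm=H^\infty_\pm(\mathbb{R})$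 is the set of functions in $L^\infty(\mathbb{R})$ that are non-tangential boundary limits of bounded analytic functions in $\mathbb{C}_\pm=\{z\in\mathbb{C}:\pm\operatorname{Im}z>0\}$. $C(\dot{\mathbb{R}})$ is the space of continuous functions on $\mathbb{R}$ whose limits at $+\infty$ and $-\infty$ exist and coincide; $C(\dot{\mathbb{R}})+H^\infty_\pm$ is the algebraic sum (a closed subalgebra of $L^\infty(\mathbb{R})$). For a Banach algebra $B$, $\mathcal{G}B$ is the group of invertible elements of $B$. A function $f\in L^\infty(\mathbb{R})$ is sectorial if there exist a real $\varepsilon>0$ and $c\in\mathbb{C}$ with $|c|=1$ such that $\operatorname{Re}(cf(x))\ge\varepsilon$ for almost every $x\in\mathbb{R}$. A bounded linear operator $T:X\to Y$ between Hilbert spaces is normally solvable if its image is closed. A normally solvable $T$ is left-Fredholm if $\dim\operatorname{Ker}T<\infty$, right-Fredholm if $\dim (Y/\operatorname{Im}T)<\infty$, and Fredholm if both are finite. $T$ is left-invertible (right-invertible) if it has a bounded left (right) inverse, and invertible if it has a bounded two-sided inverse. *)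

(* Defs.v *)
From HB Require Import structures.
From mathcomp Require Import all_boot all_order all_algebra.
From mathcomp Require Import all_classical all_reals all_analysis.
From mathcomp Require Import complex.

Set Implicit Arguments.
Unset Strict Implicit.
Unset Printing Implicit Defensive.

Import Order.TTheory GRing.Theory Num.Theory.
Import numFieldNormedType.Exports.

Local Open Scope classical_set_scope.
Local Open Scope ring_scope.
Local Open Scope complex_scope.

(* [R[i]^o] is R[i] with its normed-space structure over itself. *)
Notation Cplx R := (R[i]^o).

(* Elements of L^p spaces are represented by functions R -> C. They are never
   quotiented: the notions below, except [Cdot], are invariant under a.e.
   equality of Borel functions, and equations between elements of L^p spaces are stated a.e. The sigma-algebra
   is the Borel one, which yields the same a.e. classes as Lebesgue's. *)
Section FunctionSpaces.
Context {R : realType}.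
Implicit Types (D : set R) (f g phi : R -> Cplx R).

Definition cmod (z : Cplx R) : R := ComplexField.Normc.normc z.

Definition cmeasurable D f : Prop :=
  measurable_fun D (fun x => complex.Re (f x)) /\ measurable_fun D (fun x => complex.Im (f x)).

Definition l2norm D f : \bar R :=
  ((\int[@lebesgue_measure R]_(x in D) (cmod (f x) ^+ 2)%:E) `^ 2^-1)%E.

Definition L2 D : set (R -> Cplx R) :=
  [set f | cmeasurable D f /\ (l2norm D f < +oo)%E].

Definition Linfty : set (R -> Cplx R) :=
  [set f | cmeasurable setT f /\
           exists M : R, {ae @lebesgue_measure R, forall x, cmod (f x) <= M}].

(* The group of invertible elements of an algebra A of functions modulo
   a.e. equality. *)
Definition units_of (A : set (R -> Cplx R)) : set (R -> Cplx R) :=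
  [set f | A f /\
     exists g, A g /\ {ae @lebesgue_measure R, forall x, f x * g x = 1}].

Definition reflection f : R -> Cplx R := fun x => f (- x).

Definition ptinv f : R -> Cplx R := fun x => (f x)^-1.

Definition sectorial : set (R -> Cplx R) :=
  [set f | Linfty f /\
     exists (e : R) (c : Cplx R), [/\ 0 < e, cmod c = 1 &
       {ae @lebesgue_measure R, forall x, e <= complex.Re (c * f x)}]].

Inductive hsign := Plus | Minus.

Definition half_plane (sg : hsign) : set (Cplx R) :=
  [set z | match sg with Plus => 0 < complex.Im z | Minus => complex.Im z < 0 end].

Definition stolz (sg : hsign) (a x : R) : set (Cplx R) :=
  [set z | half_plane sg z /\ `|complex.Re z - x| < a * `|complex.Im z|].

(* [derivable F z 1] over the scalar field R[i] is complex differentiability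
   at z. *)
Definition bounded_analytic (sg : hsign) (F : Cplx R -> Cplx R) : Prop :=
  (forall z, half_plane sg z -> derivable F z 1) /\
  exists M : R, forall z, half_plane sg z -> cmod (F z) <= M.

Definition nontangential_limit (sg : hsign) (F : Cplx R -> Cplx R) (x : R)
    (l : Cplx R) : Prop :=
  forall a : R, 0 < a ->
    F z @[z --> within (stolz sg a x) (nbhs (x%:C : Cplx R))] --> l.

Definition Hinfty (sg : hsign) : set (R -> Cplx R) :=
  [set f | Linfty f /\
     exists F, bounded_analytic sg F /\
       {ae @lebesgue_measure R, forall x, nontangential_limit sg F x (f x)}].

Definition Cdot : set (R -> Cplx R) :=
  [set f | continuous f /\
     exists l : Cplx R, (f x @[x --> +oo] --> l) /\ (f x @[x --> -oo] --> l)].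

Definition CplusHinfty (sg : hsign) : set (R -> Cplx R) :=
  [set f | Linfty f /\
     exists c h, [/\ Cdot c, Hinfty sg h &
       {ae @lebesgue_measure R, forall x, f x = c x + h x}]].

Definition expi (t : R) : Cplx R := cos t +i* sin t.

Definition cintegral D f : Cplx R :=
  Rintegral (@lebesgue_measure R) D (fun x => complex.Re (f x)) +i*
  Rintegral (@lebesgue_measure R) D (fun x => complex.Im (f x)).

Definition trunc_fourier f (n : nat) : R -> Cplx R :=
  fun x => cintegral `[- n%:R, n%:R]%classic (fun t => expi (x * t) * f t).

(* g is the L^2 (Plancherel) Fourier transform of f, i.e. the L^2 limit of the
   integrals of e^{ixt} f(t) over [-n, n]. *)
Definition is_fourier f g : Prop :=
  [/\ L2 setT f, L2 setT g &
      l2norm setT (fun x => trunc_fourier f n x - g x) @[n --> \oo] --> 0%E].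

(* The default value 0 is only reached outside L^2. *)
Definition fourier f : R -> Cplx R := xget (fun=> 0) [set g | is_fourier f g].

Definition fourier_inv g : R -> Cplx R :=
  xget (fun=> 0) [set f | is_fourier f g].

Definition Rplus : set R := `]0, +oo[%classic.

(* Functions on R_+ are represented by functions on R, considered on R_+ only. *)
Definition restr_plus f : R -> Cplx R := fun x => if 0 < x then f x else 0.

Definition wiener_hopf phi f : R -> Cplx R :=
  restr_plus (fourier_inv (phi \* fourier f)).

Definition hankel phi f : R -> Cplx R :=
  restr_plus (fourier_inv (phi \* fourier (reflection f))).

Definition wh_plus phi f : R -> Cplx R := wiener_hopf phi f \+ hankel phi f.

Definition wh_minus phi f : R -> Cplx R := wiener_hopf phi f \- hankel phi f.

(* A Hilbert space of classes of functions: its elements are the members of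
   [carrier] modulo a.e. equality on [dom], its norm is [l2norm dom]. *)
Record l2space := L2Space { dom : set R ; carrier : set (R -> Cplx R) }.

Definition L2plus : l2space :=
  L2Space setT [set f | L2 setT f /\
    {ae @lebesgue_measure R, forall x, x < 0 -> f x = 0}].

Definition L2Rplus : l2space := L2Space Rplus (L2 Rplus).

Definition eqv (X : l2space) f g : Prop :=
  {ae @lebesgue_measure R, forall x, dom X x -> f x = g x}.

End FunctionSpaces.

Section Operators.
Context {R : realType}.
Implicit Types (X Y : @l2space R) (S T : (R -> Cplx R) -> (R -> Cplx R)).

Definition bounded_linear X Y S : Prop :=
  [/\ forall f, carrier X f -> carrier Y (S f),
      forall (a : R[i]) f g, carrier X f -> carrier X g ->
        eqv Y (S (fun x => a * f x + g x)) (fun x => a * S f x + S g x) &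
      exists M : R, forall f, carrier X f ->
        (l2norm (dom Y) (S f) <= M%:E * l2norm (dom X) f)%E].

Definition left_invertible X Y T : Prop :=
  exists S, bounded_linear Y X S /\ forall f, carrier X f -> eqv X (S (T f)) f.

Definition right_invertible X Y T : Prop :=
  exists S, bounded_linear Y X S /\ forall g, carrier Y g -> eqv Y (T (S g)) g.

Definition invertible X Y T : Prop :=
  exists S, [/\ bounded_linear Y X S,
    forall f, carrier X f -> eqv X (S (T f)) f &
    forall g, carrier Y g -> eqv Y (T (S g)) g].

(* The image of T is closed: it contains its adherent points. *)
Definition normally_solvable X Y T : Prop :=
  forall g, carrier Y g ->
    (forall e : R, 0 < e -> exists f, carrier X f /\
       (l2norm (dom Y) (fun x => (T f x - g x)%R) < e%:E)%E) ->
    exists f, carrier X f /\ eqv Y (T f) g.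

Definition finite_dim_ker X Y T : Prop :=
  exists (n : nat) (v : 'I_n -> R -> Cplx R),
    (forall i, carrier X (v i) /\ eqv Y (T (v i)) (fun=> 0)) /\
    forall f, carrier X f -> eqv Y (T f) (fun=> 0) ->
      exists c : 'I_n -> R[i], eqv X f (fun x => \sum_(i < n) c i * v i x).

(* dim (Y / Im T) is finite: finitely many elements of Y span Y modulo Im T. *)
Definition finite_dim_coker X Y T : Prop :=
  exists (n : nat) (v : 'I_n -> R -> Cplx R),
    (forall i, carrier Y (v i)) /\
    forall g, carrier Y g ->
      exists (f : R -> Cplx R) (c : 'I_n -> R[i]), carrier X f /\
        eqv Y g (fun x => T f x + \sum_(i < n) c i * v i x).

Definition left_fredholm X Y T : Prop :=
  normally_solvable X Y T /\ finite_dim_ker X Y T.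

Definition right_fredholm X Y T : Prop :=
  normally_solvable X Y T /\ finite_dim_coker X Y T.

Definition fredholm X Y T : Prop :=
  [/\ normally_solvable X Y T, finite_dim_ker X Y T & finite_dim_coker X Y T].

End Operators.

(* Main.v *)
(* Let [J] be the reflection and [psi = phi / J phi]. On the Fourier side, with
   the Riesz projection [P], the operator [x |-> P (phi x) + (1 - P) (J phi x)]
   commutes with [J], and its restrictions to even and odd functions are
   [W_phi + H_phi] and [W_phi - H_phi]. Up to invertible factors on both sides it
   is the direct sum of the Toeplitz operator [T f = P (psi f)] on the Hardy space
   and the identity of the orthogonal complement, so that all properties of the
   pair are properties of [T] and of its adjoint, whose symbol is [conj psi].

   [T] is bounded below if and only if [psi = s h] with [s] sectorial and [h] in
   H^infty_+. If [|T f| >= d |f|], then [S = T* T - d^2 / 2] is positive definite.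
   Let [S a = 1 / (x + i)] and [h = P (psi a) / a]. Comparing moments with respect
   to the powers of [chi = (x - i) / (x + i)] gives [|psi - h|^2 < |psi|^2 - d^2 / 2]
   almost everywhere, so [psi / h] is sectorial; and [h] multiplies the Hardy space
   because [a] generates it under the shift. The multipliers of the Hardy space are
   the elements of H^infty_+, by Cauchy's theorem and Fatou's theorem on Poisson
   integrals.

   [T] is left-Fredholm if and only if it becomes bounded below after [psi] is
   multiplied by a power of [chi], since the powers of the backward shift tend
   strongly to 0. Continuous functions on the compactified line are uniform limits
   of quotients [g / chi^N] with [g] in H^infty_+, which absorbs their effect into
   the sectorial factor. *)

From HB Require Import structures.
Require Import Defs.
From mathcomp Require Import all_boot all_order all_algebra.
From mathcomp Require Import all_classical all_reals all_analysis.
From mathcomp Require Import complex ring lra measurable_realfun.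

Set Implicit Arguments.
Unset Strict Implicit.
Unset Printing Implicit Defensive.

Import Order.TTheory GRing.Theory Num.Theory.
Import numFieldNormedType.Exports.

Local Open Scope classical_set_scope.
Local Open Scope ring_scope.
Local Open Scope complex_scope.

Local Notation Re := complex.Re.
Local Notation Im := complex.Im.

(** * Complex numbers *)

Section ComplexModulus.
Context {R : realType}.
Implicit Types (z w : R[i]) (r : R).

(** The usual road to [psi = s h] goes through Nehari's distance formula and outer functions; here
    one coercive equation replaces both. Subtracting only half of [d^2] serves twice: the half that
    is kept makes [S] bounded below, so that the equation is solvable, and the half that is
    subtracted reappears as the gap in the pointwise estimate, which reads
    [2 Re (psi conj h) > |h|^2 + d^2 / 2] and so yields the bounds on [h] as well as the
    sectoriality of the quotient. The right-hand side is the vector of the Hardy space orthogonal to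
    the range of the shift; therefore the moments of positive order vanish, and the remaining one is
    matched by a positive multiple of [1 / (x^2 + 1)]. Surjectivity and finite codimension are not
    lower bounds. The uniform boundedness principle turns them into lower bounds for the adjoint, so
    the right-sided statements are the left-sided ones for [conj psi], and conjugation exchanges the
    two Hardy algebras. In the Fredholm case the powers of [chi] for [psi] and for [conj psi] are
    unrelated at first; an index argument finds one power that serves both. *)

Definition cj z : R[i] := z^*.

Lemma ReD z w : Re (z + w) = Re z + Re w. Proof. by case: z w => a b []. Qed.
Lemma ImD z w : Im (z + w) = Im z + Im w. Proof. by case: z w => a b []. Qed.
Lemma ReN z : Re (- z) = - Re z. Proof. by case: z. Qed.
Lemma ImN z : Im (- z) = - Im z. Proof. by case: z. Qed.
Lemma ReB z w : Re (z - w) = Re z - Re w. Proof. by rewrite ReD ReN. Qed.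
Lemma ImB z w : Im (z - w) = Im z - Im w. Proof. by rewrite ImD ImN. Qed.
Lemma ReM z w : Re (z * w) = Re z * Re w - Im z * Im w.
Proof. by case: z w => a b []. Qed.
Lemma ImM z w : Im (z * w) = Re z * Im w + Im z * Re w.
Proof. by case: z w => a b [] c d  /=; ring. Qed.
Lemma ReJ z : Re (cj z) = Re z. Proof. by case: z. Qed.
Lemma ImJ z : Im (cj z) = - Im z. Proof. by case: z. Qed.
Lemma ReC r : Re r%:C = r. Proof. by []. Qed.
Lemma ImC r : Im r%:C = 0. Proof. by []. Qed.
Lemma complex_ext z w : Re z = Re w -> Im z = Im w -> z = w.
Proof. by case: z w => a b [] c d /= -> ->. Qed.

Lemma JD z w : cj (z + w) = cj z + cj w. Proof. exact: rmorphD. Qed.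
Lemma JN z : cj (- z) = - cj z. Proof. exact: rmorphN. Qed.
Lemma JB z w : cj (z - w) = cj z - cj w. Proof. exact: rmorphB. Qed.
Lemma JM z w : cj (z * w) = cj z * cj w. Proof. exact: rmorphM. Qed.
Lemma JV z : cj z^-1 = (cj z)^-1. Proof. exact: conjc_inv. Qed.
Lemma JX z n : cj (z ^+ n) = cj z ^+ n. Proof. exact: rmorphXn. Qed.
Lemma JK z : cj (cj z) = z. Proof. exact: conjcK. Qed.
Lemma J0 : cj 0 = 0 :> R[i]. Proof. exact: rmorph0. Qed.
Lemma J1 : cj 1 = 1 :> R[i]. Proof. exact: rmorph1. Qed.
Lemma JC r : cj r%:C = r%:C. Proof. exact: conjc_real. Qed.

Lemma sqr_mono (r r' : R) : 0 <= r -> r <= r' -> r ^+ 2 <= r' ^+ 2.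
Proof. by move=> h h'; rewrite ler_sqr ?nnegrE// (le_trans h). Qed.

Lemma sqr_cmod z : cmod z ^+ 2 = Re z ^+ 2 + Im z ^+ 2.
Proof. by case: z => a b; rewrite /cmod /= sqr_sqrtr// addr_ge0 ?sqr_ge0. Qed.
Lemma cmod_ge0 z : 0 <= cmod z. Proof. by case: z => a b; exact: sqrtr_ge0. Qed.
Lemma cmod0 : cmod (0 : R[i]) = 0. Proof. exact: Normc.normc0. Qed.
Lemma cmod1 : cmod (1 : R[i]) = 1. Proof. exact: Normc.normc1. Qed.
Lemma cmodM z w : cmod (z * w) = cmod z * cmod w. Proof. exact: Normc.normcM. Qed.
Lemma cmodV z : cmod z^-1 = (cmod z)^-1. Proof. exact: Normc.normcV. Qed.
Lemma cmodD z w : cmod (z + w) <= cmod z + cmod w. Proof. exact: le_normcD. Qed.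
Lemma cmodN z : cmod (- z) = cmod z. Proof. exact: normcN. Qed.
Lemma cmodJ z : cmod (cj z) = cmod z.
Proof. by case: z => a b; rewrite /cmod /= sqrrN. Qed.
Lemma cmodB z w : cmod (z - w) = cmod (w - z). Proof. by rewrite -cmodN opprB. Qed.
Lemma cmod_eq0 z : cmod z = 0 -> z = 0. Proof. exact: Normc.eq0_normc. Qed.
Lemma cmod_gt0 z : z != 0 -> 0 < cmod z.
Proof. by move=> z0; rewrite lt_def cmod_ge0 andbT; apply: contra z0 => /eqP/cmod_eq0 ->. Qed.
Lemma cmod_gt0P z : 0 < cmod z -> z != 0.
Proof. by move=> h; apply/eqP => z0; rewrite z0 cmod0 ltxx in h. Qed.
Lemma cmodX z n : cmod (z ^+ n) = cmod z ^+ n.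
Proof. by elim: n => [|n IH]; rewrite ?expr0 ?cmod1 // !exprS cmodM IH. Qed.
Lemma cmodC r : cmod r%:C = `|r|.
Proof. by rewrite /cmod /= expr0n addr0 sqrtr_sqr. Qed.
Lemma cmod_Re z : `|Re z| <= cmod z.
Proof. by rewrite -ler_sqr ?nnegrE ?cmod_ge0// sqr_cmod real_normK ?num_real// lerDl sqr_ge0. Qed.
Lemma cmod_Im z : `|Im z| <= cmod z.
Proof. by rewrite -ler_sqr ?nnegrE ?cmod_ge0// sqr_cmod real_normK ?num_real// lerDr sqr_ge0. Qed.
Lemma Re_le_cmod z : Re z <= cmod z. Proof. exact: le_trans (ler_norm _) (cmod_Re z). Qed.
Lemma cmod_le_ReIm z : cmod z <= `|Re z| + `|Im z|.
Proof.
rewrite -ler_sqr ?nnegrE ?cmod_ge0// ?addr_ge0// sqr_cmod sqrrD !real_normK ?num_real//.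
have := mulr_ge0 (normr_ge0 (Re z)) (normr_ge0 (Im z)); lra.
Qed.
Lemma mulcJ z : z * cj z = (cmod z ^+ 2)%:C.
Proof. by rewrite sqr_cmod; case: z => a b; apply: complex_ext => /=; ring. Qed.
Lemma cmod_sqrJ z : Re (z * cj z) = cmod z ^+ 2. Proof. by rewrite mulcJ. Qed.
Lemma cmodB_ge z w : cmod z - cmod w <= cmod (z - w).
Proof. by rewrite lerBlDr (le_trans _ (cmodD _ _))// subrK. Qed.
Lemma sqr_cmodD z w :
  cmod (z + w) ^+ 2 = cmod z ^+ 2 + cmod w ^+ 2 + 2 * Re (z * cj w).
Proof. by rewrite !sqr_cmod; case: z w => a b [] c d /=; ring. Qed.

End ComplexModulus.

(** * Hilbert spaces *)

(** Positivity is imposed on the real part of [dot x x], since [dotJ] makes the imaginary part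
    vanish. Completeness is sequential and uses squared norms, so the carrier bears no topology. *)
Record hilbert (R : realType) := Hilbert {
  hsort :> lmodType R[i];
  dot : hsort -> hsort -> R[i];
  dotDl : forall x y z, dot (x + y) z = dot x z + dot y z;
  dotZl : forall a x y, dot (a *: x) y = a * dot x y;
  dotJ : forall x y, dot y x = cj (dot x y);
  dot_ge0 : forall x, 0 <= Re (dot x x);
  dot_def : forall x, Re (dot x x) = 0 -> x = 0;
  hcomplete : forall u : nat -> hsort,
    (forall e : R, 0 < e -> exists N, forall m n, (N <= m)%N -> (N <= n)%N ->
       Re (dot (u m - u n) (u m - u n)) < e) ->
    exists l, forall e : R, 0 < e -> exists N, forall n, (N <= n)%N ->
       Re (dot (u n - l) (u n - l)) < e }.

Section Hilbert.
Context {R : realType} {H : hilbert R}.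
Implicit Types (x y z f g : H) (a b c : R[i]) (S M : set H) (T : H -> H).

Lemma dotDr x y z : dot x (y + z) = dot x y + dot x z.
Proof. by rewrite dotJ dotDl JD -!dotJ. Qed.
Lemma dotZr a x y : dot x (a *: y) = cj a * dot x y.
Proof. by rewrite dotJ dotZl JM -dotJ. Qed.
Lemma dotNl x y : dot (- x) y = - dot x y.
Proof. by rewrite -scaleN1r dotZl mulN1r. Qed.
Lemma dotNr x y : dot x (- y) = - dot x y.
Proof. by rewrite dotJ dotNl JN -dotJ. Qed.
Lemma dotBl x y z : dot (x - y) z = dot x z - dot y z.
Proof. by rewrite dotDl dotNl. Qed.
Lemma dotBr x y z : dot x (y - z) = dot x y - dot x z.
Proof. by rewrite dotDr dotNr. Qed.
Lemma dot0l x : dot 0 x = 0. Proof. by rewrite -(scale0r (0 : H)) dotZl mul0r. Qed.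
Lemma dot0r x : dot x 0 = 0. Proof. by rewrite dotJ dot0l J0. Qed.
Lemma dot_suml n (F : 'I_n -> H) y : dot (\sum_i F i) y = \sum_i dot (F i) y.
Proof.
by elim/big_rec2: _ => [|i a b _ <-]; rewrite ?dot0l ?dotDl.
Qed.
Lemma dot_sumr n (F : 'I_n -> H) y : dot y (\sum_i F i) = \sum_i dot y (F i).
Proof.
by elim/big_rec2: _ => [|i a b _ <-]; rewrite ?dot0r ?dotDr.
Qed.
Lemma dotC0 x y : dot x y = 0 -> dot y x = 0.
Proof. by move=> h; rewrite dotJ h J0. Qed.

Definition nrm x : R := Num.sqrt (Re (dot x x)).

Lemma nrm_ge0 x : 0 <= nrm x. Proof. exact: sqrtr_ge0. Qed.
Lemma sqr_nrm x : nrm x ^+ 2 = Re (dot x x). Proof. by rewrite sqr_sqrtr// dot_ge0. Qed.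
Lemma dotxx x : dot x x = (nrm x ^+ 2)%:C.
Proof.
rewrite sqr_nrm; apply: complex_ext => //=.
have /(congr1 (@Im R)) := dotJ x x; rewrite ImJ; lra.
Qed.
Lemma nrm0 : nrm 0 = 0. Proof. by rewrite /nrm dot0l sqrtr0. Qed.
Lemma nrm_eq0 x : nrm x = 0 -> x = 0.
Proof. by move=> h; apply: dot_def; rewrite -sqr_nrm h expr0n. Qed.
Lemma nrm_gt0 x : x != 0 -> 0 < nrm x.
Proof. by move=> x0; rewrite lt_def nrm_ge0 andbT; apply: contra x0 => /eqP/nrm_eq0 ->. Qed.
Lemma nrmZ a x : nrm (a *: x) = cmod a * nrm x.
Proof.
apply/eqP; rewrite -(@eqrXn2 _ 2) ?nrm_ge0 ?mulr_ge0 ?cmod_ge0 ?nrm_ge0//.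
rewrite sqr_nrm dotZl dotZr mulrA mulcJ dotxx exprMn; apply/eqP.
by rewrite -rmorphM.
Qed.
Lemma nrmN x : nrm (- x) = nrm x.
Proof. by rewrite -scaleN1r nrmZ cmodN cmod1 mul1r. Qed.
Lemma nrmB x y : nrm (x - y) = nrm (y - x).
Proof. by rewrite -nrmN opprB. Qed.
Lemma sqr_nrmD x y :
  nrm (x + y) ^+ 2 = nrm x ^+ 2 + nrm y ^+ 2 + 2 * Re (dot x y).
Proof.
rewrite !sqr_nrm dotDl !dotDr !ReD (dotJ x y) ReJ; ring.
Qed.
Lemma sqr_nrmB x y :
  nrm (x - y) ^+ 2 = nrm x ^+ 2 + nrm y ^+ 2 - 2 * Re (dot x y).
Proof. by rewrite sqr_nrmD nrmN dotNr ReN; ring. Qed.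

Lemma cauchy_schwarz x y : cmod (dot x y) <= nrm x * nrm y.
Proof.
have [->|y0] := eqVneq y 0; first by rewrite dot0r cmod0 nrm0 mulr0.
have n0 := nrm_gt0 y0.
rewrite -ler_sqr ?nnegrE ?mulr_ge0 ?nrm_ge0 ?cmod_ge0//.
have := sqr_ge0 (nrm (x - (dot x y / (nrm y ^+ 2)%:C) *: y)).
rewrite sqr_nrmB nrmZ dotZr cmodM cmodV cmodC ger0_norm ?sqr_ge0//.
have -> : Re (cj (dot x y / (nrm y ^+ 2)%:C) * dot x y) = cmod (dot x y) ^+ 2 / nrm y ^+ 2.
  rewrite JM JV JC mulrAC [_ * dot x y]mulrC mulcJ.
  by rewrite -fmorphV -rmorphM.
rewrite exprMn; set k := cmod _ => h.
have n2 : 0 < nrm y ^+ 2 by rewrite exprn_gt0.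
have e : (k / nrm y ^+ 2) ^+ 2 * nrm y ^+ 2 = k ^+ 2 / nrm y ^+ 2 by field; lra.
rewrite e in h.
have : 0 <= (nrm x ^+ 2 - k ^+ 2 / nrm y ^+ 2) * nrm y ^+ 2 
  by apply: mulr_ge0; [lra|exact: ltW].
by rewrite mulrBl mulfVK ?gt_eqF// exprMn subr_ge0.
Qed.

Lemma Re_dot_le x y : Re (dot x y) <= nrm x * nrm y.
Proof. exact: le_trans (Re_le_cmod _) (cauchy_schwarz _ _). Qed.

Lemma nrmD x y : nrm (x + y) <= nrm x + nrm y.
Proof.
rewrite -ler_sqr ?nnegrE ?addr_ge0 ?nrm_ge0// sqr_nrmD.
have := Re_dot_le x y; nra.
Qed.
Lemma nrm_sub x y z : nrm (x - z) <= nrm (x - y) + nrm (y - z).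
Proof. by rewrite (le_trans _ (nrmD _ _))// addrA subrK. Qed.
Lemma nrmB_ge x y : nrm x - nrm y <= nrm (x - y).
Proof. by rewrite lerBlDr (le_trans _ (nrmD _ _))// subrK. Qed.

Lemma pythagoras x y : dot x y = 0 -> nrm (x + y) ^+ 2 = nrm x ^+ 2 + nrm y ^+ 2.
Proof. by move=> h; rewrite sqr_nrmD h mulr0 addr0. Qed.

Lemma eq_dot x y : (forall z, dot x z = dot y z) -> x = y.
Proof.
move=> h; apply/eqP; rewrite -subr_eq0; apply/eqP/dot_def.
by rewrite dotBl h subrr.
Qed.

(** Identities in a module are proved by pairing both sides with a generic vector, after which they
    are ring identities between scalars. *)
Ltac hring := apply: eq_dot => ?; rewrite ?(dotDl, dotNl, dotZl, dot0l); ring.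

Definition linop T := forall a x y, T (a *: x + y) = a *: T x + T y.
Definition bddop T := exists M : R, 0 <= M /\ forall x, nrm (T x) <= M * nrm x.
(** A relation: adjoints are exhibited explicitly, so no Riesz representation theorem is called
    for. *)
Definition adjoint T T' := forall x y, dot (T x) y = dot x (T' y).
Definition bop T := linop T /\ bddop T.

Section linop.
Context (T : H -> H) (Tl : linop T).
Lemma lin0 : T 0 = 0.
Proof. by have := Tl (-1) 0 0; rewrite scaler0 addr0 scaleN1r addNr. Qed.
Lemma linD x y : T (x + y) = T x + T y. Proof. by rewrite -{1}(scale1r x) Tl scale1r. Qed.
Lemma linZ a x : T (a *: x) = a *: T x.
Proof. by rewrite -(addr0 (a *: x)) Tl lin0 addr0. Qed.
Lemma linN x : T (- x) = - T x. Proof. by rewrite -scaleN1r linZ scaleN1r. Qed.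
Lemma linB x y : T (x - y) = T x - T y. Proof. by rewrite linD linN. Qed.
Lemma lin_sum n (F : 'I_n -> H) : T (\sum_i F i) = \sum_i T (F i).
Proof.
by elim/big_rec2: _ => [|i a b _ <-]; rewrite ?lin0 ?linD.
Qed.
End linop.

Lemma adjoint_sym T T' : adjoint T T' -> adjoint T' T.
Proof. by move=> h x y; rewrite dotJ -h -dotJ. Qed.

Lemma adjoint_lin T T' : adjoint T T' -> linop T.
Proof.
move=> h a x y; apply: eq_dot => z.
by rewrite h !dotDl !dotZl !h.
Qed.

(** [nrm (T x) ^+ 2] is the pairing of [x] with [T' (T x)], and one factor [nrm (T x)] cancels. *)
Lemma adjoint_bdd T T' : adjoint T T' -> bddop T' -> bddop T.
Proof.
move=> h [M [M0 hM]]; exists M; split=> // x.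
have [->|n0] := eqVneq (T x) 0; first by rewrite nrm0 mulr_ge0 ?nrm_ge0.
have p := nrm_gt0 n0; rewrite -(ler_pM2r p) -expr2 sqr_nrm h.
apply: le_trans (Re_dot_le _ _) _; rewrite [M * _ * _]mulrAC mulrC.
by rewrite ler_wpM2r ?nrm_ge0.
Qed.

Lemma bop_comp T T' : bop T -> bop T' -> bop (T \o T').
Proof.
move=> [l1 [M1 [p1 h1]]] [l2 [M2 [p2 h2]]]; split.
  by move=> a x y /=; rewrite l2 l1.
exists (M1 * M2); split; first exact: mulr_ge0.
by move=> x /=; rewrite (le_trans (h1 _))// -mulrA ler_wpM2l.
Qed.

Lemma bop_add T T' : bop T -> bop T' -> bop (fun x => T x + T' x).
Proof.
move=> [l1 [M1 [p1 h1]]] [l2 [M2 [p2 h2]]]; split.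
  by move=> a x y; rewrite l1 l2 scalerDr addrACA.
exists (M1 + M2); split; first exact: addr_ge0.
by move=> x; rewrite (le_trans (nrmD _ _))// mulrDl lerD.
Qed.

Lemma bop_scale T c : bop T -> bop (fun x => c *: T x).
Proof.
move=> [l1 [M1 [p1 h1]]]; split.
  by move=> a x y; rewrite l1 scalerDr !scalerA mulrC.
exists (cmod c * M1); split; first by rewrite mulr_ge0 ?cmod_ge0.
by move=> x; rewrite nrmZ -mulrA ler_wpM2l ?cmod_ge0.
Qed.

Definition hcvg (u : nat -> H) l :=
  forall e : R, 0 < e -> exists N, forall n, (N <= n)%N -> nrm (u n - l) < e.

Lemma hcomplete_nrm (u : nat -> H) :
  (forall e : R, 0 < e -> exists N, forall m n, (N <= m)%N -> (N <= n)%N ->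
       nrm (u m - u n) < e) -> exists l, hcvg u l.
Proof.
move=> h; have [e e0|l hl] := @hcomplete R H u.
  have [N hN] := h (Num.sqrt e) (ltac:(by rewrite sqrtr_gt0)).
  exists N => m n hm hn; rewrite -sqr_nrm.
  by rewrite -[ltRHS]sqr_sqrtr ?ltW// ltr_pXn2r ?nnegrE ?nrm_ge0 ?sqrtr_ge0//; apply: hN.
exists l => e e0; have [N hN] := hl (e ^+ 2) (exprn_gt0 _ e0).
exists N => n hn; rewrite -(@ltr_pXn2r _ 2) ?nnegrE ?nrm_ge0 ?ltW// sqr_nrm.
exact: hN.
Qed.

Lemma geo_lt (q C e : R) : 0 <= q < 1 -> 0 < e -> exists N, forall n, (N <= n)%N -> C * q ^+ n < e.
Proof.
move=> /andP[q0 q1] e0.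
have [C0|C0] := leP C 0.
  by exists 0%N => n _; apply: le_lt_trans e0; rewrite mulr_le0_ge0// exprn_ge0.
have : `|q| < 1 by rewrite ger0_norm.
move=> /cvg_expr /cvgrPdist_lt /(_ (e / C) (divr_gt0 e0 C0)) [N _ hN].
exists N => n /hN /=; rewrite sub0r normrN ger0_norm ?exprn_ge0// ltr_pdivlMr//.
by rewrite mulrC.
Qed.

Lemma geo_cvg (u : nat -> H) (C q : R) : 0 <= q < 1 -> 0 <= C ->
  (forall n, nrm (u n.+1 - u n) <= C * q ^+ n) ->
  exists l, hcvg u l /\ forall n, nrm (l - u n) <= C * q ^+ n / (1 - q).
Proof.
move=> /andP[q0 q1] C0 h.
have q1' : 0 < 1 - q by rewrite subr_gt0.
have key n k : nrm (u (n + k)%N - u n) <= C * q ^+ n / (1 - q).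
  suff : nrm (u (n + k)%N - u n) <= C * q ^+ n * (1 - q ^+ k) / (1 - q).
    move=> /le_trans; apply; rewrite ler_pM2r ?invr_gt0// ler_piMr ?mulr_ge0 ?exprn_ge0//.
    by rewrite lerBlDr lerDl exprn_ge0.
  elim: k => [|k IH]; first by rewrite addn0 subrr nrm0 expr0 subrr mulr0 mul0r.
  rewrite addnS; apply: le_trans (nrm_sub _ (u (n + k)%N) _) _.
  apply: le_trans (lerD (h _) IH) _.
  rewrite exprD exprS le_eqVlt; apply/orP; left; apply/eqP; field; lra.
have [|l hl] := @hcomplete_nrm u.
  move=> e e0; have [N hN] := @geo_lt q (C / (1 - q) * 2) e (ltac:(by rewrite q0)) e0.
  exists N => m n hm hn; apply: le_lt_trans (hN N (leqnn _)).
  apply: le_trans (nrm_sub _ (u N) _) _; rewrite (nrmB (u N)).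
  rewrite -(subnKC hm) -(subnKC hn); apply: le_trans (lerD (key _ _) (key _ _)) _.
  by rewrite le_eqVlt; apply/orP; left; apply/eqP; field; lra.
exists l; split=> // n; apply/ler_addgt0Pr => e e0.
have [N hN] := hl e e0.
apply: le_trans (nrm_sub _ (u (n + N)%N) _) _; rewrite addrC lerD//.
by rewrite nrmB ltW// hN// leq_addl.
Qed.

Definition subsp S := S 0 /\ forall a x y, S x -> S y -> S (a *: x + y).
Definition clos S x := forall e : R, 0 < e -> exists s, S s /\ nrm (x - s) < e.
Definition hclosed S := forall x, clos S x -> S x.

Lemma subspD S x y : subsp S -> S x -> S y -> S (x + y).
Proof. by move=> [_ h] sx sy; rewrite -(scale1r x); apply: h. Qed.
Lemma subspZ S a x : subsp S -> S x -> S (a *: x).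
Proof. by move=> [s0 h] sx; rewrite -[_ *: _]addr0; apply: h. Qed.
Lemma subspB S x y : subsp S -> S x -> S y -> S (x - y).
Proof. by move=> [_ h] sx sy; rewrite addrC -scaleN1r; apply: h. Qed.
Lemma subset_clos S x : S x -> clos S x.
Proof. by move=> sx e e0; exists x; rewrite subrr nrm0. Qed.

Lemma clos_clos S : hclosed (clos S).
Proof.
move=> x hx e e0; have e2 : 0 < e / 2 by rewrite divr_gt0.
have [s [hs xs]] := hx _ e2; have [t [ht st]] := hs _ e2.
exists t; split=> //; apply: le_lt_trans (nrm_sub _ s _) _; lra.
Qed.

Lemma clos_subsp S : subsp S -> subsp (clos S).
Proof.
move=> Ss; split; first by apply: subset_clos; case: Ss.
move=> a x y hx hy e e0.
have k0 : 0 < 2 * (cmod a + 1) by have := cmod_ge0 a; lra.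
have [s [hs xs]] := hx (e / (2 * (cmod a + 1))) (divr_gt0 e0 k0).
have [t [ht yt]] := hy (e / 2) (ltac:(by rewrite divr_gt0)).
exists (a *: s + t); split; first by case: Ss => _; apply.
rewrite opprD addrACA -scalerBr; apply: le_lt_trans (nrmD _ _) _; rewrite nrmZ.
suff : cmod a * nrm (x - s) <= e / 2 by lra.
have := ltW xs; rewrite ler_pdivlMr// => h.
have := nrm_ge0 (x - s); have := cmod_ge0 a; nra.
Qed.

Lemma hcvg_clos (u : nat -> H) l S : hcvg u l -> (forall n, S (u n)) -> clos S l.
Proof.
move=> h hu e e0; have [N hN] := h _ e0; exists (u N); split=> //.
by rewrite nrmB; exact: hN.
Qed.

Lemma bop_hcvg T u l : bop T -> hcvg u l -> hcvg (T \o u) (T l).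
Proof.
move=> [Tl [M [M0 hM]]] h e e0.
have M1 : 0 < M + 1 by lra.
have [N hN] := h (e / (M + 1)) (divr_gt0 e0 M1); exists N => n /hN.
rewrite ltr_pdivlMr//= -linB// => h1; apply: le_lt_trans (hM _) _.
apply: le_lt_trans h1; rewrite mulrC ler_wpM2l ?nrm_ge0//; lra.
Qed.

Lemma nrm_small x : (forall e : R, 0 < e -> nrm x < e) -> x = 0.
Proof.
move=> h; apply: nrm_eq0; apply/eqP; rewrite eq_le nrm_ge0 andbT.
by apply/ler_addgt0Pr => e e0; rewrite add0r ltW// h.
Qed.

Lemma hcvg_unique u l l' : hcvg u l -> hcvg u l' -> l = l'.
Proof.
move=> h h'; apply/eqP; rewrite -subr_eq0; apply/eqP/nrm_small => e e0.
have e2 : 0 < e / 2 by rewrite divr_gt0.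
have [N hN] := h _ e2; have [N' hN'] := h' _ e2.
apply: le_lt_trans (nrm_sub _ (u (maxn N N')) _) _; rewrite (nrmB l).
have := hN _ (leq_maxl N N'); have := hN' _ (leq_maxr N N'); lra.
Qed.

Definition bounded_below T := exists C : R, forall x, nrm x <= C * nrm (T x).

Lemma coercive_below T c (e : R) : cmod c = 1 -> 0 < e ->
  (forall x, e * nrm x ^+ 2 <= Re (c * dot (T x) x)) ->
  forall x, e * nrm x <= nrm (T x).
Proof.
move=> c1 e0 h x; have [->|x0] := eqVneq x 0; first by rewrite nrm0 mulr0 nrm_ge0.
have := h x => /le_trans /(_ (Re_le_cmod _)); rewrite cmodM c1 mul1r.
move=> /le_trans /(_ (cauchy_schwarz _ _)); rewrite expr2 mulrA ler_pM2r//.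
exact: nrm_gt0.
Qed.

(** The map [x |-> x - t c (T x - y)] with [t = e / M^2] is a contraction: expanding the square of
    its linear part gives the factor [1 - e^2 / M^2]. Its fixed point solves the equation. *)
Lemma lax_milgram T c (e : R) : bop T -> cmod c = 1 -> 0 < e ->
  (forall x, e * nrm x ^+ 2 <= Re (c * dot (T x) x)) -> forall y, exists x, T x = y.
Proof.
move=> [Tl [M0 [M0p hM0]]] c1 e0 h y.
(* The bound is enlarged by [e] so that [e / M <= 1] and the square [q2] of the contraction factor
   is nonnegative. *)
pose M := M0 + e; have Mp : 0 < M by rewrite /M; lra.
have hM x : nrm (T x) <= M * nrm x.
  by apply: le_trans (hM0 x) _; rewrite ler_wpM2r ?nrm_ge0// /M lerDl ltW.
pose t := e / M ^+ 2; have t0 : 0 < t by rewrite divr_gt0// exprn_gt0.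
pose D x := x - (t%:C * c) *: T x.
pose q2 : R := 1 - e ^+ 2 / M ^+ 2.
have eM : e / M <= 1 by rewrite ler_pdivrMr// mul1r /M lerDr.
have eM0 : 0 < e / M by rewrite divr_gt0.
have q20 : 0 <= q2 < 1.
  have -> : q2 = 1 - (e / M) ^+ 2 by rewrite expr_div_n.
  by rewrite subr_ge0 gtrBl exprn_gt0// andbT expr_le1// ltW.
have hD x : nrm (D x) <= Num.sqrt q2 * nrm x.
  rewrite -ler_sqr ?nnegrE ?mulr_ge0 ?sqrtr_ge0 ?nrm_ge0//.
  have -> : (Num.sqrt q2 * nrm x) ^+ 2 = q2 * nrm x ^+ 2.
    by rewrite exprMn sqr_sqrtr//; case/andP: q20.
  rewrite /D sqr_nrmB nrmZ cmodM c1 mulr1 cmodC gtr0_norm// dotZr.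
  have -> : Re (cj (t%:C * c) * dot x (T x)) = t * Re (c * dot (T x) x).
    rewrite (dotJ (T x)) -JM -mulrA; case: (c * _) => u v /=; ring.
  have h2 := ler_wpM2l (ltW t0) (h x).
  have h3 : (t * nrm (T x)) ^+ 2 <= (t * (M * nrm x)) ^+ 2.
    by apply: sqr_mono; [rewrite mulr_ge0 ?nrm_ge0 ?ltW|rewrite ler_pM2l].
  have e1 : (t * (M * nrm x)) ^+ 2 = (e ^+ 2 / M ^+ 2) * nrm x ^+ 2 by rewrite /t; field; lra.
  have e2 : t * (e * nrm x ^+ 2) = (e ^+ 2 / M ^+ 2) * nrm x ^+ 2 by rewrite /t; field; lra.
  rewrite e1 in h3; rewrite e2 in h2; rewrite /q2; lra.
have Dl : linop D.
  move=> a x z; rewrite /D Tl scalerDr scalerBr !scalerA opprD addrACA.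
  by rewrite [a * _]mulrC.
pose u n := iter n (fun x => D x + (t%:C * c) *: y) 0.
have q1 : 0 <= Num.sqrt q2 < 1.
  rewrite sqrtr_ge0/= -[ltRHS]sqrtr1 ltr_sqrt//; by case/andP: q20.
have hu n : nrm (u n.+1 - u n) <= nrm (u 1%N - u 0%N) * Num.sqrt q2 ^+ n.
  elim: n => [|n IH]; first by rewrite expr0 mulr1.
  have uS m : u m.+1 = D (u m) + (t%:C * c) *: y by rewrite /u iterS.
  have -> : u n.+2 - u n.+1 = D (u n.+1 - u n) by rewrite (uS n.+1) {2}(uS n) linB//; hring.
  apply: le_trans (hD _) _; rewrite exprS mulrCA ler_wpM2l ?sqrtr_ge0//.
have [l [hl _]] := geo_cvg q1 (nrm_ge0 _) hu.
exists l; apply/eqP; rewrite -subr_eq0; apply/eqP.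
have hl' : hcvg (u \o S) l.
  by move=> e' /hl[N hN]; exists N => n hn; apply: hN; rewrite (leq_trans hn).
have hl2 : hcvg (u \o S) (D l + (t%:C * c) *: y).
  have bD : bop D.
    by split=> //; exists (Num.sqrt q2); rewrite sqrtr_ge0.
  move=> e' /(bop_hcvg bD hl)[N hN]; exists N => n /hN.
  have -> // : (u \o succn) n - (D l + (t%:C * c) *: y) = (D \o u) n - D l.
  by rewrite [LHS]/(D (u n) + (t%:C * c) *: y - (D l + (t%:C * c) *: y)); hring.
have := hcvg_unique hl' hl2; rewrite /D -addrA -[X in X = _]addr0 => /addrI.
rewrite addrC -scalerBr => /esym/eqP; rewrite scaler_eq0 => /orP[/eqP tc|/eqP].
  have := congr1 (@cmod R) tc; rewrite cmodM c1 cmod0 cmodC gtr0_norm// mulr1 => t00.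
  by rewrite t00 ltxx in t0.
by move=> h0; rewrite -opprB h0 oppr0.
Qed.

Lemma invn_lt (e : R) : 0 < e -> exists N : nat, forall n, (N <= n)%N -> n.+1%:R^-1 < e.
Proof.
move=> e0; have [N _ hN] := (near_infty_natSinv_lt (PosNum e0)).
by exists N => n /hN.
Qed.

Lemma projection S x : subsp S -> hclosed S ->
  exists p, S p /\ forall s, S s -> dot (x - p) s = 0.
Proof.
move=> Ss Sc.
pose A : set R := [set nrm (x - s) ^+ 2 | s in S].
have A0 : A !=set0 by exists (nrm (x - 0) ^+ 2); exists 0 => //; case: Ss.
have Alb : has_lbound A by exists 0 => _ [s _ <-]; exact: sqr_ge0.
pose d := inf A.
have hd s : S s -> d <= nrm (x - s) ^+ 2 by move=> hs; apply: ge_inf => //; exists s.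
have /choice[u hu] (n : nat) : exists s, S s /\ nrm (x - s) ^+ 2 < d + n.+1%:R^-1.
  have [_ [s ss <-] hs] := @inf_adherent _ A n.+1%:R^-1 (ltac:(by rewrite invr_gt0)) (conj A0 Alb).
  by exists s.
(* The parallelogram identity at the midpoint makes a minimizing sequence a Cauchy sequence. *)
have par m n : nrm (u m - u n) ^+ 2 <= 2 * (m.+1%:R^-1 + n.+1%:R^-1).
  have [sm hm] := hu m; have [sn hn] := hu n.
  have := hd (2^-1%:C *: (u m + u n)) (subspZ _ Ss (subspD Ss sm sn)).
  have -> : x - 2^-1%:C *: (u m + u n) = 2^-1%:C *: ((x - u m) + (x - u n)).
    have e : 2^-1%:C * 2 = 1 :> R[i] 
      by apply: complex_ext => /=; lra.
    apply: eq_dot => z; rewrite !(dotDl, dotNl, dotZl).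
    rewrite -[X in X - _]mul1r -e; ring.
  rewrite nrmZ cmodC exprMn [in X in _ <= _ * X -> _]sqr_nrmD.
  have := sqr_nrmB (x - u m) (x - u n).
  have -> : x - u m - (x - u n) = u n - u m by rewrite opprB addrC subrKA.
  rewrite (nrmB (u n)) ger0_norm//.
  have -> : (2^-1 : R) ^+ 2 = 4^-1 by field.
  rewrite ler_pdivlMl// => h1 h2; rewrite h1; move: hm hn h2.
  move: (m.+1%:R^-1) (n.+1%:R^-1) => a b; lra.
have [|p hp] := hcomplete_nrm (u := u).
  move=> e e0; have [N hN] := @invn_lt (e ^+ 2 / 4) (ltac:(by rewrite divr_gt0// exprn_gt0)).
  exists N => m n hm hn.
  rewrite -(@ltr_pXn2r _ 2) ?nnegrE ?nrm_ge0 ?ltW//.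
  have := par m n; have := hN m hm; have := hN n hn.
  move: (m.+1%:R^-1) (n.+1%:R^-1) => a b; lra.
have Sp : S p by apply: Sc; apply: hcvg_clos hp _ => n; case: (hu n).
have dp : nrm (x - p) <= Num.sqrt d.
  apply/ler_addgt0Pr => e e0.
  have d0 : 0 <= d by apply: lb_le_inf => // _ [s _ <-]; exact: sqr_ge0.
  have [N hN] := hp (e / 2) (ltac:(by rewrite divr_gt0)).
  have [N' hN'] := @invn_lt (e ^+ 2 / 4) (ltac:(by rewrite divr_gt0// exprn_gt0)).
  pose n := maxn N N'.
  apply: le_trans (nrm_sub _ (u n) _) _.
  suff : nrm (x - u n) <= Num.sqrt d + e / 2.
    have := hN n (leq_maxl _ _); lra.
  rewrite -ler_sqr ?nnegrE ?nrm_ge0 ?addr_ge0 ?sqrtr_ge0 ?divr_ge0 ?ltW//.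
  have [_ h] := hu n; apply: lt_trans h _.
  rewrite sqrrD sqr_sqrtr//.
  have := hN' n (leq_maxr _ _); have := sqrtr_ge0 d.
  move: (n.+1%:R^-1) (Num.sqrt d) => a b; have := e0; nra.
exists p; split=> // s ss.
have d0 : 0 <= d by apply: lb_le_inf => // _ [s' _ <-]; exact: sqr_ge0.
have dp2 : nrm (x - p) ^+ 2 <= d by rewrite -(sqr_sqrtr d0); apply: sqr_mono => //; exact: nrm_ge0.
set w := x - p in dp2 *; apply: cmod_eq0; apply/eqP; rewrite eq_le cmod_ge0 andbT leNgt.
apply/negP => k0.
(* Moving [p] by [t <w, s> s] would come closer to [x] unless [<w, s> = 0]; the summand 1 covers
   [s = 0]. *)
pose t : R := (nrm s ^+ 2 + 1)^-1.
have s2 := sqr_ge0 (nrm s).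
have t0 : 0 < t by rewrite invr_gt0; lra.
have := hd (p + (t%:C * dot w s) *: s) (subspD Ss Sp (subspZ _ Ss ss)).
rewrite opprD addrA -/w sqr_nrmB nrmZ dotZr JM JC cmodM cmodC gtr0_norm//.
have -> : Re (t%:C * cj (dot w s) * dot w s) = t * cmod (dot w s) ^+ 2.
  by rewrite -mulrA [cj _ * _]mulrC mulcJ -rmorphM.
set k := cmod _ in k0 * => h.
have ts : t * nrm s ^+ 2 <= 1.
  by rewrite /t mulrC ler_pdivrMr ?mul1r ?lerDl//; lra.
have tk : 0 < t * k ^+ 2 by rewrite mulr_gt0 ?exprn_gt0.
have e : (t * k * nrm s) ^+ 2 = (t * nrm s ^+ 2) * (t * k ^+ 2) by ring.
rewrite e in h; nra.
Qed.

Lemma dense_of_ortho S x : subsp S -> (forall y, (forall s, S s -> dot y s = 0) -> y = 0) ->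
  clos S x.
Proof.
move=> Ss h; have [p [hp hq]] := projection x (clos_subsp Ss) (@clos_clos S).
have /eqP : x - p = 0 by apply: h => s ss; apply: hq; exact: subset_clos.
by rewrite subr_eq0 => /eqP ->.
Qed.

Lemma dot_clos0 S x y : clos S y -> (forall s, S s -> dot x s = 0) -> dot x y = 0.
Proof.
move=> hy h; apply: cmod_eq0; apply/eqP; rewrite eq_le cmod_ge0 andbT.
apply/ler_addgt0Pr => e e0; rewrite add0r.
have k0 : 0 < nrm x + 1 by have := nrm_ge0 x; lra.
have [s [ss hs]] := hy (e / (nrm x + 1)) (divr_gt0 e0 k0).
have -> : dot x y = dot x (y - s) by rewrite dotBr (h s ss) subr0.
apply: le_trans (cauchy_schwarz _ _) _.
move: (ltW hs); rewrite ler_pdivlMr//; have := nrm_ge0 (y - s); nra.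
Qed.

Lemma ortho_closed S : hclosed [set x | forall s, S s -> dot x s = 0].
Proof.
move=> x hx s ss; apply: dotC0.
by apply: dot_clos0 hx _ => y /(_ s ss) ?; exact: dotC0.
Qed.

(** A gliding hump in place of Baire's theorem: a step [d n] of length [3^-n] along [y n] is added
    with the sign that keeps the pairing with [y n] at least [3^-n nrm (y n)]; one sign does,
    because [2 b = (a + b) - (a - b)]. The later steps can destroy only half of that. *)
Lemma uniform_boundedness (F : set H) :
  (forall x, exists C : R, forall y, F y -> cmod (dot x y) <= C) ->
  exists C : R, forall y, F y -> nrm y <= C.
Proof.
move=> hF; apply: contrapT => nC.
have /choice[y hy] (n : nat) : exists y, F y /\ 2 * n%:R * 3 ^+ n < nrm y.
  apply: contrapT => nh; apply: nC; exists (2 * n%:R * 3 ^+ n) => y Fy.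
  by rewrite leNgt; apply/negP => h; apply: nh; exists y.
have y0 n : 0 < nrm (y n).
  by have [_] := hy n; apply: le_lt_trans; rewrite !mulr_ge0// exprn_ge0.
pose d n : H := ((3^-1 ^+ n) / nrm (y n))%:C *: y n.
have dd n : nrm (d n) = 3^-1 ^+ n.
  by rewrite nrmZ cmodC ger0_norm ?divr_ge0 ?exprn_ge0 ?nrm_ge0// mulfVK ?gt_eqF.
have dy n : cmod (dot (d n) (y n)) = 3^-1 ^+ n * nrm (y n).
  rewrite dotZl dotxx -rmorphM cmodC ger0_norm ?mulr_ge0 ?invr_ge0 ?exprn_ge0 ?nrm_ge0//.
  by field; rewrite gt_eqF.
pose u := fix u n := if n is m.+1 then
   (if cmod (dot (u m + d m) (y m)) >= cmod (dot (d m) (y m)) then u m + d m else u m - d m)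
   else 0.
have uS n : nrm (u n.+1 - u n) <= 1 * 3^-1 ^+ n.
  rewrite mul1r -dd /=; case: ifP => _; rewrite addrC addKr ?nrmN//.
have uy n : cmod (dot (d n) (y n)) <= cmod (dot (u n.+1) (y n)).
  have -> : u n.+1 = if cmod (dot (u n + d n) (y n)) >= cmod (dot (d n) (y n))
    then u n + d n else u n - d n by [].
  case: ifPn => //; rewrite -ltNge => /ltW.
  rewrite !dotDl dotNl; set a := dot (u n) _; set b := dot (d n) _ => h.
  have : cmod (b + b) <= cmod (a + b) + cmod (a - b).
    have -> : b + b = (a + b) - (a - b) by ring.
    by apply: le_trans (cmodD _ _) _; rewrite cmodN.
  have -> : b + b = 2%:C * b by apply: complex_ext; case: (b) => ? ? /=; ring.
  rewrite cmodM cmodC ger0_norm//; lra.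
have q1 : (0 <= (3^-1 : R)) && ((3^-1 : R) < 1) by apply/andP; split; lra.
have [l [_ hl]] := geo_cvg q1 ler01 uS.
have [C hC] := hF l.
have [n hn] : exists n : nat, C < n%:R.
  by exists (Num.truncn C).+1; exact: truncnS_gt.
have [Fy hyn] := hy n.
have := hC _ Fy; apply/negP; rewrite -ltNge; apply: lt_le_trans hn _.
have e1 : dot l (y n) = dot (u n.+1) (y n) - dot (u n.+1 - l) (y n) by rewrite dotBl; ring.
rewrite e1; apply: le_trans (cmodB_ge _ _).
have h1 := uy n; rewrite dy in h1.
have h2 := cauchy_schwarz (u n.+1 - l) (y n); rewrite nrmB in h2.
have h3 := ler_wpM2r (nrm_ge0 (y n)) (hl n.+1).
have q0 : 0 < (3^-1 : R) ^+ n by rewrite exprn_gt0// invr_gt0.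
have h4 : n%:R * 2 <= 3^-1 ^+ n * nrm (y n).
  have := ler_wpM2l (ltW q0) (ltW hyn).
  by rewrite mulrCA -exprMn mulVf// expr1n mulr1 mulrC.
have e3 : 1 * 3^-1 ^+ n.+1 / (1 - 3^-1) * nrm (y n) = 3^-1 ^+ n * nrm (y n) / 2.
  rewrite exprS; move: (3^-1 ^+ n) => q; field; lra.
rewrite e3 in h3; move: h1 h2 h3 h4.
move: (_ * nrm _) (_ * nrm _) (cmod _) (cmod _) => b1 b2 b3 b4; lra.
Qed.

(** The [y] for which the bracket on the right is at most 1 are weakly bounded, since every vector
    is [T f] plus a combination of the [v i]; uniform boundedness then bounds their norms. *)
Lemma coker_adjoint T T' n (v : 'I_n -> H) : adjoint T T' ->
  (forall g, exists f (c : 'I_n -> R[i]), g = T f + \sum_i c i *: v i) ->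
  exists C : R, forall y, nrm y <= C * (nrm (T' y) + \sum_i cmod (dot y (v i))).
Proof.
move=> adj hT.
pose N y := nrm (T' y) + \sum_i cmod (dot y (v i)).
have N0 y : 0 <= N y by rewrite addr_ge0 ?nrm_ge0 ?sumr_ge0// => i _; exact: cmod_ge0.
have [x|C hC] := @uniform_boundedness [set y | N y <= 1].
  have [f [c ->]] := hT x; exists (nrm f + \sum_i cmod (c i)) => y hy.
  have T'y1 : nrm (T' y) <= 1.
    by apply: le_trans hy; rewrite /N lerDl sumr_ge0// => i _; exact: cmod_ge0.
  rewrite dotDl adj dot_suml; apply: le_trans (cmodD _ _) _; apply: lerD.
    by apply: le_trans (cauchy_schwarz _ _) _; rewrite ler_piMr ?nrm_ge0.
  apply: (@le_trans _ _ (\sum_i cmod (dot (c i *: v i) y))).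
    elim/big_rec2: _ => [|i a b _ h]; first by rewrite cmod0.
    by apply: le_trans (cmodD _ _) _; rewrite lerD2l.
  apply: ler_sum => i _; rewrite dotZl cmodM ler_piMr ?cmod_ge0//.
  rewrite dotJ cmodJ; apply: le_trans hy; rewrite /N (bigD1 i)//= addrCA lerDl addr_ge0 ?nrm_ge0//.
  by rewrite sumr_ge0// => j _; exact: cmod_ge0.
exists `|C| => y; rewrite -/(N y).
have key e : 0 < e -> nrm y <= `|C| * (N y + e).
  move=> e0; have Ne : 0 < N y + e by have := N0 y; lra.
  have := hC (((N y + e)^-1)%:C *: y).
  rewrite nrmZ cmodC gtr0_norm ?invr_gt0// ler_pdivrMl// => h.
  rewrite mulrC (le_trans (h _))//; last by rewrite ler_pM2l// ler_norm.
  rewrite /= {1}/N linZ; last exact: adjoint_lin (adjoint_sym adj).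
  rewrite nrmZ cmodC gtr0_norm ?invr_gt0//.
  have -> : \sum_i cmod (dot ((N y + e)^-1%:C *: y) (v i)) =
      \sum_i (N y + e)^-1 * cmod (dot y (v i)).
    by apply: eq_bigr => i _; rewrite dotZl cmodM cmodC gtr0_norm ?invr_gt0.
  by rewrite -mulr_sumr -mulrDr ler_pdivrMl// mulr1 lerDl ltW.
apply/ler_addgt0Pr => e e0.
have C1 : 0 < `|C| + 1 by have := normr_ge0 C; lra.
apply: le_trans (key (e / (`|C| + 1)) (divr_gt0 e0 C1)) _.
rewrite mulrDr lerD2l mulrA ler_pdivrMr//; have := normr_ge0 C; nra.
Qed.

Lemma onto_adjoint_below T T' : adjoint T T' -> (forall g, exists f, T f = g) -> bounded_below T'.
Proof.
move=> adj hT; have [|C hC] := @coker_adjoint T T' 0 (fun=> 0) adj.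
  by move=> g; have [f <-] := hT g; exists f, (fun=> 0); rewrite big_ord0 addr0.
by exists C => y; have := hC y; rewrite big_ord0 addr0.
Qed.

Lemma range_subsp T : linop T -> subsp (range T).
Proof.
move=> Tl; split; first by exists 0 => //; exact: lin0.
by move=> a _ _ [x _ <-] [y _ <-]; exists (a *: x + y) => //; rewrite Tl.
Qed.

(** On the closed range, uniform boundedness gives [nrm g <= C nrm (T' g)]. A vector [f] orthogonal
    to the kernel is a limit of vectors [T' p] with [p] in the range, and [<f, T' p> = <T f, p>] is
    controlled by that bound. *)
Lemma closed_range_bound T T' : bop T -> adjoint T T' -> hclosed (range T) ->
  exists C : R, forall f, (forall k, T k = 0 -> dot f k = 0) -> nrm f <= C * nrm (T f).
Proof.
move=> [Tl Tb] adj Tc.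
have adj' := adjoint_sym adj; have T'l := adjoint_lin adj'.
have Rs := range_subsp Tl.
have [x|C hC] := @uniform_boundedness [set y | range T y /\ nrm (T' y) <= 1].
  have [p [[f _ fp] hp]] := projection x Rs Tc; exists (nrm f) => y [ry y1].
  have -> : dot x y = dot f (T' y).
    by rewrite -adj fp -[x](subrK p) dotDl hp// add0r.
  by apply: le_trans (cauchy_schwarz _ _) _; rewrite ler_piMr ?nrm_ge0.
have hb g e : range T g -> 0 < e -> nrm (T' g) <= e -> nrm g <= `|C| * e.
  move=> rg e0 ge.
  have := hC ((e^-1)%:C *: g); rewrite nrmZ cmodC gtr0_norm ?invr_gt0// ler_pdivrMl// mulrC => h.
  rewrite (le_trans (h _))//; last by rewrite ler_pM2r// ler_norm.
  split; first exact: subspZ.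
  by rewrite linZ// nrmZ cmodC gtr0_norm ?invr_gt0// ler_pdivrMl// mulr1.
exists (2 * `|C|) => f hf.
have [->|f0] := eqVneq f 0; first by rewrite nrm0 mulr_ge0 ?nrm_ge0// mulr_ge0.
have nf := nrm_gt0 f0.
have : clos (range T') f.
  have [p [pc hp]] := projection f (clos_subsp (range_subsp T'l)) (@clos_clos _).
  suff /eqP : f - p = 0 by rewrite subr_eq0 => /eqP ->.
  have k0 : T (f - p) = 0.
    apply: eq_dot => z; rewrite dot0l adj; apply: hp; apply: subset_clos; by exists z.
  by apply: dot_def; rewrite dotBr (hp p pc) (dotC0 (hf _ k0)) subr0.
move=> hcl; apply/ler_addgt0Pr => e e0.
(* The second bound keeps [nrm (T' p)] below [2 nrm f], so that one factor [nrm f] cancels at the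
   end. *)
pose d := Num.min e (nrm f / 2).
have d0 : 0 < d by rewrite lt_min e0 divr_gt0.
have [_ [[g _ <-] hg]] := hcl d d0.
have [p [rp hp]] := projection g Rs Tc.
have T'gp : T' g = T' p.
  apply/eqP; rewrite -subr_eq0 -linB//; apply/eqP/eq_dot => z.
  rewrite dot0l adj'; apply: hp; by exists z.
rewrite T'gp in hg.
have de : d <= e by rewrite ge_min lexx.
have df : d <= nrm f / 2 by rewrite ge_min lexx orbT.
have nT' : nrm (T' p) <= 2 * nrm f.
  have := nrmB_ge (T' p) f; rewrite nrmB; lra.
have np := hb p _ rp (ltac:(by rewrite mulr_gt0) : 0 < 2 * nrm f) nT'.
have : nrm f ^+ 2 <= nrm f * e + nrm (T f) * (`|C| * (2 * nrm f)).
  rewrite sqr_nrm -{2}[f](subrK (T' p)) dotDr ReD -adj lerD//.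
    by apply: le_trans (Re_dot_le _ _) _; rewrite ler_pM2l//; lra.
  by apply: le_trans (Re_dot_le _ _) _; rewrite ler_wpM2l ?nrm_ge0.
move=> h; rewrite -(ler_pM2r nf) -expr2; apply: le_trans h _.
by rewrite le_eqVlt; apply/orP; left; apply/eqP; ring.
Qed.

Lemma nrm_ortho_le x z : z != 0 -> nrm (x - (dot x z / (nrm z ^+ 2)%:C) *: z) <= nrm x.
Proof.
move=> z0; have p := nrm_gt0 z0.
set w := x - _; have wz : dot w z = 0.
  rewrite dotBl dotZl dotxx mulfVK ?subrr// -[0]/(0%:C).
  by apply/eqP => /complexI /eqP; rewrite expf_eq0/= gt_eqF.
rewrite -ler_sqr ?nnegrE ?nrm_ge0//.
have -> : x = w + (dot x z / (nrm z ^+ 2)%:C) *: z by rewrite subrK.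
by rewrite [leRHS]pythagoras ?dotZr ?wz ?mulr0// lerDl sqr_ge0.
Qed.

(** Replace [z] by its component [w] orthogonal to [S]: removing the component along [w] then turns
    approximants in [S] plus the line into approximants in [S], without increasing the error. *)
Lemma closed_add_line S z : subsp S -> hclosed S ->
  hclosed [set x | exists s a, S s /\ x = s + a *: z].
Proof.
move=> Ss Sc x hx.
have [p [Sp hp]] := projection z Ss Sc.
have [/eqP z0|z0] := eqVneq (z - p) 0.
  exists x, 0; rewrite scale0r addr0; split=> //; apply: Sc => e /hx[_ [[s [a [ss ->]]] h]].
  exists (s + a *: z); split=> //; apply: subspD => //; apply: subspZ => //.
  by move: z0; rewrite subr_eq0 => /eqP ->.
set w := z - p in z0 hp.
pose a := dot x w / (nrm w ^+ 2)%:C.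
have hs : S (x - a *: w).
  apply: Sc => e /hx[_ [[s [b [ss ->]]] h]].
  exists (s + b *: p); split; first by apply: subspD => //; exact: subspZ.
  apply: le_lt_trans h; set s' := s + b *: p.
  have Ss' : S s' by apply: subspD => //; exact: subspZ.
  have -> : s + b *: z = s' + b *: w by rewrite /s' /w scalerBr [b *: z - _]addrC addrA addrK.
  have -> : x - a *: w - s' = (x - (s' + b *: w)) - (dot (x - (s' + b *: w)) w / (nrm w ^+ 2)%:C) *: w.
    rewrite dotBl dotDl dotZl [dot s' w]dotJ hp// J0 add0r dotxx mulrBl mulfK.
      by rewrite -/a; hring.
    by rewrite -[0]/(0%:C); apply/eqP => /complexI /eqP; rewrite expf_eq0/= gt_eqF// nrm_gt0.
  exact: nrm_ortho_le.
exists (x - a *: w - a *: p), a; split.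
  by apply: subspB => //; exact: subspZ.
by rewrite /w scalerBr opprB !addrA [_ - _ - _]addrAC addrK subrK.
Qed.

Lemma below_range_closed T C M : bop T -> subsp M -> hclosed M ->
  (forall f, M f -> nrm f <= C * nrm (T f)) -> hclosed [set T f | f in M].
Proof.
move=> Tb Ms Mc hC y hy.
have [Tl _] := Tb.
have /choice[u hu] (n : nat) : exists f, M f /\ nrm (y - T f) < n.+1%:R^-1.
  have [_ [[f Mf <-] h]] := hy n.+1%:R^-1 (ltac:(by rewrite invr_gt0)); by exists f.
have cvT : hcvg (T \o u) y.
  move=> e /invn_lt[N hN]; exists N => n /hN h /=; rewrite nrmB; apply: lt_trans h.
  by case: (hu n).
have [|l hl] := hcomplete_nrm (u := u).
  move=> e e0; have C1 : 0 < `|C| + 1 by have := normr_ge0 C; lra.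
  have [N hN] := cvT (e / (2 * (`|C| + 1))) (ltac:(by rewrite divr_gt0// mulr_gt0)).
  exists N => m n hm hn.
  have Mmn : M (u m - u n) by apply: subspB => //; [case: (hu m)|case: (hu n)].
  have : nrm (u m - u n) <= (`|C| + 1) * nrm (T (u m - u n)).
    apply: le_trans (hC _ Mmn) _; rewrite ler_wpM2r ?nrm_ge0//; have := ler_norm C; lra.
  move/le_lt_trans; apply; rewrite mulrC -ltr_pdivlMr// linB//.
  apply: le_lt_trans (nrm_sub _ y _) _; rewrite (nrmB y).
  have := hN m hm; have := hN n hn => /=.
  have -> : e / (2 * (`|C| + 1)) = e / (`|C| + 1) / 2 by field; lra.
  lra.
exists l; first by apply: Mc; apply: hcvg_clos hl _ => n; case: (hu n).
exact: hcvg_unique (bop_hcvg Tb hl) cvT.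
Qed.

Definition spanned n (w : 'I_n -> H) x := exists c : 'I_n -> R[i], x = \sum_i c i *: w i.

Definition finite_ker T M := exists n (w : 'I_n -> H),
  (forall i, M (w i) /\ T (w i) = 0) /\ forall f, M f -> T f = 0 -> spanned w f.

(** One linear condition lowers the dimension of the kernel by at most one: either it holds on the
    whole kernel, or a single [k] violating it completes the family. *)
Lemma finite_ker_step T M v : linop T -> subsp M ->
  finite_ker T [set f | M f /\ dot f v = 0] -> finite_ker T M.
Proof.
move=> Tl Ms [n [w [hw hs]]].
have [[k [Mk [Tk kv]]]|nk] := pselect (exists k, M k /\ T k = 0 /\ dot k v != 0); last first.
  exists n, w; split=> [i|f Mf Tf]; first by have [[]] := hw i.
  apply: hs => //; split=> //; apply: contrapT => fv; apply: nk; exists f.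
  by do 2 split => //; apply/eqP.
exists n.+1, (fun i => if unlift ord0 i is Some j then w j else k); split=> [i|f Mf Tf].
  by case: unliftP => [j|] _ //; have [[]] := hw j.
have [c hc] : spanned w (f - (dot f v / dot k v) *: k).
  apply: hs; last by rewrite linB// linZ// Tf Tk scaler0 subrr.
  split; first by apply: subspB => //; exact: subspZ.
  by rewrite dotBl dotZl mulfVK// subrr.
exists (fun i => if unlift ord0 i is Some j then c j else dot f v / dot k v).
rewrite big_ord_recl unlift_none; under eq_bigr do rewrite liftK.
by rewrite -hc addrC subrK.
Qed.

(** Bounded below on a subspace of finite codimension: the form of the left-Fredholm property that
    passes through composition with invertible operators. *)
Definition fin_below T := exists n (v : 'I_n -> H) (C : R),
  forall f, (forall i, dot f (v i) = 0) -> nrm f <= C * nrm (T f).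

(** The conditions are dropped one at a time. On [M 0] the operator is bounded below, [M n] is the
    whole space, and each step adds at most a line to the range and a dimension to the kernel. *)
Lemma fin_below_fredholm T : bop T -> fin_below T ->
  hclosed (range T) /\ finite_ker T setT.
Proof.
move=> Tb [n [v [C hC]]]; have [Tl _] := Tb.
pose M k := [set f | forall i : 'I_n, (k <= i)%N -> dot f (v i) = 0].
have Ms k : subsp (M k).
  split=> [i _|a x y hx hy i hi]; first exact: dot0l.
  by rewrite dotDl dotZl hx// hy// mulr0 addr0.
suff hQ k : (k <= n)%N -> hclosed [set T f | f in M k] /\ finite_ker T (M k).
  have -> : range T = [set T f | f in M n].
    apply/seteqP; split=> _ [f _ <-]; exists f => // i; by rewrite leqNgt ltn_ord.
  have -> : setT = M n by apply/seteqP; split=> // f _ i; rewrite leqNgt ltn_ord.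
  exact: hQ.
elim: k => [_|k IH kn].
  split.
    apply: (@below_range_closed T C) => //.
    - have -> : M 0%N = [set x | forall s, (exists i, s = v i) -> dot x s = 0].
        apply/seteqP; split=> f hf.
          by move=> _ [i ->]; exact: hf.
        by move=> i _; apply: hf; exists i.
      exact: ortho_closed.
    - by move=> f hf; apply: hC => i; exact: hf.
  exists 0%N, (fun=> 0); split=> [[]//|f Mf Tf]; exists (fun=> 0); rewrite big_ord0.
  apply: nrm_eq0; apply/eqP; rewrite eq_le nrm_ge0 andbT.
  by have := hC f (fun i => Mf i (leq0n i)); rewrite Tf nrm0 mulr0.
have [cl ke] := IH (ltnW kn).
pose i0 := Ordinal kn.
have Mk : M k = [set f | M k.+1 f /\ dot f (v i0) = 0].
  apply/seteqP; split=> f hf.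
    by split=> [i hi|]; apply: hf => //; exact: ltnW.
  move=> i; rewrite leq_eqVlt => /orP[/eqP e|]; last by case: hf => + _; apply.
  by have -> : i = i0; [apply: val_inj|case: hf].
split; last by apply: (@finite_ker_step _ _ (v i0)) => //; rewrite -Mk.
have [[w [Mw wv]]|nw] := pselect (exists w, M k.+1 w /\ dot w (v i0) != 0); last first.
  have <- // : M k = M k.+1.
  rewrite Mk; apply/seteqP; split=> [f []//|f hf]; split=> //.
  by apply: contrapT => h; apply: nw; exists f; split=> //; apply/eqP.
have -> : [set T f | f in M k.+1] =
    [set x | exists s a, [set T f | f in M k] s /\ x = s + a *: T w].
  apply/seteqP; split=> [_ [f Mf <-]|_ [_ [a [[f Mf <-] ->]]]].
    exists (T (f - (dot f (v i0) / dot w (v i0)) *: w)), (dot f (v i0) / dot w (v i0)); split.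
      exists (f - (dot f (v i0) / dot w (v i0)) *: w) => //.
      rewrite Mk; split; first exact: (subspB (Ms _) Mf (subspZ _ (Ms _) Mw)).
      by rewrite dotBl dotZl mulfVK// subrr.
    by rewrite (linB Tl) (linZ Tl) subrK.
  exists (f + a *: w); last by rewrite (linD Tl) (linZ Tl).
  have Mf' : M k.+1 f by move: Mf; rewrite Mk => -[].
  exact: (subspD (Ms _) Mf' (subspZ _ (Ms _) Mw)).
apply: closed_add_line => //.
split; first by exists 0; [case: (Ms k)|exact: lin0].
move=> a _ _ [x Mx <-] [y My <-]; exists (a *: x + y); last by rewrite Tl.
by case: (Ms k) => _; apply.
Qed.

(** With [P] the projection on the kernel of [T'], the operator [T T' + P] is coercive, because
    closedness of the range bounds [T'] below off its kernel. So [T (T' y) + P y = g] is solvable,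
    and [P y = 0] when [g] is in the closure of the range of [T]. *)
Lemma closed_range_adjoint T T' : bop T -> bop T' -> adjoint T T' ->
  hclosed (range T') -> hclosed (range T).
Proof.
move=> Tb T'b adj T'c; have adj' := adjoint_sym adj.
have [C hC] := closed_range_bound T'b adj' T'c.
have [Tl _] := Tb; have [T'l _] := T'b.
pose K := [set k | T' k = 0].
have Ks : subsp K.
  by split=> [|a x y hx hy]; [exact: lin0|rewrite /K /= T'l hx hy scaler0 addr0].
have Kc : hclosed K.
  have KE : K = [set k | forall s, range T s -> dot k s = 0].
    apply/seteqP; split=> k hk.
      by move=> _ [z _ <-]; rewrite -adj' hk dot0l.
    by apply: eq_dot => z; rewrite dot0l adj'; apply: hk; exists z.
  by rewrite KE; exact: ortho_closed.
have /choice[P hP] (x : H) := projection x Ks Kc.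
have PK x : T' (P x) = 0 by case: (hP x).
have Po x k : T' k = 0 -> dot (x - P x) k = 0 by case: (hP x) => _; apply.
have Pl : linop P.
  move=> a x y; apply/eqP; rewrite -subr_eq0; apply/eqP; set d := _ - _.
  have dK : T' d = 0.
    by rewrite linB// T'l !PK scaler0 addr0 subrr.
  apply: dot_def; rewrite {1}/d.
  have -> : P (a *: x + y) - (a *: P x + P y) =
     (a *: (x - P x) + (y - P y)) - ((a *: x + y) - P (a *: x + y)).
    hring.
  by rewrite dotBl dotDl dotZl !Po// mulr0 addr0 subr0.
have Psq x : nrm x ^+ 2 = nrm (x - P x) ^+ 2 + nrm (P x) ^+ 2.
  by rewrite -pythagoras ?subrK// Po.
have PE x : dot (P x) x = (nrm (P x) ^+ 2)%:C.
  rewrite -[X in dot _ X](subrK (P x)) dotDr dotxx [dot _ (_ - _)]dotJ Po// J0 add0r//.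
have Pb : bop P.
  split=> //; exists 1; split=> // x; rewrite mul1r.
  by rewrite -ler_sqr ?nnegrE ?nrm_ge0// (Psq x) lerDr sqr_ge0.
move=> g hg.
have C1 : 0 < `|C| + 1 by have := normr_ge0 C; lra.
pose e : R := Num.min 1 ((`|C| + 1) ^+ 2)^-1.
have e0 : 0 < e by rewrite lt_min ltr01 invr_gt0 exprn_gt0.
have [y hy] : exists y, T (T' y) + P y = g.
  apply: (@lax_milgram (fun y => T (T' y) + P y) 1 e) => //; rewrite ?cmod1//.
    by apply: bop_add => //; exact: (bop_comp Tb T'b).
  move=> x; rewrite mul1r dotDl adj dotxx PE -rmorphD ReC (Psq x) mulrDr lerD//; last first.
    by rewrite ler_piMl ?sqr_ge0// ge_min lexx.
  have : nrm (x - P x) <= (`|C| + 1) * nrm (T' x).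
    have -> : T' x = T' (x - P x) by rewrite linB// PK subr0.
    apply: le_trans (hC _ _) _; first by move=> k; exact: Po.
    by rewrite ler_wpM2r ?nrm_ge0//; have := ler_norm C; lra.
  move/(sqr_mono (nrm_ge0 _)); rewrite exprMn => h.
  apply: (@le_trans _ _ (((`|C| + 1) ^+ 2)^-1 * nrm (x - P x) ^+ 2)).
    by rewrite ler_wpM2r ?sqr_ge0// ge_min lexx orbT.
  by rewrite ler_pdivrMl// exprn_gt0.
exists (T' y) => //; rewrite -hy; suff -> : P y = 0 by rewrite addr0.
apply: dot_def; rewrite dotJ ReJ.
have -> : P y = g - T (T' y) by rewrite -hy addrC addKr.
rewrite -{1}hy [T _ + _]addrC addrK dotBr -adj' PK dot0l subr0.
rewrite (dot_clos0 hg)// => _ [z _ <-].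
by rewrite -adj' PK dot0l.
Qed.

(** The orthogonal complement of the range is the kernel of [T'], which finitely many vectors
    span. *)
Lemma fin_below_coker T T' : bop T -> bop T' -> adjoint T T' -> fin_below T' ->
  hclosed (range T) /\ exists n (w : 'I_n -> H), forall g, exists f (c : 'I_n -> R[i]),
    g = T f + \sum_i c i *: w i.
Proof.
move=> Tb T'b adj lf; have [cl [n [w [hw hs]]]] := fin_below_fredholm T'b lf.
have Tc := closed_range_adjoint Tb T'b adj cl.
split=> //; exists n, w => g.
have [Tl _] := Tb.
have [p [[f _ fp] hp]] := projection g (range_subsp Tl) Tc.
have [//||c hc] := hs (g - p).
  by apply: eq_dot => z; rewrite dot0l (adjoint_sym adj); apply: hp; exists z.
by exists f, c; rewrite fp -hc addrC subrK.
Qed.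

End Hilbert.

(** * Integration of complex functions *)

Section Integration.
Context {R : realType}.
Local Notation mu := (@lebesgue_measure R).
Implicit Types (u v w : R -> R) (f g h : R -> Cplx R).

Lemma aeS (P Q : R -> Prop) : {ae mu, forall x, P x} -> (forall x, P x -> Q x) ->
  {ae mu, forall x, Q x}.
Proof. by move=> h PQ; apply: (@filterS _ _ (ae_filter_ringOfSetsType mu) P). Qed.
Lemma aeS2 (P P' Q : R -> Prop) : {ae mu, forall x, P x} -> {ae mu, forall x, P' x} ->
  (forall x, P x -> P' x -> Q x) -> {ae mu, forall x, Q x}.
Proof. by move=> h h' PQ; apply: (@filterS2 _ _ (ae_filter_ringOfSetsType mu) P P'). Qed.
Lemma aeS3 (P P' P'' Q : R -> Prop) : {ae mu, forall x, P x} -> {ae mu, forall x, P' x} ->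
  {ae mu, forall x, P'' x} -> (forall x, P x -> P' x -> P'' x -> Q x) -> {ae mu, forall x, Q x}.
Proof. by move=> h h' h'' PQ; apply: (@filterS3 _ _ (ae_filter_ringOfSetsType mu) P P' P''). Qed.
Lemma aeA (P : R -> Prop) : (forall x, P x) -> {ae mu, forall x, P x}.
Proof. by move=> h; apply: aeW. Qed.
Lemma aeI (P Q : R -> Prop) : {ae mu, forall x, P x} -> {ae mu, forall x, Q x} ->
  {ae mu, forall x, P x /\ Q x}.
Proof. by move=> h h'; apply: (aeS2 h h'). Qed.

Definition rinteg u := mu.-integrable setT (EFin \o u).
Definition rint u : R := Rintegral mu setT u.

Lemma rinteg_meas u : rinteg u -> measurable_fun setT u.
Proof. by move=> /measurable_int /measurable_EFinP. Qed.
Lemma rinteg_le u v : measurable_fun setT u -> (forall x, `|u x| <= v x) -> rinteg v -> rinteg u.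
Proof.
move=> mu_ h iv; apply: (le_integrable _ _ _ iv) => //; first exact/measurable_EFinP.
by move=> x _ /=; rewrite lee_fin (le_trans (h x))// ler_norm.
Qed.
Lemma rintegD u v : rinteg u -> rinteg v -> rinteg (fun x => u x + v x).
Proof. by move=> iu iv; have := integrableD _ iu iv; apply. Qed.
Lemma rintegZ k u : rinteg u -> rinteg (fun x => k * u x).
Proof. by move=> iu; have := integrableZl _ k iu; apply. Qed.
Lemma rintegN u : rinteg u -> rinteg (fun x => - u x).
Proof. by move=> /(rintegZ (-1)); under eq_fun do rewrite mulN1r. Qed.
Lemma rinteg_norm u : rinteg u -> rinteg (fun x => `|u x|).
Proof. exact: integrable_norm. Qed.
Lemma rinteg_ge0P u : measurable_fun setT u -> (forall x, 0 <= u x) ->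
  rinteg u <-> (\int[mu]_x (u x)%:E < +oo)%E.
Proof.
move=> mu_ u0; split.
  move=> /integrableP[_]; apply: le_lt_trans.
  by under eq_integral => x _ do rewrite -(ger0_norm (u0 x)).
move=> h; apply/integrableP; split; first exact/measurable_EFinP.
by under eq_integral => x _ do rewrite /= ger0_norm//.
Qed.
Lemma rint_EFin u : rinteg u -> (\int[mu]_x (u x)%:E)%E = (rint u)%:E.
Proof. by move=> iu; rewrite /rint /Rintegral fineK// (integrable_fin_num _ iu). Qed.
Lemma rintD u v : rinteg u -> rinteg v -> rint (fun x => u x + v x) = rint u + rint v.
Proof. by move=> iu iv; rewrite /rint RintegralD. Qed.
Lemma rintZ k u : rinteg u -> rint (fun x => k * u x) = k * rint u.
Proof. by move=> iu; rewrite /rint RintegralZl. Qed.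
Lemma rintN u : rinteg u -> rint (fun x => - u x) = - rint u.
Proof. by move=> iu; rewrite -mulN1r -rintZ//; congr rint; apply/funext => x; rewrite mulN1r. Qed.
Lemma rint_ge0 u : (forall x, 0 <= u x) -> 0 <= rint u.
Proof. by move=> h; apply: Rintegral_ge0. Qed.
Lemma rint_le u v : rinteg u -> rinteg v -> (forall x, u x <= v x) -> rint u <= rint v.
Proof. by move=> iu iv h; apply: le_Rintegral. Qed.
Lemma eq_ae_rint u v : measurable_fun setT u -> measurable_fun setT v ->
  {ae mu, forall x, u x = v x} -> rint u = rint v.
Proof.
move=> mu_ mv h; congr fine; apply: ae_eq_integral => //; try exact/measurable_EFinP.
by apply: (aeS h) => x + _; move=> ->.
Qed.
Lemma eq_ae_rinteg u v : measurable_fun setT v ->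
  {ae mu, forall x, u x = v x} -> rinteg u -> rinteg v.
Proof.
move=> mv h iu; have mu_ := rinteg_meas iu; move/integrableP: iu => [_ iu].
apply/integrableP; split; first exact/measurable_EFinP.
apply: le_lt_trans iu; rewrite le_eqVlt; apply/orP; left; apply/eqP.
apply: ae_eq_integral => //; try (apply: measurableT_comp => //; exact/measurable_EFinP).
by apply: (aeS h) => x /= + _; move=> ->.
Qed.
Lemma rint_ae_le u v : rinteg u -> rinteg v -> {ae mu, forall x, u x <= v x} -> rint u <= rint v.
Proof.
move=> iu iv h; have mu_ := rinteg_meas iu; have mv := rinteg_meas iv.
(* The maximum dominates [u] everywhere and equals [v] almost everywhere. *)
have iw : rinteg (fun x => Num.max (u x) (v x)).
  apply: rinteg_le (rintegD (rinteg_norm iu) (rinteg_norm iv)); first exact: measurable_maxr.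
  move=> x; rewrite /Num.max; case: ifP => _; first by rewrite lerDr.
  by rewrite lerDl.
apply: le_trans (rint_le iu iw _) _; first by move=> x; rewrite le_max lexx.
rewrite le_eqVlt; apply/orP; left; apply/eqP; apply: eq_ae_rint => //; first exact: measurable_maxr.
by apply: (aeS h) => x {}h; apply/max_idPr.
Qed.
Lemma rint_eq0 u : rinteg u -> (forall x, 0 <= u x) -> rint u = 0 -> {ae mu, forall x, u x = 0}.
Proof.
move=> iu u0 h0; have mu_ := rinteg_meas iu.
have : (\int[mu]_x `|(EFin \o u) x| = 0)%E.
  under eq_integral => x _ do rewrite /= ger0_norm//.
  by rewrite rint_EFin// h0.
move=> /(ae_eq_integral_abs _ _ _) => /(_ measurableT (proj2 (measurable_EFinP _ _) mu_)).
by move=> h; apply: (aeS h) => x /(_ I) /= [].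
Qed.
Lemma rint0 : rint (fun=> 0) = 0.
Proof. by rewrite /rint /Rintegral integral0. Qed.
Lemma rinteg0 : rinteg (fun=> 0).
Proof. exact: integrable0. Qed.

Lemma cvgr_eps (u : nat -> R) l :
  u n @[n --> \oo] --> l <->
  forall e : R, 0 < e -> exists N, forall n, (N <= n)%N -> `|u n - l| < e.
Proof.
split=> [/cvgrPdist_lt h e /h[N _ hN]|h].
  by exists N => n /hN /=; rewrite distrC.
by apply/cvgrPdist_lt => e /h[N hN]; exists N => // n /hN /=; rewrite distrC.
Qed.

Lemma dominated_rint (U : nat -> R -> R) u v :
  (forall n, measurable_fun setT (U n)) -> measurable_fun setT u -> rinteg v ->
  {ae mu, forall x, U n x @[n --> \oo] --> u x} ->
  (forall n, {ae mu, forall x, `|U n x| <= v x}) ->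
  rint (U n) @[n --> \oo] --> rint u.
Proof.
move=> mU mu_ iv hU hv.
have ae' : {ae mu, forall x, forall n, `|U n x| <= v x}.
  by apply/ae_foralln.
have [||||iu _ hc] := @dominated_convergence _ _ R mu setT measurableT (fun n => EFin \o U n)
  (EFin \o u) (EFin \o v) _ _ _ iv.
- by move=> n; apply/measurable_EFinP; exact: mU.
- by apply/measurable_EFinP.
- by apply: (aeS hU) => x h _; apply: cvg_EFin => //; exact: nearW.
- by apply: (aeS ae') => x h n _ /=; rewrite lee_fin.
by apply: fine_cvg; rewrite -rint_EFin.
Qed.

Lemma cmeas_add f g : cmeasurable setT f -> cmeasurable setT g -> cmeasurable setT (fun x => f x + g x).
Proof.
move=> [f1 f2] [g1 g2]; split.
  by under eq_fun do rewrite ReD; exact: measurable_funD.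
by under eq_fun do rewrite ImD; exact: measurable_funD.
Qed.
Lemma cmeas_opp f : cmeasurable setT f -> cmeasurable setT (fun x => - f x).
Proof.
move=> [f1 f2]; split.
  by under eq_fun do rewrite ReN; exact: measurable_funN.
by under eq_fun do rewrite ImN; exact: measurable_funN.
Qed.
Lemma cmeas_sub f g : cmeasurable setT f -> cmeasurable setT g -> cmeasurable setT (fun x => f x - g x).
Proof. by move=> mf mg; apply: cmeas_add => //; exact: cmeas_opp. Qed.
Lemma cmeas_mul f g : cmeasurable setT f -> cmeasurable setT g -> cmeasurable setT (fun x => f x * g x).
Proof.
move=> [f1 f2] [g1 g2]; split.
  by under eq_fun do rewrite ReM; apply: measurable_funB; exact: measurable_funM.
by under eq_fun do rewrite ImM; apply: measurable_funD; exact: measurable_funM.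
Qed.
Lemma cmeas_conj f : cmeasurable setT f -> cmeasurable setT (fun x => cj (f x)).
Proof.
move=> [f1 f2]; split; first by under eq_fun do rewrite ReJ.
by under eq_fun do rewrite ImJ; exact: measurable_funN.
Qed.
Lemma cmeas_cst (c : Cplx R) : cmeasurable setT (fun=> c).
Proof. by split; exact: measurable_cst. Qed.
Lemma cmeas_real u : measurable_fun setT u -> cmeasurable setT (fun x => (u x)%:C).
Proof. by move=> h; split=> //=. Qed.
Lemma measurable_sqrtr u : measurable_fun setT u -> measurable_fun setT (fun x => Num.sqrt (u x)).
Proof.
by move=> h; apply: (measurableT_comp _ h); apply: continuous_measurable_fun; exact: sqrt_continuous.
Qed.
Lemma measurable_cmod f : cmeasurable setT f -> measurable_fun setT (fun x => cmod (f x)).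
Proof.
move=> [f1 f2]; have -> : (fun x => cmod (f x)) = (fun x => Num.sqrt (Re (f x) ^+ 2 + Im (f x) ^+ 2)).
  by apply/funext => x; rewrite -sqr_cmod sqrtr_sqr ger0_norm ?cmod_ge0.
by apply: measurable_sqrtr; apply: measurable_funD; exact: measurable_funX.
Qed.
Lemma measurable_invr d (T : measurableType d) (u : T -> R) :
  measurable_fun setT u -> measurable_fun setT (fun x => (u x)^-1).
Proof.
move=> hu; apply: (@measurable_comp _ _ _ _ _ _ setT (@GRing.inv R)) => //.
have -> : [set: R] = [set~ 0] `|` [set 0] by rewrite setUC setUv.
apply/measurable_funU => //; first exact: measurableC.
split; last exact: measurable_fun_set1.
apply: open_continuous_measurable_fun.
  by apply: closed_openC; exact: closed_eq.
by move=> x /=; rewrite inE /= => /eqP x0; exact: inv_continuous.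
Qed.
Lemma cmeas_inv f : cmeasurable setT f -> cmeasurable setT (fun x => (f x)^-1).
Proof.
move=> mf; have -> : (fun x => (f x)^-1) = (fun x => ((cmod (f x) ^+ 2)^-1)%:C * cj (f x)).
  apply/funext => x; have [->|f0] := eqVneq (f x) 0; first by rewrite invr0 [cj 0]J0 mulr0.
  apply: (mulfI f0); rewrite mulfV// mulrCA [f x * cj _]mulcJ -rmorphM mulVf//.
  by rewrite sqrf_eq0 gt_eqF// cmod_gt0.
apply: cmeas_mul; last exact: cmeas_conj.
by apply: cmeas_real; apply: measurable_invr; apply: measurable_funX; exact: measurable_cmod.
Qed.
Lemma cmeas_ext f g : (forall x, f x = g x) -> cmeasurable setT f -> cmeasurable setT g.
Proof. by move=> h; have -> : g = f by apply/funext => x; rewrite h. Qed.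
Lemma measurable_oppr : measurable_fun [set: R] (fun x : R => - x).
Proof. exact: oppr_measurable. Qed.
Lemma cmeas_refl f : cmeasurable setT f -> cmeasurable setT (fun x => f (- x)).
Proof.
move=> [f1 f2]; split; [apply: (measurableT_comp f1)|apply: (measurableT_comp f2)]; exact: measurable_oppr.
Qed.
Definition cinteg f := cmeasurable setT f /\ rinteg (fun x => cmod (f x)).
Definition cint f : Cplx R := cintegral setT f.

Lemma cinteg_le f u : cmeasurable setT f -> rinteg u -> (forall x, cmod (f x) <= u x) -> cinteg f.
Proof.
move=> mf iu h; split=> //; apply: rinteg_le iu; first exact: measurable_cmod.
by move=> x; rewrite ger0_norm ?cmod_ge0.
Qed.
Lemma cinteg_Re f : cinteg f -> rinteg (fun x => Re (f x)).
Proof. by move=> [[m1 _] h]; apply: rinteg_le h => // x; exact: cmod_Re. Qed.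
Lemma cinteg_Im f : cinteg f -> rinteg (fun x => Im (f x)).
Proof. by move=> [[_ m1] h]; apply: rinteg_le h => // x; exact: cmod_Im. Qed.
Lemma cintegD f g : cinteg f -> cinteg g -> cinteg (fun x => f x + g x).
Proof.
move=> [mf hf] [mg hg]; apply: cinteg_le (rintegD hf hg) _; first exact: cmeas_add.
by move=> x; exact: cmodD.
Qed.
Lemma cintegZ (a : Cplx R) f : cinteg f -> cinteg (fun x => a * f x).
Proof.
move=> [mf hf]; apply: cinteg_le (rintegZ (cmod a) hf) _; first by apply: cmeas_mul => //; exact: cmeas_cst.
by move=> x; rewrite cmodM.
Qed.
Lemma cintegN f : cinteg f -> cinteg (fun x => - f x).
Proof. by move=> /(cintegZ (-1)); under eq_fun do rewrite mulN1r. Qed.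
Lemma cintegB f g : cinteg f -> cinteg g -> cinteg (fun x => f x - g x).
Proof. by move=> hf hg; apply: cintegD => //; exact: cintegN. Qed.
Lemma cintegJ f : cinteg f -> cinteg (fun x => cj (f x)).
Proof.
move=> [mf hf]; apply: cinteg_le hf _; first exact: cmeas_conj.
by move=> x; rewrite cmodJ.
Qed.
Lemma cintD f g : cinteg f -> cinteg g -> cint (fun x => f x + g x) = cint f + cint g.
Proof.
move=> hf hg; apply: complex_ext => /=.
  under eq_fun do rewrite ReD; apply: rintD; exact: cinteg_Re.
under eq_fun do rewrite ImD; apply: rintD; exact: cinteg_Im.
Qed.
Lemma cintZ (a : Cplx R) f : cinteg f -> cint (fun x => a * f x) = a * cint f.
Proof.
move=> hf; have h1 := cinteg_Re hf; have h2 := cinteg_Im hf.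
apply: complex_ext => /=; rewrite ?ReM ?ImM /=.
  under eq_fun do rewrite ReM.
  by rewrite -/(rint _) rintD ?rintN ?rintZ//; try apply: rintegN; exact: rintegZ.
under eq_fun do rewrite ImM.
by rewrite -/(rint _) rintD ?rintZ//; exact: rintegZ.
Qed.
Lemma cintN f : cinteg f -> cint (fun x => - f x) = - cint f.
Proof.
by move=> hf; rewrite -[RHS]mulN1r -cintZ//; congr cint; apply/funext => x; rewrite mulN1r.
Qed.
Lemma cintB f g : cinteg f -> cinteg g -> cint (fun x => f x - g x) = cint f - cint g.
Proof. by move=> hf hg; rewrite cintD ?cintN//; exact: cintegN. Qed.
Lemma cintJ f : cinteg f -> cint (fun x => cj (f x)) = cj (cint f).
Proof.
move=> hf; apply: complex_ext => /=; rewrite ?ReJ ?ImJ /=; first by under eq_fun do rewrite ReJ.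
by under eq_fun do rewrite ImJ; apply: rintN; exact: cinteg_Im.
Qed.
Lemma cint0 : cint (fun=> 0) = 0.
Proof. by apply: complex_ext => /=; rewrite /Rintegral integral0. Qed.
Lemma cinteg0 : cinteg (fun=> 0).
Proof. by split; [exact: cmeas_cst|under eq_fun do rewrite cmod0; exact: rinteg0]. Qed.
Lemma cint_sum n (F : 'I_n -> R -> Cplx R) : (forall i, cinteg (F i)) ->
  cinteg (fun x => \sum_i F i x) /\ cint (fun x => \sum_i F i x) = \sum_i cint (F i).
Proof.
elim: n F => [|n IH] F hF.
  have -> : (fun x => \sum_(i < 0) F i x) = (fun=> 0) by apply/funext => x; rewrite big_ord0.
  by rewrite big_ord0; split; [exact: cinteg0|exact: cint0].
have [] := IH (fun i => F (lift ord0 i)) (fun i => hF _).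
have -> : (fun x => \sum_(i < n.+1) F i x) = (fun x => F ord0 x + \sum_(i < n) F (lift ord0 i) x).
  by apply/funext => x; rewrite big_ord_recl.
by move=> h1 h2; rewrite big_ord_recl cintD// h2; split=> //; exact: cintegD.
Qed.
Lemma eq_ae_cint f g : cmeasurable setT f -> cmeasurable setT g ->
  {ae mu, forall x, f x = g x} -> cint f = cint g.
Proof.
by move=> [f1 f2] [g1 g2] h; apply: complex_ext; apply: eq_ae_rint => //; apply: (aeS h) => x ->.
Qed.
(** Multiplying by the conjugate of the integral turns it into the integral of a real part. *)
Lemma cmod_cint f : cinteg f -> cmod (cint f) <= rint (fun x => cmod (f x)).
Proof.
move=> hf; set I := cint f; have [I0|I0] := eqVneq I 0.
  by rewrite I0 cmod0; apply: rint_ge0 => x; exact: cmod_ge0.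
have p := cmod_gt0 I0.
rewrite -(ler_pM2l p) -expr2.
have -> : cmod I ^+ 2 = rint (fun x => Re (cj I * f x)).
  by rewrite -[rint _]/(Re (cint (fun x => cj I * f x))) cintZ// mulrC cmod_sqrJ.
have [mf hf'] := hf.
rewrite -rintZ//; apply: rint_le.
- by apply: cinteg_Re; exact: cintegZ.
- exact: rintegZ.
- by move=> x; apply: le_trans (Re_le_cmod _) _; rewrite cmodM cmodJ.
Qed.

Lemma cmod_cint_le f u : cmeasurable setT f -> rinteg u -> {ae mu, forall x, cmod (f x) <= u x} ->
  cinteg f /\ cmod (cint f) <= rint u.
Proof.
move=> mf iu h.
have u0 : {ae mu, forall x, 0 <= u x} by apply: (aeS h) => x /(le_trans (cmod_ge0 _)).
have hf : cinteg f.
  split=> //; apply: (@eq_ae_rinteg (fun x => Num.min (cmod (f x)) `|u x|)).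
  - exact: measurable_cmod.
  - by apply: (aeS h) => x {}h; apply/min_idPl; rewrite (le_trans h)// ler_norm.
  - apply: rinteg_le (rinteg_norm iu).
      by apply: measurable_minr; [exact: measurable_cmod|apply: measurableT_comp => //; exact: rinteg_meas].
    by move=> x; rewrite ger0_norm ?le_min ?cmod_ge0 ?normr_ge0// ge_min lexx orbT.
split=> //; apply: le_trans (cmod_cint hf) _; apply: rint_ae_le => //; by case: hf.
Qed.

Lemma dominated_cint (F : nat -> R -> Cplx R) f u :
  (forall n, cmeasurable setT (F n)) -> cmeasurable setT f -> rinteg u ->
  {ae mu, forall x, cmod (F n x - f x) @[n --> \oo] --> 0} ->
  (forall n, {ae mu, forall x, cmod (F n x) <= u x}) ->
  cmod (cint (F n) - cint f) @[n --> \oo] --> 0.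
Proof.
move=> mF mf iu hF hu.
have u0 : {ae mu, forall x, forall n, cmod (F n x) <= u x} by apply/ae_foralln.
have hfu : {ae mu, forall x, cmod (f x) <= u x}.
  apply: (aeS2 hF u0) => x {}hF h; apply/ler_addgt0Pr => e e0.
  have [N hN] := (iffLR (cvgr_eps _ _) hF) e e0.
  have := hN N (leqnn _); rewrite subr0 ger0_norm ?cmod_ge0// => hl.
  have := cmodB_ge (f x) (F N x); rewrite cmodB; have := h N; lra.
have mc n : measurable_fun setT (fun x => cmod (F n x - f x)).
  by apply: measurable_cmod; exact: cmeas_sub.
have ae2 n : {ae mu, forall x, `|cmod (F n x - f x)| <= 2 * u x}.
  apply: (aeS2 (hu n) hfu) => x h1 h2; rewrite ger0_norm ?cmod_ge0//.
  apply: le_trans (cmodD _ _) _; rewrite cmodN; lra.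
have h := dominated_rint mc (@measurable_cst _ _ _ _ setT (0 : R)) (rintegZ 2 iu) hF ae2.
rewrite rint0 in h.
apply/cvgr_eps => e e0; have [N hN] := (iffLR (cvgr_eps _ _) h) e e0.
exists N => n /hN; rewrite !subr0; apply: le_lt_trans.
rewrite ger0_norm ?cmod_ge0// -cintB; [|exact: (cmod_cint_le (mF n) iu (hu n)).1|exact: (cmod_cint_le mf iu hfu).1].
apply: le_trans (cmod_cint _) (ler_norm _).
by apply: cintegB; [exact: (cmod_cint_le (mF n) iu (hu n)).1|exact: (cmod_cint_le mf iu hfu).1].
Qed.

(** * The space L^2 *)

Definition sqint f := rinteg (fun x => cmod (f x) ^+ 2).

Lemma l2normE f : cmeasurable setT f -> sqint f ->
  l2norm setT f = (Num.sqrt (rint (fun x => cmod (f x) ^+ 2)))%:E.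
Proof.
move=> mf hf; rewrite /l2norm rint_EFin// poweR_EFin powR12_sqrt//.
by apply: rint_ge0 => x; exact: sqr_ge0.
Qed.

Lemma L2P f : L2 setT f <-> cmeasurable setT f /\ sqint f.
Proof.
split=> [[mf h]|[mf hf]]; split=> //; last by rewrite l2normE// ltry.
apply/rinteg_ge0P.
- by apply: measurable_funX; exact: measurable_cmod.
- by move=> x; exact: sqr_ge0.
- move: h; rewrite /l2norm; case: integral => //=; first by move=> r _; exact: ltry.
  by rewrite (negbTE (invr_neq0 _))// pnatr_eq0.
Qed.

Lemma L2_meas f : L2 setT f -> cmeasurable setT f. Proof. by case. Qed.
Lemma L2_sq f : L2 setT f -> sqint f. Proof. by move=> /L2P[]. Qed.

Lemma L2_le f u : cmeasurable setT f -> rinteg u -> (forall x, cmod (f x) ^+ 2 <= u x) -> L2 setT f.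
Proof.
move=> mf iu h; apply/L2P; split=> //; apply: rinteg_le iu.
  by apply: measurable_funX; exact: measurable_cmod.
by move=> x; rewrite ger0_norm ?sqr_ge0.
Qed.

Lemma L2D f g : L2 setT f -> L2 setT g -> L2 setT (fun x => f x + g x).
Proof.
move=> /L2P[mf hf] /L2P[mg hg].
apply: L2_le (rintegD (rintegZ 2 hf) (rintegZ 2 hg)) _; first exact: cmeas_add.
move=> x; apply: le_trans (sqr_mono (cmod_ge0 _) (cmodD _ _)) _.
rewrite -subr_ge0; have := sqr_ge0 (cmod (f x) - cmod (g x)); lra.
Qed.

Lemma L2_mul (M : R) f g : cmeasurable setT g -> {ae mu, forall x, cmod (g x) <= M} ->
  L2 setT f -> L2 setT (fun x => g x * f x).
Proof.
move=> mg h /L2P[mf hf]; apply/L2P; split; first exact: cmeas_mul.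
apply: (@eq_ae_rinteg (fun x => Num.min (cmod (g x * f x) ^+ 2) (M ^+ 2 * cmod (f x) ^+ 2))).
- by apply: measurable_funX; apply: measurable_cmod; exact: cmeas_mul.
- apply: (aeS h) => x {}h; apply/min_idPl; rewrite cmodM exprMn ler_wpM2r ?sqr_ge0//.
  by apply: sqr_mono; rewrite ?cmod_ge0.
- apply: rinteg_le (rintegZ (M ^+ 2) hf).
    apply: measurable_minr; first by apply: measurable_funX; apply: measurable_cmod; exact: cmeas_mul.
    by apply: measurable_funM => //; apply: measurable_funX; exact: measurable_cmod.
  have MM x : 0 <= M ^+ 2 * cmod (f x) ^+ 2 by rewrite mulr_ge0 ?sqr_ge0.
  by move=> x; rewrite ger0_norm ?le_min ?sqr_ge0 ?MM// ge_min lexx orbT.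
Qed.

Lemma L2Z (a : Cplx R) f : L2 setT f -> L2 setT (fun x => a * f x).
Proof. by apply: (@L2_mul (cmod a)); [exact: cmeas_cst|apply: aeW]. Qed.
Lemma L2N f : L2 setT f -> L2 setT (fun x => - f x).
Proof. by move=> /(L2Z (-1)); under eq_fun do rewrite mulN1r. Qed.
Lemma L2B f g : L2 setT f -> L2 setT g -> L2 setT (fun x => f x - g x).
Proof. by move=> hf hg; apply: L2D => //; exact: L2N. Qed.
Lemma L2J f : L2 setT f -> L2 setT (fun x => cj (f x)).
Proof.
move=> /L2P[mf hf]; apply: L2_le hf _; first exact: cmeas_conj.
by move=> x; rewrite cmodJ.
Qed.
Lemma L2_0 : L2 setT (fun=> 0 : Cplx R).
Proof. by apply: L2_le rinteg0 _; [exact: cmeas_cst|move=> x; rewrite cmod0 expr0n]. Qed.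
Lemma L2_prod f g : L2 setT f -> L2 setT g -> cinteg (fun x => f x * g x).
Proof.
move=> /L2P[mf hf] /L2P[mg hg]; apply: cinteg_le (rintegD hf hg) _; first exact: cmeas_mul.
move=> x; rewrite cmodM; have := sqr_ge0 (cmod (f x) - cmod (g x)).
have := cmod_ge0 (f x); have := cmod_ge0 (g x); nra.
Qed.
Lemma L2_prodJ f g : L2 setT f -> L2 setT g -> cinteg (fun x => f x * cj (g x)).
Proof. by move=> hf hg; apply: L2_prod => //; exact: L2J. Qed.

(** The intervals [[c k, b k]] of radius [2 C 2^-k] around [a k] are nested, so the limit comes with
    its rate, which [riesz_fischer] and [goursat] need. *)
Lemma geo_real (a : nat -> R) (C : R) :
  (forall k, `|a k.+1 - a k| <= C * 2^-1 ^+ k) ->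
  exists l, forall k, `|l - a k| <= 2 * C * 2^-1 ^+ k.
Proof.
move=> h.
pose b k := a k + 2 * C * 2^-1 ^+ k; pose c k := a k - 2 * C * 2^-1 ^+ k.
have C0 : 0 <= C by have := h 0%N; rewrite expr0 mulr1; apply: le_trans.
have p0 k : 0 <= C * 2^-1 ^+ k by rewrite mulr_ge0// exprn_ge0// invr_ge0.
have bd k : b k.+1 <= b k.
  have := h k; rewrite /b ler_norml exprS; have := p0 k; set q := 2^-1 ^+ k; nra.
have cd k : c k <= c k.+1.
  have := h k; rewrite /c ler_norml exprS; have := p0 k; set q := 2^-1 ^+ k; nra.
have cm i j : (i <= j)%N -> c i <= c j 
  by apply: (@homo_leq _ c <=%R) => [x|x y z h1 h2|]; [exact: lexx|exact: le_trans h1 h2|].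
have bm i j : (i <= j)%N -> b j <= b i.
  by apply: (@homo_leq _ b (fun x y => y <= x)) => [x|x y z h1 h2|]; [exact: lexx|exact: le_trans h2 h1|].
have cb i j : c i <= b j.
  apply: le_trans (cm _ _ (leq_maxl i j)) _; apply: le_trans _ (bm _ _ (leq_maxr i j)).
  rewrite /c /b; have := p0 (maxn i j); lra.
exists (sup (range c)) => k.
have hs : has_sup (range c).
  by split; [exists (c 0%N); exists 0%N|exists (b 0%N) => _ [i _ <-]].
have h1 : c k <= sup (range c) by apply: ub_le_sup; [case: hs|exists k].
have h2 : sup (range c) <= b k by apply: ge_sup; [case: hs|move=> _ [i _ <-]].
by move: h1 h2; rewrite /b /c ler_norml; lra.
Qed.

Lemma geo_complex (z : nat -> Cplx R) (C : R) :
  (forall k, cmod (z k.+1 - z k) <= C * 2^-1 ^+ k) ->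
  exists l : Cplx R, forall k, cmod (l - z k) <= 4 * C * 2^-1 ^+ k.
Proof.
move=> h.
have [k|l1 hl1] := @geo_real (fun k => Re (z k)) C.
  by rewrite -ReB; apply: le_trans (cmod_Re _) (h k).
have [k|l2 hl2] := @geo_real (fun k => Im (z k)) C.
  by rewrite -ImB; apply: le_trans (cmod_Im _) (h k).
exists (l1 +i* l2) => k; apply: le_trans (cmod_le_ReIm _) _; rewrite ReB ImB /=.
have := hl1 k; have := hl2 k; lra.
Qed.

(** A fast subsequence has a weighted sum [G] of squared increments that is integrable. Where [G] is
    finite, the subsequence converges geometrically with a constant proportional to the square root
    of [G], which gives both the pointwise limit and a majorant. *)
Lemma riesz_fischer (F : nat -> R -> Cplx R) : (forall n, L2 setT (F n)) ->
  (forall e : R, 0 < e -> exists N, forall m n, (N <= m)%N -> (N <= n)%N ->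
     rint (fun x => cmod (F m x - F n x) ^+ 2) < e) ->
  exists f, L2 setT f /\ forall e : R, 0 < e -> exists N, forall n, (N <= n)%N ->
     rint (fun x => cmod (F n x - f x) ^+ 2) < e.
Proof.
move=> hF hc.
have /choice[N hN] (k : nat) : exists N, forall m n, (N <= m)%N -> (N <= n)%N ->
     rint (fun x => cmod (F m x - F n x) ^+ 2) < 8^-1 ^+ k.
  by apply: hc; rewrite exprn_gt0// invr_gt0.
pose s := fix s k := if k is j.+1 then maxn (s j).+1 (N j.+1) else N 0%N.
have sN k : (N k <= s k)%N by case: k => //= k; exact: leq_maxr.
have ss k : (s k < s k.+1)%N by exact: leq_maxl.
have sk k : (k <= s k)%N by elim: k => // k IH; exact: leq_ltn_trans (ss k).
(* Against increments below [8^-k], the weight [4^k] still leaves a summable [2^-k], and it makes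
   the increments at most [2^-k] times the square root of [G]. *)
pose D k x := 4 ^+ k * cmod (F (s k.+1) x - F (s k) x) ^+ 2.
have D0 k x : 0 <= D k x by rewrite mulr_ge0 ?sqr_ge0 ?exprn_ge0.
have L2d m n : L2 setT (fun x => F m x - F n x) by exact: L2B.
have Di k : rinteg (D k) by apply: rintegZ; exact: L2_sq (L2d _ _).
have Dint k : rint (D k) <= 2 / (2 ^ k.+1)%:R.
  rewrite rintZ; last exact: L2_sq (L2d _ _).
  have := hN k _ _ (leq_trans (sN k) (ltnW (ss k))) (sN k) => /ltW h.
  apply: le_trans (ler_wpM2l (exprn_ge0 k (ler0n R 4)) h) _.
  rewrite natrX -exprMn exprS invfM mulrA divff ?mul1r// -exprVn.
  by rewrite (_ : 4 * 8^-1 = 2^-1 :> R)//; field.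
pose G x : \bar R := (\sum_(k <oo) (D k x)%:E)%E.
have mD k : measurable_fun setT (fun x => (D k x)%:E).
  by apply/measurable_EFinP; exact: rinteg_meas.
have G0 x : (0 <= G x)%E by apply: nneseries_ge0 => k _ _; rewrite lee_fin.
have mG : measurable_fun setT G.
  by apply: ge0_emeasurable_sum => // k x _ _; rewrite lee_fin.
have Gint : (\int[mu]_x G x < +oo)%E.
  rewrite integral_nneseries//; last by move=> k x _; rewrite lee_fin.
  apply: (@le_lt_trans _ _ 2%:E); last exact: ltry.
  apply: le_trans (le_trans _ (@epsilon_trick R (fun k => 0%E) 2 xpredT _ _)) _ => //; last first.
    by rewrite eseries0// add0e.
  apply: lee_nneseries => [k _ _|k _]; first by apply: integral_ge0 => x _; rewrite lee_fin.
  by rewrite rint_EFin// add0e lee_fin.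
pose g x := fine (G x).
have g0 x : 0 <= g x by apply: fine_ge0.
have mg : measurable_fun setT g by apply: measurableT_comp => //; exact: fine_measurable.
have ig : rinteg g.
  apply/rinteg_ge0P => //; apply: le_lt_trans Gint; apply: ge0_le_integral => //.
  - by move=> x _; rewrite lee_fin.
  - exact/measurable_EFinP.
  - by move=> x _; rewrite /g; have := G0 x; case: (G x) => //= *; rewrite leey.
have iG : mu.-integrable setT G.
  apply/integrableP; split=> //.
  by under eq_integral => x _ do rewrite gee0_abs//.
have Gfin : {ae mu, forall x, G x \is a fin_num}.
  by have h := integrable_ae measurableT iG; apply: (aeS h) => x; exact.
pose A := [set x | G x \is a fin_num].
have mA : measurable A by rewrite -[A]setTI; exact: emeasurable_fin_num.
have AD x k : A x -> D k x <= g x.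
  move=> Ax; rewrite -lee_fin /g fineK//.
  have hh i : (0 <= i)%N -> true -> (0 <= (D i x)%:E)%E by rewrite lee_fin.
  apply: le_trans (nneseries_lim_ge k.+1 hh).
  rewrite big_nat_recr//= leeDr// sume_ge0// => i _; by rewrite lee_fin.
have step x k : A x -> cmod (F (s k.+1) x - F (s k) x) <= Num.sqrt (g x) * 2^-1 ^+ k.
  move=> Ax; rewrite -ler_sqr ?nnegrE ?cmod_ge0 ?mulr_ge0 ?sqrtr_ge0 ?exprn_ge0 ?invr_ge0//.
  rewrite exprMn sqr_sqrtr// -exprM mulnC exprM.
  have := AD x k Ax; rewrite /D -ler_pdivlMl ?exprn_gt0// => h; apply: le_trans h _.
  by rewrite mulrC -exprVn (_ : (2^-1 : R) ^+ 2 = 4^-1)//; field.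
(* The limit is set to 0 off [A], so that the subsequence times [\1_A] converges everywhere and [f]
   is measurable. *)
have /choice[f hf] (x : R) : exists l : Cplx R,
    if pselect (A x) then forall k, cmod (l - F (s k) x) <= 4 * Num.sqrt (g x) * 2^-1 ^+ k
    else l = 0.
  case: pselect => Ax; last by exists 0.
  exact: (@geo_complex (fun k => F (s k) x) (Num.sqrt (g x)) (fun k => step x k Ax)).
have fA x k : A x -> cmod (f x - F (s k) x) <= 4 * Num.sqrt (g x) * 2^-1 ^+ k.
  by move=> Ax; have := hf x; case: pselect.
have fnA x : ~ A x -> f x = 0 by move=> nA; have := hf x; case: pselect.
have cvf x : cmod ((\1_A x)%:C * F (s k) x - f x) @[k --> \oo] --> 0.
  have [Ax|Ax] := pselect (A x); last first.
    rewrite fnA// indicE memNset//; under eq_cvg do rewrite mul0r subrr cmod0; exact: cvg_cst.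
  rewrite indicE mem_set//; under eq_cvg do rewrite mul1r.
  apply/cvgr_eps => e e0.
  have [M hM] := @geo_lt R 2^-1 (4 * Num.sqrt (g x)) e (ltac:(apply/andP; split; lra)) e0.
  exists M => n /hM h; rewrite subr0 ger0_norm ?cmod_ge0// cmodB.
  exact: le_lt_trans (fA x n Ax) h.
have mF k : cmeasurable setT (fun x => (\1_A x)%:C * F (s k) x).
  apply: cmeas_mul; last exact: L2_meas.
  by apply: cmeas_real; exact: measurable_indic.
have mf : cmeasurable setT f.
  split.
    apply: (@measurable_fun_cvg _ _ _ setT (fun k x => Re ((\1_A x)%:C * F (s k) x))).
      by move=> k; case: (mF k).
    move=> x _; apply/cvgr_eps => e e0; have [M hM] := (iffLR (cvgr_eps _ _) (cvf x)) e e0.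
    exists M => n /hM; rewrite subr0 ger0_norm ?cmod_ge0//; apply: le_lt_trans.
    by rewrite -ReB; exact: cmod_Re.
  apply: (@measurable_fun_cvg _ _ _ setT (fun k x => Im ((\1_A x)%:C * F (s k) x))).
    by move=> k; case: (mF k).
  move=> x _; apply/cvgr_eps => e e0; have [M hM] := (iffLR (cvgr_eps _ _) (cvf x)) e e0.
  exists M => n /hM; rewrite subr0 ger0_norm ?cmod_ge0//; apply: le_lt_trans.
  by rewrite -ImB; exact: cmod_Im.
have aef k : {ae mu, forall x, cmod (F (s k) x - f x) ^+ 2 <= 16 * 4^-1 ^+ k * g x}.
  apply: (aeS Gfin) => x Ax; rewrite cmodB.
  apply: le_trans (sqr_mono (cmod_ge0 _) (fA x k Ax)) _.
  rewrite !exprMn sqr_sqrtr// -exprM mulnC exprM (_ : (2^-1 : R) ^+ 2 = 4^-1); last by field.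
  by rewrite le_eqVlt; apply/orP; left; apply/eqP; move: (4^-1 ^+ k) (g x) => ? ?; ring.
have mfs k : cmeasurable setT (fun x => F (s k) x - f x).
  by apply: cmeas_sub => //; exact: L2_meas.
have msq k : measurable_fun setT (fun x => cmod (F (s k) x - f x) ^+ 2).
  by apply: measurable_funX; exact: measurable_cmod.
have isq k : rinteg (fun x => cmod (F (s k) x - f x) ^+ 2).
  have mm : cmeasurable setT (fun x => (cmod (F (s k) x - f x) ^+ 2)%:C) by exact: cmeas_real.
  have [|[_ h] _] := cmod_cint_le mm (rintegZ (16 * 4^-1 ^+ k) ig).
    by apply: (aeS (aef k)) => x; rewrite cmodC ger0_norm ?sqr_ge0.
  by apply: rinteg_le h => // x; rewrite cmodC.
have Lsf k : L2 setT (fun x => F (s k) x - f x).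
  by apply/L2P; split; [exact: mfs|exact: isq].
have Lf : L2 setT f.
  have := L2B (hF (s 0%N)) (Lsf 0%N).
  by under eq_fun do rewrite subKr.
exists f; split=> // e e0.
have [k hk] := @geo_lt R 4^-1 (16 * rint g) (e / 4) (ltac:(apply/andP; split; lra)) (ltac:(by rewrite divr_gt0)).
have [M hM] := hc (e / 4) (ltac:(by rewrite divr_gt0)).
exists M => n Mn.
pose i := maxn k M.
have h1 := hM n (s i) Mn (leq_trans (leq_maxr k M) (sk i)).
have h2 : rint (fun x => cmod (F (s i) x - f x) ^+ 2) <= 16 * rint g * 4^-1 ^+ i.
  rewrite mulrAC -rintZ//; apply: rint_ae_le => //; exact: rintegZ.
have h3 := hk i (leq_maxl _ _).
have i1 := L2_sq (L2d n (s i)).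
apply: (@le_lt_trans _ _ (rint (fun x => 2 * cmod (F n x - F (s i) x) ^+ 2 + 2 * cmod (F (s i) x - f x) ^+ 2))).
  apply: rint_le.
  - by apply: L2_sq; exact: L2B.
  - by apply: rintegD; exact: rintegZ.
  - move=> x; have -> : F n x - f x = (F n x - F (s i) x) + (F (s i) x - f x) by rewrite addrA subrK.
    apply: le_trans (sqr_mono (cmod_ge0 _) (cmodD _ _)) _.
    rewrite -subr_ge0; have := sqr_ge0 (cmod (F n x - F (s i) x) - cmod (F (s i) x - f x)); lra.
rewrite rintD ?rintZ//; [lra|exact: rintegZ|exact: rintegZ].
Qed.

End Integration.

(** * The Hilbert space L^2(R) *)

Section L2Hilbert.
Context {R : realType}.
Local Notation mu := (@lebesgue_measure R).
Implicit Types (f g : R -> Cplx R).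

(* The chosen representative of the a.e. class of f, so that elements of L^2
   can be compared with Leibniz equality. *)
Definition l2rep f : R -> Cplx R :=
  xget (fun=> 0) [set g | L2 setT g /\
    {ae mu, forall x, (if `[< L2 setT f >] then f else fun=> 0) x = g x}].

Lemma l2repP f : L2 setT (l2rep f) /\
  {ae mu, forall x, (if `[< L2 setT f >] then f else fun=> 0) x = l2rep f x}.
Proof.
rewrite /l2rep; case: xgetP => [g _ []//|h].
exfalso; apply: (h (if `[< L2 setT f >] then f else fun=> 0)); split; last exact: aeW.
by case: ifPn => [/asboolP//|_]; exact: L2_0.
Qed.

Lemma l2rep_eq f g : L2 setT f -> L2 setT g -> {ae mu, forall x, f x = g x} -> l2rep f = l2rep g.
Proof.
move=> Lf Lg fg; rewrite /l2rep !asboolT//; congr xget; apply/seteqP.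
split=> h [Lh hh]; split=> //; apply: (aeS2 fg hh) => x; first by move=> -> ->.
by move=> -> ->.
Qed.

Lemma l2rep_id f : l2rep (l2rep f) = l2rep f.
Proof.
have [Lr hr] := l2repP f.
have [Lf|nLf] := pselect (L2 setT f).
  by apply: l2rep_eq => //; move: hr; rewrite asboolT// => h; apply: (aeS h).
transitivity (l2rep (fun=> 0)).
  apply: l2rep_eq => //; first exact: L2_0.
  by move: hr; rewrite asboolF// => h; apply: (aeS h).
by rewrite /l2rep asboolT ?asboolF//; exact: L2_0.
Qed.

Definition L2t := {f : R -> Cplx R | l2rep f = f}.
Definition fn (x : L2t) : R -> Cplx R := sval x.
Definition cls f : L2t := exist _ (l2rep f) (l2rep_id f).

HB.instance Definition _ := gen_eqMixin L2t.
HB.instance Definition _ := gen_choiceMixin L2t.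

Lemma fn_L2 (x : L2t) : L2 setT (fn x).
Proof. by case: x => f /= <-; case: (l2repP f). Qed.
Lemma fn_meas (x : L2t) : cmeasurable setT (fn x).
Proof. exact: L2_meas (fn_L2 x). Qed.
Lemma fn_cls f : L2 setT f -> {ae mu, forall x, fn (cls f) x = f x}.
Proof. by move=> Lf; have [_] := l2repP f; rewrite asboolT// => h; apply: (aeS h). Qed.
Lemma L2t_ext (x y : L2t) : {ae mu, forall t, fn x t = fn y t} -> x = y.
Proof.
move=> h; have : sval x = sval y.
  by rewrite -(svalP x) -(svalP y); apply: l2rep_eq => //; exact: fn_L2.
by case: x y {h} => f hf [g hg] /= e; subst g; congr exist; exact: Prop_irrelevance.
Qed.
Lemma cls_ext f g : L2 setT f -> L2 setT g -> {ae mu, forall t, f t = g t} -> cls f = cls g.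
Proof.
move=> Lf Lg h; apply: L2t_ext; apply: (aeS3 (fn_cls Lf) (fn_cls Lg) h) => x.
by move=> -> -> ->.
Qed.
Lemma cls_fn x : cls (fn x) = x.
Proof. by apply: L2t_ext; exact: fn_cls (fn_L2 x). Qed.
Lemma cls_eq f x : L2 setT f -> {ae mu, forall t, f t = fn x t} -> cls f = x.
Proof. by move=> Lf h; rewrite -[RHS]cls_fn; apply: cls_ext => //; exact: fn_L2. Qed.

Definition l2zero : L2t := cls (fun=> 0).
Definition l2add (x y : L2t) : L2t := cls (fun t => fn x t + fn y t).
Definition l2opp (x : L2t) : L2t := cls (fun t => - fn x t).
Definition l2scale (a : R[i]) (x : L2t) : L2t := cls (fun t => a * fn x t).

Lemma fn_add_ x y : {ae mu, forall t, fn (l2add x y) t = fn x t + fn y t}.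
Proof. by apply: fn_cls; apply: L2D; exact: fn_L2. Qed.
Lemma fn_opp_ x : {ae mu, forall t, fn (l2opp x) t = - fn x t}.
Proof. by apply: fn_cls; apply: L2N; exact: fn_L2. Qed.
Lemma fn_scale_ a x : {ae mu, forall t, fn (l2scale a x) t = a * fn x t}.
Proof. by apply: fn_cls; apply: L2Z; exact: fn_L2. Qed.
Lemma fn_zero_ : {ae mu, forall t, fn l2zero t = 0}.
Proof. by apply: fn_cls; exact: L2_0. Qed.

Lemma l2addA : associative l2add.
Proof.
move=> x y z; apply: L2t_ext.
apply: (aeS (aeI (aeI (fn_add_ x (l2add y z)) (fn_add_ y z)) (aeI (fn_add_ (l2add x y) z) (fn_add_ x y)))).
by move=> t [[-> ->] [-> ->]]; rewrite addrA.
Qed.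
Lemma l2addC : commutative l2add.
Proof.
by move=> x y; apply: L2t_ext; apply: (aeS2 (fn_add_ x y) (fn_add_ y x)) => t -> ->; rewrite addrC.
Qed.
Lemma l2add0 : left_id l2zero l2add.
Proof.
by move=> x; apply: L2t_ext; apply: (aeS2 (fn_add_ l2zero x) fn_zero_) => t -> ->; rewrite add0r.
Qed.
Lemma l2addN : left_inverse l2zero l2opp l2add.
Proof.
move=> x; apply: L2t_ext; apply: (aeS3 (fn_add_ (l2opp x) x) (fn_opp_ x) fn_zero_) => t -> -> ->.
by rewrite addNr.
Qed.
HB.instance Definition _ := GRing.isZmodule.Build L2t l2addA l2addC l2add0 l2addN.

Lemma l2scaleA a b x : l2scale a (l2scale b x) = l2scale (a * b) x.
Proof.
apply: L2t_ext; apply: (aeS3 (fn_scale_ a (l2scale b x)) (fn_scale_ b x) (fn_scale_ (a * b) x)).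
by move=> t -> -> ->; rewrite mulrA.
Qed.
Lemma l2scale1 : left_id 1 l2scale.
Proof. by move=> x; apply: L2t_ext; apply: (aeS (fn_scale_ 1 x)) => t ->; rewrite mul1r. Qed.
Lemma l2scaleDr : right_distributive l2scale +%R.
Proof.
move=> a x y; apply: L2t_ext.
apply: (aeS (aeI (aeI (fn_scale_ a (l2add x y)) (fn_add_ x y))
  (aeI (fn_add_ (l2scale a x) (l2scale a y)) (aeI (fn_scale_ a x) (fn_scale_ a y))))).
by move=> t [[h1 h2] [h3 [h4 h5]]]; rewrite h1 h2 h3 h4 h5 mulrDr.
Qed.
Lemma l2scaleDl x : {morph l2scale^~ x : a b / a + b}.
Proof.
move=> a b; apply: L2t_ext.
apply: (aeS (aeI (fn_scale_ (a + b) x) (aeI (fn_add_ (l2scale a x) (l2scale b x)) (aeI (fn_scale_ a x) (fn_scale_ b x))))).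
by move=> t [h1 [h2 [h3 h4]]]; rewrite h1 h2 h3 h4 mulrDl.
Qed.
HB.instance Definition _ := GRing.Zmodule_isLmodule.Build R[i] L2t l2scaleA l2scale1 l2scaleDr l2scaleDl.

Lemma fn_add (x y : L2t) : {ae mu, forall t, fn (x + y) t = fn x t + fn y t}.
Proof. exact: fn_add_. Qed.
Lemma fn_opp (x : L2t) : {ae mu, forall t, fn (- x) t = - fn x t}.
Proof. exact: fn_opp_. Qed.
Lemma fn_sub (x y : L2t) : {ae mu, forall t, fn (x - y) t = fn x t - fn y t}.
Proof. by apply: (aeS2 (fn_add x (- y)) (fn_opp y)) => t -> ->. Qed.
Lemma fn_scale a (x : L2t) : {ae mu, forall t, fn (a *: x) t = a * fn x t}.
Proof. exact: fn_scale_. Qed.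
Lemma fn_zero : {ae mu, forall t, fn 0 t = 0}.
Proof. exact: fn_zero_. Qed.

Definition l2dot (x y : L2t) : R[i] := cint (fun t => fn x t * cj (fn y t)).

Lemma l2dot_integ (x y : L2t) : cinteg (fun t => fn x t * cj (fn y t)).
Proof. by apply: L2_prodJ; exact: fn_L2. Qed.

Lemma l2dotDl x y z : l2dot (x + y) z = l2dot x z + l2dot y z.
Proof.
rewrite /l2dot -cintD; [|exact: l2dot_integ|exact: l2dot_integ].
apply: eq_ae_cint; first by case: (l2dot_integ (x + y) z).
  by case: (cintegD (l2dot_integ x z) (l2dot_integ y z)).
by apply: (aeS (fn_add x y)) => t ->; rewrite mulrDl.
Qed.
Lemma l2dotZl a x y : l2dot (a *: x) y = a * l2dot x y.
Proof.
rewrite /l2dot -cintZ; last exact: l2dot_integ.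
apply: eq_ae_cint; first by case: (l2dot_integ (a *: x) y).
  by case: (cintegZ a (l2dot_integ x y)).
by apply: (aeS (fn_scale a x)) => t ->; rewrite mulrA.
Qed.
Lemma l2dotJ x y : l2dot y x = cj (l2dot x y).
Proof.
rewrite /l2dot -cintJ; last exact: l2dot_integ.
by congr cint; apply/funext => t; rewrite JM JK mulrC.
Qed.
Lemma l2dotxx x : Re (l2dot x x) = rint (fun t => cmod (fn x t) ^+ 2).
Proof. by rewrite /l2dot /= -/(rint _); congr rint; apply/funext => t; rewrite cmod_sqrJ. Qed.
Lemma l2dot_ge0 x : 0 <= Re (l2dot x x).
Proof. by rewrite l2dotxx; apply: rint_ge0 => t; exact: sqr_ge0. Qed.
Lemma l2dot_def x : Re (l2dot x x) = 0 -> x = 0.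
Proof.
rewrite l2dotxx => h; apply: L2t_ext.
have := rint_eq0 (L2_sq (fn_L2 x)) (fun t => sqr_ge0 _) h => h'.
apply: (aeS2 h' fn_zero) => t /eqP; rewrite sqrf_eq0 => /eqP/cmod_eq0 -> //.
Qed.
Lemma rint_sub_sq x y f : L2 setT f -> {ae mu, forall t, fn y t = f t} ->
  Re (l2dot (x - y) (x - y)) = rint (fun t => cmod (fn x t - f t) ^+ 2).
Proof.
move=> Lf hf; rewrite l2dotxx; apply: eq_ae_rint.
- by apply: measurable_funX; apply: measurable_cmod; exact: fn_meas.
- by apply: measurable_funX; apply: measurable_cmod; apply: cmeas_sub; [exact: fn_meas|exact: L2_meas].
- by apply: (aeS2 (fn_sub x y) hf) => t -> ->.
Qed.
Lemma l2complete (u : nat -> L2t) :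
    (forall e : R, 0 < e -> exists N, forall m n, (N <= m)%N -> (N <= n)%N ->
       Re (l2dot (u m - u n) (u m - u n)) < e) ->
    exists l, forall e : R, 0 < e -> exists N, forall n, (N <= n)%N ->
       Re (l2dot (u n - l) (u n - l)) < e.
Proof.
move=> hu; have [n|e e0|f [Lf hf]] := @riesz_fischer R (fun n => fn (u n)); first exact: fn_L2.
  have [N hN] := hu e e0; exists N => m n hm hn.
  rewrite -(@rint_sub_sq (u m) (u n)); [exact: hN|exact: fn_L2|exact: aeW].
exists (cls f) => e /hf[N hN]; exists N => n /hN.
by rewrite -(@rint_sub_sq (u n) (cls f))//; exact: fn_cls.
Qed.

Definition L2H : hilbert R :=
  @Hilbert R L2t l2dot l2dotDl l2dotZl l2dotJ l2dot_ge0 l2dot_def l2complete.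

End L2Hilbert.

(** * Fubini's theorem for kernels bounded by a product *)

Section Fubini.
Context {R : realType}.
Local Notation mu := (@lebesgue_measure R).

Lemma rfubini_prod (k : R * R -> R) (u v : R -> R) : measurable_fun setT k ->
  rinteg u -> rinteg v -> (forall x t, `|k (x, t)| <= u x * v t) ->
  (forall x, rinteg (fun t => k (x, t))) /\ (mu \x mu)%E.-integrable setT (EFin \o k).
Proof.
move=> mk iu iv hk.
have mx x : measurable_fun setT (fun t => k (x, t)).
  by apply: (measurableT_comp mk); exact: measurable_pair1.
have ix x : rinteg (fun t => k (x, t)).
  by apply: rinteg_le (rintegZ (u x) iv) => // t; exact: hk.
split=> //; apply/integrable12ltyP; first exact/measurable_EFinP.
apply: (@le_lt_trans _ _ (\int[mu]_x (rint v * u x)%:E)%E); last first.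
  by rewrite rint_EFin ?ltry//; exact: rintegZ.
apply: ge0_le_integral => //.
- by move=> x _; apply: integral_ge0.
- apply: (@measurable_fun_fubini_tonelli_F _ _ (measurableTypeR R) (measurableTypeR R) R mu
    (fun p => `|(EFin \o k) p|)%E) => //.
  by apply: measurableT_comp => //; exact/measurable_EFinP.
- by apply/measurable_EFinP; apply: rinteg_meas; exact: rintegZ.
- move=> x _; rewrite [leLHS](rint_EFin (rinteg_norm (ix x))) lee_fin.
  rewrite mulrC -rintZ//; apply: rint_le => //; first exact: rinteg_norm.
  exact: rintegZ.
Qed.

Lemma rfubini_integ (k : R * R -> R) (u v : R -> R) : measurable_fun setT k ->
  rinteg u -> rinteg v -> (forall x t, `|k (x, t)| <= u x * v t) ->
  rinteg (fun x => rint (fun t => k (x, t))).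
Proof.
move=> mk iu iv hk; have [ix ik] := rfubini_prod mk iu iv hk.
apply: rinteg_le (rintegZ (rint v) iu).
  rewrite [X in measurable_fun _ X](_ : _ = fine \o (fun x => \int[mu]_t (k (x, t))%:E)%E)//.
  apply: measurableT_comp; first exact: fine_measurable.
  exact: (@measurable_fubini_F _ _ (measurableTypeR R) (measurableTypeR R) R mu mu _ ik).
move=> x; apply: le_trans (le_normr_Rintegral measurableT (ix x)) _.
rewrite mulrC -rintZ//; apply: rint_le => //; first exact: rinteg_norm.
exact: rintegZ.
Qed.

Lemma rfubini (k : R * R -> R) (u v : R -> R) : measurable_fun setT k ->
  rinteg u -> rinteg v -> (forall x t, `|k (x, t)| <= u x * v t) ->
  rint (fun x => rint (fun t => k (x, t))) = rint (fun t => rint (fun x => k (x, t))).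
Proof.
move=> mk iu iv hk.
have [ix ik] := rfubini_prod mk iu iv hk.
have mk' : measurable_fun setT (fun p : R * R => k (p.2, p.1)).
  by apply: (measurableT_comp mk); exact: measurable_swap.
have hk' x t : `|k (t, x)| <= v x * u t by rewrite mulrC; exact: hk.
have [it _] := rfubini_prod mk' iv iu hk'.
have := @Fubini _ _ (measurableTypeR R) (measurableTypeR R) R mu mu _ ik.
rewrite /rint /Rintegral => h; congr fine.
transitivity (\int[mu]_x \int[mu]_y (EFin \o k) (x, y))%E.
  by apply: eq_integral => x _; rewrite fineK//; exact: (integrable_fin_num _ (ix x)).
rewrite h; apply: eq_integral => y _; rewrite fineK//; exact: (integrable_fin_num _ (it y)).
Qed.

Lemma cfubini (k : R -> R -> Cplx R) (u v : R -> R) :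
  measurable_fun setT (fun p : R * R => Re (k p.1 p.2)) ->
  measurable_fun setT (fun p : R * R => Im (k p.1 p.2)) ->
  rinteg u -> rinteg v -> (forall x t, cmod (k x t) <= u x * v t) ->
  [/\ forall x, cinteg (k x), forall t, cinteg (k^~ t), cinteg (fun x => cint (k x)),
   cinteg (fun t => cint (k^~ t)) &
   cint (fun x => cint (k x)) = cint (fun t => cint (k^~ t))].
Proof.
move=> m1 m2 iu iv hk.
have h1 x t : `|Re (k x t)| <= u x * v t by exact: le_trans (cmod_Re _) (hk _ _).
have h2 x t : `|Im (k x t)| <= u x * v t by exact: le_trans (cmod_Im _) (hk _ _).
have mx x : cmeasurable setT (k x).
  by split; [apply: (measurableT_comp m1 (@measurable_pair1 _ _ R R x))|apply: (measurableT_comp m2 (@measurable_pair1 _ _ R R x))].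
have mt t : cmeasurable setT (k^~ t).
  by split; [apply: (measurableT_comp m1 (@measurable_pair2 _ _ R R t))|apply: (measurableT_comp m2 (@measurable_pair2 _ _ R R t))].
split.
- by move=> x; apply: cinteg_le (rintegZ (u x) iv) _.
- by move=> t; apply: cinteg_le (rintegZ (v t) iu) _ => // x; rewrite mulrC.
- have i1 := rfubini_integ m1 iu iv h1; have i2 := rfubini_integ m2 iu iv h2.
  apply: cinteg_le (rintegD (rinteg_norm i1) (rinteg_norm i2)) _.
    by split; [exact: rinteg_meas i1|exact: rinteg_meas i2].
  by move=> x; exact: cmod_le_ReIm.
- have m1' := measurableT_comp m1 (@measurable_swap _ _ R R).
  have m2' := measurableT_comp m2 (@measurable_swap _ _ R R).
  have h1' t x : `|Re (k x t)| <= v t * u x by rewrite mulrC.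
  have h2' t x : `|Im (k x t)| <= v t * u x by rewrite mulrC.
  have i1 := rfubini_integ m1' iv iu h1'; have i2 := rfubini_integ m2' iv iu h2'.
  apply: cinteg_le (rintegD (rinteg_norm i1) (rinteg_norm i2)) _.
    by split; [exact: rinteg_meas i1|exact: rinteg_meas i2].
  by move=> x; exact: cmod_le_ReIm.
- by apply: complex_ext; [exact: (rfubini m1 iu iv h1)|exact: (rfubini m2 iu iv h2)].
Qed.

End Fubini.

(** * Poisson kernel *)

Section Poisson.
Context {R : realType}.
Local Notation mu := (@lebesgue_measure R).
Implicit Types (x y t : R) (f g : R -> Cplx R).

Definition pk x y t : R := y / (pi * ((t - x) ^+ 2 + y ^+ 2)).

Lemma pk_den x y t : 0 < y -> 0 < (t - x) ^+ 2 + y ^+ 2.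
Proof. by move=> y0; rewrite ltr_wpDl ?sqr_ge0// exprn_gt0. Qed.
Lemma pk_ge0 x y t : 0 < y -> 0 <= pk x y t.
Proof. by move=> y0; rewrite divr_ge0 ?mulr_ge0 ?pi_ge0 ?ltW// pk_den. Qed.
Lemma pk_sym x y t : pk x y t = pk t y x.
Proof. by rewrite /pk -[x - t]opprB sqrrN. Qed.
Lemma pk_bound x y t : 0 < y -> pk x y t <= (pi * y)^-1.
Proof.
move=> y0; rewrite /pk ler_pdivrMr ?mulr_gt0 ?pi_gt0 ?pk_den// ler_pdivlMl ?mulr_gt0 ?pi_gt0//.
rewrite -mulrA ler_pM2l ?pi_gt0// -expr2 lerDr sqr_ge0//.
Qed.

Lemma pk_cont x y : 0 < y -> continuous (pk x y).
Proof.
move=> y0 t; apply: cvgM; first exact: cvg_cst.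
apply: cvgV; first by rewrite gt_eqF// mulr_gt0 ?pi_gt0// pk_den.
apply: cvgM; first exact: cvg_cst.
apply: cvgD; last exact: cvg_cst.
by apply: cvgM; apply: cvgB; [exact: cvg_id|exact: cvg_cst|exact: cvg_id|exact: cvg_cst].
Qed.

Lemma pk_meas x y : 0 < y -> measurable_fun setT (pk x y).
Proof. by move=> y0; apply: continuous_measurable_fun; exact: pk_cont. Qed.

Lemma integral_oneDsqr : (\int[mu]_t ((oneDsqr t)^-1)%:E = pi%:E)%E.
Proof.
rewrite (@ge0_symfun_integralT _ (fun t => (oneDsqr t)^-1)); last 3 first.
- by move=> t; rewrite invr_ge0.
- exact: continuous_oneDsqrV.
- by move=> t /=; rewrite /oneDsqr sqrrN.
have -> : [set t : R | 0 <= t] = `[0%R, +oo[%classic.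
  by apply/seteqP; split=> t /=; rewrite in_itv/= andbT.
rewrite (@integral0y_oneDsqr R) -EFinM; congr EFin.
by rewrite mulrC divfK.
Qed.

Lemma pk_int x y : 0 < y -> rinteg (pk x y) /\ rint (pk x y) = 1.
Proof.
move=> y0.
have dF t : is_derive t 1 (fun t => (t - x) / y) (y^-1).
  by apply: is_derive_eq; rewrite /GRing.scale /= ?mulr1 ?mulr0 ?add0r ?addr0 subr0 mulr1.
have F'E : derive1 (fun t => (t - x) / y) = cst y^-1.
  by apply/funext => t; rewrite derive1E derive_val.
have E : (\int[mu]_t (pk x y t)%:E = 1)%E.
  have := @increasing_ge0_integration_by_substitutionT R (fun t => (t - x) / y)
    (fun t => (oneDsqr t)^-1).
  rewrite integral_oneDsqr F'E => h.
  have {}h : (pi%:E = \int[mu]_t ((pi * pk x y t)%:E))%E.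
    rewrite h//.
    - apply: eq_integral => t _; congr EFin => /=; rewrite /pk /oneDsqr /=.
      have := pk_den x t y0; move/gt_eqF/negbT => d0.
      have alg (p : R) : p != 0 -> (1 + ((t - x) / y) ^+ 2)^-1 * y^-1 =
          p * (y / (p * ((t - x) ^+ 2 + y ^+ 2))).
        by move=> p0; field; rewrite p0 d0 gt_eqF.
      by rewrite -alg// gt_eqF ?pi_gt0.
    - by move=> a b ab; rewrite ltr_pM2r ?invr_gt0// ltrD2r.
    - by move=> t; exact: cvg_cst.
    - exact: is_cvg_cst.
    - exact: is_cvg_cst.
    - apply/cvgrNyPle => A; near=> t.
      by rewrite ler_pdivrMr// lerBlDr; near: t; apply: nbhs_ninfty_le; exact: num_real.
    - apply/cvgryPge => A; near=> t.
      by rewrite ler_pdivlMr// lerBrDr; near: t; apply: nbhs_pinfty_ge; exact: num_real.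
    - exact: continuous_oneDsqrV.
  have := congr1 (fun a => ((pi : R)^-1%:E * a)%E) h.
  rewrite -ge0_integralZl//; last 3 first.
  - apply/measurable_EFinP; apply: measurable_funM => //; exact: pk_meas.
  - by move=> t _; rewrite lee_fin mulr_ge0 ?pi_ge0 ?pk_ge0.
  - by rewrite lee_fin invr_ge0 pi_ge0.
  rewrite -EFinM mulVf ?gt_eqF ?pi_gt0// => ->.
  by apply: eq_integral => t _; rewrite -EFinM mulrA mulVf ?mul1r// gt_eqF ?pi_gt0.
have ip : rinteg (pk x y).
  apply/rinteg_ge0P; [exact: pk_meas|by move=> t; exact: pk_ge0|by rewrite E ltry].
by split=> //; rewrite /rint /Rintegral E.
Unshelve. all: by end_near. Qed.

(** At distance at least [K y], the kernel is dominated by a small multiple of the wider kernel of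
    height [K y] centred at [x]. That kernel still has integral 1, so the tail costs [8 / K]. *)
Lemma pk_tail (x x' y a K t : R) : 0 < y -> `|x' - x| <= a * y -> 2 * a <= K -> 0 < K ->
  K * y <= `|t - x| -> pk x' y t <= 8 / K * pk x (K * y) t.
Proof.
move=> y0 h aK K0 hK.
have h1 : `|t - x| <= 2 * `|t - x'|.
  have : `|t - x| <= `|t - x'| + `|x' - x| 
    by rewrite (_ : t - x = (t - x') + (x' - x)) ?ler_normD//; ring.
  have : 2 * (a * y) <= K * y by rewrite mulrA ler_pM2r.
  lra.
have h2 : (t - x) ^+ 2 <= 4 * (t - x') ^+ 2.
  have := sqr_mono (normr_ge0 _) h1; rewrite exprMn !real_normK ?num_real// => /le_trans; apply.
  by rewrite ler_wpM2r ?sqr_ge0//; lra.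
have h3 : (K * y) ^+ 2 <= (t - x) ^+ 2.
  have := sqr_mono (ltW (mulr_gt0 K0 y0)) hK; by rewrite real_normK ?num_real.
have Ky : 0 < K * y by rewrite mulr_gt0.
have d1 := pk_den x t Ky; have d2 := pk_den x' t y0.
rewrite /pk mulrA (_ : 8 / K * (K * y) = 8 * y); last by field; rewrite gt_eqF.
rewrite ler_pdivrMr ?mulr_gt0 ?pi_gt0//.
rewrite mulrAC ler_pdivlMr ?mulr_gt0 ?pi_gt0//.
have y2 := sqr_ge0 y; have pip := pi_gt0 R.
rewrite [pi * _]mulrC [pi * _]mulrC !mulrA ler_pM2r// [8 * y]mulrC -mulrA ler_pM2l//; lra.
Qed.

(** The averages in the definition of a Lebesgue point, multiplied by the measure [2 r] of the
    ball. *)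
Lemma lebesgue_pt_small (u : R -> R) x : measurable_fun setT u -> lebesgue_pt u x ->
  forall e : R, 0 < e -> exists d : R, 0 < d /\ forall r, 0 < r < d ->
  (\int[mu]_(t in ball x r) `|(u t - u x)%:E| <= (e * r)%:E)%E.
Proof.
move=> mu_ h e e0.
have /fine_cvgP[hf hc] := h.
have e2 : 0 < e / 2 by rewrite divr_gt0.
have : \forall r \near 0^'+, davg u x r \is a fin_num /\ `|fine (davg u x r)| < e / 2.
  near=> r; split; first by near: r.
  by near: r; move/cvgr0Pnorm_lt : hc => /(_ _ e2).
move=> [d /= d0 hd]; exists d; split=> // r /andP[r0 rd].
have /hd : ball_ [eta Num.norm] 0 d r by rewrite /= sub0r normrN gtr0_norm.
move=> /(_ r0) []; rewrite /davg /iavg lebesgue_measure_ball; last exact: ltW.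
move=> fin.
rewrite -[X in _ -> (X <= _)%E]/(\int[mu]_(t in ball x r) `|((center (u x) \o u) t)%:E|)%E.
set I := (\int[mu]_(y in _) _)%E in fin * => hI.
have I0 : (0 <= I)%E by apply: integral_ge0.
have r2 : 0 < r *+ 2 by rewrite mulrn_wgt0.
rewrite inver gt_eqF//= in fin hI.
have : I \is a fin_num.
  by move: fin I0; case: (I) => //=; rewrite mulry gtr0_sg ?invr_gt0// mul1e.
case: (I) I0 hI => // i i0 hI _ /=; rewrite lee_fin in i0 *; move: hI => /=.
rewrite ger0_norm ?mulr_ge0 ?invr_ge0 ?(ltW r2)// ltr_pdivrMl// => /ltW hi.
apply: le_trans hi _; rewrite -mulr_natr le_eqVlt; apply/orP; left; apply/eqP; field.
Unshelve. all: by end_near. Qed.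

Lemma lebesgue_pt_rint (u : R -> R) x : measurable_fun setT u -> lebesgue_pt u x ->
  forall e : R, 0 < e -> exists d : R, 0 < d /\ forall r, 0 < r < d ->
  rinteg (fun t => \1_(ball x r) t * `|u t - u x|) /\
  rint (fun t => \1_(ball x r) t * `|u t - u x|) <= e * r.
Proof.
move=> mu_ h e e0; have [d [d0 hd]] := lebesgue_pt_small mu_ h e0.
exists d; split=> // r /hd; set B := ball x r.
have mB : measurable B by exact: measurable_ball.
have -> : (\int[mu]_(t in B) `|(u t - u x)%:E| = \int[mu]_t (\1_B t * `|u t - u x|)%:E)%E.
  rewrite integral_mkcond; apply: eq_integral => t _; rewrite patchE indicE.
  by case: ifPn => _; rewrite ?mul1r ?mul0r.
move=> hle; set w := fun t => _ * _ in hle *.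
have iw : rinteg w.
  apply/rinteg_ge0P; last by apply: le_lt_trans hle _; exact: ltry.
    apply: measurable_funM; first exact: measurable_indic.
    by apply: measurableT_comp => //; apply: measurable_funB.
  by move=> t; rewrite /w mulr_ge0// indicE ler0n.
by split=> //; rewrite -lee_fin -rint_EFin.
Qed.

Lemma bounded_locally_integrable (u : R -> R) (M : R) : measurable_fun setT u ->
  (forall t, `|u t| <= M) -> locally_integrable setT u.
Proof.
move=> mu_ hM; split=> //; first exact: openT.
move=> K _ cK.
have mK : measurable K by exact: compact_measurable.
apply: (@le_lt_trans _ _ (\int[mu]_(t in K) (cst M%:E t))%E).
  apply: ge0_le_integral => //.
  - by apply/measurable_EFinP; apply: measurableT_comp => //; exact: measurable_funTS.
  - by move=> t _; rewrite lee_fin.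
rewrite integral_cst//=.
have [k [kr hk]] := compact_bounded cK.
pose I : set R := `[- (`|k| + 1), `|k| + 1]%classic.
have : (mu K <= mu I)%E.
  apply: le_measure; rewrite ?inE//; first exact: measurable_itv.
  move=> t Kt; rewrite /I /= in_itv/= -ler_norml.
  by apply: (hk (`|k| + 1)) => //; have := ler_norm k; lra.
rewrite lebesgue_measure_itv/= => hle.
apply: (@le_lt_trans _ _ (`|M|%:E * mu K)%E); first by rewrite lee_wpmul2r// lee_fin ler_norm.
apply: lte_mul_pinfty; [by rewrite lee_fin|by []|].
by apply: le_lt_trans hle _; case: ifP => _; rewrite -?EFinB ?ltry.
Qed.

Definition poisson f x y : Cplx R := cint (fun t => (pk x y t)%:C * f t).

Lemma poisson_bound f (M : R) x y : cmeasurable setT f -> {ae mu, forall t, cmod (f t) <= M} -> 0 < y ->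
  cinteg (fun t => (pk x y t)%:C * f t) /\ cmod (poisson f x y) <= M.
Proof.
move=> mf hM y0; have [ip p1] := pk_int x y0.
have := @cmod_cint_le R (fun t => (pk x y t)%:C * f t) (fun t => M * pk x y t).
rewrite rintZ// p1 mulr1; apply.
- apply: cmeas_mul => //; apply: cmeas_real; exact: pk_meas.
- exact: rintegZ.
- by apply: (aeS hM) => t h; rewrite cmodM cmodC ger0_norm ?pk_ge0// mulrC ler_wpM2r// pk_ge0.
Qed.

(** At a Lebesgue point of the real and the imaginary part, the ball of radius [K y] is handled with
    the bound [1 / (pi y)] of the kernel and the rest with [pk_tail]; [K] depends on the aperture
    and on [e] but not on [y]. *)
Lemma fatou_poisson_bounded f (M : R) : cmeasurable setT f -> (forall t, cmod (f t) <= M) ->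
  {ae mu, forall x, forall a e : R, 0 < a -> 0 < e -> exists d : R, 0 < d /\
    forall x' y, 0 < y < d -> `|x' - x| <= a * y -> cmod (poisson f x' y - f x) <= e}.
Proof.
move=> mf hM; have [m1 m2] := mf.
have b1 t : `|Re (f t)| <= M by exact: le_trans (cmod_Re _) (hM _).
have b2 t : `|Im (f t)| <= M by exact: le_trans (cmod_Im _) (hM _).
have L1 := lebesgue_differentiation (bounded_locally_integrable m1 b1).
have L2' := lebesgue_differentiation (bounded_locally_integrable m2 b2).
apply: (aeS2 L1 L2') => x l1 l2 a e a0 e0.
have M0 : 0 <= M by exact: le_trans (cmod_ge0 _) (hM 0).
(* [2 a] is required by [pk_tail], 1 keeps [K] positive, and [32 M / e] makes the tail [16 M / K] at
   most [e / 2]. *)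
pose K := 2 * a + 1 + 32 * M / e.
have Me : 0 <= 32 * M / e by apply: divr_ge0; [exact: mulr_ge0|exact: ltW].
have K0 : 0 < K by rewrite /K; lra.
have aK : 2 * a <= K by rewrite /K; lra.
have eK : 0 < e / (4 * K) by rewrite divr_gt0// mulr_gt0.
have [d1 [d10 hd1]] := lebesgue_pt_rint m1 l1 eK.
have [d2 [d20 hd2]] := lebesgue_pt_rint m2 l2 eK.
exists (Num.min d1 d2 / K); split; first by rewrite divr_gt0// lt_min d10.
move=> x' y /andP[y0]; rewrite ltr_pdivlMr// lt_min mulrC => /andP[y1 y2] hx.
have Ky : 0 < K * y by rewrite mulr_gt0.
have [i1 r1] := hd1 (K * y) (ltac:(by rewrite Ky)).
have [i2 r2] := hd2 (K * y) (ltac:(by rewrite Ky)).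
have [ip p1] := pk_int x' y0.
have [iq q1] := pk_int x Ky.
have [ipf _] := poisson_bound x' mf (aeA hM) y0.
have mcst (c : Cplx R) : cinteg (fun t => (pk x' y t)%:C * c).
  by have [] := poisson_bound x' (cmeas_cst c) (aeA (fun=> lexx (cmod c))) y0.
have -> : poisson f x' y - f x = cint (fun t => (pk x' y t)%:C * (f t - f x)).
  have e1 : f x = cint (fun t => (pk x' y t)%:C * f x).
    have ipc : cinteg (fun t => (pk x' y t)%:C).
      by apply: cinteg_le ip _; [apply: cmeas_real; exact: pk_meas|move=> t; rewrite cmodC ger0_norm ?pk_ge0].
    under eq_fun do rewrite mulrC.
    rewrite cintZ// [cint _](_ : _ = 1) ?mulr1//; apply: complex_ext => /=; first exact: p1.
    exact: rint0.
  rewrite [X in _ - X]e1 /poisson -cintB//; congr cint; apply/funext => t; by rewrite mulrBr.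
pose w t := (pi * y)^-1 * (\1_(ball x (K * y)) t * `|Re (f t) - Re (f x)| +
     \1_(ball x (K * y)) t * `|Im (f t) - Im (f x)|) + (16 * M / K) * pk x (K * y) t.
have iw : rinteg w.
  apply: rintegD; apply: rintegZ => //; exact: rintegD.
have mpf : cmeasurable setT (fun t => (pk x' y t)%:C * (f t - f x)).
  apply: cmeas_mul; first by apply: cmeas_real; exact: pk_meas.
  by apply: cmeas_sub => //; exact: cmeas_cst.
have [|_ /le_trans] := cmod_cint_le mpf iw.
  apply: aeA => t; rewrite cmodM cmodC ger0_norm ?pk_ge0// /w.
  have [bt|bt] := pselect (ball x (K * y) t).
    rewrite indicE mem_set// !mul1r ler_wpDr//.
      by rewrite mulr_ge0 ?pk_ge0// divr_ge0 ?mulr_ge0// ltW.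
    apply: ler_pM; [exact: pk_ge0|exact: cmod_ge0|exact: pk_bound|].
    by rewrite -ReB -ImB; exact: cmod_le_ReIm.
  rewrite indicE memNset// !mul0r addr0 mulr0 add0r.
  have ht : K * y <= `|t - x|.
    by rewrite leNgt; apply/negP => h; apply: bt; rewrite /ball /= distrC.
  have f2 : cmod (f t - f x) <= 2 * M.
    apply: le_trans (cmodD _ _) _; rewrite cmodN; have := hM t; have := hM x; lra.
  apply: le_trans (ler_pM (pk_ge0 _ _ y0) (cmod_ge0 _) (pk_tail y0 hx aK K0 ht) f2) _.
  by rewrite le_eqVlt; apply/orP; left; apply/eqP; field; rewrite gt_eqF.
apply.
rewrite [rint w](rintD (rintegZ _ (rintegD i1 i2)) (rintegZ _ iq)).
rewrite (rintZ _ (rintegD i1 i2)) (rintD i1 i2) (rintZ _ iq) q1 mulr1.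
have t1 : 16 * M / K <= e / 2.
  rewrite ler_pdivrMr// (_ : 16 * M = e / 2 * (32 * M / e)); last by field; rewrite gt_eqF.
  by rewrite ler_pM2l ?divr_gt0// /K; lra.
suff : (pi * y)^-1 * (e / (4 * K) * (K * y) + e / (4 * K) * (K * y)) <= e / 2.
  have : (pi * y)^-1 * (rint (fun t => \1_(ball x (K * y)) t * `|Re (f t) - Re (f x)|) +
      rint (fun t => \1_(ball x (K * y)) t * `|Im (f t) - Im (f x)|)) <=
      (pi * y)^-1 * (e / (4 * K) * (K * y) + e / (4 * K) * (K * y)).
    apply: ler_wpM2l; last exact: lerD.
    by rewrite invr_ge0 mulr_ge0 ?pi_ge0// ltW.
  lra.
rewrite (_ : _ + _ = e * y / 2); last by field; rewrite gt_eqF.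
rewrite ler_pdivrMl ?mulr_gt0 ?pi_gt0// [e * y]mulrC -mulrA [pi * y]mulrC -mulrA ler_pM2l//.
by rewrite ler_peMl ?divr_ge0 ?ltW// (lt_le_trans _ (pi_ge2 R))//; lra.
Qed.

Lemma fatou_poisson f (M : R) : cmeasurable setT f -> {ae mu, forall t, cmod (f t) <= M} ->
  {ae mu, forall x, forall a e : R, 0 < a -> 0 < e -> exists d : R, 0 < d /\
    forall x' y, 0 < y < d -> `|x' - x| <= a * y -> cmod (poisson f x' y - f x) <= e}.
Proof.
move=> mf hM.
pose A := [set t | cmod (f t) <= M].
have mA : measurable A.
  rewrite -[A]setTI; apply: measurable_fun_ler => //; exact: measurable_cmod.
pose g t : Cplx R := (\1_A t)%:C * f t.
have mg : cmeasurable setT g.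
  by apply: cmeas_mul => //; apply: cmeas_real; exact: measurable_indic.
have gb t : cmod (g t) <= `|M|.
  rewrite /g cmodM cmodC indicE; have [At|At] := pselect (A t).
    by rewrite mem_set//= normr1 mul1r (le_trans At)// ler_norm.
  by rewrite memNset//= normr0 mul0r.
have gf : {ae mu, forall t, g t = f t}.
  by apply: (aeS hM) => t h; rewrite /g indicE mem_set// mul1r.
apply: (aeS2 (fatou_poisson_bounded mg gb) gf) => x hx gx a e a0 e0.
have [d [d0 hd]] := hx a e a0 e0; exists d; split=> // x' y hy hx'.
have -> : poisson f x' y = poisson g x' y.
  have y0 : 0 < y by case/andP: hy.
  apply: eq_ae_cint.
  - by apply: cmeas_mul => //; apply: cmeas_real; exact: pk_meas.
  - by apply: cmeas_mul => //; apply: cmeas_real; exact: pk_meas.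
  - by apply: (aeS gf) => t ->.
by rewrite -gx; exact: hd.
Qed.

Lemma rinteg_indic_itv (n : nat) : rinteg (\1_(`[- n%:R, n%:R]%classic) : R -> R).
Proof.
apply/rinteg_ge0P; [exact: measurable_indic|by move=> t; rewrite indicE ler0n|].
rewrite integral_indic; [|exact: measurableT|exact: measurable_itv].
rewrite setIT -[X in (X < _)%E]/(mu [set` `[- n%:R, n%:R]]) lebesgue_measure_itv/=; case: ifP => _; by rewrite -?EFinB ltry.
Qed.

(** [E] is merely integrable, so Fatou's theorem is not applied to it. It is tested against the
    bounded [g], the conjugate phase of [E] cut off to [[-n, n]]; by Fubini and the symmetry of the
    kernel the Poisson integral moves from [E] to [g]. *)
Lemma poisson_unique (E : R -> Cplx R) : cinteg E ->
  (forall x y, 0 < y < 2^-1 -> poisson E x y = 0) -> {ae mu, forall x, E x = 0}.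
Proof.
move=> hE h0; have [mE iE] := hE.
pose A (n : nat) := `[- n%:R, n%:R]%classic : set R.
suff hn n : {ae mu, forall x, \1_(A n) x * cmod (E x) = 0}.
  have /ae_foralln h := hn; apply: (aeS h) => x hx.
  have := hx (Num.truncn `|x|).+1; rewrite indicE mem_set ?mul1r; first exact: cmod_eq0.
  by rewrite /A /= in_itv/= -ler_norml; apply: ltW; exact: truncnS_gt.
pose g x : Cplx R := (\1_(A n) x)%:C * (cj (E x) * (((cmod (E x))^-1)%:C)).
have mcE := measurable_cmod mE.
have mA : measurable (A n) by exact: measurable_itv.
have mg : cmeasurable setT g.
  apply: cmeas_mul; first by apply: cmeas_real; exact: measurable_indic.
  apply: cmeas_mul; first exact: cmeas_conj.
  by apply: cmeas_real; exact: measurable_invr.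
have gb x : cmod (g x) <= \1_(A n) x.
  rewrite /g !cmodM !cmodC cmodJ ger0_norm ?indicE ?ler0n// ler_piMr ?ler0n//.
  rewrite ger0_norm ?invr_ge0 ?cmod_ge0//.
  by have [->|/mulfV ->//] := eqVneq (cmod (E x)) 0; rewrite mul0r.
have gb1 x : cmod (g x) <= 1 by apply: le_trans (gb x) _; rewrite indicE lern1 leq_b1.
have Eg x : E x * g x = (\1_(A n) x * cmod (E x))%:C.
  rewrite /g mulrCA [E x * _]mulrA [E x * cj _]mulcJ -!rmorphM; congr (_%:C).
  have [->|c0] := eqVneq (cmod (E x)) 0; first by rewrite expr0n mul0r.
  by rewrite expr2 mulfK.
have key y : 0 < y < 2^-1 -> cmeasurable setT (fun t => E t * poisson g t y) /\
    cint (fun t => E t * poisson g t y) = 0.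
  move=> /andP[y0 y1].
  pose k x t : Cplx R := (pk x y t)%:C * E t * g x.
  have mp : measurable_fun setT (fun p : R * R => pk p.1 y p.2).
    apply: measurable_funM => //; apply: measurable_invr; apply: measurable_funM => //.
    apply: measurable_funD => //; apply: measurable_funX; apply: measurable_funB.
      exact: measurable_snd.
    exact: measurable_fst.
  have m1 : measurable_fun setT (fun p : R * R => Re (k p.1 p.2)).
    rewrite /k; under eq_fun do rewrite -mulrA ReM ReC ImC mul0r subr0 ReM.
    apply: measurable_funM => //; apply: measurable_funB; apply: measurable_funM.
    - by apply: (measurableT_comp mE.1); exact: measurable_snd.
    - by apply: (measurableT_comp mg.1); exact: measurable_fst.
    - by apply: (measurableT_comp mE.2); exact: measurable_snd.
    - by apply: (measurableT_comp mg.2); exact: measurable_fst.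
  have m2 : measurable_fun setT (fun p : R * R => Im (k p.1 p.2)).
    rewrite /k; under eq_fun do rewrite -mulrA ImM ReC ImC mul0r addr0 ImM.
    apply: measurable_funM => //; apply: measurable_funD; apply: measurable_funM.
    - by apply: (measurableT_comp mE.1); exact: measurable_snd.
    - by apply: (measurableT_comp mg.2); exact: measurable_fst.
    - by apply: (measurableT_comp mE.2); exact: measurable_snd.
    - by apply: (measurableT_comp mg.1); exact: measurable_fst.
  have hk x t : cmod (k x t) <= ((pi * y)^-1 * \1_(A n) x) * cmod (E t).
    rewrite /k [cmod (_ * g x)]cmodM cmodM cmodC ger0_norm ?pk_ge0// mulrAC ler_wpM2r ?cmod_ge0//.
    by apply: ler_pM; [exact: pk_ge0|exact: cmod_ge0|exact: pk_bound|exact: gb].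
  have [kx kt ik [mk _] eF] := cfubini m1 m2 (rintegZ _ (rinteg_indic_itv n)) iE hk.
  have -> : (fun t => E t * poisson g t y) = (fun t => cint (k^~ t)).
    apply/funext => t; rewrite /poisson -cintZ.
      congr cint; apply/funext => x; rewrite /k (pk_sym t).
      by move: ((pk x y t)%:C) (E t) (g x) => p1' e1' g1'; ring.
    have gM : {ae mu, forall x, cmod (g x) <= 1} by exact: aeA.
    by have [] := poisson_bound t mg gM y0.
  split; first exact: mk.
  rewrite -eF -[RHS]cint0; congr cint; apply/funext => x.
  rewrite (_ : k x = fun t => g x * ((pk x y t)%:C * E t)); last first.
    by apply/funext => t; rewrite /k mulrC.
  have ipE : cinteg (fun t => (pk x y t)%:C * E t); last first.
    have y01 : 0 < y < 2^-1 by rewrite y0.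
    by rewrite (cintZ _ ipE) -/(poisson E x y) (h0 x y y01) mulr0.
  clear m1 m2 hk kx kt ik mk eF k mp.
  apply: cinteg_le (rintegZ (pi * y)^-1 iE) _.
    apply: cmeas_mul; last exact: mE.
    by apply: cmeas_real; exact: pk_meas.
  by move=> t; rewrite cmodM cmodC ger0_norm ?pk_ge0// ler_wpM2r ?cmod_ge0// pk_bound.
have gM : {ae mu, forall x, cmod (g x) <= 1} by exact: aeA.
(* Heights tending to 0 and strictly below [2^-1], as the hypothesis demands. *)
pose ym (m : nat) : R := m.+3%:R^-1.
have ym0 m : 0 < ym m < 2^-1.
  by rewrite invr_gt0 ltr0n/= ltf_pV2 ?posrE ?ltr0n// ltr_nat.
have hl : cint (fun t => E t * g t) = 0.
  apply: cmod_eq0.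
  have hc : cmod (cint (fun t => E t * poisson g t (ym m)) - cint (fun t => E t * g t)) @[m --> \oo] --> 0.
    apply: (@dominated_cint R (fun m t => E t * poisson g t (ym m)) _ (fun t => cmod (E t))) => //.
    - by move=> m; case: (key _ (ym0 m)).
    - exact: cmeas_mul.
    - apply: (aeS (fatou_poisson mg gM)) => t ht; apply/cvgr_eps => e e0.
      have cE : 0 < cmod (E t) + 1 by have := cmod_ge0 (E t); lra.
      have [d [d0 hd]] := ht 1 (e / (2 * (cmod (E t) + 1))) ltr01 (ltac:(by rewrite divr_gt0// mulr_gt0)).
      have [N hN] := invn_lt d0; exists N => m Nm.
      rewrite subr0 ger0_norm ?cmod_ge0// -mulrBr cmodM.
      have /andP[y0 _] := ym0 m.
      have := hd t (ym m); rewrite y0 subrr normr0 mul1r ltW//=.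
      rewrite (_ : ym m < d); last exact: hN (leqW (leqW Nm)).
      move=> /(_ isT isT) => h.
      apply: (@le_lt_trans _ _ ((cmod (E t) + 1) * (e / (2 * (cmod (E t) + 1))))).
        by apply: ler_pM; rewrite ?cmod_ge0// lerDl.
      by rewrite (_ : _ * _ = e / 2) ?ltr_pdivrMr ?ltr_pMr ?ltr1n//; field; rewrite gt_eqF.
    - move=> m; apply: aeA => t; rewrite cmodM ler_piMr ?cmod_ge0//.
      have /andP[y0 _] := ym0 m.
      by have [] := poisson_bound t mg gM y0.
  have : cmod (0 - cint (fun t => E t * g t)) = 0.
    apply/eqP; rewrite -(cvg_lim _ hc)//; apply/eqP/esym/cvg_lim => //.
    by under eq_cvg do rewrite (key _ (ym0 _)).2; exact: cvg_cst.
  by rewrite sub0r cmodN.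
have i1 : rinteg (fun x => \1_(A n) x * cmod (E x)).
  apply: rinteg_le iE; first by apply: measurable_funM => //; exact: measurable_indic.
  move=> x; rewrite ger0_norm ?mulr_ge0 ?cmod_ge0 ?indicE ?ler0n//.
  by rewrite ler_piMl ?cmod_ge0// lern1 leq_b1.
apply: rint_eq0 => //; first by move=> x; rewrite mulr_ge0 ?cmod_ge0// indicE ler0n.
have := congr1 (@Re R) hl; under eq_fun do rewrite Eg.
by [].
Qed.

End Poisson.

Ltac hring := apply: eq_dot => ?; rewrite ?(dotDl, dotNl, dotZl, dot0l); ring.

(** * Cauchy kernels and their totality in L^2 *)

Section CauchyKernel.
Context {R : realType}.
Local Notation mu := (@lebesgue_measure R).
Implicit Types (x y t : R) (z : Cplx R) (f g : R -> Cplx R).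

Definition kz z : R -> Cplx R := fun t => (t%:C - z)^-1.

Lemma kz_den z t : Im z != 0 -> t%:C - z != 0.
Proof.
by apply: contra_neq => /(congr1 (@Im R)); rewrite ImB ImC; lra.
Qed.

Lemma kz_sq z t : cmod (kz z t) ^+ 2 = ((t - Re z) ^+ 2 + Im z ^+ 2)^-1.
Proof. by rewrite cmodV exprVn sqr_cmod ReB ImB ReC ImC sub0r sqrrN. Qed.

Lemma kzJ z t : cj (kz z t) = kz (cj z) t.
Proof. by rewrite /kz JV JB JC. Qed.

Lemma kz_pk z t : Im z != 0 -> cmod (kz z t) ^+ 2 = pi / `|Im z| * pk (Re z) `|Im z| t.
Proof.
move=> z0; rewrite kz_sq /pk real_normK ?num_real//.
have d0 : (t - Re z) ^+ 2 + Im z ^+ 2 != 0.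
  have : 0 < Im z ^+ 2 by rewrite exprn_even_gt0.
  by move=> h; rewrite gt_eqF// ltr_wpDl// sqr_ge0.
have : (pi : R) != 0 by rewrite gt_eqF// pi_gt0.
have : `|Im z| != 0 by rewrite normr_eq0.
move: `|Im z| (pi : R) d0; move: (_ + _) => D b p D0 b0 p0.
by field; rewrite D0 b0 p0.
Qed.

Lemma cmeas_kz z : cmeasurable setT (kz z).
Proof.
by apply: cmeas_inv; apply: cmeas_sub; [apply: cmeas_real|exact: cmeas_cst].
Qed.

Lemma kz_L2 z : Im z != 0 -> L2 setT (kz z) /\ rint (fun t => cmod (kz z t) ^+ 2) = pi / `|Im z|.
Proof.
move=> z0; have b0 : 0 < `|Im z| by rewrite normr_gt0.
have [ip p1] := pk_int (Re z) b0.
have e : (fun t => cmod (kz z t) ^+ 2) = (fun t => pi / `|Im z| * pk (Re z) `|Im z| t).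
  by apply/funext => t; exact: kz_pk.
split; last by rewrite e rintZ// p1 mulr1.
by apply/L2P; split; [exact: cmeas_kz|rewrite /sqint e; exact: rintegZ].
Qed.

Lemma kz_bound z t : Im z != 0 -> cmod (kz z t) <= `|Im z|^-1.
Proof.
move=> z0; rewrite cmodV lef_pV2 ?posrE ?normr_gt0//; last exact/cmod_gt0/kz_den.
by apply: le_trans (cmod_Im _); rewrite ImB ImC sub0r normrN.
Qed.

Lemma pk_kz x y t : 0 < y ->
  (pk x y t)%:C = (y / pi)%:C * kz (x +i* y) t * kz (x -i* y) t.
Proof.
move=> y0; rewrite -mulrA /kz -invfM.
have -> : (t%:C - (x +i* y)) * (t%:C - (x -i* y)) = ((t - x) ^+ 2 + y ^+ 2)%:C.
  by apply: complex_ext; rewrite ?ReM ?ImM ?ReB ?ImB ?ReC ?ImC /=; ring.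
rewrite -fmorphV -rmorphM; congr (_%:C).
by rewrite /pk invfM mulrA.
Qed.

(** The depth [3 / 4] is below all poles [x - i y] with [y < 1 / 2] and inside the strip
    [|Im z| < 1]. *)
Definition w0 : Cplx R := 0 -i* (3 / 4).

(* The auxiliary pole [w0] makes [f(t)/(t - w0)] integrable and is separated
   from the test points. *)
Lemma kz_total f : L2 setT f ->
  (forall z, 0 < `|Im z| < 1 -> cint (fun t => f t * kz z t) = 0) ->
  {ae mu, forall t, f t = 0}.
Proof.
move=> Lf h0.
have w00 : Im w0 != 0 by rewrite /= oppr_eq0 mulf_neq0 ?invr_eq0 ?pnatr_eq0.
have iE : cinteg (fun t => f t * kz w0 t) by apply: L2_prod => //; case: (kz_L2 w00).
suff : {ae mu, forall t, f t * kz w0 t = 0}.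
  move=> h; apply: (aeS h) => t /eqP; rewrite mulf_eq0 => /orP[/eqP//|].
  by rewrite invr_eq0 => /eqP d0; have := kz_den t w00; rewrite d0 eqxx.
apply: poisson_unique => // x y /andP[y0 y1].
pose z : Cplx R := x +i* y; pose z' : Cplx R := x -i* y.
have zi : Im z != 0 by rewrite /= gt_eqF.
have z'i : Im z' != 0 by rewrite /= oppr_eq0 gt_eqF.
have zz' : z - z' != 0.
  by apply/eqP => /(congr1 (@Im R)); rewrite ImB /=; lra.
have zw : z - w0 != 0.
  by apply/eqP => /(congr1 (@Im R)); rewrite ImB /=; lra.
have z'w : z' - w0 != 0.
  by apply/eqP => /(congr1 (@Im R)); rewrite ImB /=; lra.
pose c : Cplx R := (y / pi)%:C.
(* Partial fractions: the Poisson kernel has the poles [z] and [z'], and together with [w0] the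
   integrand splits into three Cauchy kernels, each covered by [h0]. *)
pose a1 := c / ((z - z') * (z - w0)).
pose a2 := - (c / ((z - z') * (z' - w0))).
pose a3 := c / ((z - w0) * (z' - w0)).
have i1 : cinteg (fun t => f t * kz z t) by apply: L2_prod => //; case: (kz_L2 zi).
have i2 : cinteg (fun t => f t * kz z' t) by apply: L2_prod => //; case: (kz_L2 z'i).
have -> : poisson (fun t => f t * kz w0 t) x y =
  cint (fun t => a1 * (f t * kz z t) + a2 * (f t * kz z' t) + a3 * (f t * kz w0 t)).
  congr cint; apply/funext => t; rewrite pk_kz// -/z -/z' -/c.
  have := kz_den t zi; have := kz_den t z'i; have := kz_den t w00.
  rewrite /a1 /a2 /a3 /kz; move: zz' zw z'w.
  move: (z) (z') (w0) (c) (f t) (t%:C : Cplx R) => z1 z2 w c' ft s d1 d2 d3 d4 d5 d6.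
  by field; rewrite d1 d2 d3 d4 d5 d6.
rewrite (cintD (cintegD (cintegZ a1 i1) (cintegZ a2 i2)) (cintegZ a3 iE)).
rewrite (cintD (cintegZ a1 i1) (cintegZ a2 i2)) !cintZ//.
rewrite !h0 ?mulr0 ?addr0//=.
- by rewrite normrN ger0_norm; lra.
- by rewrite normrN gtr0_norm//; lra.
- by rewrite gtr0_norm//; lra.
Qed.

End CauchyKernel.

(** * Reflections and exponential integrals over the half-line *)

Section HalfLineIntegrals.
Context {R : realType}.
Local Notation mu := (@lebesgue_measure R).
Implicit Types (x y t : R) (f g : R -> Cplx R).

Lemma rint_refl (u : R -> R) : rinteg u -> rinteg (fun x => u (- x)) /\ rint (fun x => u (- x)) = rint u.
Proof.
move=> iu; have mu_ := rinteg_meas iu.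
have mN : measurable_fun setT (fun x => u (- x)).
  by apply: (measurableT_comp mu_); exact: measurable_oppr.
have E (w : R -> R) : measurable_fun setT w -> (forall x, 0 <= w x) ->
    (\int[mu]_x (w (- x))%:E = \int[mu]_x (w x)%:E)%E.
  move=> mw w0.
  rewrite -[LHS](@ge0_integral_pushforward _ _ (measurableTypeR R) (measurableTypeR R) R -%R
    measurable_oppr mu setT (fun x => (w x)%:E))//; last first.
  - by move=> x _; rewrite lee_fin.
  - exact/measurable_EFinP.
  by apply: eq_measure_integral => //= A mA AS; exact: lebesgue_measureN.
have iN : rinteg (fun x => u (- x)).
  apply/integrableP; split; first exact/measurable_EFinP.
  rewrite (E (fun x => `|u x|)) => [|//|//].
    by move/integrableP: iu => [].
  by apply: measurableT_comp.
split=> //.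
have nn := rintegD (rinteg_norm iu) iu.
have nn' := rintegD (rinteg_norm iN) iN.
have E1 : rint (fun x => `|u (- x)| + u (- x)) = rint (fun x => `|u x| + u x).
  rewrite /rint /Rintegral (E (fun x => `|u x| + u x))//; first exact: rinteg_meas nn.
  by move=> x; have := ler_norm (- u x); rewrite normrN; lra.
have E2 : rint (fun x => `|u (- x)|) = rint (fun x => `|u x|).
  by rewrite /rint /Rintegral (E (fun x => `|u x|))//; apply: measurableT_comp.
move: E1; rewrite (rintD (rinteg_norm iu) iu) (rintD (rinteg_norm iN) iN) E2; lra.
Qed.

Lemma cint_refl f : cinteg f -> cinteg (fun x => f (- x)) /\ cint (fun x => f (- x)) = cint f.
Proof.
move=> hf; have [mf /rint_refl[i _]] := hf.
split; first by split=> //; exact: cmeas_refl.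
apply: complex_ext => /=.
  by have [] := rint_refl (cinteg_Re hf).
by have [] := rint_refl (cinteg_Im hf).
Qed.

Lemma half_FTC (f F : R -> R) (l : R) : (forall x, 0 <= f x) -> continuous f ->
  (forall x : R, is_derive x (1 : R) F (f x)) -> F x @[x --> +oo] --> l ->
  rinteg (fun x => \1_Rplus x * f x) /\ rint (fun x => \1_Rplus x * f x) = l - F 0.
Proof.
move=> f0 cf dF Fl.
have mRp : measurable (@Rplus R) by exact: measurable_itv.
have mf := continuous_measurable_fun cf.
have E : (\int[mu]_x (\1_Rplus x * f x)%:E = (l - F 0)%:E)%E.
  rewrite EFinB -(@ge0_continuous_FTC2y R f F 0 l)//.
  - rewrite -integral_itv_obnd_cbnd; last exact/measurable_EFinP/measurable_funTS.
    rewrite [RHS]integral_mkcond; apply: eq_integral => x _; rewrite patchE indicE /Rplus.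
    by case: ifPn => _; rewrite ?mul1r ?mul0r.
  - by apply: continuous_subspaceT.
  - apply/cvg_at_right_filter; apply: differentiable_continuous; apply/derivable1_diffP; exact: ex_derive.
  - by move=> x _; rewrite derive1E derive_val.
have i : rinteg (fun x => \1_Rplus x * f x).
  apply/rinteg_ge0P; last by rewrite E ltry.
    by apply: measurable_funM => //; exact: measurable_indic.
  by move=> x; rewrite mulr_ge0// indicE ler0n.
by split=> //; rewrite /rint /Rintegral E.
Qed.

Lemma expR_cvg0 (b : R) : 0 < b -> expR (- (b * x)) @[x --> +oo] --> 0.
Proof.
move=> b0; rewrite (_ : (fun x => expR (- (b * x))) = (fun z => expR (- z)) \o (fun z => b * z))//.
apply: (@cvg_comp _ _ _ _ _ _ (pinfty_nbhs R)); last exact: cvgr_expR.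
exact: gt0_cvgMry.
Qed.

(** The summand 1 makes the integrand nonnegative, as [half_FTC] requires; [ft_hexp] subtracts the
    case [p = q = 0] again. *)
Lemma laplace_trig (b c p q : R) : 0 < b -> (forall t, 0 <= 1 + p * cos t + q * sin t) ->
  let u t := \1_Rplus t * (expR (- (b * t)) * (1 + p * cos (c * t) + q * sin (c * t))) in
  rinteg u /\ rint u = b^-1 + (p * b + q * c) / (b ^+ 2 + c ^+ 2).
Proof.
move=> b0 h0.
pose D : R := b ^+ 2 + c ^+ 2.
have D0 : 0 < D by rewrite ltr_wpDr ?sqr_ge0// exprn_gt0.
pose G t : R := - b^-1 + (p * (c * sin (c * t) - b * cos (c * t)) - q * (b * sin (c * t) + c * cos (c * t))) / D.
pose F t : R := expR (- (b * t)) * G t.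
have dc (x : R) : is_derive x (1 : R) (fun t => c * t) c.
  by apply: is_derive_eq; rewrite /GRing.scale /= mulr1.
have db (x : R) : is_derive x (1 : R) (fun t => - (b * t)) (- b).
  by apply: is_derive_eq; rewrite /GRing.scale /= mulr1.
have de (x : R) : is_derive x (1 : R) (fun t => expR (- (b * t))) (- b * expR (- (b * x))).
  by have := @is_derive1_comp R expR (fun t => - (b * t)) x _ _ (is_derive_expR _) (db x); rewrite mulrC.
have ds (x : R) : is_derive x (1 : R) (fun t => sin (c * t)) (c * cos (c * x)).
  by have := @is_derive1_comp R sin (fun t => c * t) x _ _ (is_derive_sin _) (dc x); rewrite mulrC.
have dcos (x : R) : is_derive x (1 : R) (fun t => cos (c * t)) (- (c * sin (c * x))).
  by have := @is_derive1_comp R cos (fun t => c * t) x _ _ (is_derive_cos _) (dc x); rewrite mulrC mulrN.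
have dF (x : R) : is_derive x (1 : R) F (expR (- (b * x)) * (1 + p * cos (c * x) + q * sin (c * x))).
  rewrite /F /G; apply: is_derive_eq; rewrite /GRing.scale /=.
  move: (sin (c * x)) (cos (c * x)) (expR _) => s co ee.
  rewrite /D in D0 *; field; rewrite !gt_eqF//.
have GK : exists K, forall t, `|G t| <= K.
  exists (`|b^-1| + (`|p| * (`|c| + `|b|) + `|q| * (`|b| + `|c|)) * `|D^-1|) => t.
  have s1 : `|sin (c * t)| <= 1 by rewrite ler_norml sin_geN1 sin_le1.
  have c1 : `|cos (c * t)| <= 1 by rewrite ler_norml cos_geN1 cos_le1.
  rewrite /G (le_trans (ler_normD _ _))// normrN lerD2l normrM ler_wpM2r//.
  rewrite (le_trans (ler_normB _ _))// lerD// normrM ler_wpM2l//.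
    by rewrite (le_trans (ler_normB _ _))// lerD// normrM ler_piMr.
  by rewrite (le_trans (ler_normD _ _))// lerD// normrM ler_piMr.
have F0 : F x @[x --> +oo] --> 0.
  have [K hK] := GK; apply: norm_cvg0.
  apply: (@squeeze_cvgr _ _ _ _ (fun=> 0) (fun x => expR (- (b * x)) * K)).
  - near=> x; rewrite normr_ge0 /= /F normrM ger0_norm ?expR_ge0//.
    by rewrite ler_wpM2l ?expR_ge0.
  - exact: cvg_cst.
  - by rewrite -(mul0r K); apply: cvgM; [exact: expR_cvg0|exact: cvg_cst].
have cont : continuous (fun x : R => expR (- (b * x)) * (1 + p * cos (c * x) + q * sin (c * x))).
  move=> x; apply: differentiable_continuous; apply/derivable1_diffP; exact: ex_derive.
have [|i e] := half_FTC _ cont dF F0.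
  by move=> x; rewrite mulr_ge0 ?expR_ge0.
split=> //; rewrite e sub0r /F /G !mulr0 oppr0 expR0 sin0 cos0 mul1r /D.
by rewrite /D in D0; field; rewrite !gt_eqF.
Unshelve. all: by end_near. Qed.

End HalfLineIntegrals.

(** * The Fourier transformation *)

Section Fourier.
Context {R : realType}.
Local Notation mu := (@lebesgue_measure R).
Implicit Types (x y t : R) (f g : R -> Cplx R).

Lemma cmod_expi t : cmod (expi t) = 1.
Proof.
apply/eqP; rewrite -(@eqrXn2 _ 2) ?cmod_ge0// sqr_cmod /= cos2Dsin2 expr1n//.
Qed.
Lemma expiD s t : expi (s + t) = expi s * expi t :> Cplx R.
Proof. by apply: complex_ext; rewrite ?ReM ?ImM /= ?cosD ?sinD; ring. Qed.
Lemma expiJ t : cj (expi t) = expi (- t) :> Cplx R.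
Proof. by apply: complex_ext; rewrite ?ReJ ?ImJ /= ?cosN ?sinN. Qed.

Lemma cmeas_expi x : cmeasurable setT (fun t => expi (x * t)).
Proof.
by split => /=; (apply: measurableT_comp; last exact: measurable_funM);
  apply: continuous_measurable_fun; [exact: continuous_cos|exact: continuous_sin].
Qed.

Lemma cmeas_expi2 :
  measurable_fun setT (fun p : R * R => Re (expi (p.1 * p.2))) /\
  measurable_fun setT (fun p : R * R => Im (expi (p.1 * p.2))).
Proof.
have m : measurable_fun setT (fun p : R * R => p.1 * p.2).
  by apply: measurable_funM; [exact: measurable_fst|exact: measurable_snd].
by split => /=; (apply: (measurableT_comp _ m));
  apply: continuous_measurable_fun; [exact: continuous_cos|exact: continuous_sin].
Qed.

Lemma measurable_ReM2 d (T : measurableType d) (u v : T -> Cplx R) :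
  measurable_fun setT (fun p => Re (u p)) -> measurable_fun setT (fun p => Im (u p)) ->
  measurable_fun setT (fun p => Re (v p)) -> measurable_fun setT (fun p => Im (v p)) ->
  measurable_fun setT (fun p => Re (u p * v p)) /\ measurable_fun setT (fun p => Im (u p * v p)).
Proof.
move=> u1 u2 v1 v2; split.
  by under eq_fun do rewrite ReM; apply: measurable_funB; exact: measurable_funM.
by under eq_fun do rewrite ImM; apply: measurable_funD; exact: measurable_funM.
Qed.

Lemma measurable_fst_c f : cmeasurable setT f ->
  measurable_fun setT (fun p : R * R => Re (f p.1)) /\
  measurable_fun setT (fun p : R * R => Im (f p.1)).
Proof.
move=> [m1 m2]; split; [apply: (measurableT_comp m1)|apply: (measurableT_comp m2)]; exact: measurable_fst.
Qed.
Lemma measurable_snd_c f : cmeasurable setT f ->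
  measurable_fun setT (fun p : R * R => Re (f p.2)) /\
  measurable_fun setT (fun p : R * R => Im (f p.2)).
Proof.
move=> [m1 m2]; split; [apply: (measurableT_comp m1)|apply: (measurableT_comp m2)]; exact: measurable_snd.
Qed.

Definition ft f x : Cplx R := cint (fun t => expi (x * t) * f t).

Lemma ft_integ f x : cinteg f -> cinteg (fun t => expi (x * t) * f t).
Proof.
move=> [mf hf]; apply: cinteg_le hf _; first by apply: cmeas_mul => //; exact: cmeas_expi.
by move=> t; rewrite cmodM cmod_expi mul1r.
Qed.

(** The multiplication formula, on which Plancherel's inequality and the adjoint of the
    transformation both rest. *)
Lemma ft_fubini f g : cinteg f -> cinteg g ->
  [/\ cinteg (fun x => ft f x * g x), cinteg (fun t => f t * ft g t) &
    cint (fun x => ft f x * g x) = cint (fun t => f t * ft g t)].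
Proof.
move=> hf hg; have [mf if_] := hf; have [mg ig] := hg.
pose k x t : Cplx R := expi (x * t) * (g x * f t).
have [e1 e2] := cmeas_expi2.
have [g1 g2] := measurable_fst_c mg.
have [f1 f2] := measurable_snd_c mf.
have [h1 h2] := measurable_ReM2 g1 g2 f1 f2.
have [k1 k2] := measurable_ReM2 e1 e2 h1 h2.
have kb x t : cmod (k x t) <= cmod (g x) * cmod (f t) by rewrite /k !cmodM cmod_expi mul1r.
have [kx kt i1 i2 e] := @cfubini R k _ _ k1 k2 ig if_ kb.
have E1 : (fun x => cint (k x)) = (fun x => ft f x * g x).
  apply/funext => x; rewrite mulrC /ft -(cintZ _ (ft_integ x hf)).
  by congr cint; apply/funext => t; rewrite /k mulrCA.
have E2 : (fun t => cint (k^~ t)) = (fun t => f t * ft g t).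
  apply/funext => t; rewrite /ft -(cintZ _ (ft_integ t hg)).
  congr cint; apply/funext => x; rewrite /k (mulrC x t).
  by move: (expi _) (g x) (f t) => a b c; ring.
by rewrite -E1 -E2; split.
Qed.

(** [ft f] times a positive integrable function is measurable by Fubini's theorem; the factor, here
    a Poisson kernel, is divided out. *)
Lemma ft_meas f : cinteg f -> cmeasurable setT (ft f).
Proof.
move=> hf; have [ip _] := pk_int 0 (@ltr01 R).
have hp : cinteg (fun t => (pk 0 1 t)%:C).
  apply: cinteg_le ip _; first by apply: cmeas_real; exact: pk_meas.
  by move=> t; rewrite cmodC ger0_norm// pk_ge0.
have [[m _] _ _] := ft_fubini hf hp.
apply: (cmeas_ext _ (cmeas_mul m (cmeas_inv hp.1))) => x /=.
rewrite mulfK//; apply/eqP => /(congr1 (@Re R)) /= /eqP.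
by rewrite gt_eqF// divr_gt0// mulr_gt0 ?pi_gt0// pk_den.
Qed.

Definition hexp (b : R) t : R := \1_Rplus t * expR (- (b * t)).

Lemma hexp_meas b : measurable_fun setT (hexp b).
Proof.
apply: measurable_funM; first by apply: measurable_indic; exact: measurable_itv.
apply: measurableT_comp; first exact: measurable_expR.
by apply: measurableT_comp => //; exact: measurable_funM.
Qed.

Lemma hexp_ge0 b t : 0 <= hexp b t.
Proof. by rewrite mulr_ge0 ?expR_ge0// indicE ler0n. Qed.

Lemma hexp_int b : 0 < b -> rinteg (hexp b) /\ rint (hexp b) = b^-1.
Proof.
move=> b0; have [|] := @laplace_trig R b 0 0 0 b0.
  by move=> t; rewrite !mul0r !addr0.
rewrite !mul0r !addr0 mul0r addr0.
under eq_fun do rewrite !mul0r !addr0 mulr1.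
by move=> i e; split.
Qed.

Lemma ft_hexp b c : 0 < b -> cinteg (fun t => (hexp b t)%:C) /\
  ft (fun t => (hexp b t)%:C) c = (b -i* c)^-1.
Proof.
move=> b0; have [i1 e1] := hexp_int b0.
have ih : cinteg (fun t => (hexp b t)%:C).
  apply: cinteg_le i1 _; first by apply: cmeas_real; exact: hexp_meas.
  by move=> t; rewrite cmodC ger0_norm// hexp_ge0.
split=> //.
have [|i2 e2] := @laplace_trig R b c 1 0 b0.
  by move=> t; have := cos_geN1 t; lra.
have [|i3 e3] := @laplace_trig R b c 0 1 b0.
  by move=> t; have := sin_geN1 t; lra.
have D0 : 0 < b ^+ 2 + c ^+ 2 by rewrite ltr_wpDr ?sqr_ge0// exprn_gt0.
have ifc := ft_integ c ih.
have r1 : rint (fun t => Re (expi (c * t) * (hexp b t)%:C)) = b / (b ^+ 2 + c ^+ 2).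
  have E : (fun t : R => \1_Rplus t * (expR (- (b * t)) * (1 + 1 * cos (c * t) + 0 * sin (c * t)))) =
     (fun t => Re (expi (c * t) * (hexp b t)%:C) + hexp b t).
    by apply/funext => t; rewrite ReM ReC ImC /hexp /=; ring.
  move: e2; rewrite E (rintD (cinteg_Re ifc) i1) e1; lra.
have r2 : rint (fun t => Im (expi (c * t) * (hexp b t)%:C)) = c / (b ^+ 2 + c ^+ 2).
  have E : (fun t : R => \1_Rplus t * (expR (- (b * t)) * (1 + 0 * cos (c * t) + 1 * sin (c * t)))) =
     (fun t => Im (expi (c * t) * (hexp b t)%:C) + hexp b t).
    by apply/funext => t; rewrite ImM ReC ImC /hexp /=; ring.
  move: e3; rewrite E (rintD (cinteg_Im ifc) i1) e1; lra.
have -> : ft (fun t => (hexp b t)%:C) c = (b / (b ^+ 2 + c ^+ 2)) +i* (c / (b ^+ 2 + c ^+ 2)).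
  by apply: complex_ext; [exact: r1|exact: r2].
have n0 : (b -i* c : Cplx R) != 0 by apply/eqP => /(congr1 (@Re R)) /=; lra.
apply: (mulIf n0); rewrite mulVf//.
by apply: complex_ext; rewrite ?ReM ?ImM /=; field; rewrite gt_eqF.
Qed.

End Fourier.

(** * Plancherel's inequality for truncated functions *)

Section Plancherel.
Context {R : realType}.
Local Notation mu := (@lebesgue_measure R).
Implicit Types (x y t : R) (f g : R -> Cplx R).

Lemma rinteg_monotone (U : nat -> R -> R) (u : R -> R) (C : R) : (forall m, rinteg (U m)) ->
  (forall m x, 0 <= U m x) -> (forall x m n, (m <= n)%N -> U m x <= U n x) ->
  (forall x, U m x @[m --> \oo] --> u x) -> measurable_fun setT u ->
  (forall m, rint (U m) <= C) -> rinteg u /\ rint u <= C.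
Proof.
move=> iU U0 ndU Uu mu_ hC.
have u0 x : 0 <= u x.
  rewrite -(cvg_lim (@Rhausdorff R) (Uu x)); apply: limr_ge; last by apply: nearW => m; exact: U0.
  by apply/cvg_ex; exists (u x); exact: Uu.
have hlim : (\int[mu]_x (U m x)%:E @[m --> \oo] --> \int[mu]_x (u x)%:E)%E.
  have := @cvg_monotone_convergence _ _ R mu setT measurableT (fun m x => (U m x)%:E).
  have -> : (fun x => limn (fun m => (U m x)%:E)) = EFin \o u.
    by apply/funext => x; apply/cvg_lim => //; apply: cvg_EFin; [exact: nearW|exact: Uu].
  apply.
  - by move=> m; apply/measurable_EFinP; exact: rinteg_meas.
  - by move=> m x _; rewrite lee_fin.
  - by move=> x _ m n mn; rewrite lee_fin; exact: ndU.
have le : (\int[mu]_x (u x)%:E <= C%:E)%E.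
  rewrite -(cvg_lim _ hlim)//; apply: lime_le; first by apply/cvg_ex; eexists; exact: hlim.
  by apply: nearW => m; rewrite rint_EFin// lee_fin.
have iu : rinteg u by apply/rinteg_ge0P => //; apply: le_lt_trans le _; exact: ltry.
by split=> //; move: le; rewrite rint_EFin// lee_fin.
Qed.

Lemma ae_neq (a : R) : {ae mu, forall x, x != a}.
Proof.
exists [set a]; split; [exact: measurable_set1|exact: lebesgue_measure_set1|].
by move=> x /=; case: eqVneq => // h /(_ isT).
Qed.

(** The Abel weight, whose transform is [2 pi] times the Poisson kernel of height [e]. *)
Definition wexp (e : R) x : R := expR (- (e * `|x|)).

Lemma wexp_ae e : {ae mu, forall x, wexp e x = hexp e x + hexp e (- x)}.
Proof.
apply: (aeS (ae_neq 0)) => x; rewrite neq_lt /wexp /hexp /Rplus => /orP[x0|x0].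
  rewrite !indicE [x \in _]memNset ?mem_set//= ?in_itv/= ?andbT; last 2 first.
  - by rewrite oppr_gt0.
  - by apply/negP; rewrite -leNgt ltW.
  by rewrite mul0r add0r mul1r ltr0_norm.
rewrite !indicE [- x \in _]memNset ?mem_set//= ?in_itv/= ?andbT; last 2 first.
- by [].
- by apply/negP; rewrite -leNgt oppr_le0 ltW.
by rewrite mul0r addr0 mul1r gtr0_norm.
Qed.

Lemma wexp_meas e : measurable_fun setT (wexp e).
Proof.
apply: measurableT_comp; first exact: measurable_expR.
by apply: measurableT_comp => //; apply: measurable_funM.
Qed.

Lemma wexp_ge0 e x : 0 <= wexp e x.
Proof. exact: expR_ge0. Qed.

Lemma wexp_int e : 0 < e -> rinteg (wexp e).
Proof.
move=> e0; have [i _] := hexp_int e0; have [i' _] := rint_refl i.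
apply: eq_ae_rinteg (rintegD i i'); first exact: wexp_meas.
by apply: (aeS (wexp_ae e)) => x ->.
Qed.

Lemma ft_refl f x : cinteg f -> ft (fun t => f (- t)) x = ft f (- x).
Proof.
move=> hf; rewrite /ft; have [_ <-] := cint_refl (ft_integ (- x) hf).
by congr cint; apply/funext => t; rewrite mulrNN.
Qed.

Lemma ft_ae f g x : cmeasurable setT f -> cmeasurable setT g -> {ae mu, forall t, f t = g t} ->
  ft f x = ft g x.
Proof.
move=> mf mg h; apply: eq_ae_cint; try by apply: cmeas_mul => //; exact: cmeas_expi.
by apply: (aeS h) => t ->.
Qed.

Lemma ftD f g x : cinteg f -> cinteg g -> ft (fun t => f t + g t) x = ft f x + ft g x.
Proof.
move=> hf hg; rewrite /ft -cintD; [|exact: ft_integ|exact: ft_integ].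
by congr cint; apply/funext => t; rewrite mulrDr.
Qed.

Lemma ftZ a f x : cinteg f -> ft (fun t => a * f t) x = a * ft f x.
Proof.
move=> hf; rewrite /ft -cintZ; last exact: ft_integ.
by congr cint; apply/funext => t; rewrite mulrCA.
Qed.

Lemma wexp_cinteg e : 0 < e -> cinteg (fun t => (wexp e t)%:C).
Proof.
move=> e0; apply: cinteg_le (wexp_int e0) _; first by apply: cmeas_real; exact: wexp_meas.
by move=> t; rewrite cmodC ger0_norm// wexp_ge0.
Qed.

Lemma ft_wexp e t : 0 < e -> ft (fun t => (wexp e t)%:C) t = (2 * pi * pk 0 e t)%:C.
Proof.
move=> e0; have [ih he] := ft_hexp t e0; have [_ he'] := ft_hexp (- t) e0.
have [ih' _] := cint_refl ih.
have -> : ft (fun t => (wexp e t)%:C) t = ft (fun t => (hexp e t)%:C + (hexp e (- t))%:C) t.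
  apply: ft_ae; [by case: (wexp_cinteg e0)|by case: (cintegD ih ih')|].
  by apply: (aeS (wexp_ae e)) => x ->; rewrite rmorphD.
rewrite (ftD _ ih ih') (ft_refl _ ih) he he'.
have n1 : (e -i* t : Cplx R) != 0 by apply/eqP => /(congr1 (@Re R)) /=; lra.
have n2 : (e -i* - t : Cplx R) != 0 by apply/eqP => /(congr1 (@Re R)) /=; lra.
have D0 : t ^+ 2 + e ^+ 2 != 0 by rewrite gt_eqF// ltr_wpDl ?sqr_ge0// exprn_gt0.
have -> : 2 * pi * pk 0 e t = 2 * e / (t ^+ 2 + e ^+ 2).
  have p0 : (pi : R) != 0 by rewrite gt_eqF ?pi_gt0.
  by rewrite /pk subr0; move: (pi : R) p0 => p p0; field; rewrite D0 p0.
apply: (mulIf n1); apply: (mulIf n2); rewrite mulrDl mulVf// mulrDl mul1r mulrAC mulVf// mul1r.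
by apply: complex_ext; rewrite ?ReM ?ImM ?ReD ?ImD /= ?ReM ?ImM /=; field.
Qed.

Lemma pk_shift e s t : pk 0 e (s + t) = pk (- t) e s.
Proof. by rewrite /pk subr0 opprK. Qed.

Local Opaque pk.

Lemma pk_shift_int e t : 0 < e ->
  rinteg (fun s => pk 0 e (s + t)) /\ rint (fun s => pk 0 e (s + t)) = 1.
Proof.
move=> e0; rewrite (_ : (fun s => _) = pk (- t) e); first exact: pk_int.
by apply/funext => s; exact: pk_shift.
Qed.

Lemma rinteg_pkM (w : R -> R) (e t : R) : 0 < e -> rinteg w -> rinteg (fun s => w s * pk 0 e (s + t)).
Proof.
move=> e0 iw; have mw := rinteg_meas iw.
have mp : measurable_fun setT (fun s : R => pk 0 e (s + t)).
  by apply: (measurableT_comp (pk_meas 0 e0)); exact: measurable_funD.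
apply: rinteg_le (rintegZ (pi * e)^-1 (rinteg_norm iw)); first exact: measurable_funM.
move=> s; rewrite normrM mulrC; apply: ler_wpM2r => //.
by rewrite ger0_norm; [exact: pk_bound|exact: pk_ge0].
Qed.

Lemma pk_double (w1 w2 : R -> R) (e : R) : 0 < e -> rinteg w1 -> rinteg w2 ->
  (forall t, 0 <= w1 t) -> (forall t, 0 <= w2 t) ->
  [/\ (forall t, rinteg (fun s => w1 t * w2 s * pk 0 e (s + t))),
      rinteg (fun t => rint (fun s => w1 t * w2 s * pk 0 e (s + t))),
      rinteg (fun s => rint (fun t => w1 t * w2 s * pk 0 e (s + t))) &
    rint (fun t => rint (fun s => w1 t * w2 s * pk 0 e (s + t))) =
    rint (fun s => rint (fun t => w1 t * w2 s * pk 0 e (s + t)))].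
Proof.
move=> e0 i1 i2 p1 p2.
have mw1 := rinteg_meas i1; have mw2 := rinteg_meas i2.
have mp : measurable_fun setT (fun p : R * R => pk 0 e (p.2 + p.1)).
  apply: (measurableT_comp (pk_meas 0 e0)); apply: measurable_funD.
    exact: measurable_snd.
  exact: measurable_fst.
pose k (p : R * R) : R := w1 p.1 * w2 p.2 * pk 0 e (p.2 + p.1).
have mk : measurable_fun setT k.
  apply: measurable_funM; last exact: mp.
  apply: measurable_funM.
    by apply: (measurableT_comp mw1); exact: measurable_fst.
  by apply: (measurableT_comp mw2); exact: measurable_snd.
have hk x t : `|k (x, t)| <= w1 x * ((pi * e)^-1 * w2 t).
  rewrite normrM /=; have := pk_bound 0 (t + x) e0; have := pk_ge0 0 (t + x) e0.
  move: (pk 0 e (t + x)) => P P0 hP.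
  rewrite (ger0_norm P0) ger0_norm; last exact: mulr_ge0.
  by rewrite -mulrA; apply: ler_wpM2l => //; rewrite mulrC; apply: ler_wpM2r.
have hk' t x : `|k (x, t)| <= ((pi * e)^-1 * w2 t) * w1 x by rewrite mulrC; exact: hk.
have i2' := rintegZ (pi * e)^-1 i2.
have mk' := measurableT_comp mk (@measurable_swap _ _ R R).
have [ix _] := rfubini_prod mk i1 i2' hk.
split; first exact: ix.
- exact: (rfubini_integ mk i1 i2' hk).
- exact: (rfubini_integ mk' i2' i1 hk').
- exact: (rfubini mk i1 i2' hk).
Qed.

(** Schur's test: [u(t) v(s)] is at most the mean of the two squares, and the Poisson kernel has
    integral 1 in either variable. The supports in [[-n, n]] allow the factor [\1_A] in the other
    variable, which Fubini's theorem needs. *)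
Lemma schur_pk (u v : R -> R) (n : nat) (e : R) : 0 < e ->
  measurable_fun setT u -> measurable_fun setT v ->
  rinteg (fun t => u t ^+ 2) -> rinteg (fun t => v t ^+ 2) ->
  (forall t, 0 <= u t) -> (forall t, 0 <= v t) ->
  (forall t, u t = \1_(`[- n%:R, n%:R]%classic) t * u t) ->
  (forall t, v t = \1_(`[- n%:R, n%:R]%classic) t * v t) ->
  rinteg (fun t => u t * rint (fun s => v s * pk 0 e (s + t))) /\
  rint (fun t => u t * rint (fun s => v s * pk 0 e (s + t))) <=
    (rint (fun t => u t ^+ 2) + rint (fun t => v t ^+ 2)) / 2.
Proof.
move=> e0 mu_ mv iu iv u0 v0 hu hv.
set A := `[- n%:R, n%:R]%classic in hu hv.
have iA : rinteg (\1_A) by exact: rinteg_indic_itv.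
have A0 t : 0 <= (\1_A t : R) by rewrite indicE ler0n.
have A1 t : (\1_A t : R) <= 1 by rewrite indicE lern1 leq_b1.
have L1 (w : R -> R) : measurable_fun setT w -> rinteg (fun t => w t ^+ 2) -> (forall t, 0 <= w t) ->
    (forall t, w t = \1_A t * w t) -> rinteg w.
  move=> mw iw w0 hw; apply: rinteg_le (rintegD iA iw) => // t.
  rewrite ger0_norm// {1}hw indicE; case: (_ \in _) => /=; last by rewrite mul0r add0r sqr_ge0.
  by have := sqr_ge0 (w t - 1); nra.
have iu1 := L1 u mu_ iu u0 hu; have iv1 := L1 v mv iv v0 hv.
have s2 (w : R -> R) t : 0 <= w t ^+ 2 by exact: sqr_ge0.
have E : (fun t => u t * rint (fun s => v s * pk 0 e (s + t))) =
    (fun t => rint (fun s => u t * v s * pk 0 e (s + t))).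
  apply/funext => t; rewrite -rintZ; last exact: rinteg_pkM.
  by congr rint; apply/funext => s; rewrite mulrA.
rewrite E {E}.
have [a1 a2 _ _] := pk_double e0 iu1 iv1 u0 v0.
split; first exact: a2.
have [b1 b2 _ _] := pk_double e0 iu iA (s2 u) A0.
have [d1 d2 d4 d3] := pk_double e0 iA iv A0 (s2 v).
have bi : rint (fun t => rint (fun s => u t ^+ 2 * \1_A s * pk 0 e (s + t))) <= rint (fun t => u t ^+ 2).
  apply: rint_le; [exact: b2|exact: iu|] => t; have [i1 i2] := pk_shift_int t e0.
  rewrite -[leRHS]mulr1 -i2 -(rintZ _ i1); apply: rint_le; [exact: b1|exact: rintegZ|] => s.
  rewrite -mulrA; apply: ler_wpM2l; first exact: sqr_ge0.
  by apply: ler_piMl; [exact: pk_ge0|exact: A1].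
have di : rint (fun t => rint (fun s => \1_A t * v s ^+ 2 * pk 0 e (s + t))) <= rint (fun t => v t ^+ 2).
  rewrite d3; apply: rint_le; [exact: d4|exact: iv|] => s; have [i1 i2] := pk_shift_int s e0.
  rewrite -[leRHS]mulr1 -i2 -(rintZ _ i1).
  have -> : (fun t => \1_A t * v s ^+ 2 * pk 0 e (s + t)) = fun t => v s ^+ 2 * (\1_A t * pk 0 e (t + s)).
    apply/funext => t; rewrite (addrC s); move: (pk 0 e _) (v s) (\1_A t) => p1 p2 p3; ring.
  apply: rint_le; [by apply: rintegZ; exact: rinteg_pkM|exact: rintegZ|] => t.
  apply: ler_wpM2l; first exact: sqr_ge0.
  by apply: ler_piMl; [exact: pk_ge0|exact: A1].
apply: (@le_trans _ _ (2^-1 * rint (fun t => rint (fun s => u t ^+ 2 * \1_A s * pk 0 e (s + t)) +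
   rint (fun s => \1_A t * v s ^+ 2 * pk 0 e (s + t))))); last first.
  rewrite (rintD b2 d2) mulrC; apply: ler_wpM2r; last exact: lerD.
  by rewrite invr_ge0 ler0n.
rewrite -(rintZ _ (rintegD b2 d2)).
apply: rint_le; [exact: a2|exact: (rintegZ _ (rintegD b2 d2))|] => t.
rewrite -(rintD (b1 t) (d1 t)) -(rintZ _ (rintegD (b1 t) (d1 t))).
apply: rint_le; [exact: a1|exact: (rintegZ _ (rintegD (b1 t) (d1 t)))|] => s.
clear a1 a2 b1 b2 d1 d2 d3 d4 bi di.
rewrite -mulrDl mulrA; apply: ler_wpM2r; first exact: pk_ge0.
rewrite [u t * v s](_ : _ = (\1_A t * u t) * (\1_A s * v s)); last by rewrite -hu -hv.
rewrite !indicE; case: (t \in A); case: (s \in A); rewrite /= ?mul1r ?mul0r ?mulr0 ?mulr1 ?addr0 ?add0r.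
- by have := sqr_ge0 (u t - v s); nra.
- by rewrite mulr_ge0 ?sqr_ge0.
- by rewrite mulr_ge0 ?sqr_ge0.
- by [].
Qed.

Definition trunc (n : nat) f t : Cplx R := (\1_(`[- n%:R, n%:R]%classic) t)%:C * f t.

Lemma trunc_meas n f : cmeasurable setT f -> cmeasurable setT (trunc n f).
Proof.
move=> mf; apply: cmeas_mul => //; apply: cmeas_real; apply: measurable_indic; exact: measurable_itv.
Qed.

Lemma cmod_trunc n f t : cmod (trunc n f t) = \1_(`[- n%:R, n%:R]%classic) t * cmod (f t).
Proof. by rewrite cmodM cmodC ger0_norm// indicE ler0n. Qed.

Lemma cmod_trunc_le n f t : cmod (trunc n f t) <= cmod (f t).
Proof. by rewrite cmod_trunc ler_piMl ?cmod_ge0// indicE lern1 leq_b1. Qed.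

Lemma trunc_L2 n f : L2 setT f -> L2 setT (trunc n f).
Proof.
move=> Lf; apply: L2_le (L2_sq Lf) _; first exact/trunc_meas/L2_meas.
by move=> t; apply: sqr_mono; [exact: cmod_ge0|exact: cmod_trunc_le].
Qed.

Lemma trunc_integ n f : L2 setT f -> cinteg (trunc n f).
Proof.
move=> Lf; apply: L2_prod => //.
apply: L2_le (rinteg_indic_itv n) _.
  by apply: cmeas_real; apply: measurable_indic; exact: measurable_itv.
by move=> t; rewrite cmodC indicE; case: (_ \in _); rewrite /= ?normr1 ?normr0 ?expr1n ?expr0n.
Qed.

Lemma rint_trunc_sq n f : L2 setT f ->
  rint (fun t => cmod (trunc n f t) ^+ 2) <= rint (fun t => cmod (f t) ^+ 2).
Proof.
move=> Lf; apply: rint_le; [exact/L2_sq/trunc_L2|exact: L2_sq|] => t.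
by apply: sqr_mono; [exact: cmod_ge0|exact: cmod_trunc_le].
Qed.

Lemma indic_sym n t : \1_(`[- n%:R, n%:R]%classic) (- t) = \1_(`[- n%:R, n%:R]%classic) t :> R.
Proof.
rewrite !indicE; congr (_%:R); congr nat_of_bool; apply/idP/idP; rewrite !inE /= !in_itv /=;
  move=> /andP[h1 h2]; apply/andP; split; lra.
Qed.

(** The multiplication formula rewrites the weighted integral of [|ft g|^2] as a double integral of
    [g(t)] and [conj g(-s)] against a Poisson kernel, where Schur's test gives a bound independent
    of [e]. *)
Lemma plancherel_weight f (n : nat) (e : R) : L2 setT f -> 0 < e ->
  rinteg (fun x => cmod (ft (trunc n f) x) ^+ 2 * wexp e x) /\
  rint (fun x => cmod (ft (trunc n f) x) ^+ 2 * wexp e x) <=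
    2 * pi * rint (fun t => cmod (trunc n f t) ^+ 2).
Proof.
move=> Lf e0; set g := trunc n f.
have Lg : L2 setT g by exact: trunc_L2.
have ig : cinteg g by exact: trunc_integ.
have [mg ng] := ig.
(* The function whose transform is the conjugate of [ft g]. *)
pose g' s := cj (g (- s)).
have ig' : cinteg g' by have [i _] := cint_refl ig; exact: cintegJ.
have wi := wexp_cinteg e0.
pose h x : Cplx R := ft g' x * (wexp e x)%:C.
have [ih _ _] := ft_fubini ig' wi; rewrite -/h in ih.
have hg' x : cj (ft g x) = ft g' x.
  rewrite (@ft_refl (fun t => cj (g t))); last exact: cintegJ.
  rewrite /ft -(cintJ (ft_integ x ig)); congr cint; apply/funext => t.
  by rewrite JM expiJ mulNr.
have [F1 F2 F3] := ft_fubini ig ih.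
have E1 : (fun x => ft g x * h x) = (fun x => (cmod (ft g x) ^+ 2 * wexp e x)%:C).
  by apply/funext => x; rewrite /h -hg' mulrA [ft g x * _]mulcJ -rmorphM.
rewrite E1 in F1 F3.
have fth t : ft h t = cint (fun s => g' s * (2 * pi * pk 0 e (s + t))%:C).
  pose G x : Cplx R := expi (t * x) * (wexp e x)%:C.
  have iG : cinteg G by exact: ft_integ.
  have [_ _ e1] := ft_fubini ig' iG.
  transitivity (cint (fun x => ft g' x * G x)).
    congr cint; apply/funext => x; rewrite /h /G.
    by move: (expi _) (ft g' x) (wexp e x)%:C => p1 p2 p3; ring.
  rewrite e1; congr cint; apply/funext => s; congr (_ * _).
  rewrite -ft_wexp// /ft; congr cint; apply/funext => x; rewrite /G mulrA -expiD.
  by congr (expi _ * _); ring.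
pose v s := cmod (g (- s)); pose u t := cmod (g t).
have iu : rinteg (fun t => u t ^+ 2) by exact: L2_sq.
have [iv ev] := rint_refl iu.
have [mu_ mv] : measurable_fun setT u /\ measurable_fun setT v.
  by split; [exact: measurable_cmod|exact: (measurable_cmod (cmeas_refl mg))].
have hu t : u t = \1_(`[- n%:R, n%:R]%classic) t * u t.
  by rewrite /u cmod_trunc indicE; case: (_ \in _); rewrite /= ?mul1r ?mul0r ?mulr0.
have hv t : v t = \1_(`[- n%:R, n%:R]%classic) t * v t by rewrite -indic_sym; exact: hu.
have [S1 S2] := schur_pk e0 mu_ mv iu iv (fun=> cmod_ge0 _) (fun=> cmod_ge0 _) hu hv.
have iv1 : rinteg v by case: ig' => _; under eq_fun do rewrite cmodJ.
have fhb t : cmod (ft h t) <= 2 * pi * rint (fun s => v s * pk 0 e (s + t)).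
  rewrite fth -rintZ; last exact: rinteg_pkM.
  have [|||_ ->//] := @cmod_cint_le R (fun s => g' s * (2 * pi * pk 0 e (s + t))%:C)
     (fun s => 2 * pi * (v s * pk 0 e (s + t))).
  - apply: cmeas_mul; first by case: ig'.
    apply: cmeas_real; apply: measurable_funM; first exact: measurable_cst.
    by apply: (measurableT_comp (pk_meas 0 e0)); exact: measurable_funD.
  - by apply: rintegZ; exact: rinteg_pkM.
  apply: aeA => s; rewrite cmodM cmodJ cmodC ger0_norm.
    rewrite -/(v s) le_eqVlt; apply/orP; left; apply/eqP.
    by move: (pk 0 e _) (v s) (pi : R) => p1 p2 p3; ring.
  by apply: mulr_ge0; [rewrite mulr_ge0 ?pi_ge0|exact: pk_ge0].
split.
  apply: rinteg_le F1.2.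
    apply: measurable_funM; last exact: wexp_meas.
    by apply: measurable_funX; exact: (measurable_cmod (ft_meas ig)).
  by move=> x; rewrite cmodC.
have R1 : rint (fun x => cmod (ft g x) ^+ 2 * wexp e x) = Re (cint (fun x => (cmod (ft g x) ^+ 2 * wexp e x)%:C)) by [].
rewrite R1 F3; apply: le_trans (Re_le_cmod _) _; apply: le_trans (cmod_cint F2) _.
apply: (@le_trans _ _ (rint (fun t => 2 * pi * (u t * rint (fun s => v s * pk 0 e (s + t)))))).
  apply: rint_le; [exact: F2.2|exact: rintegZ|] => t.
  by rewrite cmodM mulrCA; apply: ler_wpM2l; [exact: cmod_ge0|exact: fhb].
rewrite (rintZ _ S1); apply: ler_wpM2l; first by rewrite mulr_ge0 ?pi_ge0.
have ev' : rint (fun t => v t ^+ 2) = rint (fun t => u t ^+ 2) by exact: ev.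
apply: le_trans S2 _; rewrite ev' -[leRHS]/(rint (fun t => u t ^+ 2)).
move: (rint _) => r; lra.
Qed.

(** The weights increase to 1 as [e] decreases to 0, so monotone convergence removes them. *)
Lemma plancherel_trunc f (n : nat) : L2 setT f -> L2 setT (ft (trunc n f)) /\
  rint (fun x => cmod (ft (trunc n f) x) ^+ 2) <= 2 * pi * rint (fun t => cmod (trunc n f t) ^+ 2).
Proof.
move=> Lf; have mg := ft_meas (trunc_integ n Lf).
set g := ft (trunc n f) in mg *.
have e0 m : 0 < (m.+1%:R^-1 : R) by rewrite invr_gt0 ltr0n.
have [||||||i le] := @rinteg_monotone (fun m x => cmod (g x) ^+ 2 * wexp m.+1%:R^-1 x)
   (fun x => cmod (g x) ^+ 2) (2 * pi * rint (fun t => cmod (trunc n f t) ^+ 2)).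
- by move=> m; have [] := plancherel_weight n Lf (e0 m).
- by move=> m x; rewrite mulr_ge0 ?sqr_ge0 ?wexp_ge0.
- move=> x m k mk; apply: ler_wpM2l; first exact: sqr_ge0.
  rewrite /wexp ler_expR lerN2; apply: ler_wpM2r => //.
  by rewrite lef_pV2 ?posrE ?ltr0n// ler_nat.
- move=> x; rewrite -[X in _ --> X]mulr1; apply: cvgM; first exact: cvg_cst.
  rewrite -[X in _ --> X]expR0 /wexp; apply: continuous_cvg; first exact: continuous_expR.
  rewrite -[X in _ --> X]oppr0; apply: cvgN; rewrite -[X in _ --> X](mul0r `|x|).
  apply: cvgM; last exact: cvg_cst.
  exact: cvg_harmonic.
- by apply: measurable_funX; exact: measurable_cmod.
- by move=> m; have [] := plancherel_weight n Lf (e0 m).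
by split=> //; apply/L2P.
Qed.

Lemma trunc_cvg f : L2 setT f -> rint (fun t => cmod (f t - trunc n f t) ^+ 2) @[n --> \oo] --> 0.
Proof.
move=> Lf; have mf := L2_meas Lf; rewrite -(@rint0 R).
apply: (@dominated_rint R (fun n t => cmod (f t - trunc n f t) ^+ 2) _ (fun t => cmod (f t) ^+ 2)).
- by move=> n; apply: measurable_funX; apply: measurable_cmod; apply: cmeas_sub => //; exact: trunc_meas.
- exact: measurable_cst.
- exact: L2_sq.
- apply: aeA => t; apply/cvgr_eps => e e0; exists (Num.truncn `|t|).+1 => n hn.
  have -> : trunc n f t = f t.
    rewrite /trunc indicE mem_set ?mul1r//= in_itv /= -ler_norml.
    by apply: ltW; apply: lt_le_trans (truncnS_gt _) _; rewrite ler_nat.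
  by rewrite subrr cmod0 expr0n subr0 normr0.
- move=> n; apply: aeA => t; rewrite ger0_norm ?sqr_ge0//; apply: sqr_mono; first exact: cmod_ge0.
  rewrite /trunc indicE; case: (_ \in _) => /=; first by rewrite mul1r subrr cmod0 cmod_ge0.
  by rewrite mul0r subr0.
Qed.

Lemma trunc_fourierE f n x : trunc_fourier f n x = ft (trunc n f) x.
Proof.
rewrite /trunc_fourier /ft /cint /cintegral; apply: complex_ext => /=;
  rewrite Rintegral_mkcond; congr Rintegral; apply/funext => t; rewrite patchE /trunc indicE;
  by case: (_ \in _); rewrite /= ?mul1r ?mul0r ?mulr0.
Qed.

End Plancherel.

(** * Limits in a Hilbert space *)

Section HilbertLimits.
Context {R : realType} {H : hilbert R}.
Implicit Types (x y : H) (u v : nat -> H).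

Lemma hcvg_lin u v x y (a : R[i]) : hcvg u x -> hcvg v y -> hcvg (fun n => a *: u n + v n) (a *: x + y).
Proof.
move=> hu hv e e0; have c0 : 0 < cmod a + 1 by have := cmod_ge0 a; lra.
have [N1 h1] := hu (e / (2 * (cmod a + 1))) (ltac:(by rewrite divr_gt0// mulr_gt0)).
have [N2 h2] := hv (e / 2) (ltac:(by rewrite divr_gt0)).
exists (maxn N1 N2) => n; rewrite geq_max => /andP[/h1 {}h1 /h2 {}h2].
have -> : a *: u n + v n - (a *: x + y) = a *: (u n - x) + (v n - y) by hring.
apply: le_lt_trans (nrmD _ _) _; rewrite nrmZ.
have : cmod a * nrm (u n - x) <= (cmod a + 1) * (e / (2 * (cmod a + 1))).
  by apply: ler_pM; rewrite ?cmod_ge0 ?nrm_ge0 ?lerDl// ltW.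
rewrite (_ : (cmod a + 1) * _ = e / 2); last by field; rewrite gt_eqF.
lra.
Qed.

Lemma hcvg_cst x : hcvg (fun=> x) x.
Proof. by move=> e e0; exists 0%N => n _; rewrite subrr nrm0. Qed.

Lemma hcvg_ext u v x : (exists N, forall n, (N <= n)%N -> u n = v n) -> hcvg u x -> hcvg v x.
Proof.
move=> [N hN] hu e e0; have [N' hN'] := hu e e0; exists (maxn N N') => n.
by rewrite geq_max => /andP[/hN <- /hN'].
Qed.

Lemma hcvg_nrm u x : hcvg u x -> forall C : R, (forall n, nrm (u n) <= C) -> nrm x <= C.
Proof.
move=> hu C hC; apply/ler_addgt0Pr => e e0; have [N hN] := hu e e0.
have := hN N (leqnn _); have := hC N; have := nrmB_ge x (u N); rewrite nrmB; lra.
Qed.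

Lemma hcvg_dot u v x y y0 z0 : hcvg u x -> hcvg v y ->
  (forall n, dot (u n) y0 = dot (v n) z0) -> dot x y0 = dot y z0.
Proof.
move=> hu hv h.
apply/eqP; rewrite -subr_eq0; apply/eqP; apply: cmod_eq0; apply/eqP; rewrite eq_le cmod_ge0 andbT.
apply/ler_addgt0Pr => e e0; rewrite add0r.
have c1 : 0 < nrm y0 + 1 by have := nrm_ge0 y0; lra.
have c2 : 0 < nrm z0 + 1 by have := nrm_ge0 z0; lra.
have [N1 h1] := hu (e / (2 * (nrm y0 + 1))) (ltac:(by rewrite divr_gt0// mulr_gt0)).
have [N2 h2] := hv (e / (2 * (nrm z0 + 1))) (ltac:(by rewrite divr_gt0// mulr_gt0)).
have {h1}h1 := h1 _ (leq_maxl N1 N2); have {h2}h2 := h2 _ (leq_maxr N1 N2).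
set n := maxn N1 N2 in h1 h2.
have -> : dot x y0 - dot y z0 = dot (v n - y) z0 - dot (u n - x) y0.
  by rewrite !dotBl h; ring.
apply: le_trans (cmodD _ _) _; rewrite cmodN.
have := cauchy_schwarz (v n - y) z0; have := cauchy_schwarz (u n - x) y0.
have : nrm (u n - x) * nrm y0 <= e / (2 * (nrm y0 + 1)) * (nrm y0 + 1).
  by apply: ler_pM; rewrite ?nrm_ge0 ?lerDl// ltW.
have : nrm (v n - y) * nrm z0 <= e / (2 * (nrm z0 + 1)) * (nrm z0 + 1).
  by apply: ler_pM; rewrite ?nrm_ge0 ?lerDl// ltW.
rewrite (_ : e / (2 * (nrm z0 + 1)) * (nrm z0 + 1) = e / 2); last by field; rewrite gt_eqF.
rewrite (_ : e / (2 * (nrm y0 + 1)) * (nrm y0 + 1) = e / 2); last by field; rewrite gt_eqF.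
lra.
Qed.

Lemma hcvg_dotr u v x y y0 z0 : hcvg u x -> hcvg v y ->
  (forall n, dot y0 (u n) = dot z0 (v n)) -> dot y0 x = dot z0 y.
Proof.
move=> hu hv h; rewrite dotJ (dotJ y); congr cj.
by apply: (hcvg_dot hu hv) => n; rewrite dotJ h -dotJ.
Qed.

(* A contraction is isometric at [e] only if [e] is fixed by [V' V]. *)
Lemma contraction_fixed (V V' : H -> H) (c : R) e : adjoint V V' -> 0 <= c ->
  (forall x, nrm (V' x) ^+ 2 <= c * nrm x ^+ 2) -> nrm (V e) ^+ 2 = c * nrm e ^+ 2 ->
  V' (V e) = c%:C *: e.
Proof.
move=> adj c0 hc he; apply/eqP; rewrite -subr_eq0; apply/eqP/nrm_eq0/eqP.
rewrite -sqrf_eq0 eq_le sqr_ge0 andbT sqr_nrmB nrmZ cmodC ger0_norm// dotZr JC.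
have -> : dot (V' (V e)) e = (nrm (V e) ^+ 2)%:C.
  by rewrite -dotxx (adjoint_sym adj).
rewrite -rmorphM /= he exprMn; have := hc (V e); rewrite he; lra.
Qed.

End HilbertLimits.

(* The concrete space [L2H] is sealed behind an opaque constant: otherwise
   unification unfolds its operations. *)
Record l2model (R : realType) := L2Model {
  mspace : hilbert R;
  mrep : mspace -> R -> Cplx R;
  mvec : (R -> Cplx R) -> mspace;
  mrep_L2 : forall x, L2 setT (mrep x);
  mrep_vec : forall f, L2 setT f -> {ae @lebesgue_measure R, forall t, mrep (mvec f) t = f t};
  mvec_ext : forall f g, L2 setT f -> L2 setT g -> {ae @lebesgue_measure R, forall t, f t = g t} ->
    mvec f = mvec g;
  mvec_rep : forall x, mvec (mrep x) = x;
  mvec_lin : forall (a : R[i]) f g, L2 setT f -> L2 setT g ->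
    mvec (fun t => a * f t + g t) = a *: mvec f + mvec g;
  mdot_rep : forall x y, dot x y = cint (fun t => mrep x t * cj (mrep y t)) }.

Lemma l2model_exists (R : realType) : l2model R.
Proof.
apply: (@L2Model R (@L2H R) (@fn R) (@cls R)).
- exact: fn_L2.
- exact: fn_cls.
- exact: cls_ext.
- exact: cls_fn.
- move=> a f g Lf Lg; apply: cls_eq; first by apply: L2D => //; exact: L2Z.
  apply: (aeS2 (aeI (fn_add (a *: cls f) (cls g)) (fn_scale a (cls f))) (aeI (fn_cls Lf) (fn_cls Lg))).
  by move=> t [-> ->] [-> ->].
- reflexivity.
Qed.

(** * Vectors of L^2 and their representatives *)

Section L2Interface.
Context {R : realType}.
Local Notation mu := (@lebesgue_measure R).

Definition L2S : hilbert R := mspace (l2model_exists R).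
Implicit Types (x y : L2S) (f g : R -> Cplx R).

Definition rep x : R -> Cplx R := mrep x.
Definition vec f : L2S := mvec _ f.

Lemma rep_L2 x : L2 setT (rep x).
Proof. exact: mrep_L2. Qed.
Lemma rep_meas x : cmeasurable setT (rep x).
Proof. by case: (rep_L2 x). Qed.
Lemma rep_vec f : L2 setT f -> {ae mu, forall t, rep (vec f) t = f t}.
Proof. exact: mrep_vec. Qed.
Lemma vec_ext f g : L2 setT f -> L2 setT g -> {ae mu, forall t, f t = g t} -> vec f = vec g.
Proof. exact: mvec_ext. Qed.
Lemma vec_rep x : vec (rep x) = x.
Proof. exact: mvec_rep. Qed.
Lemma L2_ext x y : {ae mu, forall t, rep x t = rep y t} -> x = y.
Proof.
move=> h; rewrite -(vec_rep x) -(vec_rep y); apply: vec_ext h; exact: rep_L2.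
Qed.
Lemma vec_lin (a : R[i]) f g : L2 setT f -> L2 setT g ->
  vec (fun t => a * f t + g t) = a *: vec f + vec g.
Proof. exact: mvec_lin. Qed.

Lemma rep_lin (a : R[i]) x y : {ae mu, forall t, rep (a *: x + y) t = a * rep x t + rep y t}.
Proof.
have Lx := rep_L2 x; have Ly := rep_L2 y.
rewrite -[in X in rep X](vec_rep x) -[in X in rep X](vec_rep y) -vec_lin//.
by apply: rep_vec; apply: L2D => //; exact: L2Z.
Qed.

Lemma dot_rep x y : dot x y = cint (fun t => rep x t * cj (rep y t)).
Proof. exact: mdot_rep. Qed.

Lemma dot_vec f g : L2 setT f -> L2 setT g -> dot (vec f) (vec g) = cint (fun t => f t * cj (g t)).
Proof.
move=> Lf Lg; rewrite dot_rep; apply: eq_ae_cint.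
- by case: (L2_prodJ (rep_L2 (vec f)) (rep_L2 (vec g))).
- by case: (L2_prodJ Lf Lg).
- by apply: (aeS2 (rep_vec Lf) (rep_vec Lg)) => t -> ->.
Qed.

End L2Interface.
Arguments L2S : clear implicits.

(** * The Fourier transformation as an operator on L^2 *)

Section FourierOperator.
Context {R : realType}.
Local Notation mu := (@lebesgue_measure R).
Local Notation H := (L2S R).
Implicit Types (x y : L2S R) (f g : R -> Cplx R) (n m : nat).

Lemma nrm_vec f : L2 setT f -> nrm (vec f) ^+ 2 = rint (fun t => cmod (f t) ^+ 2).
Proof.
move=> Lf; rewrite sqr_nrm dot_vec// -[LHS]/(rint _); congr rint.
by apply/funext => t; rewrite mulcJ.
Qed.

Lemma nrm_rep x : nrm x ^+ 2 = rint (fun t => cmod (rep x t) ^+ 2).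
Proof. by rewrite -[in LHS](vec_rep x) nrm_vec//; exact: rep_L2. Qed.

Lemma vec0 : vec (fun=> 0) = 0 :> H.
Proof.
have := vec_lin (-1) (@L2_0 R) (@L2_0 R); rewrite (_ : -1 *: vec _ + vec _ = 0 :> H); last by hring.
by move=> <-; congr vec; apply/funext => t; rewrite mulr0 addr0.
Qed.

Lemma vecZ (a : R[i]) f : L2 setT f -> vec (fun t => a * f t) = a *: vec f.
Proof.
move=> Lf; have := vec_lin a Lf (@L2_0 R); rewrite vec0 addr0 => <-.
by congr vec; apply/funext => t; rewrite addr0.
Qed.

Lemma vecD f g : L2 setT f -> L2 setT g -> vec (fun t => f t + g t) = vec f + vec g.
Proof.
move=> Lf Lg; have := vec_lin 1 Lf Lg; rewrite scale1r => <-.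
by congr vec; apply/funext => t; rewrite mul1r.
Qed.

Lemma vecN f : L2 setT f -> vec (fun t => - f t) = - vec f.
Proof.
move=> Lf; rewrite -scaleN1r -vecZ//; congr vec; apply/funext => t; by rewrite mulN1r.
Qed.

Lemma vec_sub f g : L2 setT f -> L2 setT g -> vec (fun t => f t - g t) = vec f - vec g.
Proof.
move=> Lf Lg; have := vec_lin (-1) Lg Lf.
rewrite (_ : -1 *: vec g + vec f = vec f - vec g); last by hring.
by move=> <-; congr vec; apply/funext => t; rewrite mulN1r addrC.
Qed.

(** Multiplication, conjugation and reflection are locked, so that unification does not unfold them
    to representatives. *)
Definition mulf : (R -> Cplx R) -> H -> H := locked (fun g x => vec (fun t => g t * rep x t)).
Definition conjf : H -> H := locked (fun x => vec (fun t => cj (rep x t))).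
Definition reflf : H -> H := locked (fun x => vec (reflection (rep x))).

Lemma mulfE g x : mulf g x = vec (fun t => g t * rep x t).
Proof. by rewrite /mulf -lock. Qed.
Lemma conjfE x : conjf x = vec (fun t => cj (rep x t)).
Proof. by rewrite /conjf -lock. Qed.
Lemma reflfE x : reflf x = vec (reflection (rep x)).
Proof. by rewrite /reflf -lock. Qed.

Lemma conjf_vec f : L2 setT f -> conjf (vec f) = vec (fun t => cj (f t)).
Proof.
move=> Lf; rewrite conjfE; apply: vec_ext; [exact/L2J/rep_L2|exact: L2J|].
by apply: (aeS (rep_vec Lf)) => t ->.
Qed.

Lemma conjfK x : conjf (conjf x) = x.
Proof.
rewrite (conjfE x) conjf_vec; last exact/L2J/rep_L2.
by rewrite (_ : (fun t => _) = rep x) ?vec_rep//; apply/funext => t; rewrite JK.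
Qed.

Lemma nrm_conjf x : nrm (conjf x) = nrm x.
Proof.
apply/eqP; rewrite -(@eqrXn2 _ 2) ?nrm_ge0// [nrm x ^+ 2]nrm_rep conjfE nrm_vec; last exact/L2J/rep_L2.
by apply/eqP; congr rint; apply/funext => t; rewrite cmodJ.
Qed.

Lemma dot_conjf x y : dot (conjf x) (conjf y) = dot y x.
Proof.
rewrite !conjfE dot_vec; [|exact/L2J/rep_L2|exact/L2J/rep_L2].
by rewrite dot_rep; congr cint; apply/funext => t; rewrite JK mulrC.
Qed.

Lemma conjf_semilin (a : R[i]) x y : conjf (a *: x + y) = cj a *: conjf x + conjf y.
Proof.
apply: eq_dot => z; rewrite -(conjfK z) dotDl dotZl !dot_conjf dotDr dotZr.
by [].
Qed.

Lemma conjfB x y : conjf (x - y) = conjf x - conjf y.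
Proof.
have := conjf_semilin (-1) y x; rewrite (_ : -1 *: y + x = x - y); last by hring.
by rewrite JN J1 => ->; hring.
Qed.

Lemma ae_refl (P : R -> Prop) : {ae mu, forall t, P t} -> {ae mu, forall t, P (- t)}.
Proof.
move=> [N [mN N0 hN]]; exists (-%R @^-1` N); split.
- by rewrite -[X in measurable X]setTI; exact: measurable_oppr.
- by have := lebesgue_measureN mN; rewrite N0.
- by move=> x /= h; exact: hN.
Qed.

Lemma L2_refl f : L2 setT f -> L2 setT (reflection f) /\
  rint (fun t => cmod (reflection f t) ^+ 2) = rint (fun t => cmod (f t) ^+ 2).
Proof.
move=> /L2P[mf hf]; have [i e] := rint_refl hf; split=> //.
by apply/L2P; split=> //; exact: cmeas_refl.
Qed.

Lemma reflf_vec f : L2 setT f -> reflf (vec f) = vec (reflection f).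
Proof.
move=> Lf; rewrite reflfE; apply: vec_ext; [by have [] := L2_refl (rep_L2 (vec f))|by have [] := L2_refl Lf|].
by apply: (aeS (ae_refl (rep_vec Lf))) => t; rewrite /reflection => ->.
Qed.

Lemma reflfK x : reflf (reflf x) = x.
Proof.
rewrite (reflfE x) reflf_vec; last by have [] := L2_refl (rep_L2 x).
rewrite (_ : reflection _ = rep x) ?vec_rep//.
by apply/funext => t; rewrite /reflection opprK.
Qed.

Lemma reflf_adj x y : dot (reflf x) y = dot x (reflf y).
Proof.
have [Lx _] := L2_refl (rep_L2 x); have [Ly _] := L2_refl (rep_L2 y).
rewrite !reflfE -[in LHS](vec_rep y) -[in RHS](vec_rep x) !dot_vec//; try exact: rep_L2.
have [_ <-] := cint_refl (L2_prodJ (rep_L2 x) Ly).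
by congr cint; apply/funext => t; rewrite /reflection opprK.
Qed.

Lemma reflf_lin : linop reflf.
Proof. by apply: (@adjoint_lin _ _ _ reflf) => x y; exact: reflf_adj. Qed.

Lemma nrm_reflf x : nrm (reflf x) = nrm x.
Proof.
apply/eqP; rewrite -(@eqrXn2 _ 2) ?nrm_ge0// !sqr_nrm reflf_adj reflfK//.
Qed.

Definition truncf n x : H := vec (trunc n (rep x)).
Definition fourn n x : H := vec (ft (trunc n (rep x))).

Lemma truncf_cvg x : hcvg (fun n => truncf n x) x.
Proof.
move=> e e0; have e2 : 0 < e ^+ 2 by rewrite exprn_gt0.
have [N hN] := (iffLR (cvgr_eps _ _) (trunc_cvg (rep_L2 x))) _ e2; exists N => n /hN.
rewrite subr0 ger0_norm; last by apply: rint_ge0 => t; exact: sqr_ge0.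
rewrite -(nrm_vec (L2B (rep_L2 x) (trunc_L2 n (rep_L2 x)))) vec_sub; [|exact: rep_L2|exact/trunc_L2/rep_L2].
by rewrite vec_rep ltr_pXn2r// ?nnegrE ?nrm_ge0 ?ltW// nrmB.
Qed.

Lemma trunc_ae n f g : {ae mu, forall t, f t = g t} -> {ae mu, forall t, trunc n f t = trunc n g t}.
Proof. by move=> h; apply: (aeS h) => t; rewrite /trunc => ->. Qed.

Lemma fourn_vec n f : L2 setT f -> fourn n (vec f) = vec (ft (trunc n f)).
Proof.
move=> Lf; congr vec; apply/funext => x; apply: ft_ae.
- exact/trunc_meas/rep_meas.
- exact/trunc_meas/L2_meas.
- by apply: trunc_ae; exact: rep_vec.
Qed.

Lemma fourn_lin n : linop (fourn n).
Proof.
move=> a x y; have [Lx _] := plancherel_trunc n (rep_L2 x); have [Ly _] := plancherel_trunc n (rep_L2 y).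
have ix := trunc_integ n (rep_L2 x); have iy := trunc_integ n (rep_L2 y).
rewrite -[in LHS](vec_rep x) -[in LHS](vec_rep y) -vec_lin; [|exact: rep_L2|exact: rep_L2].
rewrite fourn_vec; last by apply: L2D; [exact/L2Z/rep_L2|exact: rep_L2].
rewrite -vec_lin//; congr vec; apply/funext => t.
rewrite -(ftZ _ _ ix) -ftD//; last exact: cintegZ.
by congr (ft _ t); apply/funext => s; rewrite /trunc; move: (rep x s) (rep y s) (_%:C) => p1 p2 p3; ring.
Qed.

Lemma fourn_le n x : nrm (fourn n x) ^+ 2 <= 2 * pi * nrm x ^+ 2.
Proof.
have [Lx hx] := plancherel_trunc n (rep_L2 x).
rewrite nrm_vec// nrm_rep; apply: le_trans hx _.
apply: ler_wpM2l; first by rewrite mulr_ge0 ?pi_ge0.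
exact/rint_trunc_sq/rep_L2.
Qed.

Lemma trunc_trunc n m f : (n <= m)%N -> trunc m (trunc n f) = trunc n f.
Proof.
move=> nm; apply/funext => t; rewrite /trunc mulrA -rmorphM; congr (_%:C * _).
rewrite !indicE; have [h|h] := boolP (t \in `[- n%:R, n%:R]%classic); last by rewrite mulr0.
rewrite mulr1 (_ : t \in _)//; move: h; rewrite !inE /= !in_itv/= -!ler_norml => /le_trans; apply.
by rewrite ler_nat.
Qed.

Lemma fourn_trunc n m x : (n <= m)%N -> fourn m (truncf n x) = fourn n x.
Proof.
by move=> nm; rewrite fourn_vec ?trunc_trunc//; exact/trunc_L2/rep_L2.
Qed.

Lemma sqr_le (a b c : R) : 0 <= c -> 0 <= a -> 0 <= b -> a ^+ 2 <= c * b ^+ 2 -> a <= Num.sqrt c * b.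
Proof.
move=> c0 a0 b0 h; rewrite -ler_sqr ?nnegrE ?mulr_ge0 ?sqrtr_ge0// exprMn sqr_sqrtr//.
Qed.

Lemma pi2_ge0 : 0 <= 2 * pi :> R.
Proof. by rewrite mulr_ge0 ?pi_ge0. Qed.

(** For [n >= N], the difference of [fourn n x] and [fourn N x] is [fourn n] of [x - truncf N x],
    and the bound for [fourn n] does not depend on [n]. *)
Lemma fourn_cauchy x : exists l, hcvg (fun n => fourn n x) l.
Proof.
apply: hcomplete_nrm => e e0.
pose c := Num.sqrt (2 * pi : R) + 1.
have c0 : 0 < c by have := sqrtr_ge0 (2 * pi : R); rewrite /c; lra.
have [N hN] := truncf_cvg x (ltac:(by rewrite divr_gt0// (mulr_gt0 _ c0)) : 0 < e / (2 * c)).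
have key n : (N <= n)%N -> nrm (fourn n x - fourn N x) < e / 2.
  move=> Nn; rewrite -(fourn_trunc _ Nn) -(linB (fourn_lin n)).
  have h1 := sqr_le pi2_ge0 (nrm_ge0 _) (nrm_ge0 _) (fourn_le n (x - truncf N x)).
  have h2 := hN N (leqnn _); rewrite nrmB in h2.
  apply: le_lt_trans h1 _; apply: (@le_lt_trans _ _ (c * nrm (x - truncf N x))).
    by apply: ler_wpM2r; [exact: nrm_ge0|rewrite /c lerDl].
  by rewrite -ltr_pdivlMl// (_ : c^-1 * (e / 2) = e / (2 * c))//; field; rewrite gt_eqF.
exists N => m n /key hm /key hn; apply: le_lt_trans (nrm_sub _ (fourn N x) _) _.
by rewrite [X in _ + X]nrmB; apply: lt_le_trans (ltrD hm hn) _; rewrite -splitr.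
Qed.

Definition four : H -> H := locked (fun x => xget 0 [set l | hcvg (fun n => fourn n x) l]).

Lemma four_cvg x : hcvg (fun n => fourn n x) (four x).
Proof.
rewrite /four -lock; case: xgetP => [//|h]; have [l hl] := fourn_cauchy x.
by case: (h l).
Qed.

Lemma four_lin : linop four.
Proof.
move=> a x y; apply: (@hcvg_unique _ _ (fun n => fourn n (a *: x + y))); first exact: four_cvg.
apply: hcvg_ext (hcvg_lin a (four_cvg x) (four_cvg y)).
by exists 0%N => n _; rewrite fourn_lin.
Qed.

Lemma four_le x : nrm (four x) <= Num.sqrt (2 * pi) * nrm x.
Proof.
apply: (hcvg_nrm (four_cvg x)) => n.
exact: sqr_le pi2_ge0 (nrm_ge0 _) (nrm_ge0 _) (fourn_le n x).
Qed.

Lemma four_trunc n x : four (truncf n x) = fourn n x.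
Proof.
apply: (hcvg_unique (four_cvg (truncf n x))).
apply: hcvg_ext (hcvg_cst (fourn n x)).
by exists n => m nm; rewrite fourn_trunc.
Qed.

(** Conjugating the kernel [exp(i x t)] yields the adjoint, so no second transformation has to be
    constructed. *)
Definition four' x : H := conjf (four (conjf x)).

Lemma conjf_hcvg (u : nat -> H) x : hcvg u x -> hcvg (fun n => conjf (u n)) (conjf x).
Proof.
by move=> hu e /hu[N hN]; exists N => n /hN; rewrite -conjfB nrm_conjf.
Qed.

Lemma dot_fourn n m x y : dot (fourn n x) (truncf m y) = dot (truncf n x) (conjf (fourn m (conjf y))).
Proof.
have Lx := rep_L2 x; have Ly := rep_L2 y; have Lcy := L2J Ly.
have [L1 _] := plancherel_trunc n Lx; have [L2' _] := plancherel_trunc m Lcy.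
rewrite (conjfE y) [fourn m _]fourn_vec// [conjf (vec _)]conjf_vec//.
rewrite [fourn n x]/fourn dot_vec//; last exact: trunc_L2.
rewrite dot_vec; [|exact: trunc_L2|exact: L2J].
have [_ _ e] := ft_fubini (trunc_integ n Lx) (trunc_integ m Lcy).
transitivity (cint (fun t => ft (trunc n (rep x)) t * trunc m (fun s => cj (rep y s)) t)).
  by congr cint; apply/funext => t; rewrite /trunc JM JC.
by rewrite e; congr cint; apply/funext => t; rewrite JK.
Qed.

Lemma four_adj : adjoint four four'.
Proof.
move=> x y.
apply: (hcvg_dot (four_cvg x) (truncf_cvg x)) => n.
apply: (hcvg_dotr (truncf_cvg y) (conjf_hcvg (four_cvg (conjf y)))) => m.
exact: dot_fourn.
Qed.

(** The two sides agree when paired with truncated vectors, where the multiplication formula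
    applies, and these are dense. *)
Lemma four_L1 f : L2 setT f -> cinteg f -> L2 setT (ft f) -> four (vec f) = vec (ft f).
Proof.
move=> Lf if_ Lft; apply: eq_dot => y.
apply: (hcvg_dotr (truncf_cvg y) (truncf_cvg y)) => m.
have Lcy := L2J (rep_L2 y).
have [Lc _] := plancherel_trunc m Lcy.
rewrite four_adj /four' [RHS]dot_vec//; last exact/trunc_L2/rep_L2.
have -> : conjf (truncf m y) = truncf m (conjf y).
  rewrite conjf_vec; last exact/trunc_L2/rep_L2.
  rewrite conjfE; apply: vec_ext; [exact/L2J/trunc_L2/rep_L2|exact/trunc_L2/rep_L2|].
  by apply: (aeS (rep_vec Lcy)) => t; rewrite /trunc => ->; rewrite JM JC.
rewrite four_trunc (conjfE y) fourn_vec// conjf_vec// dot_vec//; last exact: L2J.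
have [_ _ e] := ft_fubini if_ (trunc_integ m Lcy).
transitivity (cint (fun t => f t * ft (trunc m (fun t => cj (rep y t))) t)).
  by congr cint; apply/funext => t; rewrite JK.
by rewrite -e; congr cint; apply/funext => t; rewrite /trunc JM JC.
Qed.

Lemma four_reflf x : four (reflf x) = reflf (four x).
Proof.
apply: (hcvg_unique (four_cvg (reflf x))).
apply: (@hcvg_ext _ _ (fun n => reflf (fourn n x))); last first.
  have rb : bop reflf.
    by split; [exact: reflf_lin|exists 1; split=> // z; rewrite nrm_reflf mul1r].
  exact: (bop_hcvg rb (four_cvg x)).
exists 0%N => n _.
have [Lr _] := L2_refl (rep_L2 x); have [L1 _] := plancherel_trunc n (rep_L2 x).
rewrite (reflfE x) fourn_vec; last exact: Lr.
rewrite [fourn n x]/fourn reflf_vec; last exact: L1.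
congr vec; apply/funext => t.
rewrite /reflection -ft_refl; last exact/trunc_integ/rep_L2.
by congr (ft _ t); apply/funext => s; rewrite /trunc indic_sym.
Qed.

End FourierOperator.

(** * Inversion of the Fourier transformation *)

Section FourierUnitary.
Context {R : realType}.
Local Notation mu := (@lebesgue_measure R).
Local Notation H := (L2S R).
Implicit Types (x y : L2S R) (f g : R -> Cplx R) (z : Cplx R).

Lemma four'_le x : nrm (four' x) ^+ 2 <= 2 * pi * nrm x ^+ 2.
Proof.
rewrite nrm_conjf -[in leRHS](nrm_conjf x) -[X in X * _ ^+ 2](sqr_sqrtr (@pi2_ge0 R)) -exprMn.
by apply: sqr_mono; [exact: nrm_ge0|exact: four_le].
Qed.

Definition kv z : H := vec (kz z).

Lemma cmod_i : cmod ('i%C : Cplx R) = 1.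
Proof.
by apply/eqP; rewrite -(@eqrXn2 _ 2) ?cmod_ge0// sqr_cmod /= expr0n add0r.
Qed.

Lemma kv_nrm z : Im z != 0 -> nrm (kv z) ^+ 2 = pi / `|Im z|.
Proof. by move=> z0; have [L e] := kz_L2 z0; rewrite nrm_vec. Qed.

Lemma dot_kv x z : Im z != 0 -> dot x (kv z) = cint (fun t => rep x t * kz (cj z) t).
Proof.
move=> z0; have [L _] := kz_L2 z0; rewrite -[in LHS](vec_rep x) dot_vec//; last exact: rep_L2.
by congr cint; apply/funext => t; rewrite kzJ.
Qed.

Lemma kv_total x : (forall z, 0 < `|Im z| < 1 -> dot x (kv z) = 0) -> x = 0.
Proof.
move=> h; rewrite -(vec_rep x).
rewrite -vec0; apply: vec_ext; [exact: rep_L2|exact: L2_0|].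
apply: kz_total; first exact: rep_L2.
move=> z hz; have z0 : Im (cj z) != 0.
  by rewrite ImJ oppr_eq0 -normr_gt0; case/andP: hz.
have := h (cj z); rewrite ImJ normrN hz => /(_ isT).
by rewrite dot_kv ?ImJ ?oppr_eq0 -?normr_gt0 ?JK//; case/andP: hz.
Qed.

(** The one-sided exponentials, whose transforms are the Cauchy kernels with poles in the lower
    half-plane, up to the factor [i]. *)
Definition ev (a b : R) : R -> Cplx R := fun t => (hexp b t)%:C * expi (- a * t).

Lemma ev_L2 a b : 0 < b -> [/\ L2 setT (ev a b), cinteg (ev a b) & nrm (vec (ev a b)) ^+ 2 = (2 * b)^-1].
Proof.
move=> b0; have b2 : 0 < 2 * b by rewrite mulr_gt0.
have [i1 _] := hexp_int b0; have [i2 e2] := hexp_int b2.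
have m : cmeasurable setT (ev a b).
  by apply: cmeas_mul; [apply: cmeas_real; exact: hexp_meas|exact: cmeas_expi].
have ce t : cmod (ev a b t) = hexp b t by rewrite cmodM cmod_expi mulr1 cmodC ger0_norm// hexp_ge0.
have sq : (fun t => cmod (ev a b t) ^+ 2) = hexp (2 * b).
  apply/funext => t; rewrite ce /hexp exprMn -expRM_natl indicE; congr (_ * _); last first.
    by congr expR; ring.
  by case: (_ \in _); rewrite /= ?expr1n ?expr0n.
have L : L2 setT (ev a b) by apply/L2P; split=> //; rewrite /sqint sq.
split=> //; last by rewrite nrm_vec// sq.
by apply: cinteg_le i1 _ => // t; rewrite ce.
Qed.

Lemma ft_ev a b t : 0 < b -> ft (ev a b) t = 'i%C * kz (a -i* b) t.
Proof.
move=> b0; have [_ e] := ft_hexp (t - a) b0.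
have -> : ft (ev a b) t = ft (fun s => (hexp b s)%:C) (t - a).
  congr cint; apply/funext => s; rewrite /ev mulrCA -expiD mulrC.
  by congr (expi _ * _); ring.
rewrite e /kz.
have n1 : (b -i* (t - a) : Cplx R) != 0 by apply/eqP => /(congr1 (@Re R)) /=; lra.
have n2 : (t%:C - (a -i* b) : Cplx R) != 0 by apply: kz_den; rewrite /= oppr_eq0 gt_eqF.
apply: (mulIf n1); apply: (mulIf n2); rewrite mulVf// mul1r mulrAC mulfVK//.
by apply: complex_ext; rewrite ?ReM ?ImM ?ReB ?ImB /=; ring.
Qed.

Lemma four_ev a b : 0 < b -> four (vec (ev a b)) = 'i%C *: kv (a -i* b).
Proof.
move=> b0; have [L i _] := ev_L2 a b0.
have z0 : Im (a -i* b : Cplx R) != 0 by rewrite /= oppr_eq0 gt_eqF.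
have [Lk _] := kz_L2 z0.
have E : ft (ev a b) = fun t => 'i%C * kz (a -i* b) t.
  by apply/funext => t; rewrite ft_ev.
by rewrite four_L1// E; [rewrite vecZ|exact: L2Z].
Qed.

Lemma reflf_kv z : Im z != 0 -> reflf (kv z) = - kv (- z).
Proof.
move=> z0; have z0' : Im (- z) != 0 by rewrite ImN oppr_eq0.
have [L _] := kz_L2 z0; have [L' _] := kz_L2 z0'.
rewrite /kv reflf_vec// -vecN//; congr vec; apply/funext => t; rewrite /reflection /kz.
have -> : ((- t)%:C - z : Cplx R) = - (t%:C - - z) by rewrite rmorphN opprD opprK addrC.
by rewrite invrN.
Qed.

(* [four] is [sqrt (2 pi)] times a contraction, which is isometric at the
   exponential that it maps to a multiple of [kv z]. *)
Lemma four_kv z : Im z != 0 -> four (four' (kv z)) = (2 * pi)%:C *: kv z.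
Proof.
suff key (e : H) (c : R[i]) : cmod c = 1 -> four e = c *: kv z -> nrm e ^+ 2 = (2 * `|Im z|)^-1 ->
    Im z != 0 -> four (four' (kv z)) = (2 * pi)%:C *: kv z.
  move=> z0; have [zn|zp|z00] := ltgtP (Im z) 0; last by rewrite z00 eqxx in z0.
    have b0 : 0 < - Im z by rewrite oppr_gt0.
    have [_ _ hn] := ev_L2 (Re z) b0.
    apply: (key (vec (ev (Re z) (- Im z))) 'i%C) => //.
    - exact: cmod_i.
    - by rewrite four_ev//; congr (_ *: kv _); apply: complex_ext => //=; rewrite opprK.
    - by rewrite hn ltr0_norm.
  have [_ _ hn] := ev_L2 (- Re z) zp.
  apply: (key (reflf (vec (ev (- Re z) (Im z)))) (- 'i%C)) => //.
  - by rewrite cmodN; exact: cmod_i.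
  - rewrite four_reflf four_ev// (linZ reflf_lin) reflf_kv/=; last by rewrite oppr_eq0.
    rewrite (_ : - (- Re z -i* Im z) = z); last by apply: complex_ext; rewrite ?ReN ?ImN /= opprK.
    by rewrite scalerN scaleNr.
  - by rewrite nrm_reflf hn gtr0_norm.
move=> cc he hn z0.
have pz : 0 < `|Im z| by rewrite normr_gt0.
have pi0 := pi_gt0 R.
have c0 : c != 0 by apply: cmod_gt0P; rewrite cc.
have c1 : four' (four e) = (2 * pi)%:C *: e.
  apply: (contraction_fixed four_adj (@pi2_ge0 R) four'_le).
  rewrite he nrmZ cc mul1r hn kv_nrm//.
  by move: (pi : R) `|Im z| pz => p b b0; field; rewrite gt_eqF.
have hk : kv z = c^-1 *: four e by rewrite he scalerA mulVf// scale1r.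
have lin' : linop (@four' R) by apply: (adjoint_lin (adjoint_sym four_adj)).
rewrite hk (linZ lin') (linZ four_lin) c1 (linZ four_lin) [LHS]scalerA [RHS]scalerA.
by rewrite [c^-1 * _]mulrC.
Qed.

(** The operator on the left is self-adjoint and acts as [2 pi] on the kernels [kv z], which are
    total. *)
Lemma four4' x : four (four' x) = (2 * pi)%:C *: x.
Proof.
apply/eqP; rewrite -subr_eq0; apply/eqP/kv_total => z /andP[z0 _].
have {}z0 : Im z != 0 by rewrite -normr_gt0.
rewrite dotBl four_adj (adjoint_sym four_adj) four_kv// dotZl dotZr JC.
by rewrite subrr.
Qed.

Lemma four'4 x : four' (four x) = (2 * pi)%:C *: x.
Proof.
have := four4' (conjf x); rewrite /four' conjfK => ->.
by rewrite -[_ *: conjf x]addr0 conjf_semilin conjfK JC -(subrr (0 : H)) conjfB subrr addr0.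
Qed.

Lemma pi2C_neq0 : ((2 * pi)%:C : R[i]) != 0.
Proof.
apply: cmod_gt0P; rewrite cmodC gtr0_norm; first by rewrite mulr_gt0 ?pi_gt0.
by rewrite mulr_gt0 ?pi_gt0.
Qed.

Lemma four_onto y : exists x, four x = y.
Proof.
exists (((2 * pi)%:C)^-1 *: four' y); rewrite (linZ four_lin) four4' scalerA mulVf ?scale1r//.
exact: pi2C_neq0.
Qed.

Lemma four_inj x y : four x = four y -> x = y.
Proof.
by move=> h; apply: (scalerI pi2C_neq0); rewrite -!four'4 h.
Qed.

(** The bridge from the limit that defines [is_fourier] to the operator [four]. *)
Lemma is_fourierP f g : is_fourier f g <-> [/\ L2 setT f, L2 setT g & vec g = four (vec f)].
Proof.
have E n : L2 setT f -> L2 setT g ->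
    l2norm setT (fun t => trunc_fourier f n t - g t) = (nrm (fourn n (vec f) - vec g))%:E.
  move=> Lf Lg; have [L _] := plancherel_trunc n Lf.
  have -> : (fun t => trunc_fourier f n t - g t) = fun t => ft (trunc n f) t - g t.
    by apply/funext => t; rewrite trunc_fourierE.
  have /L2P[m i] := L2B L Lg; rewrite l2normE//; congr EFin.
  rewrite -(nrm_vec (L2B L Lg)) sqrtr_sqr ger0_norm ?nrm_ge0//.
  by rewrite vec_sub// fourn_vec.
split.
  move=> [Lf Lg h]; split=> //; apply: (hcvg_unique _ (four_cvg (vec f))) => e e0.
  have {}h : (nrm (fourn n (vec f) - vec g))%:E @[n --> \oo] --> 0%:E.
    by under eq_cvg do rewrite -E//.
  have /fine_cvgP[_ hc] := h.
  have [N hN] := (iffLR (cvgr_eps _ _) hc) e e0; exists N => n /hN /=.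
  by rewrite subr0 ger0_norm ?nrm_ge0.
move=> [Lf Lg h]; split=> //.
under eq_cvg do rewrite E//.
apply: cvg_EFin; first exact: nearW.
apply/cvgr_eps => e e0; have [N hN] := four_cvg (vec f) e0; exists N => n /hN.
by rewrite /= subr0 ger0_norm ?nrm_ge0// h.
Qed.

Lemma fourier_vec f : L2 setT f -> L2 setT (fourier f) /\ vec (fourier f) = four (vec f).
Proof.
move=> Lf; rewrite /fourier; case: xgetP => [g _ /is_fourierP[] //|h].
case: (h (rep (four (vec f)))); apply/is_fourierP; split; rewrite ?vec_rep//; exact: rep_L2.
Qed.

Lemma fourier_inv_vec g : L2 setT g -> L2 setT (fourier_inv g) /\ four (vec (fourier_inv g)) = vec g.
Proof.
move=> Lg; rewrite /fourier_inv; case: xgetP => [f _ /is_fourierP[] //|h].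
have [x hx] := four_onto (vec g).
by case: (h (rep x)); apply/is_fourierP; split; rewrite ?vec_rep//; exact: rep_L2.
Qed.

End FourierUnitary.

(** * Multiplication operators *)

Section Multiplication.
Context {R : realType}.
Local Notation mu := (@lebesgue_measure R).
Local Notation H := (L2S R).
Implicit Types (x y : L2S R) (f g h : R -> Cplx R).

Lemma Linfty_cst (c : Cplx R) : Linfty (fun=> c).
Proof. by split; [exact: cmeas_cst|exists (cmod c); exact: aeA]. Qed.

Lemma Linfty_mul f g : Linfty f -> Linfty g -> Linfty (fun t => f t * g t).
Proof.
move=> [mf [M hM]] [mg [N hN]]; split; first exact: cmeas_mul.
exists (M * N); apply: (aeS2 hM hN) => t h1 h2; rewrite cmodM.
by apply: ler_pM => //; exact: cmod_ge0.
Qed.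

Lemma Linfty_add f g : Linfty f -> Linfty g -> Linfty (fun t => f t + g t).
Proof.
move=> [mf [M hM]] [mg [N hN]]; split; first exact: cmeas_add.
by exists (M + N); apply: (aeS2 hM hN) => t h1 h2; apply: le_trans (cmodD _ _) _; exact: lerD.
Qed.

Lemma Linfty_conj f : Linfty f -> Linfty (fun t => cj (f t)).
Proof.
move=> [mf [M hM]]; split; first exact: cmeas_conj.
by exists M; apply: (aeS hM) => t; rewrite cmodJ.
Qed.

Lemma Linfty_refl f : Linfty f -> Linfty (reflection f).
Proof.
move=> [mf [M hM]]; split; first exact: cmeas_refl.
by exists M; exact: (ae_refl hM).
Qed.

Lemma Linfty_exp f n : Linfty f -> Linfty (fun t => f t ^+ n).
Proof.
move=> hf; elim: n => [|n IH].
  by rewrite (_ : (fun t => _) = fun=> 1); [exact: Linfty_cst|apply/funext => t; rewrite expr0].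
rewrite (_ : (fun t => _) = fun t => f t * f t ^+ n); first exact: Linfty_mul.
by apply/funext => t; rewrite exprS.
Qed.

Lemma Linfty_L2 f g : Linfty f -> L2 setT g -> L2 setT (fun t => f t * g t).
Proof. by move=> [mf [M hM]] Lg; exact: L2_mul hM Lg. Qed.

Lemma mulf_vec f g : Linfty f -> L2 setT g -> mulf f (vec g) = vec (fun t => f t * g t).
Proof.
move=> hf Lg; rewrite mulfE; apply: vec_ext; [by apply: Linfty_L2 => //; exact: rep_L2|exact: Linfty_L2|].
by apply: (aeS (rep_vec Lg)) => t ->.
Qed.

Lemma rep_mulf f x : Linfty f -> {ae mu, forall t, rep (mulf f x) t = f t * rep x t}.
Proof. by move=> hf; rewrite mulfE; apply: rep_vec; apply: Linfty_L2 => //; exact: rep_L2. Qed.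

Lemma mulf_ext f g x : Linfty f -> Linfty g -> {ae mu, forall t, f t = g t} -> mulf f x = mulf g x.
Proof.
move=> hf hg h; rewrite !mulfE; apply: vec_ext; try by apply: Linfty_L2 => //; exact: rep_L2.
by apply: (aeS h) => t ->.
Qed.

Lemma mulf_mulf f g x : Linfty f -> Linfty g -> mulf f (mulf g x) = mulf (fun t => f t * g t) x.
Proof.
move=> hf hg; rewrite (mulfE g) mulf_vec//; last by apply: Linfty_L2 => //; exact: rep_L2.
by rewrite mulfE; congr vec; apply/funext => t; rewrite mulrA.
Qed.

Lemma mulf_adj f : Linfty f -> adjoint (mulf f) (mulf (fun t => cj (f t))).
Proof.
move=> hf x y; have hcf := Linfty_conj hf.
rewrite !mulfE -[in LHS](vec_rep y) -[in RHS](vec_rep x) dot_vec; [|by apply: Linfty_L2 => //; exact: rep_L2|exact: rep_L2].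
rewrite dot_vec; [|exact: rep_L2|by apply: Linfty_L2 => //; exact: rep_L2].
congr cint; apply/funext => t; rewrite JM JK.
by move: (f t) (rep x t) (cj _) => a b c; ring.
Qed.

Lemma nrm_mulf_le f (M : R) x : Linfty f -> {ae mu, forall t, cmod (f t) <= M} -> 0 <= M ->
  nrm (mulf f x) <= M * nrm x.
Proof.
move=> hf hM M0; rewrite -ler_sqr ?nnegrE ?mulr_ge0 ?nrm_ge0// exprMn !nrm_rep.
rewrite -rintZ; last exact/L2_sq/rep_L2.
apply: rint_ae_le; [exact/L2_sq/rep_L2|exact/rintegZ/L2_sq/rep_L2|].
apply: (aeS2 hM (rep_mulf x hf)) => t h ->; rewrite cmodM exprMn; apply: ler_wpM2r; first exact: sqr_ge0.
by apply: sqr_mono => //; exact: cmod_ge0.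
Qed.

Lemma nrm_mulf_ge f (c : R) x : Linfty f -> {ae mu, forall t, c <= cmod (f t)} -> 0 <= c ->
  c * nrm x <= nrm (mulf f x).
Proof.
move=> hf hM M0; rewrite -ler_sqr ?nnegrE ?mulr_ge0 ?nrm_ge0// exprMn !nrm_rep.
rewrite -rintZ; last exact/L2_sq/rep_L2.
apply: rint_ae_le; [exact/rintegZ/L2_sq/rep_L2|exact/L2_sq/rep_L2|].
apply: (aeS2 hM (rep_mulf x hf)) => t h ->; rewrite cmodM exprMn; apply: ler_wpM2r; first exact: sqr_ge0.
exact: sqr_mono.
Qed.

Lemma mulf_lin f : Linfty f -> linop (mulf f).
Proof. by move=> hf; exact: adjoint_lin (mulf_adj hf). Qed.

Lemma mulf_bop f : Linfty f -> bop (mulf f).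
Proof.
move=> hf; split; first exact: mulf_lin.
have [mf [M hM]] := hf; exists `|M|; split=> // x; apply: nrm_mulf_le => //.
by apply: (aeS hM) => t /le_trans -> //; exact: ler_norm.
Qed.

Lemma mulf_cst (c : Cplx R) x : mulf (fun=> c) x = c *: x.
Proof. by rewrite mulfE vecZ ?vec_rep//; exact: rep_L2. Qed.

Lemma mulf1 f x : (forall t, f t = 1) -> mulf f x = x.
Proof.
move=> h; rewrite mulfE (_ : (fun t => _) = rep x) ?vec_rep//.
by apply/funext => t; rewrite h mul1r.
Qed.

Lemma mulf_add f g x : Linfty f -> Linfty g -> mulf (fun t => f t + g t) x = mulf f x + mulf g x.
Proof.
move=> hf hg; rewrite !mulfE -vecD; try by apply: Linfty_L2 => //; exact: rep_L2.
by congr vec; apply/funext => t; rewrite mulrDl.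
Qed.

Lemma mulf_reflf f x : Linfty f -> reflf (mulf f x) = mulf (reflection f) (reflf x).
Proof.
move=> hf; have [Lx _] := L2_refl (rep_L2 x).
rewrite mulfE reflf_vec; last by apply: Linfty_L2 => //; exact: rep_L2.
by rewrite reflfE mulf_vec//; exact: Linfty_refl.
Qed.

Lemma Linfty_kz z : Im z != 0 -> Linfty (@kz R z).
Proof.
move=> z0; split; first exact: cmeas_kz.
by exists `|Im z|^-1; apply: aeA => t; exact: kz_bound.
Qed.

End Multiplication.

(** * The Hardy space *)

Section Hardy.
Context {R : realType}.
Local Notation mu := (@lebesgue_measure R).
Local Notation H := (L2S R).
Implicit Types (x y : L2S R) (f g h : R -> Cplx R) (z : Cplx R).

Definition half : R -> Cplx R := fun t => (\1_Rplus t)%:C.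

Lemma half_Linfty : Linfty half.
Proof.
split; first by apply: cmeas_real; apply: measurable_indic; exact: measurable_itv.
by exists 1; apply: aeA => t; rewrite cmodC indicE; case: (_ \in _); rewrite /= ?normr1 ?normr0 ?ler01.
Qed.

Lemma half_idem t : half t * half t = half t.
Proof.
by rewrite -rmorphM; congr (_%:C); rewrite indicE; case: (_ \in _); rewrite /= ?mulr1 ?mulr0.
Qed.

Lemma half_adj : adjoint (mulf half) (mulf half).
Proof.
move=> x y; rewrite (mulf_adj half_Linfty); congr (dot _ (mulf _ _)).
by apply/funext => t; rewrite JC.
Qed.

Lemma half_half x : mulf half (mulf half x) = mulf half x.
Proof.
rewrite mulf_mulf; [|exact: half_Linfty|exact: half_Linfty]; congr (mulf _ x).
by apply/funext => t; exact: half_idem.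
Qed.

(* The Riesz projection: multiplication by the indicator of R_+ on the Fourier
   side. It is locked against unfolding by unification. *)
Definition P : H -> H := locked (fun x => ((2 * pi)%:C)^-1 *: four (mulf half (four' x))).
Lemma PE x : P x = ((2 * pi)%:C)^-1 *: four (mulf half (four' x)).
Proof. by rewrite /P -lock. Qed.
(** The Hardy space of the upper half-plane, as the range of the Riesz projection instead of a space
    of analytic functions. *)
Definition H2 x := P x = x.

Lemma four'_lin : linop (@four' R).
Proof. exact: adjoint_lin (adjoint_sym four_adj). Qed.

Lemma P_lin : linop P.
Proof.
move=> a x y; rewrite !PE four'_lin (mulf_lin half_Linfty) four_lin.
move: (four (mulf half (four' x))) (four (mulf half (four' y))) => u v.
by rewrite scalerDr !scalerA [a * _]mulrC.
Qed.

Lemma P_four x : P (four x) = four (mulf half x).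
Proof.
rewrite PE four'4 (linZ (mulf_lin half_Linfty)) (linZ four_lin).
move: (four (mulf half x)) => u.
by rewrite scalerA mulVf ?scale1r//; exact: pi2C_neq0.
Qed.

Lemma P_adj : adjoint P P.
Proof.
move=> x y; rewrite !PE dotZl dotZr four_adj half_adj (adjoint_sym four_adj).
by rewrite JV JC.
Qed.

Lemma PP x : P (P x) = P x.
Proof.
by rewrite [P x]PE (linZ P_lin) P_four half_half.
Qed.

Lemma H2P x : H2 (P x).
Proof. exact: PP. Qed.

Lemma P_ortho x y : dot (P x) (y - P y) = 0.
Proof. by rewrite dotBr (P_adj x y) (P_adj x (P y)) PP subrr. Qed.

Lemma nrm_P_pyth x : nrm x ^+ 2 = nrm (P x) ^+ 2 + nrm (x - P x) ^+ 2.
Proof.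
by rewrite -(pythagoras (P_ortho x x)); congr (nrm _ ^+ 2); hring.
Qed.

Lemma nrm_P x : nrm (P x) <= nrm x.
Proof.
rewrite -ler_sqr ?nnegrE ?nrm_ge0// (nrm_P_pyth x) lerDl; exact: sqr_ge0.
Qed.

Lemma P_bop : bop P.
Proof. by split; [exact: P_lin|exists 1; split=> // x; rewrite mul1r; exact: nrm_P]. Qed.

Lemma H2_subsp : subsp H2.
Proof.
split; first exact: lin0 P_lin.
by move=> a x y; rewrite /H2 P_lin => -> ->.
Qed.

Lemma dotP x y : H2 y -> dot (P x) y = dot x y.
Proof. by move=> h; rewrite P_adj h. Qed.

(** With its pole below the axis, the kernel is a multiple of the transform of an exponential
    carried by the positive half-line. *)
Lemma P_kv_neg z : Im z < 0 -> P (kv z) = kv z.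
Proof.
move=> z0; have b0 : 0 < - Im z by rewrite oppr_gt0.
have e : kv z = (- 'i%C) *: four (vec (ev (Re z) (- Im z))).
  rewrite four_ev// scalerA (_ : - 'i%C * 'i%C = 1); last first.
    by apply: complex_ext; rewrite ?ReM ?ImM ?ReN ?ImN /=; ring.
  by rewrite scale1r; congr kv; apply: complex_ext => //=; rewrite opprK.
have [L _ _] := ev_L2 (Re z) b0.
rewrite e (linZ P_lin) P_four.
congr (_ *: four _); rewrite mulf_vec//; last exact: half_Linfty.
congr vec; apply/funext => t; rewrite /ev /hexp mulrA -rmorphM mulrA; congr (_%:C * _).
by rewrite indicE; case: (_ \in _); rewrite /= ?mul1r ?mul0r.
Qed.

Lemma P_kv_pos z : 0 < Im z -> P (kv z) = 0.
Proof.
move=> z0.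
have z0' : Im (- Re z -i* Im z : Cplx R) != 0 by rewrite /= oppr_eq0 gt_eqF.
have e : kv z = 'i%C *: four (reflf (vec (ev (- Re z) (Im z)))).
  rewrite four_reflf four_ev// (linZ reflf_lin) reflf_kv// scalerA (_ : 'i%C * 'i%C = -1); last first.
    by apply: complex_ext; rewrite ?ReM ?ImM ?ReN ?ImN /=; ring.
  by rewrite scaleN1r opprK; congr kv; apply: complex_ext; rewrite ?ReN ?ImN /= opprK.
have [L _ _] := ev_L2 (- Re z) z0.
rewrite e (linZ P_lin) P_four reflf_vec//.
have [Lr _] := L2_refl L.
rewrite mulf_vec//; last exact: half_Linfty.
rewrite (_ : (fun t => _) = fun=> 0); first by rewrite vec0 (lin0 four_lin) scaler0.
apply/funext => t; rewrite /ev /reflection /hexp mulrA -rmorphM mulrA.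
rewrite (_ : \1_Rplus t * \1_Rplus (- t) = 0); first by rewrite mul0r mul0r.
rewrite !indicE /Rplus; have [t0|t0] := ltP 0 t.
  by rewrite [- t \in _]memNset ?mulr0//= in_itv/= andbT; apply/negP; rewrite -leNgt oppr_le0 ltW.
by rewrite memNset ?mul0r//= in_itv/= andbT; apply/negP; rewrite -leNgt.
Qed.

Lemma kv_total_P x : P x = x -> (forall z, -1 < Im z < 0 -> dot x (kv z) = 0) -> x = 0.
Proof.
move=> hx h; apply: kv_total => z /andP[z0 z1].
have [zn|zp|z00] := ltgtP (Im z) 0; last by rewrite z00 normr0 ltxx in z0.
  by apply: h; rewrite zn andbT; move: z1; rewrite ltr0_norm//; lra.
by rewrite -hx P_adj P_kv_pos// dot0r.
Qed.

(** Testing in the strip [0 < Im z < 1] keeps [z] away from [i], where the partial fractions of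
    [sh'_kv] degenerate. *)
Lemma H2_crit x : (forall z, 0 < Im z < 1 -> dot x (kv z) = 0) -> H2 x.
Proof.
move=> h; suff : x - P x = 0 by move/eqP; rewrite subr_eq0 => /eqP.
apply: kv_total => z /andP[z0 z1].
rewrite dotBl P_adj; have [zn|zp|z00] := ltgtP (Im z) 0; last by rewrite z00 normr0 ltxx in z0.
  by rewrite P_kv_neg// subrr.
by rewrite P_kv_pos// dot0r subr0; apply: h; rewrite zp; move: z1; rewrite gtr0_norm.
Qed.

Lemma H2_dot x z : H2 x -> 0 < Im z -> dot x (kv z) = 0.
Proof. by move=> <- z0; rewrite P_adj P_kv_pos// dot0r. Qed.

End Hardy.

(** * The shift on the Hardy space *)

Section Shift.
Context {R : realType}.
Local Notation mu := (@lebesgue_measure R).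
Local Notation H := (L2S R).
Local Notation I := ('i%C : Cplx R).
Implicit Types (x y : L2S R) (f g h : R -> Cplx R) (z : Cplx R).

Definition chi (t : R) : Cplx R := (t%:C - I) * kz (- I) t.

Lemma i_den (t : R) : (t%:C - I != 0) && (t%:C - - I != 0).
Proof. by rewrite !kz_den//= ?oppr_eq0 oner_eq0. Qed.

Lemma chiJ t : cj (chi t) = (t%:C + I) * kz I t.
Proof.
rewrite /chi JM kzJ JB JC (_ : cj I = - I); last by apply: complex_ext; rewrite ?ReJ ?ImJ ?ReN ?ImN /= ?oppr0.
by rewrite JN (_ : cj I = - I) ?opprK//; apply: complex_ext; rewrite ?ReJ ?ImJ ?ReN ?ImN /= ?oppr0.
Qed.

Lemma chiJK t : cj (chi t) * chi t = 1.
Proof.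
rewrite chiJ /chi /kz; have /andP[] := i_den t; move: (t%:C : Cplx R) (I) => s i d1 d2.
by rewrite opprK in d2 *; field; rewrite d1 d2.
Qed.

Lemma chiKJ t : chi t * cj (chi t) = 1.
Proof. by rewrite mulrC chiJK. Qed.

Lemma cmod_chi t : cmod (chi t) = 1.
Proof.
apply/eqP; rewrite -(@eqrXn2 _ 2) ?cmod_ge0// expr1n; apply/eqP.
by apply: (@complexI R); rewrite -mulcJ chiKJ.
Qed.

Lemma chi_Linfty : Linfty chi.
Proof.
split; last by exists 1; apply: aeA => t; rewrite cmod_chi.
by apply: cmeas_mul; [apply: cmeas_sub; [exact: cmeas_real|exact: cmeas_cst]|exact: cmeas_kz].
Qed.

Lemma chiJ_Linfty : Linfty (fun t => cj (chi t)).
Proof. exact: Linfty_conj chi_Linfty. Qed.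

(** The bilateral shift and its inverse: the first leaves the Hardy space invariant, and [P] after
    the second is the backward shift there. *)
Definition sh := mulf chi.
Definition sh' := mulf (fun t => cj (chi t)).

Lemma sh_adj : adjoint sh sh'.
Proof. exact: mulf_adj chi_Linfty. Qed.
Lemma sh_lin : linop sh.
Proof. exact: mulf_lin chi_Linfty. Qed.
Lemma sh'_lin : linop sh'.
Proof. exact: mulf_lin chiJ_Linfty. Qed.
Lemma shK x : sh' (sh x) = x.
Proof.
rewrite /sh /sh' mulf_mulf; [|exact: chiJ_Linfty|exact: chi_Linfty].
by apply: mulf1 => t; rewrite chiJK.
Qed.
Lemma sh'K x : sh (sh' x) = x.
Proof.
rewrite /sh /sh' mulf_mulf; [|exact: chi_Linfty|exact: chiJ_Linfty].
by apply: mulf1 => t; rewrite chiKJ.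
Qed.
Lemma nrm_sh x : nrm (sh x) = nrm x.
Proof.
by apply/eqP; rewrite -(@eqrXn2 _ 2) ?nrm_ge0// !sqr_nrm sh_adj shK.
Qed.
Lemma nrm_sh' x : nrm (sh' x) = nrm x.
Proof. by rewrite -[in RHS](sh'K x) nrm_sh. Qed.

(** Partial fractions: multiplication by a Cayley factor maps a kernel to a combination of itself
    and the kernel at the pole of the factor, so invariance of the Hardy space is read off the
    poles. *)
Lemma sh'_kv z : Im z != 0 -> z != I ->
  sh' (kv z) = ((2 * I) / (I - z)) *: kv I + ((z + I) / (z - I)) *: kv z.
Proof.
move=> z0 zi; have i0 : Im I != 0 by rewrite /= oner_eq0.
have [L _] := kz_L2 z0; have [Li _] := kz_L2 i0.
rewrite /sh' /kv mulf_vec//; last exact: chiJ_Linfty.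
rewrite -[X in _ + X]vecZ// -vec_lin//; last exact: L2Z.
congr vec; apply/funext => t; rewrite chiJ /kz.
have := kz_den t z0; have /andP[+ _] := i_den t.
have : z - I != 0 by rewrite subr_eq0.
move: (t%:C : Cplx R) (I) (z) => s i z1 d1 d2 d3.
have d4 : i - z1 != 0 by rewrite -opprB oppr_eq0.
by field; rewrite d1 d2 d3 d4.
Qed.

Lemma sh_kv z : Im z != 0 -> z != - I ->
  sh (kv z) = ((2 * I) / (I + z)) *: kv (- I) + ((z - I) / (z + I)) *: kv z.
Proof.
move=> z0 zi; have i0 : Im (- I) != 0 by rewrite /= oppr_eq0 oner_eq0.
have [L _] := kz_L2 z0; have [Li _] := kz_L2 i0.
rewrite /sh /kv mulf_vec//; last exact: chi_Linfty.
rewrite -[X in _ + X]vecZ// -vec_lin//; last exact: L2Z.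
congr vec; apply/funext => t; rewrite /chi /kz.
have := kz_den t z0; have /andP[_ +] := i_den t.
have : z + I != 0 by rewrite addr_eq0.
rewrite opprK; move: (t%:C : Cplx R) (I) (z) => s i z1 d1 d2 d3.
by rewrite [i + z1]addrC; field; rewrite d1 d2 d3.
Qed.

Lemma H2_sh x : H2 x -> H2 (sh x).
Proof.
move=> hx; apply: H2_crit => z /andP[z0 z1]; rewrite sh_adj sh'_kv; last 2 first.
- by rewrite gt_eqF.
- by apply/eqP => e; move: z1; rewrite e /= ltxx.
by rewrite dotDr !dotZr !(H2_dot hx) ?mulr0 ?addr0//= ltr01.
Qed.

(** Division by [chi]. The pairing with [kv (- I)] is, up to a constant, the value at [i], the zero
    of [chi]. *)
Lemma H2_sh' x : H2 x -> dot x (kv (- I)) = 0 -> H2 (sh' x).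
Proof.
move=> hx h0; apply: H2_crit => z /andP[z0 z1]; rewrite (adjoint_sym sh_adj) sh_kv; last 2 first.
- by rewrite gt_eqF.
- by apply/eqP => e; move: z0; rewrite e /= ltr0N1.
by rewrite dotDr !dotZr h0 (H2_dot hx) ?mulr0 ?addr0.
Qed.

Lemma P_sh'0 x : P x = 0 -> P (sh' x) = 0.
Proof.
move=> h; apply: eq_dot => y; rewrite dot0l P_adj (adjoint_sym sh_adj).
by rewrite -(H2_sh (H2P y)) -P_adj h dot0l.
Qed.

Lemma P_sh'P x : P (sh' (P x)) = P (sh' x).
Proof.
apply/eqP; rewrite eq_sym -subr_eq0 -(linB P_lin) -(linB sh'_lin); apply/eqP/P_sh'0.
by rewrite (linB P_lin) PP subrr.
Qed.

Lemma iter_lin n (T : H -> H) : linop T -> linop (fun x => iter n T x).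
Proof. by move=> lT; elim: n => [//|n IH] a x y; rewrite !iterS IH lT. Qed.

Lemma nrm_iter_sh' n x : nrm (iter n sh' x) = nrm x.
Proof. by elim: n => // n IH; rewrite iterS nrm_sh'. Qed.

Lemma P_iter_sh'P n x : P (iter n sh' (P x)) = P (iter n sh' x).
Proof.
by elim: n => [|n IH]; [exact: PP|rewrite /= -P_sh'P IH P_sh'P].
Qed.

Lemma cmod_lt1 z : Im z < 0 -> cmod ((z + I) / (z - I)) < 1.
Proof.
move=> z0; have d0 : z - I != 0 by apply/eqP => /(congr1 (@Im R)); rewrite ImB /=; lra.
rewrite cmodM cmodV ltr_pdivrMr ?cmod_gt0// mul1r -ltr_sqr ?nnegrE ?cmod_ge0//.
by rewrite !sqr_cmod ReD ImD ReB ImB /=; nra.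
Qed.

(* The backward shift has the eigenvectors [1/(t - z)] with eigenvalues of
   modulus less than 1. *)
Lemma P_iter_sh'_cvg x : hcvg (fun n => P (iter n sh' x)) 0.
Proof.
pose D : set H := [set y | hcvg (fun n => P (iter n sh' y)) 0].
have Ds : subsp D.
  split; first by move=> e e0; exists 0%N => n _; rewrite (lin0 (iter_lin _ sh'_lin)) (lin0 P_lin) subrr nrm0.
  move=> a u v hu hv; rewrite /D /= (_ : 0 = a *: 0 + 0); last by rewrite scaler0 addr0.
  apply: hcvg_ext (hcvg_lin a hu hv); exists 0%N => n _.
  by rewrite (iter_lin _ sh'_lin) P_lin.
have kD z : 0 < `|Im z| < 1 -> D (kv z).
  move=> /andP[z0 z1]; have [zn|zp|z00] := ltgtP (Im z) 0; last by rewrite z00 normr0 ltxx in z0.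
    have E n : P (iter n sh' (kv z)) = ((z + I) / (z - I)) ^+ n *: kv z.
      elim: n => [|n IH]; first by rewrite P_kv_neg// expr0 scale1r.
      have zI : z != I by apply/eqP => e; move: zn; rewrite e /= ltNge ler01.
      have zz : Im z != 0 by rewrite lt_eqF.
      rewrite iterS -P_sh'P IH (linZ sh'_lin) (linZ P_lin) (sh'_kv zz zI).
      rewrite (linD P_lin) !(linZ P_lin) P_kv_pos ?ltr01//= P_kv_neg// scaler0 add0r.
      by rewrite scalerA exprSr.
    move=> e e0; have q1 := cmod_lt1 zn.
    have [N hN] := @geo_lt R (cmod ((z + I) / (z - I))) (nrm (kv z)) e (ltac:(by rewrite cmod_ge0)) e0.
    by exists N => n /hN; rewrite E subr0 nrmZ cmodX mulrC.
  move=> e e0; exists 0%N => n _; rewrite -P_iter_sh'P P_kv_pos//.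
  by rewrite (lin0 (iter_lin _ sh'_lin)) (lin0 P_lin) subrr nrm0.
have : clos D x.
  apply: dense_of_ortho => // y h; apply: kv_total => z hz; apply: h; exact: kD.
move=> hx e e0; have e2 : 0 < e / 2 by rewrite divr_gt0.
have [s [Ds' xs]] := hx _ e2; have [N hN] := Ds' _ e2; exists N => n /hN.
rewrite !subr0 => h.
have -> : iter n sh' x = iter n sh' (x - s) + iter n sh' s.
  by rewrite -(linD (iter_lin n sh'_lin)) subrK.
rewrite (linD P_lin); apply: le_lt_trans (nrmD _ _) _.
have : nrm (P (iter n sh' (x - s))) <= nrm (x - s) by apply: le_trans (nrm_P _) _; rewrite nrm_iter_sh'.
by move=> h1; rewrite [e]splitr; apply: ltrD => //; exact: le_lt_trans h1 xs.
Qed.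

End Shift.

(** * Cauchy's theorem *)

Section ComplexLimits.
Context {R : realType}.
Implicit Types (z w : Cplx R) (F : Cplx R -> Cplx R).

Lemma normC (z : Cplx R) : `|z| = (cmod z)%:C.
Proof. by []. Qed.

Lemma ltC (a b : R) : ((a%:C : R[i]) < b%:C) = (a < b).
Proof. by rewrite ltcR. Qed.

Lemma gt0C (e : R[i]) : 0 < e -> e = (Re e)%:C /\ 0 < Re e.
Proof.
rewrite ltcE /= => /andP[/eqP h1 h2]; split=> //; apply: complex_ext => //=.
Qed.

Lemma near_C z (P : set (Cplx R)) : (\forall w \near z, P w) <->
  exists d : R, 0 < d /\ forall w, cmod (w - z) < d -> P w.
Proof.
split.
  move=> /nbhs_normP [e /= e0 h]; have [ee e1] := gt0C e0; exists (Re e); split=> // w hw.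
  by apply: h; rewrite /= normC -[z - w]opprB cmodN ee ltC.
move=> [d [d0 h]]; apply/nbhs_normP; exists (d%:C : R[i]); first by rewrite /= ltC.
by move=> w /=; rewrite normC -[z - w]opprB cmodN ltC; exact: h.
Qed.

Lemma cvg_C (T : Type) (G : set_system T) {FG : Filter G} (f : T -> Cplx R) (l : Cplx R) :
  (f x @[x --> G] --> l) <-> forall e : R, 0 < e -> \forall x \near G, cmod (f x - l) <= e.
Proof.
split.
  move/cvgrPdist_lt => h e e0; have e0' : 0 < (e%:C : R[i]) by rewrite ltC.
  near=> x; have : `|l - f x| < e%:C by near: x; exact: (h _ e0').
  by rewrite normC -opprB cmodN ltC => /ltW.
move=> h; apply/cvgrPdist_lt => e /gt0C[-> e0].
near=> x; rewrite normC -opprB cmodN ltC; apply: (@le_lt_trans _ _ (Re e / 2)); last first.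
  by rewrite ltr_pdivrMr// ltr_pMr// ltr1n.
near: x; apply: h; by rewrite divr_gt0.
Unshelve. all: by end_near. Qed.

(** A form without quotients, in which [w = z] is no exception. *)
Definition cdiff F z := exists L : Cplx R, forall e : R, 0 < e -> exists d : R, 0 < d /\
  forall w, cmod (w - z) < d -> cmod (F w - F z - L * (w - z)) <= e * cmod (w - z).

Lemma derivable_cdiff F z : derivable F z 1 <-> cdiff F z.
Proof.
split.
  move=> /cvg_ex [L /cvg_C hL]; exists L => e e0.
  have := hL e e0; rewrite /dnbhs near_withinE => /near_C[d [d0 hd]]; exists d; split=> // w hw.
  have [->|wz] := eqVneq w z; first by rewrite !subrr mulr0 subr0 cmod0 mulr0.
  have wz0 : w - z != 0 by rewrite subr_eq0.
  have := hd (w - z); rewrite subr0 => /(_ hw wz0).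
  rewrite [(w - z) *: 1](_ : _ = w - z); last by rewrite /GRing.scale /= mulr1.
  rewrite /= subrK /GRing.scale /= => h.
  rewrite (_ : F w - F z - L * (w - z) = ((w - z)^-1 * (F w - F z) - L) * (w - z)).
    by rewrite cmodM; apply: ler_wpM2r => //; exact: cmod_ge0.
  by rewrite mulrBl mulrAC mulVf// mul1r.
move=> [L hL]; apply/cvg_ex; exists L; apply/cvg_C => e e0.
have [d [d0 hd]] := hL e e0; rewrite /dnbhs near_withinE; apply/near_C; exists d; split=> // h.
rewrite subr0 => hh h0; have := hd (h + z); rewrite addrK => /(_ hh).
rewrite [h *: 1](_ : _ = h); last by rewrite /GRing.scale /= mulr1.
rewrite /GRing.scale /= => h1.
rewrite (_ : h^-1 * (F (h + z) - F z) - L = h^-1 * (F (h + z) - F z - L * h)); last first.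
  by rewrite [in RHS]mulrBr mulrCA mulVf// mulr1.
by rewrite cmodM cmodV ler_pdivrMl ?cmod_gt0// [cmod h * e]mulrC.
Qed.

Lemma ntl_eps sg F (x : R) l : nontangential_limit sg F x l <->
  forall a e : R, 0 < a -> 0 < e -> exists d : R, 0 < d /\
  forall z, stolz sg a x z -> cmod (z - x%:C) < d -> cmod (F z - l) <= e.
Proof.
split.
  move=> h a e a0 e0; have /cvg_C /(_ e e0) := h a a0.
  rewrite near_withinE => /near_C[d [d0 hd]]; exists d; split=> // z hs hz; exact: hd.
move=> h a a0; apply/cvg_C => e e0; rewrite near_withinE; apply/near_C.
by have [d [d0 hd]] := h a e a0 e0; exists d; split=> // z hz hs; exact: hd.
Qed.

End ComplexLimits.

(** * Goursat's theorem for rectangles *)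

Section Goursat.
Context {R : realType}.
Local Notation mu := (@lebesgue_measure R).
Local Notation I := ('i%C : Cplx R).
Implicit Types (z w : Cplx R) (F G K : Cplx R -> Cplx R) (a b c d : R) (u v : R -> Cplx R).

Definition ccont G z := forall e : R, 0 < e -> exists d : R, 0 < d /\
  forall w, cmod (w - z) < d -> cmod (G w - G z) <= e.

Lemma cdiff_ccont G z : cdiff G z -> ccont G z.
Proof.
move=> [L hL] e e0; have [d [d0 hd]] := hL 1 ltr01.
have c0 : 0 < 1 + cmod L by have := cmod_ge0 L; lra.
exists (Num.min d (e / (1 + cmod L))); split; first by rewrite lt_min d0 divr_gt0.
move=> w; rewrite lt_min => /andP[/hd h1]; rewrite ltr_pdivlMr// => h2.
rewrite (_ : G w - G z = (G w - G z - L * (w - z)) + L * (w - z)); last by rewrite subrK.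
apply: le_trans (cmodD _ _) _; rewrite cmodM; move: h1 h2; rewrite mul1r.
by move: (cmod (w - z)) (cmod L) (cmod _) => p q r; nra.
Qed.

Lemma cdiff_quad G z (L : Cplx R) (C d : R) : 0 < d ->
  (forall w, cmod (w - z) < d -> cmod (G w - G z - L * (w - z)) <= C * cmod (w - z) ^+ 2) ->
  cdiff G z.
Proof.
move=> d0 h; exists L => e e0.
have C0 : 0 < `|C| + 1 by have := normr_ge0 C; lra.
exists (Num.min d (e / (`|C| + 1))); split; first by rewrite lt_min d0 divr_gt0.
move=> w; rewrite lt_min => /andP[/h {}h]; rewrite ltr_pdivlMr// => h2.
apply: le_trans h _; rewrite expr2 mulrA; apply: ler_wpM2r; first exact: cmod_ge0.
have := ler_norm C; have := cmod_ge0 (w - z); move: h2.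
by move: (cmod (w - z)) `|C| => p q; nra.
Qed.

Lemma cdiff_mul F K z : cdiff F z -> cdiff K z -> cdiff (fun w => F w * K w) z.
Proof.
move=> dF dK; have cK := cdiff_ccont dK; case: dF => L hL; case: dK => N hN.
exists (L * K z + F z * N) => e e0.
pose m := 1 + cmod (K z) + cmod L + cmod (F z).
have m0 : 0 < m by have := cmod_ge0 (K z); have := cmod_ge0 L; have := cmod_ge0 (F z); rewrite /m; lra.
have em : 0 < e / (3 * m) by rewrite divr_gt0// mulr_gt0.
have [d1 [d10 h1]] := hL _ em; have [d2 [d20 h2]] := hN _ em.
have [d3 [d30 h3]] := cK _ em; have [d4 [d40 h4]] := cK 1 ltr01.
exists (Num.min (Num.min d1 d2) (Num.min d3 d4)); split; first by rewrite !lt_min d10 d20 d30 d40.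
move=> w; rewrite !lt_min => /andP[/andP[/h1 {}h1 /h2 {}h2] /andP[/h3 {}h3 /h4 {}h4]].
rewrite (_ : F w * K w - F z * K z - (L * K z + F z * N) * (w - z) =
  (F w - F z - L * (w - z)) * K w + L * (w - z) * (K w - K z) + F z * (K w - K z - N * (w - z))); last by ring.
apply: le_trans (cmodD _ _) _; apply: le_trans (lerD (cmodD _ _) (lexx _)) _; rewrite !cmodM.
have Kw : cmod (K w) <= m.
  have := cmodB_ge (K w) (K z); have := cmod_ge0 L; have := cmod_ge0 (F z); rewrite /m; lra.
have Lm : cmod L <= m by have := cmod_ge0 (K z); have := cmod_ge0 (F z); rewrite /m; lra.
have Fm : cmod (F z) <= m by have := cmod_ge0 (K z); have := cmod_ge0 L; rewrite /m; lra.
have dz := cmod_ge0 (w - z).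
have E : e * cmod (w - z) = (e / (3 * m) * cmod (w - z)) * m + m * cmod (w - z) * (e / (3 * m)) +
  m * (e / (3 * m) * cmod (w - z)) by field; rewrite gt_eqF.
rewrite E; apply: lerD; [apply: lerD|].
- by apply: ler_pM => //; exact: cmod_ge0.
- apply: ler_pM => //; [by rewrite mulr_ge0 ?cmod_ge0|exact: cmod_ge0|].
  by apply: ler_wpM2r.
- by apply: ler_pM => //; exact: cmod_ge0.
Qed.

Lemma cdiff_inv w z : z != w -> cdiff (fun s => (s - w)^-1) z.
Proof.
move=> zw; have zw0 : z - w != 0 by rewrite subr_eq0.
have d0 : 0 < cmod (z - w) / 2 by rewrite divr_gt0// cmod_gt0.
apply: (@cdiff_quad _ _ (- ((z - w) ^- 2)) (2 * cmod (z - w) ^- 3) _ d0) => s hs.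
have h1 : cmod (z - w) / 2 <= cmod (s - w).
  have := cmodB_ge (z - w) (z - s); rewrite (_ : z - w - (z - s) = s - w); last by ring.
  by rewrite -[z - s]opprB cmodN; lra.
have sw : s - w != 0 by apply: cmod_gt0P; exact: lt_le_trans h1.
rewrite (_ : _ - _ - _ = (s - z) ^+ 2 * ((z - w) ^- 2 * (s - w)^-1)); last first.
  by field; rewrite sw zw0.
rewrite cmodM cmodX mulrC; apply: ler_wpM2r; first exact: sqr_ge0.
rewrite cmodM !cmodV cmodX.
have p0 := cmod_gt0 zw0.
rewrite (_ : 2 * cmod (z - w) ^- 3 = cmod (z - w) ^- 2 * (cmod (z - w) / 2)^-1); last first.
  by field; rewrite gt_eqF.
apply: ler_wpM2l; first by rewrite invr_ge0 exprn_ge0// cmod_ge0.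
by rewrite lef_pV2 ?posrE//; exact: lt_le_trans h1.
Qed.

Definition rcont u := forall x (e : R), 0 < e -> exists d : R, 0 < d /\
  forall x', `|x' - x| < d -> cmod (u x' - u x) <= e.

Lemma rcont_meas u : rcont u -> cmeasurable setT u.
Proof.
move=> hu; split; apply: continuous_measurable_fun => x; apply/cvgrPdist_le => e e0;
  have [d [d0 hd]] := hu x e e0; apply/nbhs_ballP; exists d => //= x'; rewrite /ball /= distrC => /hd h;
  rewrite distrC.
- by rewrite -ReB; exact: le_trans (cmod_Re _) h.
- by rewrite -ImB; exact: le_trans (cmod_Im _) h.
Qed.

(** Half-open, so that adjacent segments add up without overlap. *)
Definition seg a b u : Cplx R := cint (fun t => (\1_(`]a, b]%classic) t)%:C * u t).

Lemma indic_itv_rinteg a b : a <= b ->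
  rinteg (\1_(`]a, b]%classic) : R -> R) /\ rint (\1_(`]a, b]%classic) : R -> R) = b - a.
Proof.
move=> ab; have E : (\int[mu]_t (\1_(`]a, b]%classic) t)%:E = (b - a)%:E)%E.
  rewrite integral_indic; [|exact: measurableT|exact: measurable_itv].
  rewrite setIT -[X in X = _]/(mu [set` `]a, b]]) lebesgue_measure_itv /= lte_fin.
  by case: ltP => [_|ba]; rewrite -?EFinB//; congr EFin; lra.
have i : rinteg (\1_(`]a, b]%classic) : R -> R).
  apply/rinteg_ge0P; [by apply: measurable_indic; exact: measurable_itv|by move=> t; rewrite indicE ler0n|].
  by rewrite E ltry.
by split=> //; rewrite /rint /Rintegral E.
Qed.

Lemma seg_bound a b u (M : R) : a <= b -> cmeasurable setT u ->
  (forall t, a <= t <= b -> cmod (u t) <= M) ->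
  cinteg (fun t => (\1_(`]a, b]%classic) t)%:C * u t) /\ cmod (seg a b u) <= M * (b - a).
Proof.
move=> ab mu_ hM; have [i1 e1] := indic_itv_rinteg ab; rewrite -e1 -rintZ//.
apply: cmod_cint_le; last first.
- apply: aeA => t; rewrite cmodM cmodC indicE.
  have [h|h] := boolP (t \in `]a, b]%classic); last by rewrite /= normr0 mul0r mulr0.
  rewrite /= normr1 mul1r mulr1; apply: hM; move: h; rewrite inE /= in_itv /= => /andP[h1 ->].
  by rewrite ltW.
- exact: rintegZ.
- by apply: cmeas_mul => //; apply: cmeas_real; apply: measurable_indic; exact: measurable_itv.
Qed.

Lemma rcont_bounded a b u : a <= b -> rcont u -> exists M : R, forall t, a <= t <= b -> cmod (u t) <= M.
Proof.
move=> ab hu.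
have cu : {within `[a, b], continuous (fun t => cmod (u t))}.
  apply: continuous_subspaceT => x; apply/cvgrPdist_le => e e0.
  have [d [d0 hd]] := hu x e e0; apply/nbhs_ballP; exists d => //= x'; rewrite /ball /= distrC => /hd h.
  have := cmodB_ge (u x') (u x); have := cmodB_ge (u x) (u x'); rewrite -[u x - u x']opprB cmodN.
  by rewrite ler_norml; move: h; lra.
have [t0 _ h] := EVT_max ab cu; exists (cmod (u t0)) => t ht; apply: h.
by rewrite in_itv /=.
Qed.

Lemma seg_integ a b u : a <= b -> rcont u -> cinteg (fun t => (\1_(`]a, b]%classic) t)%:C * u t).
Proof.
move=> ab hu; have [M hM] := rcont_bounded ab hu.
by have [] := seg_bound ab (rcont_meas hu) hM.
Qed.

Lemma seg_split a m b u : a <= m -> m <= b -> rcont u -> seg a b u = seg a m u + seg m b u.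
Proof.
move=> am mb hu; rewrite /seg -cintD; [|exact: seg_integ|exact: seg_integ].
congr cint; apply/funext => t; rewrite -mulrDl -rmorphD; congr (_%:C * _); rewrite !indicE.
rewrite (_ : (t \in `]a, b]%classic) = (a < t <= b)); last by apply/idP/idP; rewrite inE /= in_itv.
rewrite (_ : (t \in `]a, m]%classic) = (a < t <= m)); last by apply/idP/idP; rewrite inE /= in_itv.
rewrite (_ : (t \in `]m, b]%classic) = (m < t <= b)); last by apply/idP/idP; rewrite inE /= in_itv.
case: (leP t m) => tm /=; rewrite ?andbF ?andbT ?addr0 ?add0r.
  by rewrite (le_trans tm mb) andbT.
by rewrite (le_lt_trans am tm).
Qed.

Lemma segB a b u v : a <= b -> rcont u -> rcont v -> seg a b u - seg a b v = seg a b (fun t => u t - v t).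
Proof.
move=> ab hu hv; rewrite /seg -cintB; [|exact: seg_integ|exact: seg_integ].
by congr cint; apply/funext => t; rewrite mulrBr.
Qed.

(** The contour integral over the boundary of the rectangle [[a, b] x [c, d]], counterclockwise. *)
Definition bdry G a b c d : Cplx R :=
  (seg a b (fun x => G (x +i* c)) - seg a b (fun x => G (x +i* d))) +
  I * (seg c d (fun y => G (b +i* y)) - seg c d (fun y => G (a +i* y))).

Section Rectangle.
Context (G : Cplx R -> Cplx R) (Gc : forall z, ccont G z).

Lemma hor_cont y : rcont (fun x => G (x +i* y)).
Proof.
move=> x e e0; have [d [d0 hd]] := Gc (x +i* y) e0; exists d; split=> // x' hx; apply: hd.
by rewrite (_ : _ - _ = (x' - x)%:C) ?cmodC//; apply: complex_ext; rewrite ?ReB ?ImB /= ?subrr.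
Qed.

Lemma ver_cont x : rcont (fun y => G (x +i* y)).
Proof.
move=> y e e0; have [d [d0 hd]] := Gc (x +i* y) e0; exists d; split=> // y' hy; apply: hd.
rewrite (_ : _ - _ = I * (y' - y)%:C); first by rewrite cmodM cmod_i mul1r cmodC.
apply: complex_ext.
  by rewrite ReB ReM ReC ImC /=; ring.
by rewrite ImB ImM ReC ImC /=; ring.
Qed.

Lemma bdry_vsplit a m b c d : a <= m -> m <= b ->
  bdry G a b c d = bdry G a m c d + bdry G m b c d.
Proof.
move=> am mb; rewrite /bdry (seg_split am mb (hor_cont c)) (seg_split am mb (hor_cont d)).
move: (seg a m _) (seg m b _) (seg a m _) (seg m b _) (seg c d _) (seg c d _) (seg c d _).
by move=> p1 p2 p3 p4 p5 p6 p7; ring.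
Qed.

Lemma bdry_hsplit a b c m d : c <= m -> m <= d ->
  bdry G a b c d = bdry G a b c m + bdry G a b m d.
Proof.
move=> am mb; rewrite /bdry (seg_split am mb (ver_cont a)) (seg_split am mb (ver_cont b)).
move: (seg c m _) (seg m d _) (seg c m _) (seg m d _) (seg a b _) (seg a b _) (seg a b _).
by move=> p1 p2 p3 p4 p5 p6 p7; ring.
Qed.

End Rectangle.

Lemma bdry_affine (al be : Cplx R) a b c d : a <= b -> c <= d ->
  bdry (fun z => al + be * z) a b c d = 0.
Proof.
move=> ab cd.
have Gc z : ccont (fun z => al + be * z) z.
  apply: cdiff_ccont; apply: (@cdiff_quad _ _ be 0 1) => // w _.
  by rewrite (_ : _ - _ = 0) ?cmod0 ?mul0r//; ring.
rewrite /bdry (segB ab (hor_cont Gc c) (hor_cont Gc d)) (segB cd (ver_cont Gc b) (ver_cont Gc a)).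
have cst a' b' (k : Cplx R) : a' <= b' -> seg a' b' (fun=> k) = (b' - a')%:C * k.
  move=> h; have [i1 e1] := indic_itv_rinteg h.
  have ic : cinteg (fun t => (\1_(`]a', b']%classic) t)%:C).
    apply: cinteg_le i1 _; first by apply: cmeas_real; apply: measurable_indic; exact: measurable_itv.
    by move=> t; rewrite cmodC ger0_norm// indicE ler0n.
  rewrite /seg (_ : (fun t => _) = fun t => k * (\1_(`]a', b']%classic) t)%:C); last by apply/funext => t; rewrite mulrC.
  rewrite (cintZ _ ic) mulrC; congr (_ * _); apply: complex_ext => /=; first exact: e1.
  exact: rint0.
rewrite (_ : (fun t => _) = fun=> be * (I * (c - d)%:C)); last first.
  apply/funext => t; rewrite opprD addrACA subrr add0r -mulrBr; congr (_ * _).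
  by apply: complex_ext; [rewrite ReB ReM ReC ImC /=|rewrite ImB ImM ReC ImC /=]; ring.
rewrite (_ : (fun t => al + be * (b +i* t) - _) = fun=> be * (b - a)%:C); last first.
  apply/funext => t; rewrite opprD addrACA subrr add0r -mulrBr; congr (_ * _).
  by apply: complex_ext; [rewrite ReB|rewrite ImB] => /=; ring.
rewrite !cst// -[c - d]opprB rmorphN /=; ring.
Qed.

Lemma bdryB G K a b c d : (forall z, ccont G z) -> (forall z, ccont K z) -> a <= b -> c <= d ->
  bdry G a b c d - bdry K a b c d = bdry (fun z => G z - K z) a b c d.
Proof.
move=> hG hK ab cd; rewrite /bdry.
rewrite -(segB ab (hor_cont hG c) (hor_cont hK c)) -(segB ab (hor_cont hG d) (hor_cont hK d)).
rewrite -(segB cd (ver_cont hG b) (ver_cont hK b)) -(segB cd (ver_cont hG a) (ver_cont hK a)).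
move: (seg a b _) (seg a b _) (seg a b _) (seg a b _) (seg c d _) (seg c d _) (seg c d _) (seg c d _).
by move=> p1 p2 p3 p4 p5 p6 p7 p8; ring.
Qed.

Lemma bdry_bound G a b c d (M : R) : (forall z, ccont G z) -> a <= b -> c <= d ->
  (forall x y, a <= x <= b -> c <= y <= d -> cmod (G (x +i* y)) <= M) ->
  cmod (bdry G a b c d) <= M * (2 * ((b - a) + (d - c))).
Proof.
move=> hG ab cd hM.
have acc : c <= c <= d by rewrite lexx. 
have add : c <= d <= d by rewrite lexx cd.
have bb : a <= b <= b by rewrite lexx ab.
have aa : a <= a <= b by rewrite lexx.
have [_ h1] := seg_bound ab (rcont_meas (hor_cont hG c)) (fun x hx => hM x c hx acc).
have [_ h2] := seg_bound ab (rcont_meas (hor_cont hG d)) (fun x hx => hM x d hx add).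
have [_ h3] := seg_bound cd (rcont_meas (ver_cont hG b)) (fun y hy => hM b y bb hy).
have [_ h4] := seg_bound cd (rcont_meas (ver_cont hG a)) (fun y hy => hM a y aa hy).
rewrite /bdry; move: h1 h2 h3 h4.
move: (seg a b _) (seg a b _) (seg c d _) (seg c d _) => p1 p2 p3 p4 h1 h2 h3 h4.
apply: le_trans (cmodD _ _) _; rewrite cmodM cmod_i mul1r.
have := cmodD p2 (- p1); have := cmodD p4 (- p3); rewrite !cmodN; lra.
Qed.

Lemma goursat_step G a c (w h : R) : (forall z, ccont G z) -> 0 <= w -> 0 <= h ->
  exists p : R * R, [/\ p.1 = a \/ p.1 = a + w / 2, p.2 = c \/ p.2 = c + h / 2 &
   cmod (bdry G a (a + w) c (c + h)) <= 4 * cmod (bdry G p.1 (p.1 + w / 2) p.2 (p.2 + h / 2))].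
Proof.
move=> hG w0 h0.
have E (x y : R) : x + y = x + y / 2 + y / 2 by lra.
have a1 : a <= a + w / 2 by lra. have a2 : a + w / 2 <= a + w by lra.
have c1 : c <= c + h / 2 by lra. have c2 : c + h / 2 <= c + h by lra.
rewrite (bdry_vsplit hG _ _ a1 a2) (bdry_hsplit hG _ _ c1 c2) (bdry_hsplit hG (a + w / 2) _ c1 c2).
rewrite (E a w) (E c h).
set P1 := bdry G a _ c _; set P2 := bdry G a _ (c + h / 2) _.
set P3 := bdry G (a + w / 2) _ c _; set P4 := bdry G (a + w / 2) _ (c + h / 2) _.
have hs : cmod (P1 + P2 + (P3 + P4)) <= cmod P1 + cmod P2 + (cmod P3 + cmod P4).
  by apply: le_trans (cmodD _ _) _; apply: lerD; exact: cmodD.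
have key (S q1 q2 q3 q4 : R) : S <= q1 + q2 + (q3 + q4) -> [\/ S <= 4 * q1, S <= 4 * q2, S <= 4 * q3 | S <= 4 * q4].
  move=> hS; have [l1|l1] := leP S (4 * q1); first by constructor 1.
  have [l2|l2] := leP S (4 * q2); first by constructor 2.
  have [l3|l3] := leP S (4 * q3); first by constructor 3.
  by constructor 4; clear -hS l1 l2 l3; lra.
have [l|l|l|l] := key _ _ _ _ _ hs.
- by exists (a, c); split=> //=; left.
- by exists (a, c + h / 2); split=> //=; [left|right].
- by exists (a + w / 2, c); split=> //=; [right|left].
- by exists (a + w / 2, c + h / 2); split=> //=; right.
Qed.

Lemma dist_le3 (A t t0 b : R) : A <= t -> t <= A + b -> - (2 * b) <= t0 - A -> t0 - A <= 2 * b ->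
  `|t - t0| <= 3 * b.
Proof. by move=> *; rewrite ler_norml; apply/andP; split; lra. Qed.

(** Repeated quartering: some quarter keeps at least a fourth of the integral. Near the limit point
    [G] is affine up to [e] times the distance, and affine functions integrate to 0. Continuity is
    asked in the plane and differentiability only from height [c] upwards, to fit functions extended
    by clamping. *)
Lemma goursat G a b c d : (forall z, ccont G z) -> (forall z, c <= Im z -> cdiff G z) ->
  a <= b -> c <= d -> bdry G a b c d = 0.
Proof.
move=> hG dG ab cd; apply: cmod_eq0; apply/eqP; rewrite eq_le cmod_ge0 andbT.
pose w := b - a; pose h := d - c.
have w0 : 0 <= w by rewrite /w; lra. have h0 : 0 <= h by rewrite /h; lra.
pose q (n : nat) : R := 2^-1 ^+ n.
have q0 n : 0 <= q n by rewrite exprn_ge0// invr_ge0.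
have qS n : q n.+1 = q n / 2 by rewrite /q exprSr.
have q2 n x : x * q n / 2 = x * q n.+1 by rewrite qS mulrA.
have /choice[f hf] : forall np : nat * (R * R), exists p : R * R,
   [/\ p.1 = np.2.1 \/ p.1 = np.2.1 + w * q np.1.+1, p.2 = np.2.2 \/ p.2 = np.2.2 + h * q np.1.+1 &
   cmod (bdry G np.2.1 (np.2.1 + w * q np.1) np.2.2 (np.2.2 + h * q np.1)) <=
   4 * cmod (bdry G p.1 (p.1 + w * q np.1.+1) p.2 (p.2 + h * q np.1.+1))].
  move=> [n [a' c']] /=.
  have := @goursat_step G a' c' (w * q n) (h * q n) hG (mulr_ge0 w0 (q0 n)) (mulr_ge0 h0 (q0 n)).
  by rewrite !q2.
pose p := fix p n : R * R := if n is m.+1 then f (m, p m) else (a, c).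
have pS n := hf (n, p n).
have s1 n : `|(p n.+1).1 - (p n).1| <= w * 2^-1 ^+ n.
  have [[->|->] _ _] := pS n; rewrite /=.
    by rewrite subrr normr0 mulr_ge0.
  rewrite addrC addKr ger0_norm; last exact: mulr_ge0.
  by apply: ler_wpM2l => //; rewrite qS -/(q n); have := q0 n; lra.
have s2 n : `|(p n.+1).2 - (p n).2| <= h * 2^-1 ^+ n.
  have [_ [->|->] _] := pS n; rewrite /=.
    by rewrite subrr normr0 mulr_ge0.
  rewrite addrC addKr ger0_norm; last exact: mulr_ge0.
  by apply: ler_wpM2l => //; rewrite qS -/(q n); have := q0 n; lra.
have [x0 hx0] := geo_real s1; have [y0 hy0] := geo_real s2.
have pc n : c <= (p n).2.
  elim: n => [//|n IH]; have [_ [->|->] _] := pS n => //=.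
  by rewrite (le_trans IH)// lerDl mulr_ge0.
have y0c : c <= y0.
  apply/ler_addgt0Pr => e e0.
  have [N hN] := @geo_lt R 2^-1 (2 * h) e (ltac:(by rewrite invr_ge0 ler0n /= invf_lt1// ltr1n)) e0.
  have := hN N (leqnn _); have := hy0 N; have := pc N; rewrite ler_norml => p1 /andP[p2 p3] p4; lra.
have hA n : cmod (bdry G a b c d) <= 4 ^+ n * cmod (bdry G (p n).1 ((p n).1 + w * q n) (p n).2 ((p n).2 + h * q n)).
  elim: n => [|n IH].
    by rewrite expr0 mul1r /= /q expr0 !mulr1 /w /h !subrKC.
  apply: le_trans IH _; rewrite exprSr -mulrA; apply: ler_wpM2l; first exact: exprn_ge0.
  by have [_ _ ] := pS n.
have [L hL] := dG (x0 +i* y0) y0c.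
apply/ler_addgt0Pr => e' e'0; rewrite add0r.
pose s := w + h; have ss0 : 0 <= s by rewrite addr_ge0.
(* The perimeter [2 s q] times the distance bound [3 s q] gives [6 s^2 q^2], and [4^N q^2 = 1]. *)
have k0 : 0 < 6 * s ^+ 2 + 1 by have := sqr_ge0 s; lra.
have e0 : 0 < e' / (6 * s ^+ 2 + 1) by rewrite divr_gt0.
set e := e' / _ in e0; have [dl [dl0 hdl]] := hL _ e0.
have [N hN] := @geo_lt R 2^-1 (3 * s) dl (ltac:(by rewrite invr_ge0 ler0n /= invf_lt1// ltr1n)) dl0.
have {hN}hN := hN N (leqnn _); rewrite -/(q N) in hN.
have kb : cmod (bdry G (p N).1 ((p N).1 + w * q N) (p N).2 ((p N).2 + h * q N)) <=
   e * (3 * s * q N) * (2 * (s * q N)).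
  set A1 := (p N).1; set C1 := (p N).2.
  have wq : 0 <= w * q N by exact: mulr_ge0. have hq : 0 <= h * q N by exact: mulr_ge0.
  have i1 : A1 <= A1 + w * q N by rewrite lerDl. have i2 : C1 <= C1 + h * q N by rewrite lerDl.
  pose Af z := (G (x0 +i* y0) - L * (x0 +i* y0)) + L * z.
  have Ac z : ccont Af z.
    apply: cdiff_ccont; apply: (@cdiff_quad _ _ L 0 1) => // z' _.
    by rewrite (_ : _ - _ = 0) ?cmod0 ?mul0r// /Af; ring.
  have -> : bdry G A1 (A1 + w * q N) C1 (C1 + h * q N) = bdry (fun z => G z - Af z) A1 (A1 + w * q N) C1 (C1 + h * q N).
    by rewrite -bdryB// bdry_affine// subr0.
  have Dc z : ccont (fun z => G z - Af z) z.
    move=> e1 e10; have e12 : 0 < e1 / 2 by rewrite divr_gt0.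
    have [g1 [g10 hg1]] := hG z _ e12; have [g2 [g20 hg2]] := Ac z _ e12.
    exists (Num.min g1 g2); split; first by rewrite lt_min g10.
    move=> z'; rewrite lt_min => /andP[/hg1 u1 /hg2 u2].
    rewrite (_ : _ - _ = (G z' - G z) - (Af z' - Af z)); last by ring.
    by apply: le_trans (cmodD _ _) _; rewrite cmodN; lra.
  have := @bdry_bound _ _ _ _ _ (e * (3 * s * q N)) Dc i1 i2.
  rewrite (_ : A1 + w * q N - A1 + (C1 + h * q N - C1) = s * q N); last by rewrite /s; ring.
  apply=> x y /andP[x1 x2] /andP[y1 y2].
  have hr : cmod ((x +i* y) - (x0 +i* y0)) <= 3 * s * q N.
    apply: le_trans (cmod_le_ReIm _) _; rewrite ReB ImB /=.
    have := hx0 N; have := hy0 N; rewrite -/(q N) -/A1 -/C1 -!(mulrA 2) !ler_norml => /andP[u1 u2] /andP[u3 u4].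
    rewrite (_ : 3 * s * q N = 3 * (w * q N) + 3 * (h * q N)); last by rewrite /s; ring.
    by apply: lerD; [exact: (@dist_le3 A1)|exact: (@dist_le3 C1)].
  have := hdl (x +i* y) (le_lt_trans hr hN).
  rewrite (_ : G (x +i* y) - Af (x +i* y) = G (x +i* y) - G (x0 +i* y0) - L * ((x +i* y) - (x0 +i* y0))); last first.
    by rewrite /Af; move: (x +i* y) (x0 +i* y0) => z1 z2; ring.
  by move=> /le_trans; apply; apply: ler_wpM2l => //; exact: ltW.
apply: le_trans (hA N) _.
apply: le_trans (ler_wpM2l (exprn_ge0 N (ler0n R 4)) kb) _.
have -> : 4 ^+ N * (e * (3 * s * q N) * (2 * (s * q N))) = e * (6 * s ^+ 2) * (4 ^+ N * (q N * q N)) by ring.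
have -> : 4 ^+ N * (q N * q N) = 1.
  by rewrite /q -!exprMn (_ : 4 * (2^-1 * 2^-1) = 1) ?expr1n//; lra.
rewrite mulr1 /e -[leRHS](divfK (lt0r_neq0 k0)); apply: ler_wpM2l; first by rewrite divr_ge0// ltW.
by rewrite lerDl.
Qed.

End Goursat.

(** * Cauchy's theorem in the half-plane *)

Section HalfPlaneCauchy.
Context {R : realType}.
Local Notation mu := (@lebesgue_measure R).
Local Notation I := ('i%C : Cplx R).
Implicit Types (z w v : Cplx R) (x y c d e : R).

Lemma kz_far w (e : R) : 0 < e -> exists N : R, forall x, N <= `|x| -> cmod (kz w x) ^+ 2 <= e.
Proof.
move=> e0; exists (`|Re w| + e^-1 + 1) => x hx.
have e1 : 0 < e^-1 by rewrite invr_gt0.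
have h : e^-1 + 1 <= `|x - Re w|.
  by have := lerB_dist x (Re w); lra.
rewrite kz_sq -[leRHS]invrK.
have h2 : e^-1 <= (x - Re w) ^+ 2 + Im w ^+ 2.
  have := sqr_mono (ltW (ltr_wpDr ler01 e1)) h; rewrite real_normK ?num_real//.
  by have := sqr_ge0 (Im w); nra.
by rewrite lef_pV2 ?posrE//; exact: lt_le_trans h2.
Qed.

Context (F : Cplx R -> Cplx R) (M : R) (w v : Cplx R)
  (dF : forall z, 0 < Im z -> cdiff F z) (bF : forall z, 0 < Im z -> cmod (F z) <= M)
  (w0 : Im w < 0) (v0 : Im v < 0).

(** Two poles make [K] decay quadratically, so that a bounded [F] times [K] is integrable on
    horizontal lines, with the majorant [B] at every height. *)
Let K z : Cplx R := (z - w)^-1 * (z - v)^-1.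
Let G z : Cplx R := F z * K z.
Let B x : R := M * (2^-1 * (cmod (kz w x) ^+ 2 + cmod (kz v x) ^+ 2)).

Lemma M0 : 0 <= M.
Proof. by apply: le_trans (cmod_ge0 (F I)) _; apply: bF; rewrite /= ltr01. Qed.

Lemma dK z : 0 <= Im z -> cdiff K z.
Proof.
move=> z0; apply: cdiff_mul; apply: cdiff_inv; apply/eqP => e; [move: w0|move: v0]; rewrite -e; lra.
Qed.

Lemma dG z : 0 < Im z -> cdiff G z.
Proof. by move=> z0; apply: cdiff_mul; [exact: dF|exact: dK (ltW z0)]. Qed.

Lemma kz_shift (x y : R) (u : Cplx R) : ((x +i* y) - u)^-1 = kz (u - (0 +i* y)) x.
Proof.
rewrite /kz; congr (_^-1); apply: complex_ext.
  by rewrite !ReB /=; ring.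
by rewrite !ImB /=; ring.
Qed.

Lemma kz_le (x y : R) (u : Cplx R) : 0 <= y -> Im u < 0 -> cmod (kz (u - (0 +i* y)) x) ^+ 2 <= cmod (kz u x) ^+ 2.
Proof.
move=> y0 u0; rewrite !kz_sq.
have -> : Re (u - (0 +i* y)) = Re u by rewrite ReB /=; ring.
have -> : Im (u - (0 +i* y)) = Im u - y by rewrite ImB /=; ring.
have i2 : 0 < Im u ^+ 2 by rewrite exprn_even_gt0//= lt_eqF.
have i3 : Im u ^+ 2 <= (Im u - y) ^+ 2 by nra.
have s2 := sqr_ge0 (x - Re u).
by rewrite lef_pV2 ?posrE; [exact: lerD|apply: ltr_wpDl => //; exact: lt_le_trans i3|exact: ltr_wpDl].
Qed.

Lemma K_le x y : 0 <= y -> cmod (K (x +i* y)) <=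
  2^-1 * (cmod (kz (w - (0 +i* y)) x) ^+ 2 + cmod (kz (v - (0 +i* y)) x) ^+ 2).
Proof.
move=> y0; rewrite /K !kz_shift cmodM.
have := sqr_ge0 (cmod (kz (w - (0 +i* y)) x) - cmod (kz (v - (0 +i* y)) x)).
by move: (cmod _) (cmod _) => p q; nra.
Qed.

Lemma G_le x y : 0 < y -> cmod (G (x +i* y)) <= B x.
Proof.
move=> y0; rewrite /G cmodM; apply: ler_pM; [exact: cmod_ge0|exact: cmod_ge0|exact: bF|].
apply: le_trans (K_le x (ltW y0)) _; apply: ler_wpM2l; first by rewrite invr_ge0.
by apply: lerD; apply: kz_le => //; exact: ltW.
Qed.

Lemma nz (u : Cplx R) : Im u < 0 -> Im u != 0.
Proof. by move=> u0; rewrite lt_eqF. Qed.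

Lemma iB : rinteg B.
Proof.
by apply: rintegZ; apply: rintegZ; apply: rintegD; apply: L2_sq; have [] := kz_L2 (nz w0); have [] := kz_L2 (nz v0).
Qed.

(** Freezing the height below [c] extends [G] to a function that is continuous in the whole plane,
    as [goursat] demands. *)
Let clamp (c : R) z : Cplx R := Re z +i* Num.max (Im z) c.

Lemma clamp_lip c z z' : cmod (clamp c z - clamp c z') <= cmod (z - z').
Proof.
rewrite -ler_sqr ?nnegrE ?cmod_ge0// !sqr_cmod !ReB !ImB /=; apply: lerD => //.
rewrite -[leLHS]real_normK ?num_real// -[leRHS]real_normK ?num_real//; apply: sqr_mono => //.
by rewrite /Num.max; case: ltP => h1; case: ltP => h2; rewrite ?subrr ?normr0// !ler_norml;
  have := ler_norm (Im z - Im z'); have := ler_norm (- (Im z - Im z')); rewrite normrN; lra.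
Qed.

Let Gt c z := G (clamp c z).

Lemma Gt_cont c : 0 < c -> forall z, ccont (Gt c) z.
Proof.
move=> c0 z e e0; have cz : 0 < Im (clamp c z) by rewrite /= lt_max c0 orbT.
have [d [d0 hd]] := cdiff_ccont (dG cz) e0; exists d; split=> // z' hz; apply: hd.
exact: le_lt_trans (clamp_lip _ _ _) hz.
Qed.

Lemma GtE c x y : c <= y -> Gt c (x +i* y) = G (x +i* y).
Proof. by move=> cy; rewrite /Gt /clamp /= max_l. Qed.

Lemma Gt_diff c z : 0 < c -> c < Im z -> cdiff (Gt c) z.
Proof.
move=> c0 cz; have [L hL] := dG (lt_trans c0 cz); exists L => e e0.
have [d [d0 hd]] := hL e e0; exists (Num.min d (Im z - c)); split; first by rewrite lt_min d0 subr_gt0.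
move=> z'; rewrite lt_min => /andP[h1 h2].
have E u : c <= Im u -> Gt c u = G u by case: u => x y /= h; exact: GtE.
rewrite !E; [exact: hd|exact: ltW|].
by have := le_lt_trans (cmod_Im _) h2; rewrite ImB ltr_norml; lra.
Qed.

Lemma line_meas y : 0 < y -> cmeasurable setT (fun x => G (x +i* y)).
Proof.
move=> y0; rewrite (_ : (fun x => _) = fun x => Gt y (x +i* y)); last by apply/funext => x; rewrite GtE.
by apply: rcont_meas; apply: hor_cont; exact: Gt_cont.
Qed.

Lemma seg_cvg y (e : R) : 0 < y -> 0 < e -> exists N, forall n : nat, (N <= n)%N ->
  cmod (seg (- n%:R) n%:R (fun x => G (x +i* y)) - cint (fun x => G (x +i* y))) < e.
Proof.
move=> y0 e0; have := @dominated_cint R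
  (fun n x => (\1_(`](- n%:R), n%:R]%classic) x)%:C * G (x +i* y)) (fun x => G (x +i* y)) B.
move=> /(_ _ (line_meas y0) iB) h.
have /cvgr_eps/(_ e e0)[N hN] : cmod (seg (- n%:R) n%:R (fun x => G (x +i* y)) - cint (fun x => G (x +i* y))) @[n --> \oo] --> 0.
  apply: h.
  - move=> n; apply: cmeas_mul; last exact: line_meas.
    by apply: cmeas_real; apply: measurable_indic; exact: measurable_itv.
  - apply: aeA => x; apply/cvgr_eps => e' e'0; exists (Num.truncn `|x|).+1 => n hn.
    have xn : `|x| < n%:R by apply: lt_le_trans (truncnS_gt _) _; rewrite ler_nat.
    rewrite indicE mem_set; first by rewrite /= mul1r subrr cmod0 subr0 normr0.
    by move: xn; rewrite ltr_norml /= in_itv /= => /andP[-> /ltW].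
  - move=> n; apply: aeA => x; rewrite cmodM cmodC; apply: le_trans (G_le x y0).
    rewrite ler_piMl ?cmod_ge0// indicE; by case: (_ \in _); rewrite /= ?normr1 ?normr0 ?ler01.
by exists N => n /hN; rewrite subr0 ger0_norm ?cmod_ge0.
Qed.

(** Goursat's theorem on the rectangle between the two heights, with vertical sides at [-n] and [n]
    whose contribution tends to 0 by the decay of [K]. *)
Lemma line_const c d : 0 < c -> c <= d -> cint (fun x => G (x +i* c)) = cint (fun x => G (x +i* d)).
Proof.
move=> c0 cd; have d0 := lt_le_trans c0 cd.
apply/eqP; rewrite -subr_eq0; apply/eqP; apply: cmod_eq0; apply/eqP; rewrite eq_le cmod_ge0 andbT.
apply/ler_addgt0Pr => e e0; rewrite add0r.
have e4 : 0 < e / 4 by rewrite divr_gt0.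
have [N1 h1] := seg_cvg c0 e4; have [N2 h2] := seg_cvg d0 e4.
pose m := (M + 1) * (d - c + 1); have m0 : 0 < m.
  by rewrite mulr_gt0//; have := M0; lra.
have em : 0 < e / (4 * m) by rewrite divr_gt0// mulr_gt0.
have [X1 k1] := kz_far w em; have [X2 k2] := kz_far v em.
pose n := maxn (maxn N1 N2) (maxn (Num.truncn `|X1|).+1 (Num.truncn `|X2|).+1).
have {h1}h1 := h1 n (leq_trans (leq_maxl N1 N2) (leq_maxl _ _)).
have {h2}h2 := h2 n (leq_trans (leq_maxr N1 N2) (leq_maxl _ _)).
have n1 : X1 <= n%:R.
  apply: le_trans (ler_norm _) _; apply: le_trans (ltW (truncnS_gt _)) _; rewrite ler_nat.
  by apply: leq_trans (leq_maxr _ _); exact: leq_maxl.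
have n2 : X2 <= n%:R.
  apply: le_trans (ler_norm _) _; apply: le_trans (ltW (truncnS_gt _)) _; rewrite ler_nat.
  by apply: leq_trans (leq_maxr _ _); exact: leq_maxr.
have Bn x : `|x| = n%:R -> B x <= M * (e / (4 * m)).
  move=> hx; rewrite /B; apply: ler_wpM2l; first exact: M0.
  by have := k1 x (ltac:(by rewrite hx)); have := k2 x (ltac:(by rewrite hx)); lra.
(* Clamping at [c / 2] instead of [c] keeps [G] differentiable on the bottom side too. *)
have c20 : 0 < c / 2 by rewrite divr_gt0.
have c2c : c / 2 <= c by rewrite ler_piMr ?(ltW c0)// invf_le1// ler1n.
have c2d := le_trans c2c cd.
have Gd z : c <= Im z -> cdiff (Gt (c / 2)) z by move=> hz; apply: Gt_diff => //; lra.
have nn : - n%:R <= n%:R :> R by apply: le_trans (ler0n R n); rewrite oppr_le0 ler0n.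
have := goursat (Gt_cont c20) Gd nn cd; rewrite /bdry.
have -> : (fun x => Gt (c / 2) (x +i* c)) = fun x => G (x +i* c) by apply/funext => x; rewrite GtE.
have -> : (fun x => Gt (c / 2) (x +i* d)) = fun x => G (x +i* d) by apply/funext => x; rewrite GtE.
have side x : `|x| = n%:R -> cmod (seg c d (fun y => Gt (c / 2) (x +i* y))) <= e / 4.
  move=> hx; have mside := rcont_meas (ver_cont (Gt_cont c20) x).
  have [|_ h] := @seg_bound R c d _ (M * (e / (4 * m))) cd mside.
    move=> y /andP[cy yd]; rewrite GtE; last exact: le_trans c2c cy.
    by apply: le_trans (G_le x _) (Bn x hx); exact: lt_le_trans c0 cy.
  apply: le_trans h _.
  have -> : M * (e / (4 * m)) * (d - c) = (e / (4 * m)) * (M * (d - c)) by ring.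
  have -> : e / 4 = e / (4 * m) * m by field; rewrite gt_eqF.
  apply: ler_wpM2l; first exact: ltW.
  by rewrite /m; apply: ler_pM; rewrite ?M0 ?subr_ge0// lerDl.
have s1 := side n%:R (ger0_norm (ler0n _ _)).
have s2 := side (- n%:R) (ltac:(by rewrite normrN ger0_norm)).
move: h1 h2 s1 s2; move: (seg _ _ _) (seg _ _ _) (seg _ _ _) (seg _ _ _) (cint _) (cint _).
move=> p1 p2 p3 p4 q1 q2 g1 g2 g3 g4 E.
have E' : p4 - p3 = - (I * (p2 - p1)) by apply/eqP; rewrite -addr_eq0 E.
rewrite (_ : q2 - q1 = (p3 - q1) - (p4 - q2) + (p4 - p3)); last by ring.
rewrite E'; apply: le_trans (cmodD _ _) _; rewrite cmodN cmodM cmod_i mul1r.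
have := cmodD (p3 - q1) (- (p4 - q2)); have := cmodD p2 (- p1); rewrite !cmodN.
move: g1 g2 g3 g4; move: (cmod p1) (cmod p2) (cmod (p3 - q1)) (cmod (p4 - q2)) (cmod (p2 - p1)) (cmod _).
by move=> r1 r2 r3 r4 r5 r6; lra.
Qed.

(** The integral is independent of the height and at height [d] is at most [M pi / d]. *)
Lemma line_zero c : 0 < c -> cint (fun x => G (x +i* c)) = 0.
Proof.
move=> c0; apply: cmod_eq0; apply/eqP; rewrite eq_le cmod_ge0 andbT.
apply/ler_addgt0Pr => e e0; rewrite add0r.
have pip := pi_gt0 R.
pose d := c + M * pi / e.
have k0 : 0 <= M * pi / e by rewrite divr_ge0 ?mulr_ge0 ?M0 ?ltW.
have cd : c <= d by rewrite /d lerDl.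
have d0 := lt_le_trans c0 cd.
rewrite (line_const c0 cd).
have nzd (u : Cplx R) : Im u < 0 -> Im (u - (0 +i* d)) = Im u - d.
  by move=> _; rewrite ImB /=; ring.
have nw : Im (w - (0 +i* d)) != 0 by rewrite nzd// lt_eqF//; have := w0; lra.
have nv : Im (v - (0 +i* d)) != 0 by rewrite nzd// lt_eqF//; have := v0; lra.
have [Lw ew] := kz_L2 nw; have [Lv ev] := kz_L2 nv.
have iw := L2_sq Lw; have iv := L2_sq Lv.
have [||_ h] := @cmod_cint_le R (fun x => G (x +i* d)) (fun x => M *
   (2^-1 * (cmod (kz (w - (0 +i* d)) x) ^+ 2 + cmod (kz (v - (0 +i* d)) x) ^+ 2))) (line_meas d0).
- by apply: rintegZ; apply: rintegZ; exact: rintegD.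
- apply: aeA => x; rewrite /G cmodM; apply: ler_pM; [exact: cmod_ge0|exact: cmod_ge0|exact: bF|].
  exact: (K_le x (ltW d0)).
apply: le_trans h _; rewrite (rintZ _ (rintegZ _ (rintegD iw iv))) (rintZ _ (rintegD iw iv)) (rintD iw iv) ew ev.
rewrite !nzd//.
have dd (u : Cplx R) : Im u < 0 -> pi / `|Im u - d| <= pi / d.
  move=> u0; apply: ler_wpM2l; first exact: ltW.
  rewrite lef_pV2 ?posrE//; first by rewrite ltr0_norm; lra.
  by rewrite normr_gt0 lt_eqF//; lra.
apply: (@le_trans _ _ (M * (pi / d))).
  apply: ler_wpM2l; first exact: M0.
  by have := dd _ w0; have := dd _ v0; move: (pi / d) (pi / `|Im w - d|) (pi / `|Im v - d|) => r1 r2 r3; lra.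
rewrite mulrA ler_pdivrMr// (_ : e * d = e * c + M * pi).
  by rewrite lerDr mulr_ge0// ltW.
by rewrite /d; move: (pi : R) => p; field; rewrite gt_eqF.
Qed.

(** The heights [1 / (m + 1)] tend to 0 inside every cone, and [B] dominates. *)
Lemma boundary_zero (f : R -> Cplx R) : Linfty f ->
  {ae mu, forall x, nontangential_limit Plus F x (f x)} ->
  cint (fun t => f t * (kz w t * kz v t)) = 0.
Proof.
move=> [mf [N hN]] hl.
pose c (m : nat) : R := m.+1%:R^-1.
have c0 m : 0 < c m by rewrite invr_gt0.
apply: cmod_eq0.
have mfk : cmeasurable setT (fun t => f t * (kz w t * kz v t)).
  by apply: cmeas_mul => //; apply: cmeas_mul; exact: cmeas_kz.
have h : cmod (cint (fun x => G (x +i* c m)) - cint (fun t => f t * (kz w t * kz v t))) @[m --> \oo] --> 0.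
  apply: (@dominated_cint R (fun m x => G (x +i* c m)) _ B) => //.
  - by move=> m; exact: line_meas.
  - exact: iB.
  - apply: (aeS hl) => x /ntl_eps hx; apply/cvgr_eps => e e0.
    have K0 : K (x%:C) = kz w x * kz v x by [].
    have cK := cdiff_ccont (dK (lexx 0 : 0 <= Im (x%:C : Cplx R))).
    pose m1 := cmod (kz w x * kz v x) + M + 1.
    have m10 : 0 < m1 by have := cmod_ge0 (kz w x * kz v x); have := M0; rewrite /m1; lra.
    have em : 0 < e / (4 * m1) by rewrite divr_gt0// mulr_gt0.
    have [d1 [d10 h1]] := hx 1 _ ltr01 em; have [d2 [d20 h2]] := cK _ em.
    have [N1 hN1] := invn_lt d10; have [N2 hN2] := invn_lt d20.
    exists (maxn N1 N2) => m; rewrite geq_max => /andP[/hN1 r1 /hN2 r2].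
    have dist : cmod ((x +i* c m) - x%:C) = c m.
      rewrite -[RHS]ger0_norm ?(ltW (c0 m))// -sqrtr_sqr -[LHS]ger0_norm ?cmod_ge0// -sqrtr_sqr.
      by congr Num.sqrt; rewrite sqr_cmod ReB ImB ReC ImC /=; ring.
    have {h1}h1 : cmod (F (x +i* c m) - f x) <= e / (4 * m1).
      apply: h1; last by rewrite dist.
      by split=> /=; [exact: c0|rewrite subrr normr0 mul1r normr_gt0 gt_eqF].
    have {h2}h2 : cmod (K (x +i* c m) - K x%:C) <= e / (4 * m1) by apply: h2; rewrite dist.
    rewrite subr0 ger0_norm ?cmod_ge0// -K0 /G.
    rewrite (_ : _ - _ = F (x +i* c m) * (K (x +i* c m) - K x%:C) + (F (x +i* c m) - f x) * K x%:C); last by ring.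
    apply: le_lt_trans (cmodD _ _) _; rewrite (cmodM (F (x +i* c m))) (cmodM (F (x +i* c m) - f x)).
    have b1 : cmod (F (x +i* c m)) * cmod (K (x +i* c m) - K x%:C) <= m1 * (e / (4 * m1)).
      apply: ler_pM; [exact: cmod_ge0|exact: cmod_ge0| |exact: h2].
      apply: le_trans (bF _) _; first exact: c0.
      by rewrite /m1; have := cmod_ge0 (kz w x * kz v x); lra.
    have b2 : cmod (F (x +i* c m) - f x) * cmod (K x%:C) <= e / (4 * m1) * m1.
      apply: ler_pM; [exact: cmod_ge0|exact: cmod_ge0|exact: h1|].
      by rewrite K0 /m1; have := M0; lra.
    apply: le_lt_trans (lerD b1 b2) _.
    rewrite (_ : _ + _ = e / 2); last by field; rewrite gt_eqF.
    by move: e0; lra.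
  - by move=> m; apply: aeA => x; exact: G_le.
have : cmod (0 - cint (fun t => f t * (kz w t * kz v t))) = 0.
  apply/eqP; rewrite -(cvg_lim (@Rhausdorff R) h); apply/eqP/esym/(cvg_lim (@Rhausdorff R)).
  by under eq_cvg do rewrite line_zero//; exact: cvg_cst.
by rewrite sub0r cmodN.
Qed.

End HalfPlaneCauchy.

(** * Bounded analytic functions as multipliers of the Hardy space *)

Section Multipliers.
Context {R : realType}.
Local Notation mu := (@lebesgue_measure R).
Local Notation H := (L2S R).
Local Notation I := ('i%C : Cplx R).
Implicit Types (x y : L2S R) (f g h : R -> Cplx R) (z w s : Cplx R).

(** Bounded analytic functions as multipliers of the Hardy space, a description on which operator
    arguments act directly; [HinftyP] identifies it with [Hinfty Plus]. *)
Definition Hmul h := Linfty h /\ forall x, H2 x -> H2 (mulf h x).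

Lemma Hmul_cst (c : Cplx R) : Hmul (fun=> c).
Proof.
split; first exact: Linfty_cst.
by move=> x hx; rewrite mulf_cst; exact: subspZ H2_subsp hx.
Qed.

Lemma Hmul_mul f g : Hmul f -> Hmul g -> Hmul (fun t => f t * g t).
Proof.
move=> [Lf hf] [Lg hg]; split; first exact: Linfty_mul.
by move=> x hx; rewrite -mulf_mulf//; exact/hf/hg.
Qed.

Lemma Hmul_add f g : Hmul f -> Hmul g -> Hmul (fun t => f t + g t).
Proof.
move=> [Lf hf] [Lg hg]; split; first exact: Linfty_add.
move=> x hx; rewrite mulf_add//; apply: subspD H2_subsp _ _; [exact: hf|exact: hg].
Qed.

Lemma Hmul_chi : Hmul chi.
Proof. by split; [exact: chi_Linfty|move=> x; exact: H2_sh]. Qed.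

Lemma Hmul_exp f n : Hmul f -> Hmul (fun t => f t ^+ n).
Proof.
move=> hf; elim: n => [|n IH].
  by rewrite (_ : (fun t => _) = fun=> 1); [exact: Hmul_cst|apply/funext => t; rewrite expr0].
rewrite (_ : (fun t => _) = fun t => f t * f t ^+ n); first exact: Hmul_mul.
by apply/funext => t; rewrite exprS.
Qed.

Lemma Hmul_sum n (F : 'I_n -> R -> Cplx R) : (forall i, Hmul (F i)) -> Hmul (fun t => \sum_i F i t).
Proof.
elim: n F => [|n IH] F hF.
  by rewrite (_ : (fun t => _) = fun=> 0); [exact: Hmul_cst|apply/funext => t; rewrite big_ord0].
rewrite (_ : (fun t => _) = fun t => F ord0 t + \sum_(i < n) F (lift ord0 i) t).
  by apply: Hmul_add => //; apply: IH.
by apply/funext => t; rewrite big_ord_recl.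
Qed.

Lemma kz_neg_i t : kz (- I) t = (2 * I)^-1 * (1 - chi t).
Proof.
have /andP[_] := i_den t; rewrite /chi /kz opprK.
have i0 : I != 0 by apply: cmod_gt0P; rewrite cmod_i.
by move: (t%:C : Cplx R) (I) i0 => u i i0 d; field; rewrite i0 d.
Qed.

Lemma kz2_integ h z w : Linfty h -> Im z != 0 -> Im w != 0 -> cinteg (fun t => h t * (kz z t * kz w t)).
Proof.
move=> hh z0 w0; have [Lz _] := kz_L2 z0; have [Lw _] := kz_L2 w0.
have [m i] := L2_prod (Linfty_L2 hh Lz) Lw.
by rewrite (_ : (fun t => _) = fun t => h t * kz z t * kz w t)//; apply/funext => t; rewrite mulrA.
Qed.

(** By duality [P] has to annihilate [conj h] times a kernel with pole above the axis. Pairing that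
    with a kernel with pole below gives the conjugate of the integral in [boundary_zero]. *)
Lemma Hinfty_Hmul h : Hinfty Plus h -> Hmul h.
Proof.
move=> [Lh [F [[dF [M bF]] nt]]]; split=> // x hx.
have dF' z : 0 < Im z -> cdiff F z by move=> z0; apply/derivable_cdiff; exact: dF.
apply: H2_crit => z /andP[z0 z1]; rewrite mulf_adj//.
have Lch := Linfty_conj Lh.
set y := mulf _ (kv z).
suff hy : P y = 0 by rewrite -hx P_adj hy dot0r.
apply: kv_total_P; first exact: PP.
move=> w /andP[w1 w0]; rewrite P_adj P_kv_neg//.
have zn : Im z != 0 by rewrite gt_eqF.
have wn : Im w != 0 by rewrite lt_eqF.
have cz0 : Im (cj z) < 0 by rewrite ImJ oppr_lt0.
have czn : Im (cj z) != 0 by rewrite lt_eqF.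
have [Lz _] := kz_L2 zn; have [Lw _] := kz_L2 wn.
rewrite /y /kv mulf_vec// dot_vec//; last exact: Linfty_L2.
have := boundary_zero dF' bF w0 cz0 Lh nt.
move=> /(congr1 cj); rewrite J0 -cintJ; last exact: kz2_integ.
move=> <-; congr cint; apply/funext => t; rewrite !JM !kzJ JK -kzJ.
by move: (cj _) (cj _) (kz z t) => a b c; ring.
Qed.

Lemma cdiff_local F G z (d : R) : 0 < d -> (forall s, cmod (s - z) < d -> F s = G s) ->
  cdiff G z -> cdiff F z.
Proof.
move=> d0 E [L hL]; exists L => e e0; have [d1 [d10 h1]] := hL e e0.
exists (Num.min d d1); split; first by rewrite lt_min d0.
move=> s; rewrite lt_min => /andP[/E -> /h1]; rewrite E// subrr cmod0//.
Qed.

(** The extra kernel makes the Cauchy integral of a bounded [h] converge; [poisson_cauchy]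
    compensates with the factor [z + i]. *)
Definition cauchy h z : Cplx R := cint (fun t => h t * (kz z t * kz (- I) t)).

Lemma cauchy_cdiff h z : Linfty h -> 0 < Im z -> cdiff (cauchy h) z.
Proof.
move=> Lh z0; have [mh [M hM]] := Lh.
have zn : Im z != 0 by rewrite gt_eqF.
have i0 : Im (- I) != 0 by rewrite /= oppr_eq0 oner_eq0.
have [Lz ez] := kz_L2 zn; have iz := L2_sq Lz.
have d0 : 0 < Im z / 2 by rewrite divr_gt0.
have Lhi : Linfty (fun t => h t * kz (- I) t) by apply: Linfty_mul => //; exact: Linfty_kz.
pose L := cint (fun t => h t * kz (- I) t * (kz z t * kz z t)).
have Mi t : cmod (h t) <= M -> cmod (h t * kz (- I) t) <= `|M|.
  move=> ht; rewrite cmodM -[leRHS]mulr1; apply: ler_pM; rewrite ?cmod_ge0//.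
    by apply: le_trans ht _; exact: ler_norm.
  by apply: le_trans (kz_bound t i0) _; rewrite /= normrN normr1 invr1.
(* The three factors bound [h kz (- I)], the kernel at a point [s] of at least half the height, and
   the integral of [|kz z|^2]. *)
apply: (@cdiff_quad _ _ _ L (`|M| * (2 / Im z) * (pi / Im z)) _ d0) => s hs.
have s0 : Im z / 2 < Im s.
  by have := le_lt_trans (cmod_Im _) hs; rewrite ImB ltr_norml; lra.
have s00 : 0 < Im s by apply: lt_trans s0.
have sn : Im s != 0 by rewrite gt_eqF.
have E : cauchy h s - cauchy h z - L * (s - z) =
   (s - z) ^+ 2 * cint (fun t => h t * kz (- I) t * kz s t * (kz z t * kz z t)).
  have j1 := kz2_integ Lh sn i0; have j2 := kz2_integ Lh zn i0; have j3 := kz2_integ Lhi zn zn.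
  have j4 : cinteg (fun t => h t * kz (- I) t * kz s t * (kz z t * kz z t)).
    by apply: kz2_integ => //; apply: Linfty_mul => //; exact: Linfty_kz.
  rewrite /cauchy /L mulrC -(cintB j1 j2) -(cintZ _ j3) -(cintB (cintegB j1 j2) (cintegZ _ j3)) -(cintZ _ j4).
  congr cint; apply/funext => t; rewrite /kz.
  have := kz_den t zn; have := kz_den t sn; have := kz_den t i0.
  move: (h t) (t%:C : Cplx R) (- I) => a u i; move: (s) (z) => s1 z1 e1 e2 e3.
  by field; rewrite e1 e2 e3.
rewrite E cmodM cmodX mulrC; apply: ler_wpM2r; first exact: sqr_ge0.
have [||_ h1] := @cmod_cint_le R (fun t => h t * kz (- I) t * kz s t * (kz z t * kz z t))
  (fun t => `|M| * (2 / Im z) * cmod (kz z t) ^+ 2) _ (rintegZ _ iz).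
- by case: (kz2_integ (Linfty_mul Lhi (Linfty_kz sn)) zn zn).
- apply: (aeS hM) => t /Mi ht; rewrite cmodM (cmodM (h t * _)) (cmodM (kz z t)) -expr2.
  apply: ler_wpM2r; first exact: sqr_ge0.
  apply: ler_pM; rewrite ?cmod_ge0//; apply: le_trans (kz_bound t sn) _.
  by rewrite gtr0_norm// -[2 / Im z]invrK invf_div lef_pV2 ?posrE// ltW.
apply: le_trans h1 _; rewrite (rintZ _ iz) ez (gtr0_norm z0); exact: lexx.
Qed.

(** The Poisson kernel combines the Cauchy kernels at [z] and at its conjugate. The conjugate part
    integrates to 0 because [h] maps [kv (- I)] into the Hardy space, so the Poisson extension of a
    multiplier is analytic. *)
Lemma poisson_cauchy h z : Hmul h -> 0 < Im z ->
  poisson h (Re z) (Im z) = ((2 * pi)%:C * I)^-1 * (z + I) * cauchy h z.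
Proof.
move=> [Lh hh] z0.
have zn : Im z != 0 by rewrite gt_eqF.
have i0 : Im (- I) != 0 by rewrite /= oppr_eq0 oner_eq0.
have czn : Im (cj z) != 0 by rewrite ImJ oppr_eq0.
have [Li _] := kz_L2 i0; have [Lz _] := kz_L2 zn.
have hz : cint (fun t => h t * (kz (cj z) t * kz (- I) t)) = 0.
  have k0 : H2 (kv (- I)) by rewrite /H2 P_kv_neg//= oppr_lt0 ltr01.
  have := H2_dot (hh _ k0) z0; rewrite /kv mulf_vec// dot_vec//; last exact: Linfty_L2.
  move=> <-; congr cint; apply/funext => t; rewrite kzJ.
  by move: (h t) (kz _ t) (kz _ t) => a b c; ring.
have i1 := kz2_integ Lh zn i0; have i2 := kz2_integ Lh czn i0.
pose al : Cplx R := ((2 * pi)%:C * I)^-1 * (z + I).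
pose be : Cplx R := - (((2 * pi)%:C * I)^-1 * (cj z + I)).
have -> : poisson h (Re z) (Im z) = cint (fun t => al * (h t * (kz z t * kz (- I) t)) + be * (h t * (kz (cj z) t * kz (- I) t))).
  congr cint; apply/funext => t; rewrite pk_kz//.
  have -> : Re z +i* Im z = z by case: (z).
  have -> : Re z -i* Im z = cj z by case: (z).
  have zz : z - cj z = (2 * Im z)%:C * I.
    apply: complex_ext.
      by rewrite ReB ReJ subrr ReM (ReC (2 * Im z)) (ImC (2 * Im z)) mul0r subr0 (_ : Re I = 0)// mulr0.
    rewrite ImB ImJ opprK ImM (ReC (2 * Im z)) (ImC (2 * Im z)) mul0r addr0 (_ : Im I = 1)// mulr1.
    by ring.
  have -> : (Im z / pi)%:C = (z - cj z) / ((2 * pi)%:C * I).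
    have ni : I != 0 by apply: cmod_gt0P; rewrite cmod_i.
    have np : ((2 * pi)%:C : Cplx R) != 0 by exact: pi2C_neq0.
    apply: (mulIf (mulf_neq0 np ni)); rewrite mulfVK; last exact: mulf_neq0.
    rewrite zz mulrA -rmorphM; congr (_%:C * _).
    by have := pi_gt0 R; move: (pi : R) => p p0; field; rewrite gt_eqF.
  have := kz_den t zn; have := kz_den t czn; have := kz_den t i0; rewrite /al /be /kz opprK.
  have ni : I != 0 by apply: cmod_gt0P; rewrite cmod_i.
  have np : ((2 * pi)%:C : Cplx R) != 0 by exact: pi2C_neq0.
  move: ((2 * pi)%:C : Cplx R) (I) np ni => k i np ni.
  move: (h t) (t%:C : Cplx R) (z) (cj z : Cplx R) => a u z1 z2 e1 e2 e3.
  by field; rewrite e1 e2 e3 np ni.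
by rewrite (cintD (cintegZ al i1) (cintegZ be i2)) !cintZ// hz mulr0 addr0.
Qed.

Lemma Hmul_Hinfty h : Hmul h -> Hinfty Plus h.
Proof.
move=> Hh; have [Lh hh] := Hh; have [mh [M hM]] := Lh; split=> //.
exists (fun z => poisson h (Re z) (Im z)); split; first split.
- move=> z /= z0; apply/derivable_cdiff.
  apply: (@cdiff_local _ (fun s => ((2 * pi)%:C * I)^-1 * (s + I) * cauchy h s) z (Im z) z0).
    move=> s hs; apply: poisson_cauchy => //.
    by have := le_lt_trans (cmod_Im _) hs; rewrite ImB ltr_norml; lra.
  apply: cdiff_mul; last exact: cauchy_cdiff.
  apply: (@cdiff_quad _ _ _ (((2 * pi)%:C * I)^-1) 0 1) => // s _.
  by rewrite (_ : _ - _ = 0) ?cmod0 ?mul0r//; ring.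
- by exists M => z /= z0; have [] := poisson_bound (Re z) mh hM z0.
apply: (aeS (fatou_poisson mh hM)) => x hx; apply/ntl_eps => a e a0 e0.
have [d [d0 hd]] := hx a e a0 e0; exists d; split=> // z [/= z0 hz] hzd; apply: hd.
  rewrite z0 /=; apply: le_lt_trans hzd; apply: le_trans (cmod_Im _); rewrite ImB ImC subr0.
  exact: ler_norm.
by rewrite -[X in a * X]gtr0_norm//; exact: ltW.
Qed.

Definition opps (sg : hsign) := match sg with Plus => Minus | Minus => Plus end.

(** The extension is the Schwarz reflection [conj (F (conj z))]. *)
Lemma Hinfty_conj sg h : Hinfty sg h -> Hinfty (opps sg) (fun t => cj (h t)).
Proof.
move=> [Lh [F [[dF [M bF]] nt]]]; split; first exact: Linfty_conj.
have hp z : half_plane (opps sg) z -> half_plane sg (cj z).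
  by case: sg {dF bF nt} => /=; rewrite ImJ; lra.
exists (fun z => cj (F (cj z))); split; first split.
- move=> z /hp/dF/derivable_cdiff[L hL]; apply/derivable_cdiff; exists (cj L) => e e0.
  have [d [d0 hd]] := hL e e0; exists d; split=> // w hw.
  have E : cmod (cj w - cj z) = cmod (w - z) by rewrite -JB cmodJ.
  have := hd (cj w); rewrite E => /(_ hw); rewrite -cmodJ !JB JM JB !JK.
  by [].
- by exists M => z /hp/bF; rewrite cmodJ.
apply: (aeS nt) => x /ntl_eps hx; apply/ntl_eps => a e a0 e0.
have [d [d0 hd]] := hx a e a0 e0; exists d; split=> // z [hz hs] hzd.
rewrite -JB cmodJ; apply: hd; last by rewrite -(JC x) -JB cmodJ.
by split; [exact: hp|rewrite ReJ ImJ normrN].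
Qed.

Lemma HinftyP h : Hinfty Plus h <-> Hmul h.
Proof. by split; [exact: Hinfty_Hmul|exact: Hmul_Hinfty]. Qed.

End Multipliers.

(** * Moments with respect to the powers of the Cayley transform *)

Section Moments.
Context {R : realType}.
Local Notation mu := (@lebesgue_measure R).
Local Notation I := ('i%C : Cplx R).
Implicit Types (f g h E : R -> Cplx R) (z w s : Cplx R).

(** For [Im w < 0], the eigenvalue of the backward shift at [kv w], of modulus less than 1. *)
Definition bla w : Cplx R := (w + I) / (w - I).

Lemma wi_neq0 w : Im w < 0 -> w - I != 0.
Proof.
move=> w0; apply/eqP => /(congr1 (@Im R)); rewrite ImB (_ : Im I = 1)// (_ : Im (0 : Cplx R) = 0)//; lra.
Qed.

(** A finite geometric series, since [kz w (1 - bla w chi)] is a constant times [1 - chi]. *)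
Lemma kz_expand w N t : Im w < 0 -> kz w t = kz w t * (bla w * chi t) ^+ N +
  (I - w)^-1 * (1 - chi t) * \sum_(k < N) (bla w * chi t) ^+ k.
Proof.
move=> w0; have wn : Im w != 0 by rewrite lt_eqF.
have E : (I - w)^-1 * (1 - chi t) = kz w t * (1 - bla w * chi t).
  have := wi_neq0 w0; have := kz_den t wn; have /andP[_] := i_den t.
  rewrite /bla /chi /kz opprK; move: (t%:C : Cplx R) (I) (w) => u i w1 d1 d2 d3.
  have d4 : i - w1 != 0 by rewrite -opprB oppr_eq0.
  by field; rewrite d1 d2 d3 d4.
rewrite E -[X in _ + X]mulrA; move: (bla w * chi t) (kz w t) => a b.
have -> : (1 - a) * \sum_(k < N) a ^+ k = 1 - a ^+ N by rewrite -[1 - a]opprB mulNr -subrX1 opprB.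
by ring.
Qed.

(** The sum in [kz_expand] is a polynomial in [chi] and integrates to 0 against [E]; the remainder
    carries the factor [|bla w|^N]. *)
Lemma moments_kz E w : cinteg E -> (forall n, cint (fun t => E t * chi t ^+ n) = 0) -> Im w < 0 ->
  cint (fun t => E t * kz w t) = 0.
Proof.
move=> iE h0 w0; have [mE nE] := iE; have wn : Im w != 0 by rewrite lt_eqF.
have ib h : Linfty h -> (forall t, cmod (h t) <= 1) -> cinteg (fun t => E t * h t).
  move=> [mh _] h1; apply: cinteg_le nE _; first exact: cmeas_mul.
  by move=> t; rewrite cmodM ler_piMr ?cmod_ge0.
have ichi n : cinteg (fun t => E t * chi t ^+ n).
  by apply: ib => [|t]; [apply: Linfty_exp; exact: chi_Linfty|rewrite cmodX cmod_chi expr1n].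
have p1 := cmod_lt1 w0; rewrite -/(bla w) in p1.
have key N : cmod (cint (fun t => E t * kz w t)) <= (`|Im w|^-1 * rint (fun t => cmod (E t))) * cmod (bla w) ^+ N.
  pose F (k : 'I_N) t := (I - w)^-1 * bla w ^+ k * (E t * chi t ^+ k - E t * chi t ^+ k.+1).
  have iF k : cinteg (F k) by apply: cintegZ; exact: cintegB.
  have [iS eS] := cint_sum iF.
  have S0 : cint (fun t => \sum_k F k t) = 0.
    rewrite eS big1// => k _; rewrite /F (cintZ _ (cintegB (ichi k) (ichi k.+1))).
    by rewrite (cintB (ichi k) (ichi k.+1)) !h0 subrr mulr0.
  have mr : cmeasurable setT (fun t => E t * (kz w t * (bla w * chi t) ^+ N)).
    apply: cmeas_mul => //; apply: cmeas_mul; first exact: cmeas_kz.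
    have [m _] := @Linfty_exp R (fun t => bla w * chi t) N (Linfty_mul (Linfty_cst _) chi_Linfty).
    exact: m.
  have [|ir br] := cmod_cint_le mr (rintegZ (`|Im w|^-1 * cmod (bla w) ^+ N) nE).
    apply: aeA => t; rewrite cmodM mulrC; apply: ler_wpM2r; first exact: cmod_ge0.
    rewrite cmodM cmodX (cmodM (bla w)) cmod_chi mulr1; apply: ler_wpM2r; first by rewrite exprn_ge0 ?cmod_ge0.
    exact: kz_bound.
  have -> : cint (fun t => E t * kz w t) = cint (fun t => E t * (kz w t * (bla w * chi t) ^+ N) + \sum_k F k t).
    congr cint; apply/funext => t; rewrite [in LHS](kz_expand N t w0) mulrDr; congr (_ + _).
    rewrite mulr_sumr mulr_sumr; apply: eq_bigr => k _; rewrite /F exprMn exprS.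
    by move: (bla w ^+ k) (chi t ^+ k) (chi t) (E t) (_^-1) => a1 a2 a3 a4 a5; ring.
  rewrite (cintD ir iS) S0 addr0; apply: le_trans br _; rewrite (rintZ _ nE).
  by rewrite mulrAC; exact: lexx.
apply: cmod_eq0; apply/eqP; rewrite eq_le cmod_ge0 andbT; apply/ler_addgt0Pr => e e0; rewrite add0r.
have [N hN] := @geo_lt R (cmod (bla w)) (`|Im w|^-1 * rint (fun t => cmod (E t))) e (ltac:(by rewrite cmod_ge0)) e0.
exact: le_trans (key N) (ltW (hN N (leqnn _))).
Qed.

Lemma pk_diff x y t : 0 < y ->
  (pk x y t)%:C = ((2 * pi)%:C * I)^-1 * (kz (x +i* y) t - kz (x -i* y) t).
Proof.
move=> y0; rewrite pk_kz//.
have z0 : Im (x +i* y : Cplx R) != 0 by rewrite /= gt_eqF.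
have z1 : Im (x -i* y : Cplx R) != 0 by rewrite /= oppr_eq0 gt_eqF.
have ni : I != 0 by apply: cmod_gt0P; rewrite cmod_i.
have np : ((2 * pi)%:C : Cplx R) != 0 by exact: pi2C_neq0.
have -> : (y / pi)%:C = ((x +i* y) - (x -i* y)) / ((2 * pi)%:C * I) :> Cplx R.
  apply: (mulIf (mulf_neq0 np ni)); rewrite mulfVK; last exact: mulf_neq0.
  rewrite mulrA -rmorphM.
  have -> : y / pi * (2 * pi) = 2 * y.
    by have := pi_gt0 R; move: (pi : R) => p p0; field; rewrite gt_eqF.
  apply: complex_ext.
    by rewrite ReB ReM (ReC (2 * y)) (ImC (2 * y)) mul0r subr0 (_ : Re I = 0)// mulr0 /= subrr.
  by rewrite ImB ImM (ReC (2 * y)) (ImC (2 * y)) mul0r addr0 (_ : Im I = 1)// mulr1 /=; ring.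
have := kz_den t z0; have := kz_den t z1; rewrite /kz.
move: ((2 * pi)%:C : Cplx R) (I) np ni => k i np ni.
move: (t%:C : Cplx R) (x +i* y : Cplx R) (x -i* y : Cplx R) => u z1' z2' e1 e2.
by field; rewrite e1 e2 np ni.
Qed.

(** The moments annihilate the Cauchy kernels with poles below the axis and, by conjugation, those
    with poles above; their differences are the Poisson kernels. *)
Lemma moments_zero E : cinteg E -> (forall n, cint (fun t => E t * chi t ^+ n) = 0) ->
  (forall n, cint (fun t => E t * cj (chi t) ^+ n) = 0) -> {ae mu, forall t, E t = 0}.
Proof.
move=> iE h1 h2; apply: poisson_unique => // x y /andP[y0 _].
have z0 : Im (x +i* y : Cplx R) != 0 by rewrite /= gt_eqF.
have z1 : Im (x -i* y : Cplx R) != 0 by rewrite /= oppr_eq0 gt_eqF.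
have z1' : Im (x -i* y : Cplx R) < 0 by rewrite /= oppr_lt0.
have ik z : Im z != 0 -> cinteg (fun t => E t * kz z t).
  move=> zn; apply: cinteg_le (rintegZ `|Im z|^-1 iE.2) _.
    by apply: cmeas_mul; [exact: iE.1|exact: cmeas_kz].
  by move=> t; rewrite cmodM mulrC; apply: ler_wpM2r; [exact: cmod_ge0|exact: kz_bound].
have e1 := moments_kz iE h1 z1'.
have e2 : cint (fun t => E t * kz (x +i* y) t) = 0.
  have hJ n : cint (fun t => cj (E t) * chi t ^+ n) = 0.
    have i : cinteg (fun t => E t * cj (chi t) ^+ n).
      apply: cinteg_le iE.2 _.
        apply: cmeas_mul; first exact: iE.1.
        by have [m _] := Linfty_exp n (@chiJ_Linfty R); exact: m.
      by move=> t; rewrite cmodM cmodX cmodJ cmod_chi expr1n mulr1.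
    rewrite -[RHS](J0) -(h2 n) -(cintJ i); congr cint; apply/funext => t.
    by rewrite JM JX JK.
  have := moments_kz (cintegJ iE) hJ z1'.
  move=> /(congr1 cj); rewrite J0 => <-; rewrite -cintJ; last first.
    have := cintegJ (ik _ z0).
    by rewrite (_ : (fun t => cj _) = fun t => cj (E t) * kz (x -i* y) t)//; apply/funext => t; rewrite JM kzJ.
  congr cint; apply/funext => t; rewrite JM JK kzJ; congr (_ * kz _ t).
  by apply: complex_ext => //=; rewrite opprK.
have -> : poisson E x y = cint (fun t => ((2 * pi)%:C * I)^-1 * (E t * kz (x +i* y) t - E t * kz (x -i* y) t)).
  congr cint; apply/funext => t; rewrite pk_diff// -mulrA mulrBl; congr (_ * _).
  by congr (_ - _); rewrite mulrC.
rewrite (cintZ _ (cintegB (ik _ z0) (ik _ z1))) (cintB (ik _ z0) (ik _ z1)) e1 e2.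
by rewrite subrr mulr0.
Qed.

End Moments.

(** * Approximation of continuous functions by rational ones *)

Section Continuous.
Context {R : realType}.
Local Notation mu := (@lebesgue_measure R).
Local Notation I := ('i%C : Cplx R).
Implicit Types (c f g h : R -> Cplx R) (z w s : Cplx R).

Lemma continuous_rcont c : continuous c -> rcont c.
Proof.
move=> hc x e e0; have /cvg_C/(_ e e0)/nbhs_ballP[d /= d0 hd] := hc x.
by exists d; split=> // x' hx; apply: hd; rewrite /ball /= distrC.
Qed.

Lemma Cdot_tail c l : (c x @[x --> +oo] --> l) -> (c x @[x --> -oo] --> l) ->
  forall e : R, 0 < e -> exists N : R, forall t, N <= `|t| -> cmod (c t - l) <= e.
Proof.
move=> /cvg_C hp /cvg_C hm e e0.
have [A [_ hA]] := hp e e0; have [B [_ hB]] := hm e e0.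
exists (`|A| + `|B| + 1) => t; rewrite ler_normr => /orP[ht|ht].
  by apply: hA; have := ler_norm A; have := normr_ge0 B; lra.
by apply: hB; have := ler_norm (- B); have := normr_ge0 A; rewrite normrN; lra.
Qed.

Lemma rcont_unif c (N e : R) : rcont c -> 0 < e -> exists d : R, 0 < d /\
  forall x x', `|x| <= N -> `|x' - x| < d -> cmod (c x' - c x) <= e.
Proof.
move=> hc e0.
have := @segment_compact R (- N) N => /compact_near_coveringP.
move=> /(_ nat \oo (fun n x => forall x', `|x' - x| < n.+1%:R^-1 -> cmod (c x' - c x) <= e)).
case.
  move=> x _; have e2 : 0 < e / 2 by rewrite divr_gt0.
  have [d [d0 hd]] := hc x _ e2; have d2 : 0 < d / 2 by rewrite divr_gt0.
  have [n0 hn0] := invn_lt d2.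
  exists ([set x' | `|x' - x| < d / 2], [set n | (n0 <= n)%N]); first split=> /=.
  - by apply/nbhs_ballP; exists (d / 2) => //= x' h; rewrite /ball /= distrC in h.
  - by exists n0.
  move=> [x1 n] /= [h1 /hn0 h2] x' hx'.
  rewrite (_ : c x' - c x1 = (c x' - c x) - (c x1 - c x)); last by ring.
  apply: le_trans (cmodD _ _) _; rewrite cmodN.
  have : cmod (c x1 - c x) <= e / 2 by apply: hd; lra.
  have : cmod (c x' - c x) <= e / 2.
    apply: hd; rewrite (_ : x' - x = (x' - x1) + (x1 - x)); last by ring.
    apply: le_lt_trans (ler_normD _ _) _; move: h1 h2 hx'; move: (n.+1%:R^-1) => r; lra.
  lra.
move=> n0 _ hn0; exists (n0.+1%:R^-1); split; first by rewrite invr_gt0 ltr0n.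
move=> x x' hx; apply: (hn0 n0 (leqnn n0) x); by rewrite /= in_itv /= -ler_norml.
Qed.

(** Within distance [d] the modulus of continuity bounds the error by [e]. Beyond, [pk_tail] at
    height [d / K] leaves [16 M / K], and [K] is chosen to make this at most [e]. *)
Lemma poisson_uniform c0 (M d e : R) : rcont c0 -> (forall t, cmod (c0 t) <= M) -> 0 < d -> 0 < e ->
  (forall x x', `|x' - x| < d -> cmod (c0 x' - c0 x) <= e) ->
  exists y : R, 0 < y /\ forall x, cmod (poisson c0 x y - c0 x) <= 2 * e.
Proof.
move=> rc hM d0 e0 hd; have mc := rcont_meas rc.
have M0 : 0 <= M by exact: le_trans (cmod_ge0 (c0 0)) (hM 0).
pose K := 16 * M / e + 1.
have K1 : 0 <= 16 * M / e by rewrite divr_ge0 ?mulr_ge0// ltW.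
have K0 : 0 < K by rewrite /K; lra.
exists (d / K); have y0 : 0 < d / K by rewrite divr_gt0.
split=> // x; have [ip p1] := pk_int x y0; have [iq q1] := pk_int x d0.
have [ipf _] := poisson_bound x mc (aeA hM) y0.
have [ipc _] := poisson_bound x (cmeas_cst (c0 x)) (aeA (fun=> lexx (cmod (c0 x)))) y0.
have ipk : cinteg (fun t => (pk x (d / K) t)%:C).
  by apply: cinteg_le ip _; [apply: cmeas_real; exact: pk_meas|move=> t; rewrite cmodC ger0_norm ?pk_ge0].
have -> : poisson c0 x (d / K) - c0 x = cint (fun t => (pk x (d / K) t)%:C * (c0 t - c0 x)).
  have e1 : c0 x = cint (fun t => (pk x (d / K) t)%:C * c0 x).
    under eq_fun do rewrite mulrC.
    rewrite (cintZ _ ipk) [cint _](_ : _ = 1) ?mulr1//; apply: complex_ext => /=; first exact: p1.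
    exact: rint0.
  rewrite [X in _ - X]e1 /poisson -cintB//; congr cint; apply/funext => t; by rewrite mulrBr.
have [||_ h] := @cmod_cint_le R (fun t => (pk x (d / K) t)%:C * (c0 t - c0 x))
   (fun t => e * pk x (d / K) t + 16 * M / K * pk x d t) _ (rintegD (rintegZ _ ip) (rintegZ _ iq)).
- apply: cmeas_mul; first by apply: cmeas_real; exact: pk_meas.
  by apply: cmeas_sub => //; exact: cmeas_cst.
- apply: aeA => t; rewrite cmodM cmodC (ger0_norm (pk_ge0 _ _ y0)).
  have p0 := pk_ge0 x t y0; have q0 := pk_ge0 x t d0.
  have k0 : 0 <= 16 * M / K by rewrite divr_ge0 ?mulr_ge0// ltW.
  have [ht|ht] := ltP `|t - x| d.
    have := hd x t ht; have := mulr_ge0 k0 q0.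
    move: (16 * M / K * _) (pk x (d / K) t) p0 (cmod _) => u p p0 v; nra.
  have h2 : cmod (c0 t - c0 x) <= 2 * M.
    by apply: le_trans (cmodD _ _) _; rewrite cmodN; have := hM t; have := hM x; lra.
  have := @pk_tail R x x (d / K) 0 K t y0; rewrite subrr normr0 mul0r mulr0 [K * _]mulrC divfK ?gt_eqF//.
  move=> /(_ (lexx 0) (ltW K0) K0 ht) tl.
  apply: (@le_trans _ _ (8 / K * pk x d t * (2 * M))).
    by apply: ler_pM => //; exact: cmod_ge0.
  have -> : 8 / K * pk x d t * (2 * M) = 16 * M / K * pk x d t.
    by move: (pk x d t) => q; field; rewrite gt_eqF.
  by rewrite lerDr mulr_ge0// ltW.
apply: le_trans h _; rewrite (rintD (rintegZ _ ip) (rintegZ _ iq)) (rintZ _ ip) (rintZ _ iq) p1 q1 !mulr1.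
have : 16 * M / K <= e.
  rewrite ler_pdivrMr// (_ : 16 * M = e * (16 * M / e)); last by field; rewrite gt_eqF.
  by rewrite ler_pM2l// /K; lra.
lra.
Qed.

Section Rational.
Context (c1 : R -> Cplx R) (y : R) (ic1 : cinteg c1) (y0 : 0 < y).
(** By symmetry the Poisson kernel is, as a function of [x], a difference of Cauchy kernels with
    poles [t + i y] and [t - i y]. [om t] is the lower pole and [cf t] the coefficient in its
    expansion [kz_expand]. *)
Let om t : Cplx R := t -i* y.
Let cf t : Cplx R := (I - om t)^-1.

Lemma om_neg t : Im (om t) < 0.
Proof. by rewrite /= oppr_lt0. Qed.

Lemma cmeas_om : cmeasurable setT om.
Proof. by split=> /=; [exact: measurable_id|exact: measurable_cst]. Qed.

Lemma cmeas_bla : cmeasurable setT (fun t => bla (om t)).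
Proof.
apply: cmeas_mul; first by apply: cmeas_add; [exact: cmeas_om|exact: cmeas_cst].
by apply: cmeas_inv; apply: cmeas_sub; [exact: cmeas_om|exact: cmeas_cst].
Qed.

Lemma cmeas_cf : cmeasurable setT cf.
Proof. by apply: cmeas_inv; apply: cmeas_sub; [exact: cmeas_cst|exact: cmeas_om]. Qed.

Lemma cmod_cf t : cmod (cf t) <= 1.
Proof.
rewrite cmodV invf_le1; last by apply: cmod_gt0; rewrite -opprB oppr_eq0; exact: wi_neq0 (om_neg t).
apply: le_trans (cmod_Im _); rewrite ImB (_ : Im I = 1)//= opprK; apply: le_trans (ler_norm _).
by rewrite lerDl ltW.
Qed.

Lemma cmod_bla t : cmod (bla (om t)) < 1.
Proof. exact: cmod_lt1 (om_neg t). Qed.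

Lemma cmod_blaX t k : cmod (bla (om t) ^+ k) <= 1.
Proof. by rewrite cmodX exprn_ile1 ?cmod_ge0// ltW// cmod_bla. Qed.

Definition cfk k t : Cplx R := cf t * bla (om t) ^+ k.

Lemma cmeas_exp f n : cmeasurable setT f -> cmeasurable setT (fun t => f t ^+ n).
Proof.
move=> mf; elim: n => [|n IH].
  by apply: (cmeas_ext _ (cmeas_cst 1)) => t; rewrite expr0.
by apply: (cmeas_ext _ (cmeas_mul mf IH)) => t; rewrite exprS.
Qed.

Lemma cfk_integ k : cinteg (fun t => c1 t * cfk k t) /\ cinteg (fun t => c1 t * cj (cfk k t)).
Proof.
have m : cmeasurable setT (cfk k).
  by apply: cmeas_mul; [exact: cmeas_cf|apply: cmeas_exp; exact: cmeas_bla].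
have b t : cmod (cfk k t) <= 1.
  by rewrite cmodM -[leRHS]mulr1; apply: ler_pM; rewrite ?cmod_ge0 ?cmod_cf ?cmod_blaX.
split; apply: cinteg_le ic1.2 _.
- by apply: cmeas_mul; [exact: ic1.1|exact: m].
- by move=> t; rewrite cmodM ler_piMr ?cmod_ge0.
- by apply: cmeas_mul; [exact: ic1.1|exact: cmeas_conj].
- by move=> t; rewrite cmodM cmodJ ler_piMr ?cmod_ge0.
Qed.

(** With [X = chi x], the factor [X^N] clears the negative powers [conj X = 1 / X] in the conjugate
    of the expansion. After subtraction of the polynomial part, only the two remainders with [b^N]
    are left. *)
Lemma rational_alg N (X b k a : Cplx R) : X * cj X = 1 ->
  k = k * (b * X) ^+ N + a * (1 - X) * \sum_(j < N) (b * X) ^+ j ->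
  X ^+ N * (cj k - k) - \sum_(j < N) ((X ^+ (N - j) - X ^+ (N - j.+1)) * cj (a * b ^+ j) -
      X ^+ N * ((1 - X) * X ^+ j) * (a * b ^+ j)) = cj (k * b ^+ N) - X ^+ N * X ^+ N * (k * b ^+ N).
Proof.
move=> XX E1; have XN n : X ^+ n * cj X ^+ n = 1 by rewrite -exprMn XX expr1n.
set T := \sum_(j < N) _ in E1.
have E2 : X ^+ N * cj k = cj (k * b ^+ N) + cj a * (1 - cj X) * (X ^+ N * cj T).
  rewrite [in LHS]E1 JD (JM _ T) (JM a) JB J1 mulrDr; congr (_ + _); last by ring.
  rewrite exprMn !JM [cj (X ^+ N)]JX.
  by rewrite (_ : _ * _ = (X ^+ N * cj X ^+ N) * (cj k * cj (b ^+ N))); [rewrite XN mul1r|ring].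
have -> : \sum_(j < N) ((X ^+ (N - j) - X ^+ (N - j.+1)) * cj (a * b ^+ j) -
    X ^+ N * ((1 - X) * X ^+ j) * (a * b ^+ j)) =
    cj a * (1 - cj X) * (X ^+ N * cj T) - X ^+ N * (a * (1 - X) * T).
  have -> : cj T = \sum_(j < N) cj ((b * X) ^+ j).
    by rewrite /T; elim/big_rec2: _ => [|i c d _ <-]; rewrite ?J0 ?JD.
  rewrite /T !mulr_sumr -sumrB; apply: eq_bigr => j _.
  have r1 : X ^+ N * cj X ^+ j = X ^+ (N - j).
    by rewrite -{1}(subnK (ltnW (ltn_ord j))) exprD -mulrA XN mulr1.
  have r2 : X ^+ (N - j) * cj X = X ^+ (N - j.+1).
    have Nj : (0 < N - j)%N by rewrite subn_gt0.
    by rewrite subnS -{1}(prednK Nj) exprSr -mulrA XX mulr1.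
  rewrite -r2 -r1 (JM a) [cj ((b * X) ^+ j)]JX (JM b) !exprMn [cj (b ^+ j)]JX.
  by move: (X ^+ N) (cj X ^+ j) (cj b ^+ j) (b ^+ j) (X ^+ j) (cj X) (cj a) => p1 p2 p3 p4 p5 p6 p7; ring.
have E3 : X ^+ N * k = X ^+ N * (k * (b * X) ^+ N + a * (1 - X) * T) by rewrite -E1.
rewrite mulrBr E2 E3 exprMn.
clear E1 E2 E3; move: (cj (k * b ^+ N)) (cj a) (cj T) (cj X) (X ^+ N) (b ^+ N) (T) => b1 b2 b3 b4 b5 b6 b7; ring.
Qed.

(* The Taylor polynomials in [chi] of the Cauchy kernels with poles below the
   axis, and their conjugates, approximate the Poisson integral. *)
Lemma poisson_rational (e : R) : 0 < e -> exists N g, Hmul g /\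
  forall x, cmod (chi x ^+ N * poisson c1 x y - g x) <= e.
Proof.
move=> e0; have [m1 n1] := ic1.
have : rint (fun t => cmod (c1 t) * cmod (bla (om t)) ^+ N) @[N --> \oo] --> rint (fun=> 0).
  apply: (@dominated_rint R (fun N t => cmod (c1 t) * cmod (bla (om t)) ^+ N) _ (fun t => cmod (c1 t))) => //.
  - move=> N; apply: measurable_funM; first exact: measurable_cmod.
    by apply: measurable_funX; apply: measurable_cmod; exact: cmeas_bla.
  - apply: aeA => t; apply/cvgr_eps => e' e'0.
    have [N hN] := @geo_lt R (cmod (bla (om t))) (cmod (c1 t)) e' (ltac:(by rewrite cmod_ge0 cmod_bla)) e'0.
    by exists N => n /hN; rewrite subr0 ger0_norm// mulr_ge0 ?exprn_ge0 ?cmod_ge0.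
  - move=> N; apply: aeA => t; rewrite ger0_norm; last by rewrite mulr_ge0 ?exprn_ge0 ?cmod_ge0.
    by rewrite ler_piMr ?cmod_ge0// exprn_ile1 ?cmod_ge0// ltW// cmod_bla.
rewrite rint0 => /cvgr_eps hl.
pose ka : Cplx R := ((2 * pi)%:C * I)^-1.
have kam : cmod ka = (2 * pi)^-1.
  by rewrite cmodV cmodM cmod_i mulr1 cmodC ger0_norm// mulr_ge0 ?pi_ge0.
have py : 0 < pi * y by rewrite mulr_gt0 ?pi_gt0.
(* The remainder is at most [1 / (pi y)] times the integral of [|c1| |bla|^N], uniformly in [x]. *)
have [N hN] := hl _ (mulr_gt0 e0 py); have {hN hl}hN := hN N (leqnn _).
rewrite subr0 ger0_norm in hN; last by apply: rint_ge0 => t; rewrite mulr_ge0 ?exprn_ge0 ?cmod_ge0.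
pose B (k : 'I_N) := cint (fun t => c1 t * cfk k t).
pose A (k : 'I_N) := cint (fun t => c1 t * cj (cfk k t)).
pose g x : Cplx R := \sum_(k < N) ka * (A k * (chi x ^+ (N - k) - chi x ^+ (N - k.+1)) -
    B k * (chi x ^+ N * ((1 - chi x) * chi x ^+ k))).
exists N, g; split.
  apply: Hmul_sum => k; apply: Hmul_mul; first exact: Hmul_cst.
  have Hc := Hmul_exp _ (@Hmul_chi R).
  have mN f : Hmul f -> Hmul (fun t => - f t).
    by move=> hf; rewrite (_ : (fun t => _) = fun t => -1 * f t);
      [apply: Hmul_mul => //; exact: Hmul_cst|apply/funext => t; rewrite mulN1r].
  apply: Hmul_add.
    by apply: Hmul_mul; [exact: Hmul_cst|apply: Hmul_add => //; exact: mN].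
  apply: (mN); apply: Hmul_mul; first exact: Hmul_cst.
  apply: Hmul_mul => //; apply: Hmul_mul => //; apply: Hmul_add; first exact: Hmul_cst.
  by apply: mN; exact: Hmul_chi.
move=> x.
pose F (k : 'I_N) t : Cplx R := ka * ((chi x ^+ (N - k) - chi x ^+ (N - k.+1)) * (c1 t * cj (cfk k t)) -
    (chi x ^+ N * ((1 - chi x) * chi x ^+ k)) * (c1 t * cfk k t)).
have iF k : cinteg (F k).
  by have [i1 i2] := cfk_integ k; apply: cintegZ; apply: cintegB; exact: cintegZ.
have [iS eS] := cint_sum iF.
have gE : g x = cint (fun t => \sum_k F k t).
  rewrite eS; apply: eq_bigr => k _; have [i1 i2] := cfk_integ k; rewrite /F (cintZ _ (cintegB (cintegZ _ i2) (cintegZ _ i1))).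
  rewrite (cintB (cintegZ _ i2) (cintegZ _ i1)) !cintZ// -/(A k) -/(B k).
  by congr (_ * (_ - _)); rewrite mulrC.
have ipk : cinteg (fun t => (pk x y t)%:C * c1 t).
  apply: cinteg_le (rintegZ (pi * y)^-1 n1) _.
    by apply: cmeas_mul => //; apply: cmeas_real; exact: pk_meas.
  move=> t; rewrite cmodM cmodC (ger0_norm (pk_ge0 _ _ y0)); apply: ler_wpM2r; first exact: cmod_ge0.
  exact: pk_bound.
have cj_om t : cj (kz (om t) x) = kz (t +i* y) x.
  by rewrite kzJ; congr kz; apply: complex_ext => //=; rewrite opprK.
rewrite gE /poisson -(cintZ _ ipk) -(cintB (cintegZ _ ipk) iS).
have pointwise t : chi x ^+ N * ((pk x y t)%:C * c1 t) - \sum_k F k t =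
    ka * c1 t * (cj (kz (om t) x * bla (om t) ^+ N) - chi x ^+ N * chi x ^+ N * (kz (om t) x * bla (om t) ^+ N)).
  rewrite pk_sym pk_diff// -cj_om -/ka -(rational_alg (chiKJ x) (kz_expand N x (om_neg t))) -/(cf t).
  have -> : \sum_k F k t = ka * c1 t * \sum_(j < N) ((chi x ^+ (N - j) - chi x ^+ (N - j.+1)) * cj (cf t * bla (om t) ^+ j) -
      chi x ^+ N * ((1 - chi x) * chi x ^+ j) * (cf t * bla (om t) ^+ j)).
    rewrite mulr_sumr; apply: eq_bigr => k _; rewrite /F -/(cfk k t).
    move: (chi x ^+ (N - k) - _) (chi x ^+ N * _) (cfk k t) (c1 t) (ka) => a1 a2 a3 a4 a5.
    by move: (cj a3) => a6; ring.
  have alg (c k p q u T : Cplx R) : c * (k * (p - q) * u) - k * u * T = k * u * (c * (p - q) - T) by ring.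
  exact: alg.
have mD := (cintegB (cintegZ (chi x ^+ N) ipk) iS).1.
have iu : rinteg (fun t => cmod (c1 t) * cmod (bla (om t)) ^+ N).
  apply: rinteg_le n1; first by apply: measurable_funM; [exact: measurable_cmod|apply: measurable_funX; apply: measurable_cmod; exact: cmeas_bla].
  move=> t; rewrite ger0_norm; last by rewrite mulr_ge0 ?exprn_ge0 ?cmod_ge0.
  by rewrite ler_piMr ?cmod_ge0// exprn_ile1 ?cmod_ge0// ltW// cmod_bla.
have [|_ h] := cmod_cint_le mD (rintegZ (pi * y)^-1 iu).
  apply: aeA => t; rewrite pointwise cmodM (cmodM ka) kam.
  have kb : cmod (kz (om t) x * bla (om t) ^+ N) <= y^-1 * cmod (bla (om t)) ^+ N.
    rewrite cmodM cmodX; apply: ler_wpM2r; first by rewrite exprn_ge0 ?cmod_ge0.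
    have := @kz_bound R (om t) x; rewrite /= normrN gtr0_norm//; apply; by rewrite oppr_eq0 gt_eqF.
  have tri (X w : Cplx R) : cmod X = 1 -> cmod (cj w - X * X * w) <= 2 * cmod w.
    by move=> X1; apply: le_trans (cmodD _ _) _; rewrite cmodN cmodJ !cmodM X1 !mul1r; lra.
  have X1 : cmod (chi x ^+ N) = 1 by rewrite cmodX cmod_chi expr1n.
  have {tri X1}tri := tri _ (kz (om t) x * bla (om t) ^+ N) X1.
  apply: (@le_trans _ _ ((2 * pi)^-1 * cmod (c1 t) * (2 * (y^-1 * cmod (bla (om t)) ^+ N)))).
    apply: ler_wpM2l; first by rewrite mulr_ge0 ?cmod_ge0// invr_ge0 mulr_ge0 ?pi_ge0.
    by apply: le_trans tri _; rewrite ler_pM2l.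
  have := pi_gt0 R; move: (pi : R) (cmod (c1 t)) (cmod _ ^+ N) => p u1 u2 p0.
  by rewrite le_eqVlt; apply/orP; left; apply/eqP; field; rewrite !gt_eqF.
apply: le_trans h _; rewrite (rintZ _ iu) ler_pdivrMl// mulrC; exact: ltW.
Qed.

End Rational.

Lemma Cdot_bounded c : Cdot c -> exists M : R, forall t, cmod (c t) <= M.
Proof.
move=> [/continuous_rcont rc [l [hp hm]]]; have [N hN] := Cdot_tail hp hm ltr01.
have [|M hM] := @rcont_bounded R (- `|N|) `|N| c _ rc; first by have := normr_ge0 N; lra.
exists (`|M| + (1 + cmod l)) => t; have [ht|/ltW ht] := leP `|t| `|N|.
  have := hM t; rewrite -ler_norml => /(_ ht) h; have := ler_norm M; have := cmod_ge0 l; lra.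
have := hN t (le_trans (ler_norm _) ht) => h; have := cmodD (c t - l) l; rewrite subrK.
by have := normr_ge0 M; lra.
Qed.

Lemma Cdot_unif c (e : R) : Cdot c -> 0 < e -> exists d : R, 0 < d /\
  forall x x', `|x' - x| < d -> cmod (c x' - c x) <= e.
Proof.
move=> [/continuous_rcont rc [l [hp hm]]] e0.
have e2 : 0 < e / 2 by rewrite divr_gt0.
have [N hN] := Cdot_tail hp hm e2; have [d [d0 hd]] := rcont_unif (`|N| + 1) rc e0.
exists (Num.min d 1); split; first by rewrite lt_min d0 ltr01.
move=> x x'; rewrite lt_min => /andP[h1 h2].
have [hx|/ltW hx] := leP `|x| (`|N| + 1); first exact: hd.
have t1 : `|x| <= `|x'| + `|x' - x| by have := ler_normB x' (x' - x); rewrite opprB addrC subrK.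
have a1 : cmod (c x - l) <= e / 2 by apply: hN; have := ler_norm N; lra.
have a2 : cmod (c x' - l) <= e / 2 by apply: hN; have := ler_norm N; lra.
have -> : c x' - c x = (c x' - l) + - (c x - l) by ring.
by apply: le_trans (cmodD _ _) _; rewrite cmodN; lra.
Qed.

(** Subtract the limit at infinity, cut off to a large interval to gain integrability, and smooth by
    a Poisson kernel; then [poisson_rational] applies. Smoothing, cutting off and rational
    approximation cost [e / 4] each. *)
Lemma Cdot_approx c (e : R) : Cdot c -> 0 < e -> exists N g, Hmul g /\
  forall t, cmod (chi t ^+ N * c t - g t) <= e.
Proof.
move=> hc e0; have [M0 hM0] := Cdot_bounded hc.
have e8 : 0 < e / 8 by rewrite divr_gt0.
have [d [d0 hd]] := Cdot_unif hc e8; have [/continuous_rcont rc [l [hp hm]]] := hc.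
have e4 : 0 < e / 4 by rewrite divr_gt0.
have [A hA] := Cdot_tail hp hm e4.
pose c0 t := c t - l; have c0E x x' : c0 x' - c0 x = c x' - c x by rewrite /c0; ring.
have rc0 : rcont c0 by move=> x e' /(rc x)[d' [d'0 h]]; exists d'; split=> // x' /h; rewrite c0E.
have hM t : cmod (c0 t) <= M0 + cmod l by apply: le_trans (cmodD _ _) _; rewrite cmodN lerD2r.
have [|y [y0 hy]] := @poisson_uniform c0 (M0 + cmod l) d (e / 8) rc0 hM d0 e8.
  by move=> x x' /hd; rewrite c0E.
have [n hn] : exists n : nat, `|A| <= n%:R by exists (Num.bound `|A|); apply: ltW; apply: archi_boundP.
pose c1 (t : R) : Cplx R := (\1_(`[- n%:R, n%:R]%classic) t)%:C * c0 t.
have ic1 : cinteg c1.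
  apply: (@cinteg_le R c1 (fun t : R => (M0 + cmod l) * (\1_(`[- n%:R, n%:R]%classic) t : R))); last first.
  + move=> t; rewrite cmodM cmodC ger0_norm ?indicE ?ler0n// mulrC; apply: ler_wpM2r => //; exact: ler0n.
  + apply: rintegZ; exact: rinteg_indic_itv.
    by apply: cmeas_mul; [apply: cmeas_real; exact: measurable_indic|exact: rcont_meas].
have h10 t : cmod (c1 t - c0 t) <= e / 4.
  rewrite /c1 indicE; have [_|] := boolP (t \in _); first by rewrite mul1r subrr cmod0 ltW.
  rewrite mul0r sub0r cmodN => /negP ht; apply: hA; apply: le_trans (ler_norm _) (le_trans hn _).
  by apply: ltW; rewrite ltNge; apply/negP => h; apply: ht; rewrite inE /= in_itv /= -ler_norml.
have [N [g [Hg hg]]] := poisson_rational ic1 y0 e4.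
exists N, (fun t => g t + l * chi t ^+ N); split.
  by apply: Hmul_add => //; apply: Hmul_mul; [exact: Hmul_cst|apply: Hmul_exp; exact: Hmul_chi].
move=> x; have mc0 := rcont_meas rc0.
have hb1 t : cmod (c1 t) <= e / 4 + (M0 + cmod l).
  by have := h10 t; have := hM t; have := cmodD (c1 t - c0 t) (c0 t); rewrite subrK; lra.
have [i1 _] := poisson_bound x ic1.1 (aeA hb1) y0.
have [i0 _] := poisson_bound x mc0 (aeA hM) y0.
have [_ b10] := poisson_bound x (cmeas_sub ic1.1 mc0) (aeA h10) y0.
have p10 : poisson (fun t => c1 t - c0 t) x y = poisson c1 x y - poisson c0 x y.
  by rewrite /poisson -(cintB i1 i0); congr cint; apply/funext => t; rewrite mulrBr.
rewrite p10 in b10; have := hg x; have := hy x; move: b10 => {p10 i1 i0}.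
have -> : chi x ^+ N * c x - (g x + l * chi x ^+ N) =
  (chi x ^+ N * poisson c1 x y - g x) + - (chi x ^+ N * (poisson c1 x y - poisson c0 x y)) +
    - (chi x ^+ N * (poisson c0 x y - c0 x)).
  rewrite /c0; move: (chi x ^+ N) (poisson c1 x y) (poisson (fun _ => _) x y) => z1 z2 z3; ring.
move=> b1 b2 b3; apply: le_trans (cmodD _ _) _; rewrite cmodN cmodM cmodX cmod_chi expr1n mul1r.
have := cmodD (chi x ^+ N * poisson c1 x y - g x) (- (chi x ^+ N * (poisson c1 x y - poisson c0 x y))).
rewrite cmodN (cmodM (chi x ^+ N)) cmodX cmod_chi expr1n mul1r.
move: b1 b2 b3; move: (cmod _) (cmod _) (cmod _) (cmod _) => u1 u2 u3 u4; lra.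
Qed.

End Continuous.

(** * Toeplitz operators *)

Section Toeplitz.
Context {R : realType}.
Local Notation mu := (@lebesgue_measure R).
Local Notation H := (L2S R).
Local Notation I := ('i%C : Cplx R).
Local Notation k0 := (kv (- I) : H).
Implicit Types (x y : L2S R) (f g h psi : R -> Cplx R).

Definition toep psi x : H := P (mulf psi (P x)).

Lemma toep_adj psi : Linfty psi -> adjoint (toep psi) (toep (fun t => cj (psi t))).
Proof. by move=> h x y; rewrite /toep P_adj (mulf_adj h) P_adj. Qed.

Lemma toep_bop psi : Linfty psi -> bop (toep psi).
Proof. move=> h; exact: (bop_comp P_bop (bop_comp (mulf_bop h) P_bop)). Qed.

(** The Toeplitz operator with symbol [psi] is bounded below. All six properties of the pair reduce
    to this one for powers of [chi] times the symbol or its conjugate. *)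
Definition bb psi := exists d : R, 0 < d /\ forall x, H2 x -> d * nrm x <= nrm (P (mulf psi x)).

Lemma Im_negi : Im (- I) != 0.
Proof. by rewrite ImN oppr_eq0 oner_eq0. Qed.

Lemma H2_k0 : H2 k0.
Proof. by apply: P_kv_neg; rewrite ImN oppr_lt0 ltr01. Qed.

Lemma nrm_k0 : nrm k0 ^+ 2 = pi.
Proof. by rewrite (kv_nrm Im_negi) ImN (_ : Im I = 1)// normrN normr1 divr1. Qed.

Lemma sh'_k0 : sh' k0 = kv I.
Proof.
have [L _] := kz_L2 Im_negi; have i1 : Im I != 0 by rewrite oner_eq0.
have [L' _] := kz_L2 i1; rewrite /sh' mulf_vec//; last exact: chiJ_Linfty.
congr vec; apply/funext => t; rewrite chiJ /kz; have /andP[] := i_den t.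
move: (t%:C : Cplx R) (I) => s i d1 d2.
by rewrite opprK in d2 *; field; rewrite d1 d2.
Qed.

(** [k0] is the wandering vector of the shift: [sh'] maps it to [kv I], which is orthogonal to the
    Hardy space. *)
Lemma dot_sh_k0 x : H2 x -> dot (sh x) k0 = 0.
Proof. by move=> hx; rewrite sh_adj sh'_k0; apply: H2_dot hx _; rewrite ltr01. Qed.

Lemma mulf_chiS n x : mulf (fun t => chi t ^+ n.+1) x = sh (mulf (fun t => chi t ^+ n) x).
Proof.
rewrite /sh mulf_mulf; [|exact: chi_Linfty|apply: Linfty_exp; exact: chi_Linfty].
by congr (mulf _ x); apply/funext => t; rewrite exprS.
Qed.

Lemma mulf_chi_iter n x : mulf (fun t => chi t ^+ n) x = iter n sh x.
Proof.
elim: n => [|n IH]; first by apply: mulf1 => t; rewrite expr0.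
by rewrite mulf_chiS IH.
Qed.

Lemma H2_iter_sh n x : H2 x -> H2 (iter n sh x).
Proof. by move=> hx; elim: n => //= n; exact: H2_sh. Qed.

Lemma dot_iter n x y : dot (iter n sh x) y = dot x (iter n sh' y).
Proof. by elim: n x y => //= n IH x y; rewrite sh_adj IH -iterSr. Qed.

Lemma mulfC f g x : Linfty f -> Linfty g -> mulf f (mulf g x) = mulf g (mulf f x).
Proof. by move=> hf hg; rewrite !mulf_mulf//; congr (mulf _ x); apply/funext => t; rewrite mulrC. Qed.

Definition sq x : R -> Cplx R := fun t => (cmod (rep x t) ^+ 2)%:C.

Lemma sq_integ x : cinteg (sq x).
Proof.
have := L2_prodJ (rep_L2 x) (rep_L2 x); rewrite (_ : (fun t => _) = sq x)//.
by apply/funext => t; rewrite mulcJ.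
Qed.

Lemma cinteg_chi f n : cinteg f -> cinteg (fun t => f t * chi t ^+ n).
Proof.
move=> [mf hf]; apply: cinteg_le hf _; last by move=> t; rewrite cmodM cmodX cmod_chi expr1n mulr1.
by apply: cmeas_mul => //; have [] := Linfty_exp n (@chi_Linfty R).
Qed.

Lemma sq_moment x n : cint (fun t => sq x t * chi t ^+ n) = dot (iter n sh x) x.
Proof.
have Ln := Linfty_exp n (@chi_Linfty R).
rewrite -mulf_chi_iter mulfE -[X in dot _ X]vec_rep dot_vec; [|exact: (Linfty_L2 Ln (rep_L2 x))|exact: rep_L2].
by congr cint; apply/funext => t; rewrite /sq -mulcJ -[RHS]mulrA mulrC.
Qed.

Section Factor.
Context (psi : R -> Cplx R) (Lp : Linfty psi) (d : R) (d0 : 0 < d).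
Context (hd : forall x, H2 x -> d * nrm x <= nrm (P (mulf psi x))).
Let psc t := cj (psi t).
Let r := d ^+ 2 / 2.
(** The coercivity constant of [defect]: [r] on the Hardy space and 1 on the complement. *)
Let e := Num.min r 1.

(* [T* T - r] on the Hardy space, extended by the identity to the orthogonal
   complement, for the Toeplitz operator [T] with symbol [psi]. *)
Definition defect x : H := toep psc (toep psi x) - r%:C *: P x + (x - P x).

Lemma r_gt0 : 0 < r. Proof. by rewrite /r divr_gt0// exprn_gt0. Qed.
Lemma e_gt0 : 0 < e. Proof. by rewrite /e lt_min r_gt0 ltr01. Qed.

Lemma defect_form x y : dot (defect x) y =
  dot (toep psi x) (toep psi y) - r%:C * dot (P x) (P y) + dot (x - P x) (y - P y).
Proof.
rewrite /defect (dotDl (_ - _)) (dotBl (toep _ _)) dotZl (adjoint_sym (toep_adj Lp)) -(P_adj (P x)) PP.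
by rewrite (dotBr (x - P x)) [dot (x - P x) (P y)]dotC0 ?subr0//; exact: P_ortho.
Qed.

Lemma defect_sa : adjoint defect defect.
Proof.
move=> x y; rewrite [RHS]dotJ !defect_form !JD JN JM JC.
by rewrite -!dotJ.
Qed.

Let Q x := Re (dot (defect x) x).

Lemma QE x : Q x = nrm (toep psi x) ^+ 2 - r * nrm (P x) ^+ 2 + nrm (x - P x) ^+ 2.
Proof. by rewrite /Q defect_form !dotxx -rmorphM -rmorphB -rmorphD. Qed.

Lemma Q_ge x : e * nrm x ^+ 2 <= Q x.
Proof.
rewrite QE (nrm_P_pyth x).
have : (d * nrm (P x)) ^+ 2 <= nrm (toep psi x) ^+ 2.
  by apply: sqr_mono; [apply: mulr_ge0; [exact: ltW|exact: nrm_ge0]|exact: hd (H2P x)].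
rewrite exprMn (_ : d ^+ 2 = 2 * r); last by rewrite /r; field.
have e1 : e <= r by rewrite ge_min lexx.
have e2 : e <= 1 by rewrite ge_min lexx orbT.
have := sqr_ge0 (nrm (P x)); have := sqr_ge0 (nrm (x - P x)).
move: (nrm (P x) ^+ 2) (nrm (x - P x) ^+ 2) (nrm _ ^+ 2) => u v w v0 u0 h.
by move: e1 e2; move: (e) (r) h => e' r' h; nra.
Qed.

Lemma Q_ge0 x : 0 <= Q x.
Proof. apply: le_trans (Q_ge x); apply: mulr_ge0; [exact: ltW e_gt0|exact: sqr_ge0]. Qed.

Lemma defect_bop : bop defect.
Proof.
have idb : bop (fun x : H => x) by split=> //; exists 1; split=> // x; rewrite mul1r.
have Lc := Linfty_conj Lp.
have := bop_add (bop_add (bop_comp (toep_bop Lc) (toep_bop Lp)) (bop_scale (- r%:C) P_bop))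
  (bop_add idb (bop_scale (-1) P_bop)).
rewrite (_ : (fun x => _) = defect)//; apply/funext => x; rewrite /defect /= -/psc.
by move: (toep psc _) (P x) => u v; hring.
Qed.

Lemma P_defect x : P (defect x) = defect (P x).
Proof.
rewrite /defect (linD P_lin (_ - _)) (linB P_lin (toep _ _)) (linB P_lin x) (linZ P_lin) !PP /toep !PP !subrr.
by [].
Qed.

Lemma defect_inj x : defect x = 0 -> x = 0.
Proof.
move=> h; have := Q_ge x; rewrite /Q h dot0l => h1; apply: nrm_eq0; apply/eqP; rewrite -sqrf_eq0.
rewrite eq_le sqr_ge0 andbT -(pmulr_rle0 _ e_gt0); exact: h1.
Qed.

Lemma defect_solve y : H2 y -> exists x, [/\ defect x = y, H2 x & e * nrm x <= nrm y].
Proof.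
move=> hy; have c1 : cmod (1 : R[i]) = 1 by exact: cmod1.
have co x : e * nrm x ^+ 2 <= Re (1 * dot (defect x) x) by rewrite mul1r; exact: Q_ge.
have [x hx] := lax_milgram defect_bop c1 e_gt0 co y; exists x; split=> //.
  have [Sl _] := defect_bop.
  apply/eqP; rewrite -subr_eq0; apply/eqP/defect_inj.
  by rewrite (linB Sl) -P_defect hx hy subrr.
by rewrite -hx; exact: coercive_below c1 e_gt0 co x.
Qed.

Lemma Q_cross x y : 2 * Re (dot (defect x) y) <= Q x + Q y.
Proof.
have [Sl _] := defect_bop; have := Q_ge0 (x - y).
rewrite /Q (linB Sl) !dotBl !dotBr [dot (defect y) x]defect_sa [dot y _]dotJ !ReB ReJ.
by move: (Re _) (Re _) (Re _) => u v w; lra.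
Qed.

(** A Toeplitz operator [T] satisfies [T = P sh' T sh] on the Hardy space, so [T (sh x)] is at least
    as long as [T x], while [sh x] has the length of [x]. *)
Lemma Q_sh x : H2 x -> Q x <= Q (sh x).
Proof.
move=> hx; have hs := H2_sh hx; rewrite !QE hx hs !subrr nrm_sh lerD2r lerD2r.
apply: sqr_mono; first exact: nrm_ge0.
have -> : toep psi x = P (sh' (toep psi (sh x))).
  rewrite /toep hx hs P_sh'P; congr P.
  by rewrite /sh' (mulfC _ chiJ_Linfty Lp) -/(sh' _) shK.
by apply: le_trans (nrm_P _) _; rewrite nrm_sh'.
Qed.

(** Expand along [psi a = u + b], with [u] in the Hardy space and [b] orthogonal to it: since
    [chi^n u] stays in the Hardy space, its pairing with [b] vanishes. *)
Lemma defect_moment a n : H2 a -> let u := P (mulf psi a) in let b := mulf psi a - u in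
  dot (iter n sh (mulf psi a)) (mulf psi a) - r%:C * dot (iter n sh a) a - dot (iter n sh b) b =
  dot (iter n sh a) (defect a).
Proof.
move=> ha u b; have hn := H2_iter_sh n ha; rewrite -defect_sa defect_form hn ha !subrr dot0l addr0.
have il : linop (fun x => iter n (@sh R) x) by apply: iter_lin; exact: sh_lin.
have e1 : iter n sh (mulf psi a) = mulf psi (iter n sh a).
  by rewrite -!mulf_chi_iter mulfC//; apply: Linfty_exp; exact: chi_Linfty.
have e2 : mulf psi a = u + b by rewrite /b; move: (mulf psi a) => w; hring.
have e3 : dot (iter n sh (mulf psi a)) b = dot (iter n sh b) b.
  rewrite {1}e2 (linD il) dotDl (_ : dot (iter n sh u) b = 0) ?add0r//.
  by rewrite -(H2_iter_sh n (H2P (mulf psi a))) /b; exact: P_ortho.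
rewrite {2}e2 dotDr e3 e1 /toep hn ha -/u P_adj PP.
by move: (dot _ _) (dot _ _) (dot _ _) => z1 z2 z3; ring.
Qed.

(* By [defect_moment], [|psi a|^2 - r |a|^2 - |b|^2] has the same [chi]-moments
   as a positive multiple of [|k0|^2], hence is positive almost everywhere. *)
Lemma solve_k0 : exists a, [/\ defect a = k0, H2 a & {ae mu, forall t,
  rep a t != 0 /\ cmod (psi t - rep (P (mulf psi a)) t / rep a t) ^+ 2 < cmod (psi t) ^+ 2 - r}].
Proof.
have [a [Sa ha _]] := defect_solve H2_k0; exists a; split=> //.
set u := P (mulf psi a); pose b := mulf psi a - u.
have q0 : 0 < Q a.
  apply: lt_le_trans (Q_ge a); apply: mulr_gt0; first exact: e_gt0.
  rewrite exprn_gt0//; apply: nrm_gt0; apply/eqP => a0; have [Sl _] := defect_bop.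
  by have := nrm_k0; rewrite -Sa a0 (lin0 Sl) nrm0 expr0n /= => /eqP; rewrite lt_eqF// pi_gt0.
(* This [c] cancels the moment of order 0, because [<a, k0> = Q a] and [nrm k0 ^+ 2 = pi]. *)
pose c := Q a / pi; have c0 : 0 < c by rewrite divr_gt0// pi_gt0.
pose E t : Cplx R := sq (mulf psi a) t - r%:C * sq a t - sq b t - c%:C * sq k0 t.
have i1 := cintegB (sq_integ (mulf psi a)) (cintegZ r%:C (sq_integ a)).
have i2 := cintegB i1 (sq_integ b); have iE : cinteg E := cintegB i2 (cintegZ c%:C (sq_integ k0)).
have EJ t : cj (E t) = E t by rewrite /E /sq !JB !JM !JC.
have mom n : cint (fun t => E t * chi t ^+ n) = 0.
  have j1 := cinteg_chi n (sq_integ (mulf psi a)); have j2 := cinteg_chi n (sq_integ a).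
  have j3 := cinteg_chi n (sq_integ b); have j4 := cinteg_chi n (sq_integ k0).
  have -> : (fun t => E t * chi t ^+ n) = (fun t => sq (mulf psi a) t * chi t ^+ n -
      r%:C * (sq a t * chi t ^+ n) - sq b t * chi t ^+ n - c%:C * (sq k0 t * chi t ^+ n)).
    apply/funext => t; rewrite /E; move: (sq _ t) (sq _ t) (sq _ t) (sq _ t) (chi t ^+ n) (r%:C) (c%:C).
    by move=> z1 z2 z3 z4 z5 z6 z7; ring.
  rewrite (cintB (cintegB (cintegB j1 (cintegZ _ j2)) j3) (cintegZ _ j4)).
  rewrite (cintB (cintegB j1 (cintegZ _ j2)) j3) (cintB j1 (cintegZ _ j2)) (cintZ _ j2) (cintZ _ j4).
  rewrite !sq_moment (defect_moment n ha) Sa; case: n {j1 j2 j3 j4} => [|n] /=.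
    have -> : dot a k0 = (Q a)%:C.
      rewrite -Sa dotJ -/(Q a); apply: complex_ext; rewrite ?ReJ ?ImJ //=.
      by rewrite defect_form !dotxx -rmorphM -rmorphB -rmorphD /= oppr0.
    by rewrite dotxx nrm_k0 -rmorphM /c divfK ?subrr// gt_eqF ?pi_gt0.
  by rewrite !dot_sh_k0 ?mulr0 ?subrr//; [exact: H2_iter_sh H2_k0|exact: H2_iter_sh].
have mom' n : cint (fun t => E t * cj (chi t) ^+ n) = 0.
  have -> : (fun t => E t * cj (chi t) ^+ n) = (fun t => cj (E t * chi t ^+ n)).
    by apply/funext => t; rewrite (JM (E t)) EJ [cj (chi t ^+ n)]JX.
  by rewrite (cintJ (cinteg_chi n iE)) mom J0.
have E0 := moments_zero iE mom mom'; have [Lk _] := kz_L2 Im_negi.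
have bE : b = (-1) *: u + mulf psi a by rewrite /b; move: (mulf psi a) => w; hring.
have rb : {ae mu, forall t, rep b t = rep (mulf psi a) t - rep u t}.
  by rewrite bE; apply: (aeS (rep_lin (-1) u (mulf psi a))) => t ->; rewrite mulN1r addrC.
apply: (aeS2 (aeI E0 rb) (aeI (rep_mulf a Lp) (rep_vec Lk))) => t [Et bt] [pt kt].
have kn : 0 < cmod (kz (- I) t) ^+ 2 by rewrite exprn_gt0// cmod_gt0// invr_eq0; have /andP[] := i_den t.
have {Et}Et : cmod (psi t * rep a t) ^+ 2 - r * cmod (rep a t) ^+ 2 - cmod (psi t * rep a t - rep u t) ^+ 2 =
    c * cmod (kz (- I) t) ^+ 2.
  move: Et; rewrite /E /sq bt pt kt => /(congr1 (@Re R)); rewrite !ReB -!rmorphM /=.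
  by move=> h; apply/eqP; rewrite -subr_eq0 h.
have an : rep a t != 0.
  apply/eqP => a0; move: Et (mulr_gt0 c0 kn); rewrite a0 mulr0 cmod0 sub0r.
  have := sqr_ge0 (cmod (- rep u t)); move: (cmod (- rep u t) ^+ 2) (c * _) => z1 z2.
  by rewrite expr0n /= mulr0 subrr sub0r; lra.
split=> //; rewrite -(ltr_pM2r (_ : 0 < cmod (rep a t) ^+ 2)); last by rewrite exprn_gt0// cmod_gt0.
rewrite mulrBl -!exprMn -!cmodM mulrBl divfK//.
have := mulr_gt0 c0 kn; rewrite -Et.
by move: (cmod _ ^+ 2) (cmod _ ^+ 2) (r * _) => z1 z2 z3; lra.
Qed.

(* The submodule of the [f] with [h f] in the Hardy space contains the cyclic
   vector [a], and the shift expands the form of [defect]; a vector orthogonal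
   to it would give a form-nondecreasing sequence tending to 0. *)
Lemma submodule_full a (M : set H) : defect a = k0 -> H2 a -> subsp M -> hclosed M ->
  (forall x, M x -> H2 x) -> (forall x, M x -> M (sh x)) -> M a -> forall x, H2 x -> M x.
Proof.
move=> Sa ha Ms Mc MH Msh Ma x hx; have [p [Mp hp]] := projection x Ms Mc.
suff : x - p = 0 by move/eqP; rewrite subr_eq0 => /eqP ->.
set g0 := x - p in hp *; have hg0 : H2 g0 by apply: subspB H2_subsp hx _; exact: MH.
pose y n := P (iter n sh' g0).
have Man n : M (iter n sh a) by elim: n => //= n; exact: Msh.
have /choice[g hg] : forall n, exists x, [/\ defect x = y n, H2 x & e * nrm x <= nrm (y n)].
  by move=> n; apply: defect_solve; exact: H2P.
have mono n : Q (g n) <= Q (g n.+1).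
  have [Sg Hg _] := hg n; have [Sg1 _ _] := hg n.+1.
  (* As [k0 = defect a], this is the orthogonality of [g0] to [chi^n a], an element of the
     submodule. It allows division of [g n] by [chi] inside the Hardy space. *)
  have g0k : dot (g n) k0 = 0.
    by rewrite -Sa -defect_sa Sg /y (dotP _ ha) dotJ -dot_iter (dotC0 (hp _ (Man n))) J0.
  have Hg' := H2_sh' Hg g0k.
  have gE : g n = sh (sh' (g n)) by rewrite sh'K.
  have : Q (g n) = Re (dot (defect (g n.+1)) (sh' (g n))).
    by rewrite /Q {2}gE Sg1 Sg -(adjoint_sym sh_adj) -(dotP _ Hg') /y P_sh'P.
  have := Q_cross (g n.+1) (sh' (g n)); have := Q_sh Hg'; rewrite sh'K => a1 a2 a3.
  by move: a1 a2 a3; rewrite -/(Q _); move: (Q _) (Q _) (Q _) (Re _) => z1 z2 z3 z4; lra.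
have mono0 n : Q (g 0%N) <= Q (g n) by elim: n => // n IH; exact: le_trans IH (mono n).
have Qle n : e * Q (g n) <= nrm (y n) ^+ 2.
  have [Sg Hg le] := hg n; rewrite /Q Sg; have e0 := e_gt0.
  apply: (@le_trans _ _ (e * (nrm (y n) * nrm (g n)))); first by rewrite ler_pM2l//; exact: Re_dot_le.
  by rewrite mulrCA expr2; apply: ler_wpM2l => //; exact: nrm_ge0.
have Q0 : Q (g 0%N) = 0.
  apply/eqP; rewrite eq_le Q_ge0 andbT; apply/ler_addgt0Pr => e' e'0; rewrite add0r.
  have e0 := e_gt0.
  have m0 : 0 < Num.min 1 (e * e') by rewrite lt_min ltr01 mulr_gt0.
  have [N hN] := P_iter_sh'_cvg g0 m0.
  have := hN N (leqnn _); rewrite subr0 -/(y N) lt_min => /andP[l1 l2].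
  rewrite -(ler_pM2l e0); apply: le_trans (le_trans (Qle N) _); first by rewrite ler_pM2l.
  have := nrm_ge0 (y N); move: (e * e') (nrm (y N)) l1 l2 => ee v l1 l2 v0.
  by rewrite expr2; nra.
have g00 : g 0%N = 0.
  apply: nrm_eq0; apply/eqP; rewrite -sqrf_eq0 eq_le sqr_ge0 andbT -(pmulr_rle0 _ e_gt0) -Q0; exact: Q_ge.
have [Sg _ _] := hg 0%N; have [Sl _] := defect_bop.
by move: Sg; rewrite g00 (lin0 Sl) /y /= hg0 => <-.
Qed.

(** The estimate of [solve_k0] gives [r + |h|^2 <= 2 Re (psi conj h) <= 2 M |h|]: this bounds [h] by
    [2 M] and away from 0, and dividing by [|h|^2] gives sectoriality of [psi / h]. The vectors that
    [h] keeps in the Hardy space form a submodule to which [submodule_full] applies. *)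
Lemma bb_factor_bound : exists s h, [/\ sectorial s, Hmul h & {ae mu, forall t, psi t = s t * h t}].
Proof.
have [a [Sa ha hae]] := solve_k0; set u := P (mulf psi a) in hae.
pose h t : Cplx R := rep u t / rep a t.
have [mp [M0 hM0]] := Lp; pose M := `|M0| + 1; have M1 : 0 < M by rewrite /M; have := normr_ge0 M0; lra.
have mh : cmeasurable setT h.
  by apply: cmeas_mul; [exact: rep_meas|apply: cmeas_inv; exact: rep_meas].
have r0 := r_gt0.
have pt : {ae mu, forall t, [/\ rep a t != 0, cmod (psi t) <= M, cmod (h t) <= 2 * M,
     r <= 2 * M * cmod (h t) & r <= 2 * Re (psi t * cj (h t))]}.
  apply: (aeS2 hae hM0) => t [an lt] hM; rewrite -/(h t) in lt.
  have pM : cmod (psi t) <= M by apply: le_trans hM _; rewrite /M; have := ler_norm M0; lra.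
  have := sqr_cmodD (psi t) (- h t); rewrite JN mulrN ReN cmodN => eq.
  have re : r + cmod (h t) ^+ 2 <= 2 * Re (psi t * cj (h t)).
    by move: lt; rewrite eq; move: (cmod _ ^+ 2) (cmod _ ^+ 2) (Re _) => z1 z2 z3; lra.
  have h2 := sqr_ge0 (cmod (h t)).
  have le1 : Re (psi t * cj (h t)) <= M * cmod (h t).
    apply: le_trans (ler_norm _) (le_trans (cmod_Re _) _); rewrite cmodM cmodJ.
    by apply: ler_wpM2r => //; exact: cmod_ge0.
  have hp : cmod (h t) <= 2 * M.
    have [hz|hz] := eqVneq (cmod (h t)) 0; first by rewrite hz; lra.
    have hg : 0 < cmod (h t) by rewrite lt_def hz cmod_ge0.
    rewrite -(ler_pM2r hg); move: re le1 r0; rewrite expr2.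
    by move: (cmod (h t) * cmod (h t)) (Re _) (r) => z1 z2 z3; rewrite -mulrA; move: (M * _) => z4; lra.
  split=> //; last by lra.
  by move: re le1 h2; rewrite -mulrA; move: (Re _) (M * _) (_ ^+ 2) => z1 z2 z3; lra.
have Lh : Linfty h by split=> //; exists (2 * M); apply: (aeS pt) => t [].
pose s t : Cplx R := psi t / h t.
have hn : {ae mu, forall t, 0 < cmod (h t)}.
  apply: (aeS pt) => t [_ _ _ l _]; rewrite lt_def cmod_ge0 andbT; apply/eqP => z.
  by move: l; rewrite z mulr0; lra.
exists s, h; split.
- split.
    split; first by apply: cmeas_mul => //; exact: cmeas_inv.
    exists (2 * M ^+ 2 / r); apply: (aeS2 pt hn) => t [_ pM _ l _] h0.
    rewrite cmodM cmodV ler_pdivrMr// mulrAC ler_pdivlMr//.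
    apply: (@le_trans _ _ (M * (2 * M * cmod (h t)))); last by rewrite expr2; lra.
    by apply: ler_pM => //; [exact: cmod_ge0|exact: ltW].
  exists (r / 2 / (2 * M) ^+ 2), 1; split; [|exact: cmod1|].
    by rewrite !divr_gt0// exprn_gt0// mulr_gt0.
  apply: (aeS2 pt hn) => t [_ _ hM _ re] h0; rewrite mul1r /s.
  have -> : psi t / h t = (cmod (h t) ^+ 2)^-1%:C * (psi t * cj (h t)).
    have hz : h t != 0 by exact: cmod_gt0P.
    have Jz : cj (h t) != 0 by apply: cmod_gt0P; rewrite cmodJ.
    have -> : ((cmod (h t) ^+ 2)^-1)%:C = (h t * cj (h t))^-1 :> Cplx R by rewrite mulcJ -fmorphV.
    by move: (cj (h t)) (h t) (psi t) Jz hz => z1 z2 z3 d1 d2; field; rewrite d1 d2.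
  rewrite ReM /= mul0r subr0 mulrC; apply: ler_pM.
  + by rewrite invr_ge0 sqr_ge0.
  + by lra.
  + by rewrite lef_pV2 ?posrE ?exprn_gt0// ?mulr_gt0//; apply: sqr_mono => //; exact: cmod_ge0.
  + by lra.
- split=> // x hx.
  have [] // := @submodule_full a [set x | H2 x /\ H2 (mulf h x)] Sa ha _ _ _ _ _ x hx.
  + split; first by split; [exact: H2_subsp.1|rewrite (lin0 (mulf_lin Lh)); exact: H2_subsp.1].
    by move=> c y z [hy hhy] [hz hhz]; split; rewrite ?(mulf_lin Lh); exact: H2_subsp.2.
  + move=> y hy; suff : forall T, bop T -> (forall s, H2 s /\ H2 (mulf h s) -> H2 (T s)) -> H2 (T y).
      move=> k; split; last by apply: k => [|z []]; [exact: mulf_bop|].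
      by apply: (k (fun x => x)) => [|z []//]; split=> //; exists 1; split=> // z; rewrite mul1r.
    move=> T Tb hT; apply/eqP; rewrite -subr_eq0; apply/eqP/nrm_small => e' e'0.
    have [Tl [K [K0 hK]]] := Tb; have K1 : 0 < 2 * K + 1 by lra.
    have [z [hz lz]] := hy (e' / (2 * K + 1)) (divr_gt0 e'0 K1).
    have -> : P (T y) - T y = P (T (y - z)) - T (y - z).
      rewrite (linB Tl) (linB P_lin) (hT z hz); move: (P (T y)) (T y) (T z) => w1 w2 w3; hring.
    apply: le_lt_trans (nrmD _ _) _; rewrite nrmN; have n1 := nrm_P (T (y - z)); have n2 := hK (y - z).
    rewrite ltr_pdivlMr// in lz; have n3 := nrm_ge0 (y - z).
    by move: n1 n2 n3 lz; move: (nrm _) (nrm _) (nrm _) => v1 v2 v3; nra.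
  + by move=> y [].
  + move=> y [hy hhy]; split; first exact: H2_sh.
    by rewrite /sh mulfC//; [exact: H2_sh|exact: chi_Linfty].
  + split=> //; suff -> : mulf h a = u by exact: H2P.
    by apply: L2_ext; apply: (aeS2 (rep_mulf a Lh) pt) => t -> [an _ _ _ _]; rewrite /h divfK.
- apply: (aeS hn) => t /cmod_gt0P h0; by rewrite /s divfK.
Qed.

End Factor.

Lemma bb_factor psi : Linfty psi -> bb psi ->
  exists s h, [/\ sectorial s, Hmul h & {ae mu, forall t, psi t = s t * h t}].
Proof. move=> Lp [d [d0 hd]]; exact: (bb_factor_bound Lp d0 hd). Qed.

Lemma sectorial_conj (s : R -> Cplx R) : sectorial s -> sectorial (fun t => cj (s t)).
Proof.
move=> [Ls [e [c [e0 c1 hs]]]]; split; first exact: Linfty_conj.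
by exists e, (cj c); split; rewrite ?cmodJ//; apply: (aeS hs) => t; rewrite -JM ReJ.
Qed.

Lemma sectorial_dot s : sectorial s -> exists (e : R) (c : R[i]),
  [/\ 0 < e, cmod c = 1 & forall x, e * nrm x ^+ 2 <= Re (c * dot (mulf s x) x)].
Proof.
move=> [Ls [e [c [e0 c1 hs]]]]; exists e, c; split=> // x.
have Lx := rep_L2 x; have i := L2_prodJ (Linfty_L2 Ls Lx) Lx.
have -> : dot (mulf s x) x = cint (fun t => s t * rep x t * cj (rep x t)).
  by rewrite mulfE -[X in dot _ X]vec_rep dot_vec//; exact: Linfty_L2.
have ix := (iffLR (L2P _) Lx).2.
rewrite -(cintZ c i) nrm_rep -(rintZ e ix).
apply: rint_ae_le; [exact: rintegZ|exact: (cinteg_Re (cintegZ c i))|].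
apply: (aeS hs) => t h; rewrite -mulrA mulcJ mulrA ReM /= mulr0 subr0.
by apply: ler_wpM2r => //; exact: sqr_ge0.
Qed.

Lemma bb_sectorial s : sectorial s -> bb s.
Proof.
move=> /sectorial_dot[e [c [e0 c1 h]]]; exists e; split=> // x hx.
have [->|x0] := eqVneq x 0; first by rewrite nrm0 mulr0 nrm_ge0.
rewrite -(ler_pM2r (nrm_gt0 x0)) -mulrA -expr2; apply: le_trans (h x) _.
rewrite -[X in dot _ X]hx -P_adj; apply: le_trans (ler_norm _) (le_trans (cmod_Re _) _).
by rewrite cmodM c1 mul1r; exact: cauchy_schwarz.
Qed.

Lemma bb_ext f g : Linfty f -> Linfty g -> {ae mu, forall t, f t = g t} -> bb f -> bb g.
Proof. by move=> Lf Lg e [d [d0 h]]; exists d; split=> // x /h; rewrite (mulf_ext _ Lf Lg e). Qed.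

Definition below f := exists c : R, 0 < c /\ {ae mu, forall t, c <= cmod (f t)}.

Lemma below_factor f g h : Linfty g -> below f -> {ae mu, forall t, f t = g t * h t} -> below h.
Proof.
move=> [_ [M hM]] [c [c0 hc]] e; have M0 : 0 < `|M| + 1 by have := normr_ge0 M; lra.
exists (c / (`|M| + 1)); split; first exact: divr_gt0.
apply: (aeS3 hM hc e) => t h1 h2 h3; rewrite h3 cmodM in h2; rewrite ler_pdivrMr//.
apply: le_trans h2 _; rewrite mulrC; apply: ler_wpM2l; first exact: cmod_ge0.
by apply: le_trans h1 _; have := ler_norm M; lra.
Qed.

Lemma below_conj f : below f -> below (fun t => cj (f t)).
Proof. by move=> [c [c0 h]]; exists c; split=> //; apply: (aeS h) => t; rewrite cmodJ. Qed.

Lemma Linfty_inv f : cmeasurable setT f -> below f -> Linfty (fun t => (f t)^-1).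
Proof.
move=> mf [c [c0 hc]]; split; first exact: cmeas_inv.
exists c^-1; apply: (aeS hc) => t h; rewrite cmodV lef_pV2 ?posrE//; exact: lt_le_trans h.
Qed.

Lemma bb_mul psi h : Linfty psi -> Hmul h -> below h -> bb psi -> bb (fun t => psi t * h t).
Proof.
move=> Lp [Lh hh] [c [c0 hc]] [d [d0 hd]]; exists (d * c); split; first exact: mulr_gt0.
move=> x hx; rewrite -mulf_mulf//; apply: le_trans (hd _ (hh x hx)).
by rewrite -mulrA ler_pM2l//; apply: nrm_mulf_ge => //; exact: ltW.
Qed.

(** Dual to the invariance of the Hardy space under [h]: multiplication by [conj h] preserves its
    orthogonal complement. *)
Lemma P_anti h x : Hmul h -> P (mulf (fun t => cj (h t)) (P x)) = P (mulf (fun t => cj (h t)) x).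
Proof.
move=> [Lh hh]; apply: eq_dot => y.
rewrite !P_adj (adjoint_sym (mulf_adj Lh)) (adjoint_sym (mulf_adj Lh)).
by rewrite dotP//; exact: hh (H2P y).
Qed.

(** By [P_anti], the Toeplitz operator with symbol [conj g psi] is a bounded operator after the one
    with symbol [psi]. *)
Lemma bb_anti psi g : Linfty psi -> Hmul g -> bb (fun t => cj (g t) * psi t) -> bb psi.
Proof.
move=> Lp Hg [d [d0 hd]]; have [Lg _] := Hg; have Lc := Linfty_conj Lg.
have [_ [M [M0 hM]]] := mulf_bop Lc; have M1 : 0 < M + 1 by lra.
exists (d / (M + 1)); split; first exact: divr_gt0.
move=> x hx; rewrite mulrAC ler_pdivrMr//; apply: le_trans (hd x hx) _.
rewrite -mulf_mulf// -P_anti//; apply: le_trans (nrm_P _) (le_trans (hM _) _).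
rewrite mulrC; apply: ler_wpM2l; [exact: nrm_ge0|lra].
Qed.

Lemma nrm_coP x : nrm (x - P x) <= nrm x.
Proof. by rewrite -ler_sqr ?nnegrE ?nrm_ge0// (nrm_P_pyth x) lerDr; exact: sqr_ge0. Qed.

(** The identity on the complement turns the Toeplitz operator into an operator on the whole space
    with the same kernel and deficiency, so that the general Hilbert space lemmas apply. *)
Definition diagT psi x : H := toep psi x + (x - P x).

Lemma diagT_adj psi : Linfty psi -> adjoint (diagT psi) (diagT (fun t => cj (psi t))).
Proof.
move=> h x y; rewrite /diagT dotDl dotDr (toep_adj h) dotBl dotBr.
by rewrite P_adj.
Qed.

Lemma diagT_bop psi : Linfty psi -> bop (diagT psi).
Proof.
move=> h; have idb : bop (fun x : H => x) by split=> //; exists 1; split=> // x; rewrite mul1r.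
have := bop_add (toep_bop h) (bop_add idb (bop_scale (-1) P_bop)).
rewrite (_ : (fun x => _) = diagT psi)//; apply/funext => x; rewrite /diagT.
by move: (toep _ _) (P x) => u v; hring.
Qed.

Lemma P_diagT psi x : P (diagT psi x) = toep psi x.
Proof. by rewrite /diagT (linD P_lin) (linB P_lin x) PP subrr addr0 /toep PP. Qed.

Lemma diagT_H2 psi x : H2 x -> diagT psi x = P (mulf psi x).
Proof. by move=> hx; rewrite /diagT /toep hx subrr addr0. Qed.

Lemma diagT_le psi x : nrm x <= nrm (P x) + nrm (diagT psi x).
Proof.
have -> : nrm x = nrm (P x + (x - P x)) by congr nrm; move: (P x) => u; hring.
apply: le_trans (nrmD _ _) _; rewrite lerD2l.
have -> : x - P x = diagT psi x - P (diagT psi x).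
  by rewrite P_diagT /diagT; move: (toep _ _) (P x) => u v; hring.
exact: nrm_coP.
Qed.

Lemma nrm_toep psi x : nrm (toep psi x) <= nrm (diagT psi x).
Proof. by rewrite -P_diagT; exact: nrm_P. Qed.

Lemma bb_diagT psi : bb psi <-> bounded_below (diagT psi).
Proof.
split=> [[d [d0 hd]]|[C hC]].
  exists (d^-1 + 1) => x; apply: le_trans (diagT_le psi x) _; rewrite mulrDl mul1r lerD2r.
  rewrite ler_pdivlMl//; exact: le_trans (hd _ (H2P x)) (nrm_toep psi x).
have C1 : 0 < `|C| + 1 by have := normr_ge0 C; lra.
exists (`|C| + 1)^-1; split; first by rewrite invr_gt0.
move=> x hx; rewrite ler_pdivrMl//; apply: le_trans (hC x) _; rewrite (diagT_H2 _ hx).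
by apply: ler_wpM2r; [exact: nrm_ge0|have := ler_norm C; lra].
Qed.

Lemma coercive_inv (T : H -> H) (e : R) : bop T -> 0 < e -> (forall x, e * nrm x ^+ 2 <= Re (dot (T x) x)) ->
  exists K : H -> H, [/\ bop K, forall y, T (K y) = y & forall x, K (T x) = x].
Proof.
move=> Tb e0 co; have [Tl _] := Tb.
have co' x : e * nrm x ^+ 2 <= Re (1 * dot (T x) x) by rewrite mul1r.
have /choice[K hK] := lax_milgram Tb (@cmod1 R) e0 co'.
have bl := coercive_below (@cmod1 R) e0 co'.
have inj x y : T x = T y -> x = y.
  move=> h; apply/eqP; rewrite -subr_eq0; apply/eqP/nrm_eq0/eqP; rewrite eq_le nrm_ge0 andbT -(pmulr_rle0 _ e0).
  by apply: le_trans (bl _) _; rewrite (linB Tl) h subrr nrm0.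
exists K; split=> // [|x]; last by apply: inj; rewrite hK.
split; first by move=> a x y; apply: inj; rewrite Tl !hK.
exists e^-1; split; first by rewrite invr_ge0 ltW.
by move=> x; rewrite ler_pdivlMl//; apply: le_trans (bl _) _; rewrite hK.
Qed.

Lemma below_coercive (T T' : H -> H) : adjoint T T' -> bounded_below T ->
  exists e : R, 0 < e /\ forall x, e * nrm x ^+ 2 <= Re (dot (T' (T x)) x).
Proof.
move=> adj [C hC]; have C1 : 0 < `|C| + 1 by have := normr_ge0 C; lra.
exists ((`|C| + 1)^-1 ^+ 2); split; first by rewrite exprn_gt0// invr_gt0.
move=> x; rewrite (adjoint_sym adj) -sqr_nrm -exprMn; apply: sqr_mono.
  by apply: mulr_ge0; [rewrite invr_ge0 ltW|exact: nrm_ge0].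
rewrite ler_pdivrMl//; apply: le_trans (hC x) _.
by apply: ler_wpM2r; [exact: nrm_ge0|have := ler_norm C; lra].
Qed.

(** The left inverse is [(T' T)^-1 T'], with [T' T] coercive. *)
Lemma below_linv (T T' : H -> H) : bop T -> bop T' -> adjoint T T' -> bounded_below T ->
  exists K : H -> H, bop K /\ forall x, K (T x) = x.
Proof.
move=> Tb T'b adj /(below_coercive adj)[e [e0 co]].
have [K [Kb _ KT]] := coercive_inv (bop_comp T'b Tb) e0 co.
by exists (K \o T'); split; [exact: bop_comp|exact: KT].
Qed.

Lemma below_rinv (T T' : H -> H) : bop T -> bop T' -> adjoint T T' -> bounded_below T' ->
  exists K : H -> H, bop K /\ forall x, T (K x) = x.
Proof.
move=> Tb T'b adj /(below_coercive (adjoint_sym adj))[e [e0 co]].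
have [K [Kb TK _]] := coercive_inv (bop_comp Tb T'b) e0 co.
by exists (T' \o K); split; [exact: bop_comp|exact: TK].
Qed.

Lemma bb_onto psi : Linfty psi -> bb (fun t => cj (psi t)) <->
  forall y, H2 y -> exists x, H2 x /\ P (mulf psi x) = y.
Proof.
move=> Lp; have Lc := Linfty_conj Lp; split=> [/bb_diagT hb y hy|h].
  have [K [_ hK]] := below_rinv (diagT_bop Lp) (diagT_bop Lc) (diagT_adj Lp) hb.
  by exists (P (K y)); split; [exact: H2P|rewrite -[RHS]hy -(hK y) P_diagT hK].
apply/bb_diagT; apply: (onto_adjoint_below (diagT_adj Lp)) => g.
have [x [hx e]] := h (P g) (H2P g); exists (x + (g - P g)).
have Pz : P (x + (g - P g)) = x by rewrite (linD P_lin) (linB P_lin g) PP subrr addr0 hx.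
by rewrite /diagT /toep Pz e; move: (P g) => u; hring.
Qed.

Lemma bb_sect psi : Linfty psi -> below psi ->
  bb psi <-> exists s h, [/\ sectorial s, Hmul h & {ae mu, forall t, psi t = s t * h t}].
Proof.
move=> Lp bp; split=> [|[s [h [Ss Hh e]]]]; first exact: bb_factor.
have [Ls _] := Ss; have [Lh _] := Hh.
apply: (@bb_ext (fun t => s t * h t)) => //; [exact: Linfty_mul|by apply: (aeS e) => t ->|].
by apply: bb_mul => //; [exact: below_factor Ls bp e|exact: bb_sectorial].
Qed.

Lemma bb_sect_unit psi : Linfty psi -> below psi ->
  (bb psi /\ bb (fun t => cj (psi t))) <-> exists s h, [/\ sectorial s, units_of Hmul h &
     {ae mu, forall t, psi t = s t * h t}].
Proof.
move=> Lp bp; split=> [[b1 b2]|[s [h [Ss [Hh [g [Hg hg]]] e]]]]; last first.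
  split; first by apply/(bb_sect Lp bp); exists s, h.
  apply: (@bb_anti _ g) => //; first exact: Linfty_conj.
  have Sc := sectorial_conj Ss; have [Lc _] := Sc; have [Lg _] := Hg.
  apply: (bb_ext Lc _ _ (bb_sectorial Sc)); first by apply: Linfty_mul; exact: Linfty_conj.
  by apply: (aeS2 e hg) => t -> h1; rewrite -JM mulrCA [g t * _]mulrC h1 mulr1.
have [s [h [Ss Hh e]]] := bb_factor Lp b1; have [Ls _] := Ss; have [Lh _] := Hh.
have bh := below_factor Ls bp e; have Li := Linfty_inv Lh.1 bh.
have hi : {ae mu, forall t, h t * (h t)^-1 = 1}.
  by have [c [c0 hc]] := bh; apply: (aeS hc) => t hct; rewrite mulfV//; apply: cmod_gt0P; exact: lt_le_trans hct.
exists s, h; split=> //; split=> //; exists (fun t => (h t)^-1); split=> //; split=> // y hy.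
(* Why [1 / h] is a multiplier: solve [P (psi x) = P (s y)]. As [psi x = s (h x)] and the Toeplitz
   operator with symbol [s] is injective, [y = h x], hence [y / h = x] is in the Hardy space. *)
have [x [hx ex]] := iffLR (bb_onto Lp) b2 (P (mulf s y)) (H2P _).
have [d [d0 hd]] := bb_sectorial Ss.
have e1 : mulf psi x = mulf s (mulf h x) by rewrite mulf_mulf//; apply: mulf_ext e => //; exact: Linfty_mul.
have : y = mulf h x.
  apply/eqP; rewrite -subr_eq0; apply/eqP/nrm_eq0/eqP; rewrite eq_le nrm_ge0 andbT -(pmulr_rle0 _ d0).
  have := hd (y - mulf h x); rewrite (linB (mulf_lin Ls)) (linB P_lin) -e1 ex subrr nrm0; apply.
  by apply: subspB H2_subsp hy _; exact: Hh.2.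
move=> ->; rewrite mulf_mulf// (mulf_ext _ (Linfty_mul Li Lh) (Linfty_cst 1)); first by rewrite mulf_cst scale1r.
by apply: (aeS hi) => t; rewrite mulrC.
Qed.

(** Induction on the number of conditions: a vector [z] with [<z, v 0> = 1] corrects [f] at a cost
    proportional to [|<f, v 0>|], and if there is none, the first condition holds throughout [M]. *)
Lemma add_below (T : H -> H) n (v : 'I_n -> H) (C : R) (M : set H) : linop T -> subsp M ->
  (forall f : H, M f -> (forall i, dot f (v i) = 0) -> nrm f <= C * nrm (T f)) ->
  exists K : R, 0 <= K /\ forall f : H, M f -> nrm f <= K * (nrm (T f) + \sum_i cmod (dot f (v i))).
Proof.
move=> Tl; elim: n v M => [|n IH] v M Ms hC.
  exists `|C|; split=> // f Mf; rewrite big_ord0 addr0; apply: le_trans (hC f Mf _) _; first by case.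
  by apply: ler_wpM2r; [exact: nrm_ge0|exact: ler_norm].
pose M' : set H := [set f | M f /\ dot f (v ord0) = 0].
have M's : subsp M'.
  split; first by split; [exact: Ms.1|exact: dot0l].
  by move=> a x y [Mx ex] [My ey]; split; [exact: Ms.2|rewrite dotDl dotZl ex ey mulr0 addr0].
have [|K [K0 hK]] := IH (fun i => v (lift ord0 i)) M' M's.
  move=> f [Mf f0] hf; apply: hC => // i; have [j ->|->] := unliftP ord0 i; [exact: hf|exact: f0].
have [[z [Mz z1]]|no] := pselect (exists z, M z /\ dot z (v ord0) = 1); last first.
  exists K; split=> // f Mf; have f0 : dot f (v ord0) = 0.
    apply/eqP; apply/negPn/negP => f0; apply: no; exists ((dot f (v ord0))^-1 *: f).
    by split; [exact: subspZ|rewrite dotZl mulVf].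
  by rewrite big_ord_recl f0 cmod0 add0r; exact: hK.
pose B := K * (nrm (T z) + \sum_i cmod (dot z (v (lift ord0 i)))) + nrm z.
have S0 (w : H) : 0 <= \sum_i cmod (dot w (v (lift ord0 i))) by apply: sumr_ge0 => i _; exact: cmod_ge0.
have B0 : 0 <= B by rewrite addr_ge0 ?nrm_ge0 ?mulr_ge0 ?addr_ge0 ?nrm_ge0.
exists (K + B); split; first exact: addr_ge0.
move=> f Mf; rewrite big_ord_recl; set al := dot f (v ord0).
have M'f : M' (f - al *: z).
  by split; [apply: subspB => //; exact: subspZ|rewrite dotBl dotZl z1 mulr1 subrr].
have h1 := hK _ M'f.
have h2 : nrm (T (f - al *: z)) <= nrm (T f) + cmod al * nrm (T z).
  by rewrite (linB Tl) (linZ Tl); apply: le_trans (nrmD _ _) _; rewrite nrmN nrmZ.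
have h3 : \sum_i cmod (dot (f - al *: z) (v (lift ord0 i))) <=
    \sum_i cmod (dot f (v (lift ord0 i))) + cmod al * \sum_i cmod (dot z (v (lift ord0 i))).
  rewrite mulr_sumr -big_split; apply: ler_sum => i _ /=.
  by rewrite dotBl dotZl; apply: le_trans (cmodD _ _) _; rewrite cmodN cmodM.
have h4 : nrm f <= nrm (f - al *: z) + cmod al * nrm z.
  by rewrite -nrmZ; have := nrmD (f - al *: z) (al *: z); rewrite subrK.
apply: le_trans h4 _; apply: (@le_trans _ _ (K * (nrm (T f) + cmod al * nrm (T z) + (\sum_i cmod (dot f (v (lift ord0 i))) + cmod al * \sum_i cmod (dot z (v (lift ord0 i))))) + cmod al * nrm z)).
  rewrite lerD2r; apply: le_trans h1 _; apply: ler_wpM2l => //; exact: lerD.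
have := mulr_ge0 B0 (S0 f); have := mulr_ge0 B0 (nrm_ge0 (T f)); have := mulr_ge0 K0 (cmod_ge0 al).
rewrite /B; move: (\sum_i _) (\sum_i _) (nrm (T f)) (nrm (T z)) (cmod al) (nrm z) => s1 s2 a1 a2 a3 a4.
by move=> p1 p2 p3; rewrite -subr_ge0; move: (addr_ge0 p1 (addr_ge0 p2 p3)); congr (0 <= _); ring.
Qed.

(** Each orthogonality condition permits one more division by [chi]. *)
Lemma H2_iter_sh' n x : H2 x -> (forall i : 'I_n, dot x (iter i sh k0) = 0) -> H2 (iter n sh' x).
Proof.
elim: n x => [//|n IH] x hx h; rewrite iterSr; apply: IH.
  by apply: H2_sh' => //; exact: (h ord0).
by move=> i; rewrite (adjoint_sym sh_adj); exact: (h (lift ord0 i)).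
Qed.

Lemma iter_sh'K n x : iter n sh (iter n sh' x) = x.
Proof. by elim: n x => //= n IH x; rewrite -iterS iterSr sh'K. Qed.

Lemma nrm_iter_sh n x : nrm (iter n sh x) = nrm x.
Proof. by elim: n => //= n IH; rewrite nrm_sh. Qed.

Lemma mulf_chiX n psi x : Linfty psi -> mulf (fun t => chi t ^+ n * psi t) x = mulf psi (iter n sh x).
Proof.
move=> Lp; have Lc := Linfty_exp n (@chi_Linfty R); rewrite -mulf_chi_iter mulf_mulf//.
by congr (mulf _ x); apply/funext => t; rewrite mulrC.
Qed.

(** The [n] conditions say that the Hardy part of [x] is [chi^n] times an element of the Hardy
    space, to which the hypothesis applies. *)
Lemma bb_fin_below psi n : Linfty psi -> bb (fun t => chi t ^+ n * psi t) -> fin_below (diagT psi).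
Proof.
move=> Lp [d [d0 hd]]; exists n, (fun i => iter i sh k0), (d^-1 + 1) => x hx.
apply: le_trans (diagT_le psi x) _; rewrite mulrDl mul1r lerD2r ler_pdivlMl//.
have hP : H2 (iter n sh' (P x)).
  apply: H2_iter_sh'; first exact: H2P.
  by move=> i; rewrite dotP; [exact: hx|exact: H2_iter_sh H2_k0].
have := hd _ hP; rewrite (mulf_chiX _ _ Lp) iter_sh'K nrm_iter_sh' => h.
exact: le_trans h (nrm_toep psi x).
Qed.

Lemma sum_small n (a : 'I_n -> nat -> R) : (forall i e, 0 < e -> exists N, forall m, (N <= m)%N -> a i m < e) ->
  forall e, 0 < e -> exists N, \sum_i a i N <= e.
Proof.
move=> ha e e0; have e1 : 0 < e / n.+1%:R by rewrite divr_gt0// ltr0n.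
have /choice[N hN] : forall i, exists N, forall m, (N <= m)%N -> a i m < e / n.+1%:R by move=> i; exact: ha.
exists (\max_i N i)%N; apply: (@le_trans _ _ (\sum_(i < n) e / n.+1%:R)).
  by apply: ler_sum => i _; apply: ltW; apply: hN; exact: leq_bigmax.
rewrite sumr_const card_ord -[leLHS]mulr_natr mulrAC ler_pdivrMr ?ltr0n//.
by rewrite ler_pM2l// ler_nat.
Qed.

(** For [x] in the Hardy space, [<chi^N x, v i>] is the pairing of [x] with [P (conj chi^N v i)],
    which tends to 0. For large [N] the sum is absorbed into the left side. *)
Lemma add_below_bb psi n (v : 'I_n -> H) (K : R) : Linfty psi -> 0 <= K ->
  (forall f : H, nrm f <= K * (nrm (diagT psi f) + \sum_i cmod (dot f (v i)))) ->
  exists N, bb (fun t => chi t ^+ N * psi t).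
Proof.
move=> Lp K0 hK; have K1 : 0 < (2 * (K + 1))^-1 by rewrite invr_gt0; lra.
have [|N hN] := @sum_small n (fun i m => nrm (P (iter m sh' (v i)))) _ _ K1.
  by move=> i e e0; have [N hN] := P_iter_sh'_cvg (v i) e0; exists N => m /hN; rewrite subr0.
exists N, (2 * (K + 1))^-1; split=> // x hx; rewrite (mulf_chiX _ _ Lp).
have hs := H2_iter_sh N hx; have := hK (iter N sh x); rewrite (diagT_H2 _ hs) nrm_iter_sh.
have : \sum_i cmod (dot (iter N sh x) (v i)) <= nrm x * (2 * (K + 1))^-1.
  apply: (@le_trans _ _ (nrm x * \sum_i nrm (P (iter N sh' (v i))))); last by apply: ler_wpM2l => //; exact: nrm_ge0.
  rewrite mulr_sumr; apply: ler_sum => i _; rewrite dot_iter -[X in dot X _]hx P_adj; exact: cauchy_schwarz.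
rewrite -ler_pdivrMr ?invr_gt0 ?ler_pdivlMl// ?invrK; last by lra.
have := nrm_ge0 x; have := nrm_ge0 (P (mulf psi (iter N sh x))).
rewrite [(2 * _)^-1 * _ <= _]ler_pdivrMl; last by lra.
by move: (\sum_i _) (nrm x) (nrm _) => s a b b0 a0 h1 h2; nra.
Qed.

Lemma fin_below_bb psi : Linfty psi -> fin_below (diagT psi) -> exists N, bb (fun t => chi t ^+ N * psi t).
Proof.
move=> Lp [n [v [C hC]]]; have [Tl _] := diagT_bop Lp.
have [|K [K0 hK]] := @add_below (diagT psi) n v C setT Tl _ (fun (f : H) _ => hC f); first by split.
by apply: add_below_bb Lp K0 _ => f; exact: hK.
Qed.

(** The adjoint has closed range because it is bounded below, and dense range by injectivity; being
    onto, it forces a lower bound for the operator itself. *)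
Lemma bb_bijective psi : Linfty psi -> bb (fun t => cj (psi t)) ->
  (forall x, H2 x -> P (mulf psi x) = 0 -> x = 0) -> bb psi.
Proof.
move=> Lp bc inj; have Lc := Linfty_conj Lp; have Db := diagT_bop Lc; have [Dl _] := Db.
have adj := adjoint_sym (diagT_adj Lp).
apply/bb_diagT; apply: (onto_adjoint_below adj) => g.
have [C hC] := iffLR (bb_diagT _) bc.
have cl : hclosed [set diagT (fun t => cj (psi t)) f | f in setT].
  by apply: (below_range_closed (C := C) Db) => //; split.
have [] := cl g; last by move=> f _ <-; exists f.
apply: dense_of_ortho; first exact: range_subsp.
move=> y hy; have Dy : diagT psi y = 0.
  by apply: dot_def; rewrite (diagT_adj Lp) hy//; exists (diagT psi y).
have Py : P y = 0 by apply: inj; [exact: H2P|rewrite -/(toep psi y) -P_diagT Dy; exact: (lin0 P_lin)].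
by move: Dy; rewrite /diagT /toep Py (lin0 (mulf_lin Lp)) (lin0 P_lin) add0r subr0.
Qed.

(* An element [g] of the kernel with [dot g k0 != 0] spans the Hardy space
   together with the range of the shift, which makes the Toeplitz operator with
   symbol [chi psi] onto. *)
Lemma bb_index_step psi : Linfty psi -> bb (fun t => cj (psi t)) ->
  ~ bb (fun t => cj (chi t * psi t)) -> bb psi.
Proof.
move=> Lp bc nb; apply: bb_bijective => // x hx x0.
have nog (g : H) : H2 g -> P (mulf psi g) = 0 -> dot g k0 = 0.
  move=> hg g0; apply/eqP/negPn/negP => gk; apply: nb.
  have Lcp : Linfty (fun t => chi t * psi t) by apply: Linfty_mul => //; exact: chi_Linfty.
  apply/(bb_onto Lcp) => y hy; have [f [hf fy]] := iffLR (bb_onto Lp) bc y hy.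
  pose f' := f - (dot f k0 / dot g k0) *: g.
  have hf' : H2 f' by apply: subspB H2_subsp hf _; exact: subspZ H2_subsp hg.
  have f'0 : dot f' k0 = 0 by rewrite dotBl dotZl divfK// subrr.
  exists (sh' f'); split; first exact: H2_sh'.
  rewrite -(mulf_mulf _ (@chi_Linfty R) Lp) mulfC//; last exact: chi_Linfty.
  rewrite -/(sh _) sh'K.
  rewrite /f' (linB (mulf_lin Lp)) (linZ (mulf_lin Lp)) (linB P_lin) (linZ P_lin) g0 fy scaler0.
  by rewrite subr0.
have it n : H2 (iter n sh' x) /\ P (mulf psi (iter n sh' x)) = 0.
  elim: n => [//|n [h1 h2]] /=; split; first by apply: H2_sh' => //; exact: nog.
  by rewrite /sh' mulfC//; [exact: P_sh'0|exact: chiJ_Linfty].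
apply: nrm_small => e e0; have [N hN] := P_iter_sh'_cvg x e0.
by have := hN N (leqnn _); rewrite subr0 (it N).1 nrm_iter_sh'.
Qed.

(** Multiply by [chi] as long as the conjugate symbol stays bounded below. At the first failure
    [bb_index_step] supplies the missing lower bound; without failure the hypothesis supplies it
    after [n] steps. *)
Lemma bb_index psi n : Linfty psi -> bb (fun t => cj (psi t)) -> bb (fun t => chi t ^+ n * psi t) ->
  exists k, bb (fun t => chi t ^+ k * psi t) /\ bb (fun t => cj (chi t ^+ k * psi t)).
Proof.
elim: n psi => [|n IH] psi Lp bc b.
  exists 0%N; split=> //; move: bc; congr bb; apply/funext => t; by rewrite expr0 mul1r.
have shift k : (fun t => chi t ^+ k * (chi t * psi t)) = (fun t => chi t ^+ k.+1 * psi t).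
  by apply/funext => t; rewrite exprSr mulrA.
have [b1|nb] := pselect (bb (fun t => cj (chi t * psi t))).
  have [|||k] := IH (fun t => chi t * psi t) => //; first by apply: Linfty_mul => //; exact: chi_Linfty.
    by rewrite shift.
  rewrite shift (_ : (fun t => cj _) = fun t => cj (chi t ^+ k.+1 * psi t)); first by exists k.+1.
  by apply/funext => t; rewrite exprSr -mulrA.
exists 0%N; have e : (fun t => chi t ^+ 0 * psi t) = psi by apply/funext => t; rewrite expr0 mul1r.
rewrite e (_ : (fun t => cj _) = fun t => cj (psi t)); last by apply/funext => t; rewrite expr0 mul1r.
by split=> //; exact: bb_index_step.
Qed.

(** The constant is the value of [h] at [i], written as a Poisson integral. [h - c] then vanishes at
    the zero of [chi] and can be divided by it. *)
Lemma Hmul_divide h : Hmul h -> exists c : Cplx R, Hmul (fun t => cj (chi t) * (h t - c)).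
Proof.
move=> Hh; pose c : Cplx R := dot (mulf h k0) k0 / pi%:C; exists c.
have pi0 : pi%:C != 0 :> R[i] by apply: cmod_gt0P; rewrite cmodC gtr0_norm ?pi_gt0.
have [LF HF] : Hmul (fun t => h t - c) by apply: (Hmul_add Hh); exact: Hmul_cst.
have Fk : dot (mulf (fun t => h t - c) k0) k0 = 0.
  rewrite (mulf_add _ Hh.1 (Linfty_cst (- c))) mulf_cst dotDl dotZl dotxx nrm_k0.
  by rewrite mulNr /c divfK// subrr.
split; first by apply: Linfty_mul => //; exact: chiJ_Linfty.
move=> x hx; rewrite -mulf_mulf//; last exact: chiJ_Linfty.
apply: H2_sh'; first exact: HF.
pose x' := x - (dot x k0 / pi%:C) *: k0.
have hx' : H2 x' by apply: subspB H2_subsp hx _; exact: subspZ H2_subsp H2_k0.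
have x'0 : dot x' k0 = 0 by rewrite dotBl dotZl dotxx nrm_k0 divfK// subrr.
(* The Hardy space is the sum of the line of [k0], settled by [Fk], and the range of the shift,
   orthogonal to [k0]. *)
have -> : x = (dot x k0 / pi%:C) *: k0 + sh (sh' x') by rewrite sh'K /x'; move: (dot x k0 / _) => z; hring.
rewrite (mulf_lin LF) dotDl dotZl Fk mulr0 add0r /sh mulfC//; last exact: chi_Linfty.
by apply: dot_sh_k0; apply: HF; exact: H2_sh'.
Qed.

Lemma CdotP (c : R -> Cplx R) l : rcont c ->
  (forall e : R, 0 < e -> exists A : R, forall t, A <= `|t| -> cmod (c t - l) <= e) -> Cdot c.
Proof.
move=> rc hl; split.
  move=> x; apply/cvg_C => e e0; have [d [d0 hd]] := rc x e e0.
  by apply/nbhs_ballP; exists d => //= x'; rewrite /ball /= distrC => /hd.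
exists l; split; apply/cvg_C => e e0; have [A hA] := hl e e0.
  exists `|A|; split=> // t At; apply: hA; apply: le_trans (ler_norm _) (le_trans (ltW At) (ler_norm _)).
exists (- `|A|); split=> // t At; apply: hA; rewrite -normrN; apply: le_trans (ler_norm _) (le_trans _ (ler_norm _)).
by rewrite lerNr ltW.
Qed.

Lemma Cdot_cst (a : Cplx R) : Cdot (fun=> a).
Proof.
apply: (@CdotP _ a) => [x e e0|e e0]; first by exists 1; split=> // x' _; rewrite subrr cmod0 ltW.
by exists 0 => t _; rewrite subrr cmod0 ltW.
Qed.

Lemma Cdot_add (c d : R -> Cplx R) : Cdot c -> Cdot d -> Cdot (fun t => c t + d t).
Proof.
move=> [/continuous_rcont rc [l [hp hm]]] [/continuous_rcont rd [l' [hp' hm']]].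
have tri (a b a' b' : Cplx R) (e : R) : cmod (a - b) <= e / 2 -> cmod (a' - b') <= e / 2 -> cmod (a + a' - (b + b')) <= e.
  by move=> h1 h2; rewrite opprD addrACA; apply: le_trans (cmodD _ _) _; lra.
apply: (@CdotP _ (l + l')) => [x e e0|e e0]; have e2 : 0 < e / 2 by rewrite divr_gt0.
  have [d1 [d10 h1]] := rc x _ e2; have [d2 [d20 h2]] := rd x _ e2.
  exists (Num.min d1 d2); split; first by rewrite lt_min d10.
  by move=> x'; rewrite lt_min => /andP[/h1 a1 /h2 a2]; exact: tri.
have [A hA] := Cdot_tail hp hm e2; have [B hB] := Cdot_tail hp' hm' e2.
by exists (Num.max A B) => t; rewrite ge_max => /andP[/hA a1 /hB a2]; exact: tri.
Qed.

Lemma Cdot_mul (c d : R -> Cplx R) : Cdot c -> Cdot d -> Cdot (fun t => c t * d t).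
Proof.
move=> hc hd; have [M hM] := Cdot_bounded hc; have [M' hM'] := Cdot_bounded hd.
have [/continuous_rcont rc [l [hp hm]]] := hc; have [/continuous_rcont rd [l' [hp' hm']]] := hd.
pose B := `|M| + `|M'| + cmod l' + 1.
have B0 : 0 < B by rewrite /B; have := normr_ge0 M; have := normr_ge0 M'; have := cmod_ge0 l'; lra.
have tri (a b a' b' : Cplx R) (e : R) : cmod a <= B -> cmod b' <= B ->
    cmod (a - b) <= e / (2 * B) -> cmod (a' - b') <= e / (2 * B) -> cmod (a * a' - b * b') <= e.
  move=> h1 h2 h3 h4; have -> : a * a' - b * b' = a * (a' - b') + (a - b) * b' by ring.
  apply: le_trans (cmodD _ _) _; rewrite !cmodM.
  have -> : e = B * (e / (2 * B)) + e / (2 * B) * B by field; rewrite gt_eqF.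
  by apply: lerD; apply: ler_pM => //; exact: cmod_ge0.
have cB t : cmod (c t) <= B.
  apply: le_trans (hM t) _; rewrite /B; have := ler_norm M; have := normr_ge0 M'; have := cmod_ge0 l'; lra.
have dB t : cmod (d t) <= B.
  apply: le_trans (hM' t) _; rewrite /B; have := ler_norm M'; have := normr_ge0 M; have := cmod_ge0 l'; lra.
have lB : cmod l' <= B by rewrite /B; have := normr_ge0 M'; have := normr_ge0 M; lra.
apply: (@CdotP _ (l * l')) => [x e e0|e e0]; have e2 : 0 < e / (2 * B) by rewrite divr_gt0// mulr_gt0.
  have [d1 [d10 h1]] := rc x _ e2; have [d2 [d20 h2]] := rd x _ e2.
  exists (Num.min d1 d2); split; first by rewrite lt_min d10.
  by move=> x'; rewrite lt_min => /andP[/h1 a1 /h2 a2]; exact: tri.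
have [A hA] := Cdot_tail hp hm e2; have [B' hB] := Cdot_tail hp' hm' e2.
by exists (Num.max A B') => t; rewrite ge_max => /andP[/hA a1 /hB a2]; exact: tri.
Qed.

Lemma Cdot_conj (c : R -> Cplx R) : Cdot c -> Cdot (fun t => cj (c t)).
Proof.
move=> [/continuous_rcont rc [l [hp hm]]]; apply: (@CdotP _ (cj l)) => [x e e0|e e0].
  by have [d [d0 h]] := rc x e e0; exists d; split=> // x' /h; rewrite -JB cmodJ.
by have [A hA] := Cdot_tail hp hm e0; exists A => t /hA; rewrite -JB cmodJ.
Qed.

Lemma Cdot_kz : Cdot (kz (- I)).
Proof.
have b t : cmod (kz (- I) t) <= 1.
  by have := @kz_bound R (- I) t Im_negi; rewrite ImN (_ : Im I = 1)// normrN normr1 invr1.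
apply: (@CdotP _ 0) => [x e e0|e e0].
  exists e; split=> // x' hx.
  have -> : kz (- I) x' - kz (- I) x = (x - x')%:C * (kz (- I) x' * kz (- I) x).
    rewrite rmorphB /=; have /andP[_ ] := i_den x; have /andP[_ ] := i_den x'; rewrite /kz.
    by move: (x%:C : Cplx R) (x'%:C : Cplx R) (I) => s s' i d1 d2; field; rewrite d1 d2.
  rewrite cmodM cmodC cmodM distrC -[leRHS]mulr1; apply: ler_pM => //; first exact: mulr_ge0 (cmod_ge0 _) (cmod_ge0 _).
    exact: ltW.
  by rewrite -[leRHS]mulr1; apply: ler_pM => //; exact: cmod_ge0.
exists e^-1 => t ht; have t0 : 0 < `|t| by apply: lt_le_trans ht; rewrite invr_gt0.
rewrite subr0 cmodV; apply: (@le_trans _ _ (`|t|^-1)).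
  rewrite lef_pV2 ?posrE//; first by apply: le_trans (cmod_Re _); rewrite ReB ReC ReN (_ : Re I = 0)// oppr0 subr0.
  by apply: cmod_gt0; have /andP[] := i_den t.
by rewrite -[leRHS]invrK lef_pV2 ?posrE ?invr_gt0.
Qed.

Lemma Cdot_chi : Cdot (@chi R).
Proof.
rewrite (_ : chi = fun t => 1 + (- (2 * I)) * kz (- I) t).
  by apply: Cdot_add; [exact: Cdot_cst|apply: Cdot_mul; [exact: Cdot_cst|exact: Cdot_kz]].
apply/funext => t; rewrite kz_neg_i mulrA mulNr mulfV; last by rewrite mulf_neq0 ?pnatr_eq0//; apply: cmod_gt0P; rewrite cmod_i.
by move: (chi t) => z; ring.
Qed.

Lemma Cdot_exp (c : R -> Cplx R) n : Cdot c -> Cdot (fun t => c t ^+ n).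
Proof.
move=> hc; elim: n => [|n IH].
  by rewrite (_ : (fun t => _) = fun=> 1); [exact: Cdot_cst|apply/funext => t; rewrite expr0].
by rewrite (_ : (fun t => _) = fun t => c t * c t ^+ n); [exact: Cdot_mul|apply/funext => t; rewrite exprS].
Qed.

(** Each division by [chi] splits off a constant; together these form a polynomial in [conj chi],
    which is the continuous part. *)
Lemma chiJ_Hmul n h : Hmul h -> exists c g, [/\ Cdot c, Hmul g & forall t, cj (chi t) ^+ n * h t = c t + g t].
Proof.
elim: n h => [|n IH] h Hh.
  exists (fun=> 0), h; split=> //; first exact: Cdot_cst.
  by move=> t; rewrite expr0 mul1r add0r.
have [c0 H1] := Hmul_divide Hh; have [c [g [hc Hg e]]] := IH _ H1.
exists (fun t => c t + c0 * cj (chi t) ^+ n.+1), g; split=> //.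
  apply: Cdot_add => //; apply: Cdot_mul; first exact: Cdot_cst.
  by apply: Cdot_exp; apply: Cdot_conj; exact: Cdot_chi.
have alg (z1 z2 z3 z4 z5 k : Cplx R) : z1 * (z2 * (z3 - k)) = z4 + z5 -> z1 * z2 * z3 = z4 + k * (z1 * z2) + z5.
  by move=> E; rewrite addrAC -E; ring.
by move=> t; rewrite !exprSr; apply: alg; exact: e.
Qed.

Lemma sectorial_perturb (s : R -> Cplx R) : sectorial s -> exists d : R, 0 < d /\
  forall s', Linfty s' -> {ae mu, forall t, cmod (s' t - s t) <= d} -> sectorial s'.
Proof.
move=> [Ls [e [c [e0 c1 hs]]]]; exists (e / 2); split; first by rewrite divr_gt0.
move=> s' Ls' h; split=> //; exists (e / 2), c; split; rewrite ?divr_gt0//.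
apply: (aeS2 hs h) => t h1 h2; have -> : c * s' t = c * s t + c * (s' t - s t) by ring.
rewrite ReD; have := cmod_Re (c * (s' t - s t)); rewrite cmodM c1 mul1r.
by have := ler_norm (- Re (c * (s' t - s t))); rewrite normrN; lra.
Qed.

Lemma CplusHinfty_approx h1 (e : R) : CplusHinfty Plus h1 -> 0 < e ->
  exists N g, Hmul g /\ {ae mu, forall t, cmod (chi t ^+ N * h1 t - g t) <= e}.
Proof.
move=> [_ [c [h [hc /HinftyP Hh E]]]] e0; have [N [g [Hg hg]]] := Cdot_approx hc e0.
exists N, (fun t => g t + chi t ^+ N * h t); split.
  by apply: Hmul_add => //; apply: Hmul_mul => //; apply: Hmul_exp; exact: Hmul_chi.
apply: (aeS E) => t ->; have := hg t; congr (cmod _ <= e).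
by rewrite mulrDr; move: (chi t ^+ N) => z; ring.
Qed.

Lemma Linfty_pos (f : R -> Cplx R) : Linfty f -> exists M : R, 0 < M /\ {ae mu, forall t, cmod (f t) <= M}.
Proof.
move=> [_ [M hM]]; exists (`|M| + 1); split; first by have := normr_ge0 M; lra.
by apply: (aeS hM) => t h; apply: le_trans h _; have := ler_norm M; lra.
Qed.

Lemma units_Plus h : units_of (Hinfty Plus) h <-> units_of Hmul h.
Proof. by split=> -[/HinftyP Hh [g [/HinftyP Hg e]]]; split=> //; exists g; split=> //; exact/HinftyP. Qed.

Lemma Hmul_CplusHinfty c g : Cdot c -> Hmul g -> CplusHinfty Plus (fun t => c t + g t).
Proof.
move=> hc Hg; split; last by exists c, g; split=> //; [exact/HinftyP|exact: aeA].
apply: Linfty_add Hg.1; split; first by apply: rcont_meas; exact: continuous_rcont hc.1.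
by have [M hM] := Cdot_bounded hc; exists M; exact: aeA.
Qed.

Lemma Linfty_chiX psi n : Linfty psi -> Linfty (fun t => chi t ^+ n * psi t).
Proof. by move=> Lp; apply: Linfty_mul => //; apply: Linfty_exp; exact: chi_Linfty. Qed.

Lemma below_chiX psi n : below psi -> below (fun t => chi t ^+ n * psi t).
Proof.
by move=> [c [c0 h]]; exists c; split=> //; apply: (aeS h) => t; rewrite cmodM cmodX cmod_chi expr1n mul1r.
Qed.

(** One way, [psi = s conj chi^N h] and [chiJ_Hmul] decomposes [conj chi^N h]. For the other,
    [chi^N h1] is uniformly close to a multiplier [G] bounded away from 0, and the quotient of the
    two, close to 1, joins the sectorial factor. *)
Lemma left_fredholm_symbol psi : Linfty psi -> below psi ->
  (exists N, bb (fun t => chi t ^+ N * psi t)) <->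
  exists s h1 h2, [/\ sectorial s, CplusHinfty Plus h1, units_of (Hinfty Plus) h2 &
    {ae mu, forall t, psi t = s t * h1 t * h2 t}].
Proof.
move=> Lp bp; split=> [[N /(bb_factor (Linfty_chiX N Lp))[s [h [Ss Hh e]]]]|].
  have [c [g [hc Hg ce]]] := chiJ_Hmul N Hh.
  exists s, (fun t => c t + g t), (fun=> 1); split=> //; first exact: Hmul_CplusHinfty.
    split; first by apply/HinftyP; exact: Hmul_cst.
    by exists (fun=> 1); split; [apply/HinftyP; exact: Hmul_cst|apply: aeA => t; rewrite mulr1].
  apply: (aeS e) => t et; rewrite -ce mulr1 mulrCA -et mulrA -exprMn chiJK expr1n.
  by rewrite mul1r.
move=> [s [h1 [h2 [Ss C1 /units_Plus[H2' _] e]]]].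
have [Ls _] := Ss; have [L1 _] := C1; have [L2' _] := H2'.
have [eta [eta0 heta]] : below h1.
  by apply: (below_factor (Linfty_mul Ls L2') bp); apply: (aeS e) => t ->; rewrite mulrAC.
have [M [M0 hM]] := Linfty_pos Ls; have [d [d0 hd]] := sectorial_perturb Ss.
(* The first bound keeps [|G|] above [eta / 2], the second keeps the new factor within [d] of
   [s]. *)
pose ep := Num.min (eta / 2) (d * (eta / 2) / M).
have eta2 : 0 < eta / 2 by rewrite divr_gt0.
have ep0 : 0 < ep by rewrite lt_min eta2 divr_gt0// mulr_gt0.
have [N [G [HG hG]]] := CplusHinfty_approx C1 ep0; have [LG _] := HG.
have Gb : {ae mu, forall t, eta / 2 <= cmod (G t)}.
  apply: (aeS2 heta hG) => t a1; rewrite /ep le_min => /andP[a2 _].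
  have := cmodB_ge (chi t ^+ N * h1 t) (chi t ^+ N * h1 t - G t).
  rewrite (_ : chi t ^+ N * h1 t - (chi t ^+ N * h1 t - G t) = G t); last by move: (chi t ^+ N * h1 t) => z; ring.
  by rewrite cmodM cmodX cmod_chi expr1n mul1r; lra.
pose s' t := s t * (chi t ^+ N * h1 t) * (G t)^-1.
have Ls' : Linfty s'.
  apply: Linfty_mul; first by apply: Linfty_mul => //; exact: Linfty_chiX.
  by apply: Linfty_inv LG.1 _; exists (eta / 2).
have Ss' : sectorial s'.
  apply: hd => //; apply: (aeS3 Gb hG hM) => t a1 a2 a3.
  have G0 : G t != 0 by apply: cmod_gt0P; exact: lt_le_trans a1.
  have -> : s' t - s t = s t * (chi t ^+ N * h1 t - G t) / G t.
    by rewrite /s'; move: (chi t ^+ N * h1 t) (G t) G0 => z w w0; field.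
  rewrite cmodM cmodV cmodM ler_pdivrMr; last exact: cmod_gt0.
  move: a2; rewrite /ep le_min => /andP[_ a2].
  apply: (@le_trans _ _ (M * (d * (eta / 2) / M))); first by apply: ler_pM => //; exact: cmod_ge0.
  rewrite mulrC divfK ?gt_eqF//; apply: ler_wpM2l => //; exact: ltW.
exists N; apply/(bb_sect (Linfty_chiX N Lp) (below_chiX N bp)).
exists s', (fun t => G t * h2 t); split=> //; first exact: Hmul_mul.
apply: (aeS2 e Gb) => t -> a1; have G0 : G t != 0 by apply: cmod_gt0P; exact: lt_le_trans a1.
by rewrite /s'; move: (chi t ^+ N) (G t) G0 => z w w0; field.
Qed.

(** Forward, [conj chi^M psi] satisfies both hypotheses of [bb_index], and the powers of [chi] left
    over form a unit of the continuous functions. Backward, the conjugate symbol is multiplied by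
    the conjugates of an approximant [G] of [chi^N / h1] and of the inverse of [h2]; the result is
    close to [conj s], and [bb_anti] removes both factors. *)
Lemma fredholm_symbol psi : Linfty psi -> below psi ->
  ((exists N, bb (fun t => chi t ^+ N * psi t)) /\ (exists N, bb (fun t => chi t ^+ N * cj (psi t)))) <->
  exists s h1 h2, [/\ sectorial s, units_of (CplusHinfty Plus) h1, units_of (Hinfty Plus) h2 &
    {ae mu, forall t, psi t = s t * h1 t * h2 t}].
Proof.
move=> Lp bp; split=> [[[N bN] [M bM]]|[s [h1 [h2 [Ss [C1 [g1 [Cg eg]]] U2 e]]]]].
  pose p0 t := cj (chi t) ^+ M * psi t.
  have L0 : Linfty p0 by apply: Linfty_mul => //; apply: Linfty_exp; exact: chiJ_Linfty.
  have b0 : below p0.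
    by have [c [c0 h]] := bp; exists c; split=> //; apply: (aeS h) => t; rewrite cmodM cmodX cmodJ cmod_chi expr1n mul1r.
  have [||k [b1 b2]] := @bb_index p0 (N + M) L0.
  - rewrite (_ : (fun t => cj (p0 t)) = fun t => chi t ^+ M * cj (psi t))//.
    by apply/funext => t; rewrite /p0 JM [cj (_ ^+ _)]JX JK.
  - rewrite (_ : (fun t => _) = fun t => chi t ^+ N * psi t)//; apply/funext => t.
    by rewrite /p0 exprD -mulrA [chi t ^+ M * _]mulrA -exprMn chiKJ expr1n mul1r.
  have [s [h [Ss Uh e]]] := iffLR (bb_sect_unit (Linfty_chiX k L0) (below_chiX k b0)) (conj b1 b2).
  have Cc a b : Cdot (fun t : R => chi t ^+ a * cj (chi t) ^+ b).
    by apply: Cdot_mul; apply: Cdot_exp; [exact: Cdot_chi|apply: Cdot_conj; exact: Cdot_chi].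
  have CC a b : CplusHinfty Plus (fun t : R => chi t ^+ a * cj (chi t) ^+ b).
    have := Hmul_CplusHinfty (Cc a b) (Hmul_cst 0).
    by rewrite (_ : (fun t => _) = fun t => chi t ^+ a * cj (chi t) ^+ b)//; apply/funext => t; rewrite addr0.
  exists s, (fun t => chi t ^+ M * cj (chi t) ^+ k), h; split=> //; last 2 first.
  - exact/units_Plus.
  - apply: (aeS e) => t et; rewrite mulrAC -et /p0.
    have q1 := chiKJ t; have X1 n : chi t ^+ n * cj (chi t) ^+ n = 1 by rewrite -exprMn q1 expr1n.
    have alg (a a' b b' z : Cplx R) : a * a' = 1 -> b * b' = 1 -> z = a * (b' * z) * (b * a').
      by move=> e1 e2; transitivity (z * (a * a') * (b * b')); [rewrite e1 e2 !mulr1|ring].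
    exact: alg (X1 k) (X1 M).
  split; first exact: CC.
  exists (fun t => chi t ^+ k * cj (chi t) ^+ M); split; first exact: CC.
  apply: aeA => t; have X1 n : chi t ^+ n * cj (chi t) ^+ n = 1 by rewrite -exprMn chiKJ expr1n.
  by rewrite [chi t ^+ k * _]mulrC mulrACA X1 [_ * chi t ^+ k]mulrC X1 mulr1.
split; first by apply/(left_fredholm_symbol Lp bp); exists s, h1, h2.
have Sc := sectorial_conj Ss; have [L1 _] := C1; have [Lc _] := Sc.
have [d [d0 hd]] := sectorial_perturb Sc.
have [M [M0 hM]] := Linfty_pos (Linfty_mul Lc L1).
have [N [G [HG hG]]] := CplusHinfty_approx Cg (divr_gt0 d0 M0); have [LG _] := HG.
have /units_Plus[H2' [g2 [Hg2 e2]]] := U2; have [Lg2 _] := Hg2; have [L2' _] := H2'.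
pose s' t := cj (s t) * (cj (G t) * (chi t ^+ N * cj (h1 t))).
have Ls' : Linfty s'.
  by apply: Linfty_mul => //; apply: Linfty_mul; [exact: Linfty_conj|apply: Linfty_chiX; exact: Linfty_conj].
have Ss' : sectorial s'.
  apply: hd => //; apply: (aeS3 hM hG eg) => t a1 a2 a3.
  have XN : chi t ^+ N * cj (chi t) ^+ N = 1 by rewrite -exprMn chiKJ expr1n.
  have -> : s' t - cj (s t) = - (cj (s t) * cj (h1 t) * (chi t ^+ N * cj (chi t ^+ N * g1 t - G t))).
    have a4 : cj (h1 t) * cj (g1 t) = 1 by rewrite -JM a3 J1.
    rewrite /s' JB JM [cj (_ ^+ _)]JX.
    have alg (u g x h x' g' : Cplx R) : x * x' = 1 -> h * g' = 1 ->
        u * (g * (x * h)) - u = - (u * h * (x * (x' * g' - g))).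
      by move=> q1 q2; transitivity (u * (g * (x * h)) - u * (x * x') * (h * g')); [rewrite q1 q2 !mulr1|ring].
    exact: alg.
  rewrite cmodN cmodM cmodM cmodJ cmodM cmodX cmod_chi expr1n mul1r cmodJ.
  have -> : d = M * (d / M) by rewrite mulrC divfK// gt_eqF.
  rewrite cmodM cmodJ in a1; rewrite [cmod (cj (_ - _))]cmodJ; apply: ler_pM => //; last exact: cmod_ge0.
  by rewrite mulr_ge0 ?cmod_ge0.
exists N; apply: (@bb_anti _ G) => //; first by apply: Linfty_chiX; exact: Linfty_conj.
have Lx : Linfty (fun t => cj (G t) * (chi t ^+ N * cj (psi t))).
  by apply: Linfty_mul; [exact: Linfty_conj|apply: Linfty_chiX; exact: Linfty_conj].
apply: (@bb_anti _ g2) => //; apply: (bb_ext Ls' _ _ (bb_sectorial Ss')).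
  by apply: Linfty_mul => //; exact: Linfty_conj.
apply: (aeS2 e e2) => t -> a; have a' : cj (h2 t) * cj (g2 t) = 1 by rewrite -JM a J1.
rewrite /s' !JM; have alg (u g x h k k' : Cplx R) : k * k' = 1 -> u * (g * (x * h)) = k' * (g * (x * (u * h * k))).
  by move=> q; transitivity (u * (g * (x * h)) * (k * k')); [rewrite q mulr1|ring].
exact: alg.
Qed.

Lemma CplusHinfty_conj sg h : CplusHinfty sg h -> CplusHinfty (opps sg) (fun t => cj (h t)).
Proof.
move=> [Lh [c [g [hc Hg e]]]]; split; first exact: Linfty_conj.
exists (fun t => cj (c t)), (fun t => cj (g t)); split; [exact: Cdot_conj|exact: Hinfty_conj|].
by apply: (aeS e) => t ->; rewrite JD.
Qed.

Lemma units_conj (A B : set (R -> Cplx R)) : (forall f, A f -> B (fun t => cj (f t))) ->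
  forall f, units_of A f -> units_of B (fun t => cj (f t)).
Proof.
move=> AB f [Af [g [Ag e]]]; split; first exact: AB.
by exists (fun t => cj (g t)); split; [exact: AB|apply: (aeS e) => t h; rewrite -JM h J1].
Qed.

Lemma factor2_conj (A B : set (R -> Cplx R)) psi : (forall f, A f -> B (fun t => cj (f t))) ->
  (exists s h, [/\ sectorial s, A h & {ae mu, forall t, psi t = s t * h t}]) ->
  exists s h, [/\ sectorial s, B h & {ae mu, forall t, cj (psi t) = s t * h t}].
Proof.
move=> AB [s [h [Ss Ah e]]]; exists (fun t => cj (s t)), (fun t => cj (h t)).
by split; [exact: sectorial_conj|exact: AB|apply: (aeS e) => t ->; rewrite JM].
Qed.

Lemma factor3_conj (A B A' B' : set (R -> Cplx R)) psi : (forall f, A f -> B (fun t => cj (f t))) ->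
  (forall f, A' f -> B' (fun t => cj (f t))) ->
  (exists s h1 h2, [/\ sectorial s, A h1, A' h2 & {ae mu, forall t, psi t = s t * h1 t * h2 t}]) ->
  exists s h1 h2, [/\ sectorial s, B h1, B' h2 & {ae mu, forall t, cj (psi t) = s t * h1 t * h2 t}].
Proof.
move=> AB AB' [s [h1 [h2 [Ss Ah Ah' e]]]]; exists (fun t => cj (s t)), (fun t => cj (h1 t)), (fun t => cj (h2 t)).
by split; [exact: sectorial_conj|exact: AB|exact: AB'|apply: (aeS e) => t ->; rewrite !JM].
Qed.

End Toeplitz.

(** * Even and odd parts *)

Section Transfer.
Context {R : realType}.
Local Notation mu := (@lebesgue_measure R).
Local Notation H := (L2S R).
Implicit Types x y z : L2S R.

Lemma below_equiv (S : set H) (A D L B Bi : H -> H) : bop L -> bop B -> cancel Bi B ->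
  (forall x, A x = L (D (B x))) -> (exists C : R, forall x, S x -> nrm x <= C * nrm (A x)) ->
  exists C : R, forall y, S (Bi y) -> nrm y <= C * nrm (D y).
Proof.
move=> [_ [M [M0 hM]]] [_ [N [N0 hN]]] BK e [C hC]; exists (N * (`|C| * M)) => y /hC; rewrite e BK => h.
rewrite -{1}[y]BK; apply: le_trans (hN _) _; rewrite -mulrA; apply: ler_wpM2l => //.
apply: le_trans h _; rewrite -mulrA; apply: le_trans (ler_wpM2r (nrm_ge0 _) (ler_norm C)) _.
by apply: ler_wpM2l => //; exact: hM.
Qed.

Lemma bounded_below_equiv (A D L B Bi : H -> H) : bop L -> bop B -> cancel Bi B ->
  (forall x, A x = L (D (B x))) -> bounded_below A -> bounded_below D.
Proof.
move=> Lb Bb BK e [C hC].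
have [|C' hC'] := @below_equiv setT A D L B Bi Lb Bb BK e; first by exists C => x _; exact: hC.
by exists C' => x; exact: hC'.
Qed.

Lemma fin_below_equiv (A D L B Bi Bi' : H -> H) : bop L -> bop B -> cancel Bi B -> adjoint Bi Bi' ->
  (forall x, A x = L (D (B x))) -> fin_below A -> fin_below D.
Proof.
move=> Lb Bb BK adj e [n [v [C hC]]].
have [|C' hC'] := @below_equiv [set x | forall i, dot x (v i) = 0] A D L B Bi Lb Bb BK e; first by exists C.
by exists n, (fun i => Bi' (v i)), C' => y hy; apply: hC' => i; rewrite adj.
Qed.

(** The reflection commutes with the Fourier transformation and exchanges the two half-lines, hence
    [P] and its complement. *)
Lemma P_reflf x : P (reflf x) = reflf (x - P x).
Proof.
have [u <-] := four_onto x.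
have Lr : Linfty (reflection (@half R)) by apply: Linfty_refl; exact: half_Linfty.
rewrite -four_reflf !P_four -(linB four_lin) -four_reflf; congr four.
have e : mulf half u + mulf (reflection half) u = u.
  rewrite -(mulf_add _ (@half_Linfty R) Lr) (mulf_ext _ _ (Linfty_cst 1)) ?mulf_cst ?scale1r//.
    by apply: Linfty_add => //; exact: half_Linfty.
  have : {ae mu, forall t : R, t != 0}.
    exists [set 0]; split=> //; first exact: lebesgue_measure_set1.
    by move=> t /=; case: eqVneq.
  move=> h0; apply: (aeS h0) => t t0; rewrite /reflection /half -rmorphD !indicE.
  have -> : (t \in Rplus) = (0 < t) by apply/idP/idP => [|h]; rewrite ?inE /Rplus /= ?in_itv /= ?andbT// => ->.
  have -> : (- t \in Rplus) = (t < 0) by apply/idP/idP => [|h]; rewrite ?inE /Rplus /= ?in_itv /= ?andbT ?oppr_gt0// => ->.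
  by case: ltgtP t0 => //; rewrite ?addr0 ?add0r.
rewrite -{2}e [_ + mulf (reflection half) u]addrC addrK mulf_reflf//.
by congr (mulf _ (reflf u)); apply/funext => t; rewrite /reflection opprK.
Qed.

Lemma reflf_P x : reflf (P x) = reflf x - P (reflf x).
Proof. by rewrite P_reflf (linB reflf_lin); move: (reflf x) (reflf (P x)) => u v; hring. Qed.

Section Symbol.
Context (phi : R -> Cplx R) (phi_unit : units_of Linfty phi).

Lemma phi_Linfty : Linfty phi. Proof. by case: phi_unit. Qed.

Lemma phi_below : below phi.
Proof.
have [L1 [g [Lg e]]] := phi_unit; apply: (@below_factor _ (fun=> 1) g _ Lg).
  by exists 1; split; rewrite ?ltr01//; apply: aeA => t; rewrite cmod1.
by apply: (aeS e) => t <-; rewrite mulrC.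
Qed.

Definition phr : R -> Cplx R := reflection phi.
Definition phri : R -> Cplx R := fun t => (phr t)^-1.
Definition psi : R -> Cplx R := fun t => phi t * reflection (ptinv phi) t.

Lemma phr_Linfty : Linfty phr. Proof. exact/Linfty_refl/phi_Linfty. Qed.
Lemma phr_below : below phr.
Proof. by have [c [c0 h]] := phi_below; exists c; split=> //; exact: (ae_refl h). Qed.
Lemma phri_Linfty : Linfty phri.
Proof. exact: Linfty_inv phr_Linfty.1 phr_below. Qed.
Lemma phrK : {ae mu, forall t, phr t * phri t = 1}.
Proof.
have [c [c0 h]] := phr_below; apply: (aeS h) => t ht; rewrite mulfV//; apply: cmod_gt0P.
exact: lt_le_trans ht.
Qed.
Lemma psi_Linfty : Linfty psi. Proof. exact: Linfty_mul phi_Linfty phri_Linfty. Qed.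
Lemma psi_phr : {ae mu, forall t, phi t = phr t * psi t}.
Proof. by apply: (aeS phrK) => t h; rewrite /psi mulrCA -[reflection (ptinv _) t]/(phri t) h mulr1. Qed.
Lemma psi_below : below psi.
Proof. exact: below_factor phr_Linfty phi_below psi_phr. Qed.

Let psc t := cj (psi t).
Lemma psc_Linfty : Linfty psc. Proof. exact: Linfty_conj psi_Linfty. Qed.

(** The corner of the triangular operator [P psi + (1 - P)]. It squares to 0, so [1 + c offdiag] has
    the inverse [1 - c offdiag]. *)
Definition offdiag x : H := P (mulf psi (x - P x)).
Definition offdiag' x : H := mulf psc (P x) - P (mulf psc (P x)).

Lemma offdiag_adj : adjoint offdiag offdiag'.
Proof.
move=> x y; rewrite /offdiag /offdiag' P_adj (mulf_adj psi_Linfty) dotBl dotBr P_adj.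
by [].
Qed.

Lemma offdiag_bdd : bddop offdiag.
Proof.
have [_ [M [M0 hM]]] := mulf_bop psi_Linfty; exists M; split=> // x.
apply: le_trans (nrm_P _) (le_trans (hM _) _); apply: ler_wpM2l => //; exact: nrm_coP.
Qed.

Lemma offdiag_sq x : offdiag (offdiag x) = 0.
Proof. by rewrite {1}/offdiag (_ : offdiag x - P (offdiag x) = 0) ?(lin0 (mulf_lin psi_Linfty)) ?(lin0 P_lin)// /offdiag PP subrr. Qed.

Lemma offdiag'_sq x : offdiag' (offdiag' x) = 0.
Proof.
rewrite {1}/offdiag' (_ : P (offdiag' x) = 0) ?(lin0 (mulf_lin psc_Linfty)) ?(lin0 P_lin) ?subrr//.
by rewrite /offdiag' (linB P_lin) PP subrr.
Qed.

Definition unip (c : R[i]) x : H := x + c *: offdiag x.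
Definition unip' (c : R[i]) x : H := x + c *: offdiag' x.

Lemma unip_adj (c : R[i]) : cj c = c -> adjoint (unip c) (unip' c).
Proof. by move=> cc x y; rewrite /unip /unip' dotDl dotDr dotZl dotZr cc offdiag_adj. Qed.

Lemma offdiag_bop : bop offdiag. Proof. by split; [exact: adjoint_lin offdiag_adj|exact: offdiag_bdd]. Qed.
Lemma offdiag'_bop : bop offdiag'.
Proof. by split; [exact: adjoint_lin (adjoint_sym offdiag_adj)|exact: adjoint_bdd (adjoint_sym offdiag_adj) offdiag_bdd]. Qed.

Lemma id_bop : bop (fun x : H => x).
Proof. by split=> //; exists 1; split=> // x; rewrite mul1r. Qed.

Lemma unip_bop c : bop (unip c). Proof. exact: bop_add id_bop (bop_scale c offdiag_bop). Qed.
Lemma unip'_bop c : bop (unip' c). Proof. exact: bop_add id_bop (bop_scale c offdiag'_bop). Qed.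

Lemma unipK c x : unip (- c) (unip c x) = x.
Proof.
rewrite /unip (linD offdiag_bop.1) (linZ offdiag_bop.1) offdiag_sq.
by move: (offdiag x) => u; hring.
Qed.

Lemma unip'K c x : unip' (- c) (unip' c x) = x.
Proof.
rewrite /unip' (linD offdiag'_bop.1) (linZ offdiag'_bop.1) offdiag'_sq.
by move: (offdiag' x) => u; hring.
Qed.

(* This operator commutes with the reflection; its restrictions to even and odd
   functions are the Fourier images of [W_phi + H_phi] and [W_phi - H_phi]. *)
Definition paired x : H := P (mulf phi x) + (mulf phr x - P (mulf phr x)).
Let m := mulf phr.
Let mi := mulf phri.
Let m' := mulf (fun t => cj (phr t)).
Let mi' := mulf (fun t => cj (phri t)).
(** The adjoint of [paired], as the adjoints of the factors in [pairedE] in reverse order, so that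
    lower bounds transfer in the same way. *)
Definition paired' x : H := m' (diagT psc (unip' 1 x)).

Lemma m_mi x : m (mi x) = x.
Proof.
rewrite /m /mi mulf_mulf; [|exact: phr_Linfty|exact: phri_Linfty].
by rewrite (mulf_ext _ (Linfty_mul phr_Linfty phri_Linfty) (Linfty_cst 1) phrK) mulf_cst scale1r.
Qed.
Lemma mi_m x : mi (m x) = x.
Proof. by rewrite /m /mi mulfC; [exact: m_mi|exact: phri_Linfty|exact: phr_Linfty]. Qed.
Lemma m_adj : adjoint m m'. Proof. exact: mulf_adj phr_Linfty. Qed.
Lemma mi_adj : adjoint mi mi'. Proof. exact: mulf_adj phri_Linfty. Qed.
Lemma mi'_m' x : mi' (m' x) = x.
Proof. by apply: eq_dot => y; rewrite (adjoint_sym mi_adj) (adjoint_sym m_adj) m_mi. Qed.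

(** With [y = phr x], the left side is [P (psi y) + (y - P y)], a triangular operator with diagonal
    [diagT psi]. *)
Lemma pairedE x : paired x = unip 1 (diagT psi (m x)).
Proof.
rewrite /unip scale1r /offdiag /paired -/m P_diagT.
have -> : mulf phi x = mulf psi (m x).
  rewrite /m mulf_mulf; [|exact: psi_Linfty|exact: phr_Linfty].
  apply: mulf_ext; [exact: phi_Linfty|exact: Linfty_mul psi_Linfty phr_Linfty|].
  by apply: (aeS psi_phr) => t ->; rewrite mulrC.
move: (m x) => y.
have -> : diagT psi y - toep psi y = y - P y by rewrite /diagT; move: (toep psi y) (P y) => u v; hring.
rewrite (linB (mulf_lin psi_Linfty)) (linB P_lin) /diagT /toep.
by move: (P (mulf psi y)) (P (mulf psi (P y))) (P y) => u v w; hring.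
Qed.

Lemma paired_bop : bop paired.
Proof.
rewrite (_ : paired = fun x => unip 1 (diagT psi (m x))); last by apply/funext => x; exact: pairedE.
exact: (bop_comp (unip_bop 1) (bop_comp (diagT_bop psi_Linfty) (mulf_bop phr_Linfty))).
Qed.

Lemma paired'_bop : bop paired'.
Proof.
exact: (bop_comp (mulf_bop (Linfty_conj phr_Linfty)) (bop_comp (diagT_bop psc_Linfty) (unip'_bop 1))).
Qed.

Lemma paired_adj : adjoint paired paired'.
Proof.
move=> x y; rewrite pairedE (unip_adj J1) (diagT_adj psi_Linfty) m_adj.
by [].
Qed.

Lemma bounded_below_paired : bounded_below paired <-> bb psi.
Proof.
rewrite bb_diagT; split; first exact: bounded_below_equiv (unip_bop 1) (mulf_bop phr_Linfty) m_mi pairedE.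
apply: (bounded_below_equiv (unip_bop (- 1)) (mulf_bop phri_Linfty) mi_m) => x.
by rewrite pairedE unipK -/mi m_mi.
Qed.

Lemma fin_below_paired : fin_below paired <-> exists N, bb (fun t => chi t ^+ N * psi t).
Proof.
split=> [h|[N /(bb_fin_below psi_Linfty)]].
  apply: (fin_below_bb psi_Linfty).
  exact: fin_below_equiv (unip_bop 1) (mulf_bop phr_Linfty) m_mi mi_adj pairedE h.
apply: (fin_below_equiv (unip_bop (- 1)) (mulf_bop phri_Linfty) mi_m m_adj) => x.
by rewrite pairedE unipK -/mi m_mi.
Qed.

Lemma bounded_below_paired' : bounded_below paired' <-> bb psc.
Proof.
have unipK' x : unip' 1 (unip' (- 1) x) = x by have := unip'K (- 1) x; rewrite opprK.
rewrite bb_diagT; split; first exact: bounded_below_equiv (mulf_bop (Linfty_conj phr_Linfty)) (unip'_bop 1) unipK' _.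
apply: (bounded_below_equiv (mulf_bop (Linfty_conj phri_Linfty)) (unip'_bop (- 1)) (unip'K 1)) => x.
by rewrite /paired' unipK' -/mi' mi'_m'.
Qed.

Lemma fin_below_paired' : fin_below paired' <-> exists N, bb (fun t => chi t ^+ N * psc t).
Proof.
have unipK' x : unip' 1 (unip' (- 1) x) = x by have := unip'K (- 1) x; rewrite opprK.
have r (c : R[i]) : cj c = c -> adjoint (unip' c) (unip c) by move=> /unip_adj/adjoint_sym.
have J1' : cj (- 1 : R[i]) = - 1 by rewrite JN J1.
split=> [h|[N /(bb_fin_below psc_Linfty)]].
  apply: (fin_below_bb psc_Linfty).
  exact: fin_below_equiv (mulf_bop (Linfty_conj phr_Linfty)) (unip'_bop 1) unipK' (r _ J1') _ h.
apply: (fin_below_equiv (mulf_bop (Linfty_conj phri_Linfty)) (unip'_bop (- 1)) (unip'K 1) (r _ J1)) => x.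
by rewrite /paired' unipK' -/mi' mi'_m'.
Qed.

Lemma reflf_paired x : reflf (paired x) = paired (reflf x).
Proof.
have Jphr y : reflf (mulf phr y) = mulf phi (reflf y).
  rewrite (mulf_reflf _ phr_Linfty); congr (mulf _ (reflf y)).
  by apply/funext => t; rewrite /phr /reflection opprK.
rewrite /paired (linD reflf_lin) (linB reflf_lin) !reflf_P Jphr (mulf_reflf _ phi_Linfty) -/phr.
by move: (mulf phr _) (mulf phi _) => u v; move: (P u) (P v) => u' v'; hring.
Qed.

Lemma cmod2 : cmod (2 : R[i]) = 2.
Proof. by rewrite (_ : (2 : R[i]) = (2 : R)%:C) ?cmodC ?ger0_norm ?rmorph_nat. Qed.

Section Parity.
Context (ep : R[i]) (ep2 : ep * ep = 1).

(** With [ep] equal to 1 or -1, twice the projection on the even or the odd functions; [whf] is the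
    Fourier image of [W_phi + ep H_phi] on the Hardy space. *)
Definition symp x : H := x + ep *: reflf x.
Definition whf x : H := P (mulf phi (symp x)).

Lemma reflf_symp x : reflf (symp x) = ep *: symp x.
Proof.
rewrite /symp (linD reflf_lin) (linZ reflf_lin) reflfK scalerDr scalerA ep2 scale1r addrC.
by [].
Qed.

Lemma symp_lin : linop symp.
Proof.
by move=> a x y; rewrite /symp reflf_lin; move: (reflf x) (reflf y) => u v; hring.
Qed.

Lemma cmod_ep : cmod ep = 1.
Proof.
apply/eqP; rewrite -(@eqrXn2 _ 2) ?cmod_ge0// expr1n expr2 -cmodM ep2 cmod1.
by [].
Qed.

Lemma nrm_symp x : nrm (symp x) <= 2 * nrm x.
Proof. by apply: le_trans (nrmD _ _) _; rewrite nrmZ cmod_ep nrm_reflf mul1r; lra. Qed.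

Lemma P_symp x : H2 x -> P (symp x) = x.
Proof.
move=> hx; rewrite /symp (linD P_lin) (linZ P_lin) P_reflf hx subrr (lin0 reflf_lin) scaler0.
by rewrite addr0.
Qed.

(** An even or odd function is recovered from its Hardy part, because the reflection carries that
    part to the other one. *)
Lemma sym_symp z : reflf z = ep *: z -> symp (P z) = z.
Proof.
move=> h; rewrite /symp reflf_P h (linZ P_lin) scalerBr !scalerA ep2 !scale1r.
by move: (P z) => u; hring.
Qed.

Lemma symp_P_symp x : symp (P (symp x)) = symp x. Proof. exact: sym_symp (reflf_symp x). Qed.

Lemma P_paired x : P (paired x) = P (mulf phi x).
Proof. by rewrite /paired (linD P_lin) (linB P_lin (mulf phr x)) !PP subrr addr0. Qed.

Lemma paired_sym x : paired (symp x) = symp (whf x).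
Proof. by rewrite /whf -P_paired sym_symp// reflf_paired reflf_symp (linZ paired_bop.1). Qed.

Lemma sym_paired x : symp (paired x) = paired (symp x).
Proof. by rewrite /symp reflf_paired (linD paired_bop.1) (linZ paired_bop.1). Qed.

Lemma whf_lin : linop whf.
Proof. by move=> a x y; rewrite /whf symp_lin (mulf_lin phi_Linfty) P_lin. Qed.

Lemma whf_P_symp z : whf (P (symp z)) = P (symp (paired z)).
Proof. by rewrite /whf symp_P_symp -P_paired sym_paired. Qed.

(** On functions of parity [ep] this is [P], the inverse of [symp] on the Hardy space; in general
    the part of that parity is taken first. It intertwines [paired] with [whf]. *)
Definition hsymp z : H := 2^-1 *: P (symp z).

Lemma H2_hsymp z : H2 (hsymp z). Proof. exact: subspZ H2_subsp (H2P _). Qed.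

Lemma hsymp_lin : linop hsymp.
Proof. by move=> a x y; rewrite /hsymp symp_lin P_lin; move: (P _) (P _) => u v; hring. Qed.

Lemma hsymp_symp x : H2 x -> hsymp (symp x) = x.
Proof.
move=> hx; have -> : hsymp (symp x) = 2^-1 *: (2 *: P (symp x)).
  rewrite /hsymp {1}/symp reflf_symp scalerA ep2 scale1r (linD P_lin); move: (P (symp x)) => u; hring.
by rewrite scalerA mulVf ?pnatr_eq0// scale1r P_symp.
Qed.

Lemma whf_hsymp z : whf (hsymp z) = hsymp (paired z).
Proof. by rewrite /hsymp (linZ whf_lin) whf_P_symp. Qed.

Lemma symp_hsymp z : symp (hsymp z) = 2^-1 *: symp z.
Proof. by rewrite /hsymp (linZ symp_lin) symp_P_symp. Qed.

Lemma nrm_hsymp z : nrm (hsymp z) <= nrm z.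
Proof.
rewrite /hsymp nrmZ cmodV cmod2.
by rewrite ler_pdivrMl//; apply: le_trans (nrm_P _) (nrm_symp z).
Qed.

(** This and the next four definitions transport the operator properties of the theorem to the Hardy
    space. *)
Definition belowW := exists C : R, forall x, H2 x -> nrm x <= C * nrm (whf x).
Definition ontoW := forall y, H2 y -> exists x, H2 x /\ whf x = y.
Definition closedW := forall y, H2 y ->
  (forall e : R, 0 < e -> exists x, H2 x /\ nrm (whf x - y) < e) -> exists x, H2 x /\ whf x = y.
Definition kerW := exists n (v : 'I_n -> H), (forall i, H2 (v i) /\ whf (v i) = 0) /\
  forall x, H2 x -> whf x = 0 -> spanned v x.
Definition cokerW := exists n (v : 'I_n -> H), (forall i, H2 (v i)) /\
  forall y, H2 y -> exists x (c : 'I_n -> R[i]), H2 x /\ y = whf x + \sum_i c i *: v i.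

Lemma paired_onto_symp y : H2 y -> (exists z, paired z = symp y) -> exists x, H2 x /\ whf x = y.
Proof. by move=> hy [z e]; exists (hsymp z); split; [exact: H2_hsymp|rewrite whf_hsymp e hsymp_symp]. Qed.

Lemma paired_closedW : hclosed (range paired) -> closedW.
Proof.
move=> cl y hy ha; apply: paired_onto_symp => //; have [] := cl (symp y); last by move=> z _ <-; exists z.
move=> e e0; have [x [hx lx]] := ha (e / 2) (divr_gt0 e0 (@ltr0n R 2)).
exists (paired (symp x)); split; first by exists (symp x).
rewrite paired_sym -(linB symp_lin); apply: le_lt_trans (nrm_symp _) _; rewrite nrmB; lra.
Qed.

Lemma paired_kerW : finite_ker paired setT -> kerW.
Proof.
move=> [n [w [hw hs]]]; exists n, (fun i => hsymp (w i)); split=> [i|x hx Wx].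
  by split; [exact: H2_hsymp|rewrite whf_hsymp (hw i).2 (lin0 hsymp_lin)].
have [|c e] := hs (symp x) I; first by rewrite paired_sym Wx (lin0 symp_lin).
exists c; rewrite -{1}(hsymp_symp hx) e (lin_sum hsymp_lin); apply: eq_bigr => i _; exact: (linZ hsymp_lin).
Qed.

Lemma paired_cokerW : (exists n (w : 'I_n -> H), forall g, exists f (c : 'I_n -> R[i]), g = paired f + \sum_i c i *: w i) ->
  cokerW.
Proof.
move=> [n [w hw]]; exists n, (fun i => hsymp (w i)); split=> [i|y hy]; first exact: H2_hsymp.
have [f [c e]] := hw (symp y); exists (hsymp f), c; split; first exact: H2_hsymp.
rewrite -{1}(hsymp_symp hy) e (linD hsymp_lin) whf_hsymp (lin_sum hsymp_lin); congr (_ + _).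
by apply: eq_bigr => i _; exact: (linZ hsymp_lin).
Qed.

Lemma belowW_symp : belowW -> exists C : R, forall y, nrm (symp y) <= C * nrm (paired y).
Proof.
move=> [C hC]; exists (4 * `|C|) => y.
have := hC _ (H2_hsymp y); rewrite whf_hsymp => h.
have -> : symp y = 2%:R *: symp (hsymp y) by rewrite symp_hsymp scalerA mulfV ?pnatr_eq0// scale1r.
rewrite nrmZ cmod2.
have h1 := nrm_symp (hsymp y); have h2 := nrm_hsymp (paired y).
have h3 := ler_wpM2r (nrm_ge0 (hsymp (paired y))) (ler_norm C); have h4 := ler_wpM2l (normr_ge0 C) h2.
rewrite -mulrA; move: h h1 h2 h3 h4.
move: (`|C| * nrm (hsymp (paired y))) (`|C| * nrm (paired y)) (C * nrm (hsymp (paired y))) (nrm (symp (hsymp y))) (nrm (hsymp y)) => a b c d f; lra.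
Qed.

Lemma ontoW_symp y : ontoW -> exists x, paired x = symp y.
Proof.
move=> h; have [x [hx e]] := h _ (H2_hsymp y); exists (2 *: symp x); rewrite (linZ paired_bop.1) paired_sym e symp_hsymp.
by rewrite scalerA mulfV ?pnatr_eq0// scale1r.
Qed.

Lemma closedW_symp y : closedW -> clos (range paired) y -> exists x, paired x = symp y.
Proof.
move=> cl hy; have [|x [hx e]] := cl _ (H2_hsymp y).
  move=> e e0; have [_ [[z _ <-] lz]] := hy e e0; exists (hsymp z); split; first exact: H2_hsymp.
  by rewrite whf_hsymp -(linB hsymp_lin); apply: le_lt_trans (nrm_hsymp _) _; rewrite nrmB.
exists (2 *: symp x); rewrite (linZ paired_bop.1) paired_sym e symp_hsymp.
by rewrite scalerA mulfV ?pnatr_eq0// scale1r.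
Qed.

Lemma kerW_hsymp k : paired k = 0 -> H2 (hsymp k) /\ whf (hsymp k) = 0.
Proof. by move=> e; split; [exact: H2_hsymp|rewrite whf_hsymp e (lin0 hsymp_lin)]. Qed.

End Parity.

Lemma mulN1N1 : (- 1) * (- 1) = 1 :> R[i]. Proof. by rewrite mulrNN mulr1. Qed.
Lemma mul11 : 1 * 1 = 1 :> R[i]. Proof. by rewrite mulr1. Qed.

Lemma symp_split y : y = 2^-1 *: (symp 1 y + symp (- 1) y).
Proof.
have -> : symp 1 y + symp (- 1) y = 2 *: y by rewrite /symp; move: (reflf y) => u; hring.
by rewrite scalerA mulVf ?pnatr_eq0// scale1r.
Qed.

Lemma belowW_paired : belowW 1 -> belowW (- 1) -> bounded_below paired.
Proof.
move=> /(belowW_symp mul11)[C hC] /(belowW_symp mulN1N1)[D hD]; exists (C + D) => y; rewrite {1}(symp_split y) nrmZ cmodV.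
rewrite cmod2; have := nrmD (symp 1 y) (symp (- 1) y); have := hC y; have := hD y; rewrite mulrDl.
have := nrm_ge0 (symp 1 y); have := nrm_ge0 (symp (- 1) y); have := nrm_ge0 (symp 1 y + symp (- 1) y).
move: (nrm _) (nrm _) (nrm _) (C * _) (D * _) => a b c d e; lra.
Qed.

Lemma ontoW_paired : ontoW 1 -> ontoW (- 1) -> forall y, exists x, paired x = y.
Proof.
move=> h1 h2 y; have [x1 e1] := ontoW_symp mul11 y h1; have [x2 e2] := ontoW_symp mulN1N1 y h2.
by exists (2^-1 *: (x1 + x2)); rewrite (linZ paired_bop.1) (linD paired_bop.1) e1 e2 -symp_split.
Qed.

Lemma closedW_paired : closedW 1 -> closedW (- 1) -> hclosed (range paired).
Proof.
move=> h1 h2 y hy; have [x1 e1] := closedW_symp mul11 h1 hy; have [x2 e2] := closedW_symp mulN1N1 h2 hy.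
by exists (2^-1 *: (x1 + x2)) => //; rewrite (linZ paired_bop.1) (linD paired_bop.1) e1 e2 -symp_split.
Qed.

Definition cat_fam n1 n2 (v1 : 'I_n1 -> H) (v2 : 'I_n2 -> H) (i : 'I_(n1 + n2)) : H :=
  match fintype.split i with inl a => v1 a | inr b => v2 b end.

Lemma cat_faml n1 n2 (v1 : 'I_n1 -> H) (v2 : 'I_n2 -> H) i : cat_fam v1 v2 (lshift n2 i) = v1 i.
Proof. by rewrite /cat_fam (unsplitK (inl i)). Qed.
Lemma cat_famr n1 n2 (v1 : 'I_n1 -> H) (v2 : 'I_n2 -> H) i : cat_fam v1 v2 (rshift n1 i) = v2 i.
Proof. by rewrite /cat_fam (unsplitK (inr i)). Qed.

(** Closed range bounds [paired] below off its kernel, and the even and odd parts of a kernel vector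
    come from the finitely many kernel vectors of the two signs. *)
Lemma left_fredholmW : closedW 1 -> closedW (- 1) -> kerW 1 -> kerW (- 1) -> fin_below paired.
Proof.
move=> c1 c2 [n1 [v1 [_ s1]]] [n2 [v2 [_ s2]]].
have [C hC] := closed_range_bound paired_bop paired_adj (closedW_paired c1 c2).
exists (n1 + n2)%N, (cat_fam (fun i => symp 1 (v1 i)) (fun i => symp (- 1) (v2 i))), C => f hf.
apply: hC => k Gk; rewrite (symp_split k) dotZr dotDr.
have dz ep n (v : 'I_n -> H) : ep * ep = 1 -> spanned v (hsymp ep k) -> (forall i, dot f (symp ep (v i)) = 0) -> dot f (symp ep k) = 0.
  move=> e2 [c hc] hv; have -> : symp ep k = 2 *: symp ep (hsymp ep k) by rewrite symp_hsymp// scalerA mulfV ?pnatr_eq0// scale1r.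
  rewrite hc (lin_sum (@symp_lin ep)) dotZr dot_sumr big1 ?mulr0// => i _.
  by rewrite (linZ (@symp_lin ep)) dotZr hv mulr0.
have [h1 k1] := kerW_hsymp mul11 Gk; have [h2 k2] := kerW_hsymp mulN1N1 Gk.
rewrite (dz 1 _ _ mul11 (s1 _ h1 k1)); last by move=> i; have := hf (lshift n2 i); rewrite cat_faml.
rewrite (dz (- 1) _ _ mulN1N1 (s2 _ h2 k2)); last by move=> i; have := hf (rshift n1 i); rewrite cat_famr.
by rewrite addr0 mulr0.
Qed.

(** The even and odd parts of a vector are solved separately modulo the two finite families;
    [coker_adjoint] turns the joint family into conditions for the adjoint. *)
Lemma right_fredholmW : cokerW 1 -> cokerW (- 1) -> fin_below paired'.
Proof.
move=> [n1 [v1 [_ s1]]] [n2 [v2 [_ s2]]].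
pose v := cat_fam (fun i => symp 1 (v1 i)) (fun i => symp (- 1) (v2 i)).
have [|C hC] := @coker_adjoint R H paired paired' _ v paired_adj.
  move=> g; have [x1 [c1 [_ e1]]] := s1 _ (H2_hsymp 1 g); have [x2 [c2 [_ e2]]] := s2 _ (H2_hsymp (- 1) g).
  exists (symp 1 x1 + symp (- 1) x2), (fun i => match fintype.split i with inl a => c1 a | inr b => c2 b end).
  rewrite big_split_ord /= (linD paired_bop.1) (paired_sym mul11) (paired_sym mulN1N1).
  under [in RHS]eq_bigr do rewrite /v cat_faml (unsplitK (inl _)).
  under [X in _ + (_ + X)]eq_bigr do rewrite /v cat_famr (unsplitK (inr _)).
  have sE ep n (c : 'I_n -> R[i]) (w : 'I_n -> H) : \sum_i c i *: symp ep (w i) = symp ep (\sum_i c i *: w i).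
    by rewrite (lin_sum (@symp_lin ep)); apply: eq_bigr => i _; rewrite (linZ (@symp_lin ep)).
  have a1 : symp 1 (whf 1 x1) + symp 1 (\sum_i c1 i *: v1 i) = 2^-1 *: symp 1 g by rewrite -(linD (@symp_lin 1)) -e1 (symp_hsymp mul11).
  have a2 : symp (- 1) (whf (- 1) x2) + symp (- 1) (\sum_i c2 i *: v2 i) = 2^-1 *: symp (- 1) g.
    by rewrite -(linD (@symp_lin (- 1))) -e2 (symp_hsymp mulN1N1).
  by rewrite !sE addrACA a1 a2 -scalerDr -symp_split.
exists (n1 + n2)%N, v, C => y hy; apply: le_trans (hC y) _.
by rewrite big1 ?addr0// => i _; rewrite hy cmod0.
Qed.

End Symbol.
End Transfer.

(** * Functions on the half-line *)

Section HalfLine.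
Context {R : realType}.
Local Notation mu := (@lebesgue_measure R).
Local Notation H := (L2S R).
Implicit Types (x y : L2S R) (f g : R -> Cplx R).

Lemma RplusE (t : R) : (t \in Rplus) = (0 < t).
Proof. by apply/idP/idP => [|h]; rewrite ?inE /Rplus /= ?in_itv /= ?andbT// => ->. Qed.

Lemma ae_neq0 : {ae mu, forall t : R, t != 0}.
Proof.
exists [set 0]; split=> //; first exact: lebesgue_measure_set1.
by move=> t /=; case: eqVneq.
Qed.

Lemma halfE (t : R) : half t = (if 0 < t then 1 else 0 : Cplx R).
Proof. by rewrite /half indicE RplusE; case: ltP. Qed.

Lemma restr_half g t : restr_plus g t = half t * g t.
Proof. by rewrite halfE /restr_plus; case: ltP; rewrite ?mul1r ?mul0r. Qed.

Lemma l2norm_restr g : l2norm Rplus g = l2norm setT (restr_plus g).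
Proof.
rewrite /l2norm integral_mkcond; congr (_ `^ _)%E; apply: eq_integral => t _.
rewrite /patch RplusE /restr_plus; case: ltP => // _.
by rewrite cmod0 expr0n.
Qed.

Lemma restr_meas g : cmeasurable Rplus g <-> cmeasurable setT (restr_plus g).
Proof.
have mR : measurable (Rplus : set R) by exact: measurable_itv.
have key (u : Cplx R -> R) : u 0 = 0 ->
    measurable_fun Rplus (fun t => u (g t)) <-> measurable_fun setT (fun t => u (restr_plus g t)).
  move=> u0; have -> : (fun t => u (restr_plus g t)) = ((fun t => u (g t)) \_ Rplus).
    by apply/funext => t; rewrite /patch RplusE /restr_plus; case: ltP.
  exact: measurable_restrictT.
by split=> -[h1 h2]; split; apply/key.
Qed.

Lemma L2_Rplus g : L2 Rplus g <-> L2 setT (restr_plus g).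
Proof. by rewrite /L2 /= l2norm_restr; split=> -[/restr_meas]. Qed.

Lemma L2_restr g : L2 setT g -> L2 setT (restr_plus g) /\ vec (restr_plus g) = mulf half (vec g).
Proof.
move=> Lg; rewrite (mulf_vec (@half_Linfty R) Lg).
have -> : restr_plus g = (fun t => half t * g t) by apply/funext => t; exact: restr_half.
by split=> //; apply: Linfty_L2 => //; exact: half_Linfty.
Qed.

Lemma restr_idem g : restr_plus (restr_plus g) = restr_plus g.
Proof. by apply/funext => t; rewrite /restr_plus; case: ltP. Qed.

Lemma l2norm_vec f : L2 setT f -> l2norm setT f = (nrm (vec f))%:E.
Proof.
move=> Lf; have [mf sf] := iffLR (L2P f) Lf; rewrite l2normE// -nrm_vec// sqrtr_sqr ger0_norm//.
exact: nrm_ge0.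
Qed.

Definition sqrt2pi : R := Num.sqrt (2 * pi).
Lemma sqrt2pi_gt0 : 0 < sqrt2pi. Proof. by rewrite sqrtr_gt0 mulr_gt0// pi_gt0. Qed.

Lemma nrm_four x : nrm (four x) = sqrt2pi * nrm x.
Proof.
apply/eqP; rewrite -(@eqrXn2 _ 2) ?nrm_ge0 ?mulr_ge0 ?nrm_ge0 ?(ltW sqrt2pi_gt0)//; apply/eqP.
have k2 : sqrt2pi ^+ 2 = 2 * pi by rewrite /sqrt2pi sqr_sqrtr// mulr_ge0// pi_ge0.
by rewrite exprMn k2 !sqr_nrm four_adj four'4 dotZr JC ReM /= mul0r subr0.
Qed.

Definition fti y : H := ((2 * pi)%:C)^-1 *: four' y.
Lemma four_fti y : four (fti y) = y.
Proof. by rewrite /fti (linZ four_lin) four4' scalerA mulVf ?scale1r//; exact: pi2C_neq0. Qed.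

(* [ftv] identifies [L2plus], and [ftr] identifies [L2Rplus], with the Hardy
   space, up to the factor [sqrt2pi] in the norm. *)
Definition ftv f : H := four (vec f).
Definition ftr g : H := ftv (restr_plus g).

Lemma H2_half x : H2 (four x) <-> mulf half x = x.
Proof. by rewrite /H2 P_four; split=> [/four_inj|->]. Qed.

Lemma H2_ftv f : carrier L2plus f -> H2 (ftv f).
Proof.
move=> [Lf hf]; apply/H2_half; rewrite mulf_vec//; last exact: half_Linfty.
apply: vec_ext => //; first by apply: Linfty_L2 => //; exact: half_Linfty.
apply: (aeS2 hf ae_neq0) => t h t0; rewrite halfE; case: ltgtP t0 => // lt _; rewrite ?mul1r//.
by rewrite h// mulr0.
Qed.

Lemma ftv_onto x : H2 x -> carrier L2plus (rep (fti x)) /\ ftv (rep (fti x)) = x.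
Proof.
move=> hx; have e : ftv (rep (fti x)) = x by rewrite /ftv vec_rep four_fti.
split=> //; split; first exact: rep_L2.
have := hx; rewrite -{1}e /ftv vec_rep => /H2_half h.
have := rep_mulf (fti x) (@half_Linfty R); rewrite h => hr.
by apply: (aeS hr) => t -> t0; rewrite halfE ltNge (ltW t0) mul0r.
Qed.

Lemma H2_ftr g : L2 Rplus g -> H2 (ftr g).
Proof.
move=> /L2_Rplus Lg; apply/H2_half; have [_] := L2_restr Lg; rewrite restr_idem => e.
by rewrite -e.
Qed.

Lemma ftr_onto x : H2 x -> L2 Rplus (rep (fti x)) /\ ftr (rep (fti x)) = x.
Proof.
move=> hx; have Lr := rep_L2 (fti x); have [L e] := L2_restr Lr; split; first exact/L2_Rplus.
rewrite /ftr /ftv e vec_rep; have := hx; rewrite -{1}(four_fti x) => /H2_half ->; exact: four_fti.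
Qed.

Lemma vec_ae f g : L2 setT f -> L2 setT g -> vec f = vec g -> {ae mu, forall t, f t = g t}.
Proof. by move=> Lf Lg e; have h := rep_vec Lf; rewrite e in h; apply: (aeS2 h (rep_vec Lg)) => t <- ->. Qed.

Lemma eqv_ftv f g : L2 setT f -> L2 setT g -> eqv L2plus f g <-> ftv f = ftv g.
Proof.
move=> Lf Lg; split=> [h|/four_inj/(vec_ae Lf Lg) h]; last by apply: (aeS h) => t ->.
by congr four; apply: vec_ext => //; apply: (aeS h) => t; apply.
Qed.

Lemma eqv_ftr f g : L2 Rplus f -> L2 Rplus g -> eqv L2Rplus f g <-> ftr f = ftr g.
Proof.
move=> /L2_Rplus Lf /L2_Rplus Lg; split=> [h|/four_inj/(vec_ae Lf Lg) h].
  congr four; apply: vec_ext => //; apply: (aeS h) => t /= ht; rewrite /restr_plus; case: ltP => // t0.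
  by apply: ht; rewrite /Rplus /= in_itv /= t0.
by apply: (aeS h) => t; rewrite /restr_plus /= /Rplus /= in_itv /= andbT => e t0; rewrite t0 in e.
Qed.

Lemma l2norm_ftv f : L2 setT f -> l2norm setT f = (nrm (ftv f) / sqrt2pi)%:E.
Proof. by move=> Lf; rewrite l2norm_vec// /ftv nrm_four [sqrt2pi * _]mulrC mulfK// gt_eqF// sqrt2pi_gt0. Qed.

Lemma l2norm_ftr g : L2 Rplus g -> l2norm Rplus g = (nrm (ftr g) / sqrt2pi)%:E.
Proof. by move=> /L2_Rplus Lg; rewrite l2norm_restr l2norm_ftv. Qed.

Lemma ftv_lin (a : R[i]) f g : L2 setT f -> L2 setT g ->
  L2 setT (fun t => a * f t + g t) /\ ftv (fun t => a * f t + g t) = a *: ftv f + ftv g.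
Proof.
move=> Lf Lg; split; first by apply: L2D => //; exact: L2Z.
by rewrite /ftv vec_lin// four_lin.
Qed.

Lemma restr_lin (a : R[i]) f g : restr_plus (fun t => a * f t + g t) = (fun t => a * restr_plus f t + restr_plus g t).
Proof. by apply/funext => t; rewrite /restr_plus; case: ltP => // _; rewrite mulr0 addr0. Qed.

Lemma ftr_lin (a : R[i]) f g : L2 Rplus f -> L2 Rplus g ->
  L2 Rplus (fun t => a * f t + g t) /\ ftr (fun t => a * f t + g t) = a *: ftr f + ftr g.
Proof.
move=> /L2_Rplus Lf /L2_Rplus Lg; have [L e] := ftv_lin a Lf Lg.
by rewrite /ftr restr_lin e; split=> //; apply/L2_Rplus; rewrite restr_lin.
Qed.

Lemma ftv0 : ftv (fun=> 0) = 0. Proof. by rewrite /ftv vec0 (lin0 four_lin). Qed.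
Lemma ftr0 : L2 Rplus (fun=> 0 : Cplx R) /\ ftr (fun=> 0) = 0.
Proof.
have e : restr_plus (fun=> 0) = (fun=> 0 : Cplx R) by apply/funext => t; rewrite /restr_plus; case: ltP.
by rewrite /ftr e ftv0; split=> //; apply/L2_Rplus; rewrite e; exact: L2_0.
Qed.

Lemma ftv_sum n (v : 'I_n -> R -> Cplx R) (c : 'I_n -> R[i]) : (forall i, L2 setT (v i)) ->
  L2 setT (fun t => \sum_i c i * v i t) /\ ftv (fun t => \sum_i c i * v i t) = \sum_i c i *: ftv (v i).
Proof.
elim: n v c => [|n IH] v c hv.
  rewrite big_ord0 -ftv0 (_ : (fun t => _) = fun=> 0); first by split=> //; exact: L2_0.
  by apply/funext => t; rewrite big_ord0.
have [L e] := IH (fun i => v (lift ord0 i)) (fun i => c (lift ord0 i)) (fun i => hv _).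
have [L' e'] := ftv_lin (c ord0) (hv ord0) L.
rewrite big_ord_recl -e -e' (_ : (fun t => \sum_(i < n.+1) _) =
  fun t => c ord0 * v ord0 t + \sum_i c (lift ord0 i) * v (lift ord0 i) t)//.
by apply/funext => t; rewrite big_ord_recl.
Qed.

Lemma ftr_sum n (v : 'I_n -> R -> Cplx R) (c : 'I_n -> R[i]) : (forall i, L2 Rplus (v i)) ->
  L2 Rplus (fun t => \sum_i c i * v i t) /\ ftr (fun t => \sum_i c i * v i t) = \sum_i c i *: ftr (v i).
Proof.
move=> hv; have [|L e] := @ftv_sum n (fun i => restr_plus (v i)) c; first by move=> i; exact/L2_Rplus.
have rs : restr_plus (fun t => \sum_i c i * v i t) = (fun t => \sum_i c i * restr_plus (v i) t).
  by apply/funext => t; rewrite /restr_plus; case: ltP => // _; rewrite big1// => i _; rewrite mulr0.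
by rewrite /ftr rs e; split=> //; apply/L2_Rplus; rewrite rs.
Qed.

Lemma restr_fourier phi f x : Linfty phi -> L2 setT f -> vec f = x ->
  let g := restr_plus (fourier_inv (phi \* fourier f)) in L2 setT g /\ ftv g = P (mulf phi (four x)).
Proof.
move=> Lp Lf e g; have [L1 e1] := fourier_vec Lf; have L2' := Linfty_L2 Lp L1.
have [L3 e3] := fourier_inv_vec L2'; have [L4 e4] := L2_restr L3; split=> //.
by rewrite /ftv e4 -P_four e3 -mulf_vec// e1 e.
Qed.

Lemma whf_sum phi (c : R[i]) x : Linfty phi -> whf phi c x = P (mulf phi x) + c *: P (mulf phi (reflf x)).
Proof.
by move=> Lp; rewrite /whf /symp (linD (mulf_lin Lp)) (linZ (mulf_lin Lp)) (linD P_lin) (linZ P_lin).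
Qed.

(** On the Fourier side the restriction to the half-line becomes [P] and the reflection [reflf], so
    the two operators differ only in the sign [ep]. *)
Lemma wh_ftv phi f : Linfty phi -> L2 setT f ->
  (L2 Rplus (wh_plus phi f) /\ ftr (wh_plus phi f) = whf phi 1 (ftv f)) /\
  (L2 Rplus (wh_minus phi f) /\ ftr (wh_minus phi f) = whf phi (- 1) (ftv f)).
Proof.
move=> Lp Lf; have [Lr _] := L2_refl Lf.
have [L1 e1] : L2 setT (wiener_hopf phi f) /\ ftv (wiener_hopf phi f) = P (mulf phi (ftv f)).
  exact: (restr_fourier Lp Lf erefl).
have [L2' e2] : L2 setT (hankel phi f) /\ ftv (hankel phi f) = P (mulf phi (reflf (ftv f))).
  have [L e] := restr_fourier Lp Lr erefl; split; first exact: L.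
  by move: e; rewrite -(reflf_vec Lf) four_reflf.
have key (c : R[i]) g : (forall t, g t = c * hankel phi f t + wiener_hopf phi f t) ->
    L2 Rplus g /\ ftr g = whf phi c (ftv f).
  move=> hg; have [L e] := ftv_lin c L2' L1.
  have rE : restr_plus g = (fun t => c * hankel phi f t + wiener_hopf phi f t).
    apply/funext => t; rewrite /restr_plus hg /hankel /wiener_hopf /restr_plus; case: ltP => // _.
    by rewrite mulr0 addr0.
  split; first by apply/L2_Rplus; rewrite rE; exact: L.
  rewrite (whf_sum _ _ Lp).
  exact: (etrans (congr1 ftv rE) (etrans e (etrans (f_equal2 (fun u v => c *: u + v) e2 e1) (addrC _ _)))).
by split; apply: key => t; rewrite ?mul1r ?mulN1r addrC.
Qed.

Section Link.
Context (phi : R -> Cplx R) (phi_unit : units_of Linfty phi) (ep : R[i]) (ep2 : ep * ep = 1).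
(** [T] stands for either operator of the pair, known through its Fourier image only. *)
Context (T : (R -> Cplx R) -> R -> Cplx R).
Context (hT : forall f, carrier L2plus f -> L2 Rplus (T f) /\ ftr (T f) = whf phi ep (ftv f)).

Lemma bounded_linear_ftv S : bounded_linear L2Rplus L2plus S ->
  exists M : R, forall g, L2 Rplus g -> nrm (ftv (S g)) <= M * nrm (ftr g).
Proof.
move=> [hc _ [M hM]]; exists M => g Lg; have := hM g Lg; have [LS _] := hc g Lg; rewrite /=.
by rewrite (l2norm_ftv LS) (l2norm_ftr Lg) -EFinM lee_fin mulrA ler_pM2r// invr_gt0 sqrt2pi_gt0.
Qed.

Lemma left_invertible_belowW : left_invertible L2plus L2Rplus T -> belowW phi ep.
Proof.
move=> [S [hS ST]]; have [M hM] := bounded_linear_ftv hS; have [hc _ _] := hS; exists M => x hx.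
have [cf ax] := ftv_onto hx; have [LT bT] := hT cf; have [LS _] := hc _ LT.
have := iffLR (eqv_ftv LS cf.1) (ST _ cf) => e.
by have := hM _ LT; rewrite e bT ax.
Qed.

Lemma right_invertible_ontoW : right_invertible L2plus L2Rplus T -> ontoW phi ep.
Proof.
move=> [S [[hc _ _] TS]] y hy; have [Lg bg] := ftr_onto hy.
have cS := hc _ Lg; have [LT bT] := hT cS.
exists (ftv (S (rep (fti y)))); split; first exact: H2_ftv.
by rewrite -bT -[RHS]bg; apply/(eqv_ftr LT Lg); exact: TS.
Qed.

Section Inverse.
Context (K : H -> H) (Kb : bop K).
(** A one-sided or two-sided inverse [K] of [paired], compressed to the parity [ep] and transported
    back to the half-line. *)
Let S g : R -> Cplx R := rep (fti (hsymp ep (K (symp ep (ftr g))))).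

Lemma inverse_ftv g : carrier L2plus (S g) /\ ftv (S g) = hsymp ep (K (symp ep (ftr g))).
Proof. exact: ftv_onto (H2_hsymp _ _). Qed.

Lemma inverse_bounded_linear : bounded_linear L2Rplus L2plus S.
Proof.
have [Kl [M [M0 hM]]] := Kb.
split=> [f _|a f g Lf Lg|]; first by have [] := inverse_ftv f.
  have [L e] := ftr_lin a Lf Lg; have [[Lfg _] e0] := inverse_ftv (fun t => a * f t + g t).
  have [[Lf' _] e1] := inverse_ftv f; have [[Lg' _] e2] := inverse_ftv g.
  have [L' e'] := ftv_lin a Lf' Lg'; apply/(eqv_ftv Lfg L'); rewrite e0 e' e e1 e2.
  by rewrite (@symp_lin _ ep) Kl (@hsymp_lin _ ep).
exists (2 * M) => g Lg; have [[L _] e] := inverse_ftv g; rewrite /=.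
rewrite (l2norm_ftv L) (l2norm_ftr Lg) -EFinM lee_fin mulrA ler_pM2r ?invr_gt0 ?sqrt2pi_gt0// e.
apply: le_trans (nrm_hsymp ep2 _) (le_trans (hM _) _); rewrite [2 * M]mulrC -mulrA.
by apply: ler_wpM2l => //; exact: nrm_symp ep2 _.
Qed.

Lemma inverse_left : (forall x, K (paired phi x) = x) -> forall f, carrier L2plus f -> eqv L2plus (S (T f)) f.
Proof.
move=> KG f cf; have [LT bT] := hT cf; have [[L _] e] := inverse_ftv (T f).
apply/(eqv_ftv L cf.1); rewrite e bT -(paired_sym phi_unit ep2) KG.
by rewrite (hsymp_symp ep2)//; exact: H2_ftv.
Qed.

Lemma inverse_right : (forall x, paired phi (K x) = x) -> forall g, carrier L2Rplus g -> eqv L2Rplus (T (S g)) g.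
Proof.
move=> GK g Lg; have [cS e] := inverse_ftv g; have [LT bT] := hT cS.
apply/(eqv_ftr LT Lg); rewrite bT e (whf_hsymp phi_unit ep2) GK.
by rewrite (hsymp_symp ep2)//; exact: H2_ftr.
Qed.
End Inverse.

Lemma below_left_invertible : bounded_below (paired phi) -> left_invertible L2plus L2Rplus T.
Proof.
move=> /(below_linv (paired_bop phi_unit) (paired'_bop phi_unit) (paired_adj phi_unit))[K [Kb KG]].
by exists (fun g => rep (fti (hsymp ep (K (symp ep (ftr g)))))); split; [exact: inverse_bounded_linear|exact: inverse_left].
Qed.

Lemma below_right_invertible : bounded_below (paired' phi) -> right_invertible L2plus L2Rplus T.
Proof.
move=> /(below_rinv (paired_bop phi_unit) (paired'_bop phi_unit) (paired_adj phi_unit))[K [Kb GK]].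
by exists (fun g => rep (fti (hsymp ep (K (symp ep (ftr g)))))); split; [exact: inverse_bounded_linear|exact: inverse_right].
Qed.

Lemma below_invertible : bounded_below (paired phi) -> bounded_below (paired' phi) -> invertible L2plus L2Rplus T.
Proof.
move=> /(below_linv (paired_bop phi_unit) (paired'_bop phi_unit) (paired_adj phi_unit))[K [Kb KG]].
move=> /(below_rinv (paired_bop phi_unit) (paired'_bop phi_unit) (paired_adj phi_unit))[K' [_ GK']].
have GK x : paired phi (K x) = x by rewrite -{1}(GK' x) KG GK'.
exists (fun g => rep (fti (hsymp ep (K (symp ep (ftr g)))))); split.
- exact: inverse_bounded_linear.
- exact: inverse_left.
- exact: inverse_right.
Qed.

Lemma ftr_sub f g : L2 Rplus f -> L2 Rplus g -> L2 Rplus (fun t => f t - g t) /\ ftr (fun t => f t - g t) = ftr f - ftr g.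
Proof.
move=> Lf Lg; have [L e] := ftr_lin (-1) Lg Lf.
have fE : (fun t => f t - g t) = (fun t => -1 * g t + f t) by apply/funext => t; rewrite mulN1r addrC.
by rewrite fE e; split=> //; move: (ftr f) (ftr g) => u v; hring.
Qed.

Lemma normally_solvableW : normally_solvable L2plus L2Rplus T <-> closedW phi ep.
Proof.
have s0 := sqrt2pi_gt0; split=> [h y hy ha|h g Lg ha].
  have [Lg bg] := ftr_onto hy; have [e e0|f [cf ef]] := h _ Lg.
    have [x [hx lx]] := ha (e * sqrt2pi) (mulr_gt0 e0 s0); have [cf ax] := ftv_onto hx.
    exists (rep (fti x)); split=> //; have [LT bT] := hT cf; have [L eL] := ftr_sub LT Lg.
    by rewrite (l2norm_ftr L) lte_fin eL bT ax bg ltr_pdivrMr.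
  have [LT bT] := hT cf; exists (ftv f); split; first exact: H2_ftv.
  by rewrite -bT -[RHS]bg; apply/(eqv_ftr LT Lg).
have [|x [hx e]] := h _ (H2_ftr Lg).
  move=> e e0; have [f [cf lf]] := ha _ (divr_gt0 e0 s0); exists (ftv f); split; first exact: H2_ftv.
  have [LT bT] := hT cf; have [L eL] := ftr_sub LT Lg; move: lf.
  by rewrite (l2norm_ftr L) lte_fin eL bT ltr_pM2r// invr_gt0.
have [cf ax] := ftv_onto hx; have [LT bT] := hT cf; exists (rep (fti x)); split=> //.
by apply/(eqv_ftr LT Lg); rewrite bT ax.
Qed.

Lemma finite_dim_kerW : finite_dim_ker L2plus L2Rplus T <-> kerW phi ep.
Proof.
have [L0 b0] := ftr0; split=> [[n [v [hv hs]]]|[n [v [hv hs]]]].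
  exists n, (fun i => ftv (v i)); split=> [i|x hx Wx].
    have [cv ev] := hv i; split; first exact: H2_ftv.
    by have [LT bT] := hT cv; rewrite -bT -b0; apply/(eqv_ftr LT L0).
  have [cf ax] := ftv_onto hx; have [LT bT] := hT cf; have [|c ec] := hs _ cf.
    by apply/(eqv_ftr LT L0); rewrite bT ax b0.
  have [|L e] := @ftv_sum n v c; first by move=> i; have [[]] := hv i.
  by exists c; rewrite -ax -e; apply/(eqv_ftv cf.1 L).
exists n, (fun i => rep (fti (v i))); split=> [i|f cf Tf].
  have [hvi Wv] := hv i; have [cf ax] := ftv_onto hvi; have [LT bT] := hT cf; split=> //.
  by apply/(eqv_ftr LT L0); rewrite bT ax b0.
have [LT bT] := hT cf; have [||c ec] := hs (ftv f); first exact: H2_ftv.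
  by rewrite -bT -b0; apply/(eqv_ftr LT L0).
have hi i : carrier L2plus (rep (fti (v i))) /\ ftv (rep (fti (v i))) = v i by apply: ftv_onto; have [] := hv i.
have [|L e] := @ftv_sum n (fun i => rep (fti (v i))) c; first by move=> i; have [[]] := hi i.
exists c; apply/(eqv_ftv cf.1 L); rewrite e ec; apply: eq_bigr => i _; by have [_ ->] := hi i.
Qed.

Lemma finite_dim_cokerW : finite_dim_coker L2plus L2Rplus T <-> cokerW phi ep.
Proof.
have bD f g : L2 Rplus f -> L2 Rplus g -> L2 Rplus (fun t => f t + g t) /\ ftr (fun t => f t + g t) = ftr f + ftr g.
  move=> Lf Lg; have [L e] := ftr_lin 1 Lf Lg; rewrite scale1r in e.
  have fE : (fun t => f t + g t) = (fun t => 1 * f t + g t) by apply/funext => t; rewrite mul1r.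
  by rewrite fE.
split=> [[n [v [hv hs]]]|[n [v [hv hs]]]].
  exists n, (fun i => ftr (v i)); split=> [i|y hy]; first by apply: H2_ftr; exact: hv.
  have [Lg bg] := ftr_onto hy; have [f [c [cf e]]] := hs _ Lg; have [LT bT] := hT cf.
  have [L eL] := ftr_sum c hv; have [L' eL'] := bD _ _ LT L.
  exists (ftv f), c; split; first exact: H2_ftv.
  by rewrite -bT -eL -eL' -bg; apply/(eqv_ftr Lg L').
have hi i : L2 Rplus (rep (fti (v i))) /\ ftr (rep (fti (v i))) = v i by apply: ftr_onto.
have Lv i : L2 Rplus (rep (fti (v i))) by have [] := hi i.
exists n, (fun i => rep (fti (v i))); split=> // g Lg.
have [x [c [hx e]]] := hs _ (H2_ftr Lg); have [cf ax] := ftv_onto hx; have [LT bT] := hT cf.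
have [L eL] := ftr_sum c Lv; have [L' eL'] := bD _ _ LT L.
exists (rep (fti x)), c; split=> //; apply/(eqv_ftr Lg L'); rewrite eL' eL bT ax e; congr (_ + _).
by apply: eq_bigr => i _; have [_ ->] := hi i.
Qed.

End Link.
End HalfLine.

(** * The pair of operators in terms of its Toeplitz symbol *)

Section Equivalences.
Context {R : realType}.
Local Notation mu := (@lebesgue_measure R).
Context (phi : R -> Cplx R) (phi_unit : units_of Linfty phi).
Let psc t := cj (psi phi t).

Lemma wh_plus_ftr f : carrier L2plus f -> L2 Rplus (wh_plus phi f) /\ ftr (wh_plus phi f) = whf phi 1 (ftv f).
Proof. by move=> [Lf _]; have [] := wh_ftv phi_unit.1 Lf. Qed.

Lemma wh_minus_ftr f : carrier L2plus f -> L2 Rplus (wh_minus phi f) /\ ftr (wh_minus phi f) = whf phi (- 1) (ftv f).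
Proof. by move=> [Lf _]; have [] := wh_ftv phi_unit.1 Lf. Qed.

Lemma left_invertible_bb :
  (left_invertible L2plus L2Rplus (wh_plus phi) /\ left_invertible L2plus L2Rplus (wh_minus phi)) <-> bb (psi phi).
Proof.
rewrite -(bounded_below_paired phi_unit); split=> [[h1 h2]|h].
  by apply: (belowW_paired phi_unit); [exact: left_invertible_belowW wh_plus_ftr h1|exact: left_invertible_belowW wh_minus_ftr h2].
by split; [exact: (below_left_invertible phi_unit (@mul11 R) wh_plus_ftr h)|exact: (below_left_invertible phi_unit (@mulN1N1 R) wh_minus_ftr h)].
Qed.

Lemma right_invertible_bb :
  (right_invertible L2plus L2Rplus (wh_plus phi) /\ right_invertible L2plus L2Rplus (wh_minus phi)) <-> bb psc.
Proof.
rewrite -(bounded_below_paired' phi_unit); split=> [[h1 h2]|h].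
  apply: (onto_adjoint_below (paired_adj phi_unit)); apply: (ontoW_paired phi_unit).
    exact: right_invertible_ontoW wh_plus_ftr h1.
  exact: right_invertible_ontoW wh_minus_ftr h2.
by split; [exact: (below_right_invertible phi_unit (@mul11 R) wh_plus_ftr h)|exact: (below_right_invertible phi_unit (@mulN1N1 R) wh_minus_ftr h)].
Qed.

Lemma invertible_bb :
  (invertible L2plus L2Rplus (wh_plus phi) /\ invertible L2plus L2Rplus (wh_minus phi)) <-> bb (psi phi) /\ bb psc.
Proof.
have lr (T : (R -> Cplx R) -> R -> Cplx R) : invertible L2plus L2Rplus T ->
    left_invertible L2plus L2Rplus T /\ right_invertible L2plus L2Rplus T.
  by move=> [S [h1 h2 h3]]; split; exists S.
split=> [[/lr[l1 r1] /lr[l2 r2]]|[b1 b2]].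
  by split; [exact/left_invertible_bb|exact/right_invertible_bb].
have {}b1 := iffRL (bounded_below_paired phi_unit) b1; have {}b2 := iffRL (bounded_below_paired' phi_unit) b2.
by split; [exact: (below_invertible phi_unit (@mul11 R) wh_plus_ftr b1 b2)|exact: (below_invertible phi_unit (@mulN1N1 R) wh_minus_ftr b1 b2)].
Qed.

Lemma left_fredholm_bb :
  (left_fredholm L2plus L2Rplus (wh_plus phi) /\ left_fredholm L2plus L2Rplus (wh_minus phi)) <->
  exists N, bb (fun t => chi t ^+ N * psi phi t).
Proof.
rewrite -(fin_below_paired phi_unit) /left_fredholm.
rewrite (normally_solvableW wh_plus_ftr) (normally_solvableW wh_minus_ftr).
rewrite (finite_dim_kerW wh_plus_ftr) (finite_dim_kerW wh_minus_ftr).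
split=> [[[h1 h2] [h3 h4]]|h]; first exact: (left_fredholmW phi_unit).
have [cl fk] := fin_below_fredholm (paired_bop phi_unit) h.
by split; split; [apply: (paired_closedW phi_unit (@mul11 R))|apply: (paired_kerW phi_unit (@mul11 R))|apply: (paired_closedW phi_unit (@mulN1N1 R))|apply: (paired_kerW phi_unit (@mulN1N1 R))].
Qed.

Lemma right_fredholm_bb :
  (right_fredholm L2plus L2Rplus (wh_plus phi) /\ right_fredholm L2plus L2Rplus (wh_minus phi)) <->
  exists N, bb (fun t => chi t ^+ N * psc t).
Proof.
rewrite -(fin_below_paired' phi_unit) /right_fredholm.
rewrite (normally_solvableW wh_plus_ftr) (normally_solvableW wh_minus_ftr).
rewrite (finite_dim_cokerW wh_plus_ftr) (finite_dim_cokerW wh_minus_ftr).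
split=> [[[_ h2] [_ h4]]|h]; first exact: (right_fredholmW phi_unit).
have [cl fk] := fin_below_coker (paired_bop phi_unit) (paired'_bop phi_unit) (paired_adj phi_unit) h.
by split; split; [apply: (paired_closedW phi_unit (@mul11 R))|apply: (paired_cokerW phi_unit (@mul11 R))|apply: (paired_closedW phi_unit (@mulN1N1 R))|apply: (paired_cokerW phi_unit (@mulN1N1 R))].
Qed.

Lemma fredholm_bb :
  (fredholm L2plus L2Rplus (wh_plus phi) /\ fredholm L2plus L2Rplus (wh_minus phi)) <->
  (exists N, bb (fun t => chi t ^+ N * psi phi t)) /\ (exists N, bb (fun t => chi t ^+ N * psc t)).
Proof.
rewrite -left_fredholm_bb -right_fredholm_bb.
by split=> [[[n1 k1 c1] [n2 k2 c2]]|[[[n1 k1] [n2 k2]] [[_ c1] [_ c2]]]].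
Qed.

End Equivalences.

(** * Conjugation of factorizations *)

Section Signs.
Context {R : realType}.
Local Notation mu := (@lebesgue_measure R).
Implicit Types (A B : set (R -> Cplx R)) (psi : R -> Cplx R).

Lemma factor2_conjE A B psi : (forall f, A f -> B (fun t => cj (f t))) -> (forall f, B f -> A (fun t => cj (f t))) ->
  (exists s h, [/\ sectorial s, A h & {ae mu, forall t, psi t = s t * h t}]) <->
  exists s h, [/\ sectorial s, B h & {ae mu, forall t, cj (psi t) = s t * h t}].
Proof.
move=> AB BA; split; first exact: factor2_conj.
move=> /(factor2_conj BA)[s [h [Ss Ah e]]]; exists s, h; split=> //.
by apply: (aeS e) => t; rewrite JK.
Qed.

Lemma factor3_conjE A B A' B' psi : (forall f, A f -> B (fun t => cj (f t))) -> (forall f, B f -> A (fun t => cj (f t))) ->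
  (forall f, A' f -> B' (fun t => cj (f t))) -> (forall f, B' f -> A' (fun t => cj (f t))) ->
  (exists s h1 h2, [/\ sectorial s, A h1, A' h2 & {ae mu, forall t, psi t = s t * h1 t * h2 t}]) <->
  exists s h1 h2, [/\ sectorial s, B h1, B' h2 & {ae mu, forall t, cj (psi t) = s t * h1 t * h2 t}].
Proof.
move=> AB BA AB' BA'; split; first exact: factor3_conj.
move=> /(factor3_conj BA BA')[s [h1 [h2 [Ss A1 A2 e]]]]; exists s, h1, h2; split=> //.
by apply: (aeS e) => t; rewrite JK.
Qed.

Lemma factor2_ext A B psi : (forall f, A f <-> B f) ->
  (exists s h, [/\ sectorial s, A h & {ae mu, forall t, psi t = s t * h t}]) <->
  exists s h, [/\ sectorial s, B h & {ae mu, forall t, psi t = s t * h t}].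
Proof. by move=> AB; split=> -[s [h [Ss /AB Ah e]]]; exists s, h. Qed.

End Signs.

Theorem theorem4p5 (R : realType) (phi : R -> Cplx R)
    (phi_unit : units_of Linfty phi) :
  (* (a) *)
  (forall sg : hsign,
    (invertible L2plus L2Rplus (wh_plus phi) /\
     invertible L2plus L2Rplus (wh_minus phi)) <->
    exists s h : R -> Cplx R,
      [/\ sectorial s, units_of (Hinfty sg) h &
       {ae @lebesgue_measure R, forall x, phi x * reflection (ptinv phi) x = s x * h x}]) /\
  (* (b) *)
  ((left_invertible L2plus L2Rplus (wh_plus phi) /\
    left_invertible L2plus L2Rplus (wh_minus phi)) <->
   exists s h : R -> Cplx R,
     [/\ sectorial s, Hinfty Plus h &
      {ae @lebesgue_measure R, forall x, phi x * reflection (ptinv phi) x = s x * h x}]) /\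
  (* (c) *)
  ((right_invertible L2plus L2Rplus (wh_plus phi) /\
    right_invertible L2plus L2Rplus (wh_minus phi)) <->
   exists s h : R -> Cplx R,
     [/\ sectorial s, Hinfty Minus h &
      {ae @lebesgue_measure R, forall x, phi x * reflection (ptinv phi) x = s x * h x}]) /\
  (* (d) *)
  (forall sg : hsign,
    (fredholm L2plus L2Rplus (wh_plus phi) /\
     fredholm L2plus L2Rplus (wh_minus phi)) <->
    exists s h1 h2 : R -> Cplx R,
      [/\ sectorial s, units_of (CplusHinfty sg) h1,
          units_of (Hinfty sg) h2 &
       {ae @lebesgue_measure R, forall x,
          phi x * reflection (ptinv phi) x = s x * h1 x * h2 x}]) /\
  (* (e) *)
  ((left_fredholm L2plus L2Rplus (wh_plus phi) /\
    left_fredholm L2plus L2Rplus (wh_minus phi)) <->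
   exists s h1 h2 : R -> Cplx R,
     [/\ sectorial s, CplusHinfty Plus h1, units_of (Hinfty Plus) h2 &
      {ae @lebesgue_measure R, forall x,
         phi x * reflection (ptinv phi) x = s x * h1 x * h2 x}]) /\
  (* (f) *)
  ((right_fredholm L2plus L2Rplus (wh_plus phi) /\
    right_fredholm L2plus L2Rplus (wh_minus phi)) <->
   exists s h1 h2 : R -> Cplx R,
     [/\ sectorial s, CplusHinfty Minus h1, units_of (Hinfty Minus) h2 &
      {ae @lebesgue_measure R, forall x,
         phi x * reflection (ptinv phi) x = s x * h1 x * h2 x}]).
Proof.
have Lp := psi_Linfty phi_unit; have bp := psi_below phi_unit.
have Lc := Linfty_conj Lp; have bc := below_conj bp.
have JJ : (fun t => cj (cj (psi phi t))) = psi phi by apply/funext => t; rewrite JK.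
have Hc sg (f : R -> Cplx R) : Hinfty sg f -> Hinfty (opps sg) (fun t => cj (f t)) by exact: Hinfty_conj.
have Uc sg (f : R -> Cplx R) : units_of (Hinfty sg) f -> units_of (Hinfty (opps sg)) (fun t => cj (f t)).
  by apply: units_conj; exact: Hc.
have Cc sg (f : R -> Cplx R) : CplusHinfty sg f -> CplusHinfty (opps sg) (fun t => cj (f t)).
  exact: CplusHinfty_conj.
have UCc sg (f : R -> Cplx R) : units_of (CplusHinfty sg) f -> units_of (CplusHinfty (opps sg)) (fun t => cj (f t)).
  by apply: units_conj; exact: Cc.
have HP (f : R -> Cplx R) : Hmul f <-> Hinfty Plus f by apply: iff_sym; exact: HinftyP.
have UP (f : R -> Cplx R) : units_of Hmul f <-> units_of (Hinfty Plus) f by apply: iff_sym; exact: units_Plus.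
split; [|split; [|split; [|split; [|split]]]].
- case; apply: iff_trans (invertible_bb phi_unit) _.
    exact: iff_trans (bb_sect_unit Lp bp) (factor2_ext _ UP).
  (* The sign minus: the operator side is symmetric in the symbol and its conjugate, so the case of
     the sign plus is applied to [conj psi]. *)
  apply: iff_trans (iff_sym (factor2_conjE (psi phi) (Uc Minus) (Uc Plus))).
  apply: iff_trans (factor2_ext _ UP); apply: iff_trans (bb_sect_unit Lc bc).
  by rewrite JJ; exact: and_comm.
- apply: iff_trans (left_invertible_bb phi_unit) _.
  exact: iff_trans (bb_sect Lp bp) (factor2_ext _ HP).
- apply: iff_trans (right_invertible_bb phi_unit) _.
  apply: iff_trans (iff_sym (factor2_conjE (psi phi) (Hc Minus) (Hc Plus))).
  exact: iff_trans (bb_sect Lc bc) (factor2_ext _ HP).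
- case; apply: iff_trans (fredholm_bb phi_unit) _; first exact: fredholm_symbol.
  apply: iff_trans (iff_sym (factor3_conjE (psi phi) (UCc Minus) (UCc Plus) (Uc Minus) (Uc Plus))).
  apply: iff_trans (fredholm_symbol Lc bc).
  under [X in _ <-> (_ /\ X)]eq_exists do under eq_fun do rewrite JK.
  exact: and_comm.
- exact: iff_trans (left_fredholm_bb phi_unit) (left_fredholm_symbol Lp bp).
- apply: iff_trans (right_fredholm_bb phi_unit) _.
  apply: iff_trans (iff_sym (factor3_conjE (psi phi) (Cc Minus) (Cc Plus) (Uc Minus) (Uc Plus))).
  exact: left_fredholm_symbol Lc bc.
Qed.
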